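(* Let $\tau_q$ and $\tau$ be the quasi-periodic and the perturbed Jacobi difference expressions, respectively, where the perturbation satisfies $\sum_{n\in\mathbb Z}|n|(|a(n)-a_q(n)|+|b(n)-b_q(n)|)<\infty$. Then, for either sign, the operator $$(\mathcal K_\pm f)(n)=\sum_{m=n}^{\pm\infty}K_\pm(n,m)f(m)$$ satisfies $$\tau\,\mathcal K_\pm f=\mathcal K_\pm\,\tau_qf\qquad\text{for all } f\in\ell^\infty_\pm(\mathbb Z,\mathbb C).$$
   Context: Background operator. Fix $g\in\mathbb N$, real numbers $E_0<\dots<E_{2g+1}$, $R_{2g+2}(z)=\prod_{j=0}^{2g+1}(z-E_j)$, and $R_{2g+2}^{1/2}(z)=-\prod_{j=0}^{2g+1}\sqrt{z-E_j}$ with $\sqrt{\cdot}$ the standard root with branch cut along $(-\infty,0)$. Fix Dirichlet data $\hat\mu_j=(\mu_j,\sigma_j)$, $1\le j\le g$, with $\mu_j\in[E_{2j-1},E_{2j}]$, $\sigma_j\in\{+1,-1\}$ (the sign being irrelevant if $\mu_j$ is an endpoint), and put $\hat R_j=\sigma_jR_{2g+2}^{1/2}(\mu_j)/\prod_{k\ne j}(\mu_j-\mu_k)$. $H_q$ is the associated quasi-periodic finite-gap Jacobi operator on $\ell^2(\mathbb Z)$, with difference expression $(\tau_qu)(n)=a_q(n)u(n+1)+a_q(n-1)u(n-1)+b_q(n)u(n)$, $a_q(n)>0$, $b_q(n)\in\mathbb R$ bounded. It has spectrum $\sigma(H_q)=\bigcup_{j=0}^g[E_{2j},E_{2j+1}]$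 and is the unique such operator for which the solutions $\psi_{q,\pm}(z,\cdot)$ of $\tau_q\psi=z\psi$, $z\in\mathbb C\setminus(\sigma(H_q)\cup\{\mu_j\})$, that are square summable near $\pm\infty$ and normalized by $\psi_{q,\pm}(z,0)=1$ satisfy $$\psi_{q,\pm}(z,1)=\frac1{2a_q(0)}\Big(z-b_q(0)+\sum_{j=1}^g\frac{\hat R_j}{z-\mu_j}\pm\frac{R_{2g+2}^{1/2}(z)}{\prod_{j=1}^g(z-\mu_j)}\Big).$$ $\psi_{q,\pm}$ are the two branches of the Baker-Akhiezer function. Quasi-momentum. The numbers $\lambda_j\in(E_{2j-1},E_{2j})$ are determined by $\int_{E_{2j-1}}^{E_{2j}}\prod_{k=1}^g(z-\lambda_k)R_{2g+2}^{-1/2}(z)\,dz=0$, $1\le j\le g$. Put $w(z)=\exp\int_{E_0}^z\prod_{k=1}^g(\zeta-\lambda_k)R_{2g+2}^{-1/2}(\zeta)\,d\zeta$ for $\pm\operatorname{Im}z>0$ (path in the same half plane), extended continuously to the real line from either side. Apart from finitely many points, $w$ gives a bijection between the boundary values $\lambda+\mathrm i0$ (resp. $\lambda-\mathrm i0$), $\lambda\in\sigma(H_q)$, and the points of the unit circle with $\operatorname{Im}w>0$ (resp. $\operatorname{Im}w<0$), with inverse $\lambda(w)$; for $|w|=1$, $f(w)$ denotes the corresponding boundary value of a function $f$ of $z$. Put $d\omega(w)=\prod_{j=1}^g\frac{\lambda(w)-\mu_j}{\lambda(w)-\lambda_j}\frac{dw}{w}$. Perturbed operator. $H$ is the Jacobi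 operator with expression $(\tau u)(n)=a(n)u(n+1)+a(n-1)u(n-1)+b(n)u(n)$, $a(n)>0$, $b(n)\in\mathbb R$. Under the summability assumption there are unique Jost solutions $\psi_\pm(z,\cdot)$ of $\tau\psi=z\psi$ with $\lim_{n\to\pm\infty}|w(z)^{\mp n}(\psi_\pm(z,n)-\psi_{q,\pm}(z,n))|=0$ (holomorphic, and continuous up to $\sigma(H_q)$, where $\psi_{q,\pm}$ are, with the same type of singularities at the $\mu_j$). Transformation kernel. $K_\pm(n,m)=\frac1{2\pi\mathrm i}\int_{|w|=1}\psi_\pm(w,n)\psi_{q,\mp}(w,m)\,d\omega(w)$; one has $K_\pm(n,m)=0$ for $\pm m<\pm n$. The symbol $\sum_{m=n}^{\pm\infty}$ denotes the sum over $m\ge n$ for the upper sign and over $m\le n$ for the lower sign. $\ell^\infty_\pm(\mathbb Z,\mathbb C)$ is the set of sequences $f:\mathbb Z\to\mathbb C$ that are bounded near $\pm\infty$. *)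

(* Defs.v *)
From HB Require Import structures.
From mathcomp Require Import all_boot all_order all_algebra.
From mathcomp Require Import all_classical all_reals all_analysis.
From mathcomp Require Export complex.

Set Implicit Arguments.
Unset Strict Implicit.
Unset Printing Implicit Defensive.

Import Order.TTheory GRing.Theory Num.Theory.
Import numFieldNormedType.Exports.

Local Open Scope classical_set_scope.
Local Open Scope ring_scope.
Local Open Scope complex_scope.

(* Conventions.
   - The complex field over R : realType is R[i]; its topology is the one of
     the normed space R[i]^o.
   - A sign "+/-" is a boolean s entering formulas as (-1) ^+ s, so s = false
     is the upper sign "+" and s = true the lower sign "-".
   - E, mu, sigma, lam are used only at the indices 0..2g+1 (for E) and 1..g
     (for mu, sigma, lam); their other values are irrelevant. *)

Definition cexp (R : realType) (z : R[i]) : R[i] :=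
  (expR (complex.Re z))%:C * (cos (complex.Im z) +i* sin (complex.Im z)).

Definition cint (R : realType) (D : set R) (f : R -> R[i]) : R[i] :=
  (\int[lebesgue_measure]_(x in D) complex.Re (f x))
    +i* (\int[lebesgue_measure]_(x in D) complex.Im (f x)).

(* Counterclockwise contour integral of f(w) dw over |w| = 1. *)
Definition circle_int (R : realType) (f : R[i] -> R[i]) : R[i] :=
  cint `[0, 2 * pi] (fun t => f (cexp (0 +i* t)) * ('i * cexp (0 +i* t))).

(* Boundary value f(x + i0) (t = false) or f(x - i0) (t = true). *)
Definition bdry (R : realType) (t : bool) (f : R[i] -> R[i]) (x : R) : R[i] :=
  lim ((f (x +i* ((-1) ^+ t * e)) : R[i]^o) @[e --> 0^'+]).

(* The k-th integer from the origin in the direction of the sign s. *)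
Definition toward (s : bool) (k : nat) : int := (-1) ^+ s * k%:Z.

(** Jacobi difference expressions *)

Definition jacobi (R : realType) (a b : int -> R) (u : int -> R[i]) (n : int) :
    R[i] :=
  (a n)%:C * u (n + 1) + (a (n - 1))%:C * u (n - 1) + (b n)%:C * u n.

Definition solves (R : realType) (a b : int -> R) (z : R[i])
    (u : int -> R[i]) : Prop :=
  forall n, jacobi a b u n = z * u n.

Definition square_summable_on (R : realType) (D : set int)
    (u : int -> R[i]) : Prop :=
  (\esum_(n in D) ((ComplexField.Normc.normc (u n)) ^+ 2)%:E < +oo)%E.

Definition ell2 (R : realType) (u : int -> R[i]) : Prop :=
  square_summable_on setT u.

Definition ell2_near (R : realType) (s : bool) (u : int -> R[i]) : Prop :=
  square_summable_on [set n | 0 <= (-1) ^+ s * n] u.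

Definition bounded_towards (R : realType) (s : bool) (f : int -> R[i]) : Prop :=
  exists (N : int) (M : R), forall n : int,
    N <= (-1) ^+ s * n -> ComplexField.Normc.normc (f n) <= M.

(* Spectrum of the operator induced on l^2(Z).  For bounded coefficients the
   operator is bounded, so bijectivity of H - z already gives a bounded
   inverse. *)
Definition spectrum (R : realType) (a b : int -> R) : set R[i] :=
  [set z | ~ forall v, ell2 v ->
             exists! u, ell2 u /\ forall n, jacobi a b u n - z * u n = v n].

(** Finite-gap background *)

Definition band_edges (R : realType) (g : nat) (E : nat -> R) : Prop :=
  forall i : nat, (i < g.*2.+1)%N -> E i < E i.+1.

Definition bands (R : realType) (g : nat) (E : nat -> R) : set R :=
  [set x | exists2 j : nat, (j <= g)%N & E j.*2 <= x <= E j.*2.+1].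

Definition dirichlet_data (R : realType) (g : nat) (E mu sigma : nat -> R) :
    Prop :=
  forall j : nat, (1 <= j <= g)%N ->
    E j.*2.-1 <= mu j <= E j.*2 /\ (sigma j = 1 \/ sigma j = -1).

(* sqrtc is the principal root; on the cut it takes the values i * sqrt |x|.
   On R minus the bands an even number of factors is on the cut, and
   the choice made there does not matter. *)
Definition Rhalf (R : realType) (g : nat) (E : nat -> R) (z : R[i]) : R[i] :=
  - \prod_(0 <= j < g.*2.+2) sqrtc (z - (E j)%:C).

Definition Rhat (R : realType) (g : nat) (E mu sigma : nat -> R) (j : nat) :
    R[i] :=
  (sigma j)%:C * Rhalf g E (mu j)%:C
    / \prod_(1 <= k < g.+1 | k != j) ((mu j)%:C - (mu k)%:C).

(* sigma(H_q) together with the Dirichlet eigenvalues. *)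
Definition exceptional (R : realType) (g : nat) (E mu : nat -> R) : set R[i] :=
  [set x%:C | x in bands g E]
    `|` [set (mu j)%:C | j in [set j : nat | (1 <= j <= g)%N]].

Definition weyl_solution (R : realType) (a b : int -> R) (s : bool) (z : R[i])
    (u : int -> R[i]) : Prop :=
  [/\ solves a b z u, ell2_near s u & u 0 = 1].

Definition baker_akhiezer1 (R : realType) (g : nat) (E mu sigma : nat -> R)
    (aq bq : int -> R) (s : bool) (z : R[i]) : R[i] :=
  (2 * (aq 0)%:C)^-1 *
    (z - (bq 0)%:C
     + \sum_(1 <= j < g.+1) Rhat g E mu sigma j / (z - (mu j)%:C)
     + (-1) ^+ s * (Rhalf g E z / \prod_(1 <= j < g.+1) (z - (mu j)%:C))).

(* (aq, bq) are the coefficients of H_q, and psiq s z is the solution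
   psi_{q,+/-}(z, .). *)
Record finite_gap_background (R : realType) (g : nat) (E mu sigma : nat -> R)
    (aq bq : int -> R) (psiq : bool -> R[i] -> int -> R[i]) : Prop := {
  fg_pos : forall n, 0 < aq n;
  fg_bounded : exists M : R, forall n, `|aq n| <= M /\ `|bq n| <= M;
  fg_spectrum : spectrum aq bq = [set x%:C | x in bands g E];
  fg_weyl : forall s z, ~ exceptional g E mu z ->
    weyl_solution aq bq s z (psiq s z);
  fg_value1 : forall s z, ~ exceptional g E mu z ->
    psiq s z 1 = baker_akhiezer1 g E mu sigma aq bq s z }.

(** Quasi-momentum *)

Definition qm_density (R : realType) (g : nat) (E lam : nat -> R) (z : R[i]) :
    R[i] :=
  \prod_(1 <= k < g.+1) (z - (lam k)%:C) / Rhalf g E z.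

Definition qm_zeros (R : realType) (g : nat) (E lam : nat -> R) : Prop :=
  forall j : nat, (1 <= j <= g)%N ->
    E j.*2.-1 < lam j < E j.*2 /\
    cint `[E j.*2.-1, E j.*2] (fun x => qm_density g E lam x%:C) = 0.

(* For Im z <> 0: the path is the segment from E_0 to z. *)
Definition w_half (R : realType) (g : nat) (E lam : nat -> R) (z : R[i]) :
    R[i] :=
  let e0 := (E 0)%:C in
  cexp ((z - e0) *
    cint `[0, 1] (fun t => qm_density g E lam (e0 + t%:C * (z - e0)))).

(* On the real line, the boundary value from above.  The one from below is its
   complex conjugate, and only |w| is used at real points. *)
Definition qmap (R : realType) (g : nat) (E lam : nat -> R) (z : R[i]) : R[i] :=
  if complex.Im z == 0 then bdry false (w_half g E lam) (complex.Re z)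
  else w_half g E lam z.

(* lambda(w) for |w| = 1, obtained from the boundary values from above if
   0 <= Im w and from below if Im w < 0.  It is well defined up to finitely
   many w, where the choice is arbitrary. *)
Definition lambda_of (R : realType) (g : nat) (E lam : nat -> R) (w : R[i]) :
    R :=
  xget 0 [set x | bands g E x /\ bdry (complex.Im w < 0) (qmap g E lam) x = w].

Definition circle_value (R : realType) (g : nat) (E lam : nat -> R)
    (f : R[i] -> R[i]) (w : R[i]) : R[i] :=
  bdry (complex.Im w < 0) f (lambda_of g E lam w).

(* d omega = omega_density(w) dw *)
Definition omega_density (R : realType) (g : nat) (E mu lam : nat -> R)
    (w : R[i]) : R[i] :=
  let l := (lambda_of g E lam w)%:C in
  \prod_(1 <= j < g.+1) ((l - (mu j)%:C) / (l - (lam j)%:C)) / w.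

(** Perturbed operator and transformation kernel *)

Definition summable_perturbation (R : realType) (aq bq a b : int -> R) : Prop :=
  (\esum_(n in [set: int])
     (`|n%:~R| * (`|a n - aq n| + `|b n - bq n|))%:E < +oo)%E.

(* psi is the Jost solution psi_+ (s = false) or psi_- (s = true). *)
Definition jost_solution (R : realType) (g : nat) (E mu lam : nat -> R)
    (psiq : bool -> R[i] -> int -> R[i]) (a b : int -> R) (s : bool)
    (psi : R[i] -> int -> R[i]) : Prop :=
  forall z, ~ exceptional g E mu z ->
    solves a b z (psi z) /\
    ComplexField.Normc.normc
      (qmap g E lam z ^ (- ((-1) ^+ s * toward s k)) *
         (psi z (toward s k) - psiq s z (toward s k)))
      @[k --> \oo] --> (0 : R).

Definition kernelK (R : realType) (g : nat) (E mu lam : nat -> R)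
    (psiq psi : bool -> R[i] -> int -> R[i]) (s : bool) (n m : int) : R[i] :=
  (2 * (pi : R)%:C * 'i)^-1 *
    circle_int (fun w =>
      circle_value g E lam (fun z => psi s z n) w *
      circle_value g E lam (fun z => psiq (~~ s) z m) w *
      omega_density g E mu lam w).

(* Partial sums of sum_{m = n}^{+/- oo} K(n, m) f(m). *)
Definition transform_partial (R : realType) (s : bool) (K : int -> int -> R[i])
    (f : int -> R[i]) (n : int) : nat -> R[i]^o :=
  series (fun k : nat => K n (n + toward s k) * f (n + toward s k) : R[i]^o).

Definition transform (R : realType) (s : bool) (K : int -> int -> R[i])
    (f : int -> R[i]) (n : int) : R[i] :=
  limn (transform_partial s K f n).

(* Main.v *)
(* Idea.  In terms of the fundamental polynomial solutions c_n, s_n of tau_q u = z u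
   one has psi_{q,+/-}(z, n) = c_n + s_n (P +/- R^(1/2)) / (2 a_q(0) Q), where
   Q = prod_j (z - mu_j) divides P^2 - R.  So Q psi_{q,+}(z, l) psi_{q,-}(z, m) = A + B R^(1/2)
   with polynomials A, B that are bilinear in the pairs e_n = (c_n, s_n).  The functional
   p |-> (1/pi) Im int p / R^(1/2) along the upper side of the spectrum ([moment]) is minus the
   coefficient of 1/z of p / R^(1/2) at infinity, and decay of the Weyl solutions makes the e_n
   orthonormal for moment o A.  Truncating the perturbation at N turns the Jost solution into a
   finite combination Phi N n of the e_m, m >= n, and a Volterra equation bounds the sum of
   the absolute values of its coefficients uniformly in N.  Hence
   kappa n m = lim_N moment (A (Phi N n) e_m) vanishes for m < n, is summable in m, and
   satisfies tau_n kappa = tau_{q,m} kappa; summation by parts gives the intertwining relation.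

   It remains to see that kappa is the contour integral.  The limit Psi of the truncated
   solutions is asymptotic to psi_{q,+} relative to the size of psi_{q,+}, whereas the Jost
   condition controls errors relative to w^n; the two agree because |psi_{q,+}(z, n)| >= c |w|^n:
   the logarithmic derivative of psi_{q,+}(z, n) is (F_1 + ... + F_n) / R^(1/2) up to a bounded
   term, and boundedness at two neighbouring bands forces F_1 + ... + F_n - n prod_j (z - lambda_j)
   to stay bounded, as a polynomial of degree < g is determined by its integrals against R^(-1/2)
   over the g gaps.  Finally w = exp(i theta) on the upper side of the spectrum, and
   d theta = prod_j (x - lambda_j) dx / |R^(1/2)| turns the integral over the circle into moment.
   The lower sign follows by the reflection n |-> -n. *)

From HB Require Import structures.
Require Import Defs.
From mathcomp Require Import all_boot all_order all_algebra.
From mathcomp Require Import all_classical all_reals all_analysis.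
From mathcomp Require Import measurable_realfun.
From mathcomp Require Import ring lra zify.
From mathcomp Require polyrcf qpoly.
Import Order.TTheory GRing.Theory Num.Theory.
Import numFieldNormedType.Exports.
Local Open Scope classical_set_scope.
Local Open Scope ring_scope.
Local Open Scope complex_scope.
Set Implicit Arguments.
Unset Strict Implicit.
Unset Printing Implicit Defensive.

(** The kernel is defined from whatever Jost solutions are given, and these are known only off the
    spectrum and the Dirichlet eigenvalues; nothing can be read off the integrand before they are
    identified with a constructed solution. Estimates pointwise in z degenerate at the band edges
    and Dirichlet eigenvalues. Sizes are therefore measured by coefficients with respect to the
    vectors e_m: such a bound does not involve z, and orthonormality turns it into summability of
    the kernel. The price is the coefficient norm of the background Green kernel between two sites,
    which grows linearly with their distance; this is what the weight |n| in the hypothesis pays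
    for. Function theory on the Riemann surface is replaced by degree counts for polynomials, based
    on growth at nonreal z, and by boundary values of primitives in the upper half plane. Since a
    divergent series still has a default limit in [transform], convergence of both series is proved
    along with the identity. *)

Local Notation Re := complex.Re.
Local Notation Im := complex.Im.
Local Notation nc := ComplexField.Normc.normc.
Local Notation pC := (map_poly (real_complex _)).

(** * Complex numbers and curves *)

Section ComplexBasics.
Variable R : realType.
Implicit Types (z w : R[i]) (x y : R).

Lemma cE z : z = Re z +i* Im z. Proof. by case: z. Qed.
Lemma c_eq z w : Re z = Re w -> Im z = Im w -> z = w.
Proof. by case: z w => ? ? [? ?] /= -> ->. Qed.
Lemma ReD z w : Re (z + w) = Re z + Re w. Proof. by case: z w => ? ? []. Qed.
Lemma ImD z w : Im (z + w) = Im z + Im w. Proof. by case: z w => ? ? []. Qed.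
Lemma ReN z : Re (- z) = - Re z. Proof. by case: z. Qed.
Lemma ImN z : Im (- z) = - Im z. Proof. by case: z. Qed.
Lemma ReB z w : Re (z - w) = Re z - Re w. Proof. by rewrite ReD ReN. Qed.
Lemma ImB z w : Im (z - w) = Im z - Im w. Proof. by rewrite ImD ImN. Qed.
Lemma ReM z w : Re (z * w) = Re z * Re w - Im z * Im w.
Proof. by case: z w => ? ? []. Qed.
Lemma ImM z w : Im (z * w) = Re z * Im w + Im z * Re w.
Proof. by case: z w => ? ? []. Qed.
Lemma ReCM x z : Re (x%:C * z) = x * Re z. Proof. by rewrite ReM /= mul0r subr0. Qed.
Lemma ImCM x z : Im (x%:C * z) = x * Im z. Proof. by rewrite ImM /= mul0r addr0. Qed.
Lemma cplxE x y : x +i* y = x%:C + 'i * y%:C.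
Proof. by apply: c_eq; rewrite ?ReD ?ImD ?ReM ?ImM /=; ring. Qed.

Lemma sqr_nc z : nc z ^+ 2 = Re z ^+ 2 + Im z ^+ 2.
Proof. by case: z => a b /=; rewrite sqr_sqrtr// addr_ge0 ?sqr_ge0. Qed.
Lemma nc_ge0 z : 0 <= nc z.
Proof. by case: z => a b; rewrite sqrtr_ge0. Qed.
Lemma nc0 : nc (0 : R[i]) = 0. Proof. exact: ComplexField.Normc.normc0. Qed.
Lemma nc1 : nc (1 : R[i]) = 1. Proof. exact: ComplexField.Normc.normc1. Qed.
Lemma nc_eq0 z : (nc z == 0) = (z == 0).
Proof.
by apply/eqP/eqP => [/ComplexField.Normc.eq0_normc//|->]; rewrite nc0.
Qed.
Lemma nc_gt0 z : (0 < nc z) = (z != 0).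
Proof. by rewrite lt0r nc_eq0 nc_ge0 andbT. Qed.
Lemma ncM z w : nc (z * w) = nc z * nc w.
Proof. exact: ComplexField.Normc.normcM. Qed.
Lemma ncV z : nc z^-1 = (nc z)^-1. Proof. exact: ComplexField.Normc.normcV. Qed.
Lemma ncf z w : nc (z / w) = nc z / nc w. Proof. by rewrite ncM ncV. Qed.
Lemma ncD z w : nc (z + w) <= nc z + nc w. Proof. exact: le_normcD. Qed.
Lemma ncN z : nc (- z) = nc z. Proof. exact: normcN. Qed.
Lemma ncB z w : nc (z - w) <= nc z + nc w. Proof. by rewrite -(ncN w) ncD. Qed.
Lemma ncBC z w : nc (z - w) = nc (w - z). Proof. by rewrite -ncN opprB. Qed.
Lemma ncX z n : nc (z ^+ n) = nc z ^+ n.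
Proof. by elim: n => [|n IH]; rewrite ?expr0 ?nc1// !exprS ncM IH. Qed.
Lemma nc_real x : nc x%:C = `|x|.
Proof. by rewrite /= expr0n /= addr0 sqrtr_sqr. Qed.
Lemma nc_i : nc ('i : R[i]) = 1.
Proof. by rewrite /= expr0n expr1n add0r sqrtr1. Qed.
Lemma nc_conj z : nc (z^*) = nc z. Proof. by case: z => a b /=; rewrite sqrrN. Qed.
Lemma le_nc_dist z w : nc z - nc w <= nc (z - w).
Proof. by rewrite lerBlDr; apply: le_trans (ncD _ _); rewrite subrK. Qed.
Lemma Re_le_nc z : `|Re z| <= nc z.
Proof.
rewrite -ler_sqr ?nnegrE ?nc_ge0// sqr_nc real_normK ?num_real//.
by rewrite lerDl sqr_ge0.
Qed.
Lemma Im_le_nc z : `|Im z| <= nc z.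
Proof.
rewrite -ler_sqr ?nnegrE ?nc_ge0// sqr_nc real_normK ?num_real//.
by rewrite lerDr sqr_ge0.
Qed.
Lemma nc_le z : nc z <= `|Re z| + `|Im z|.
Proof.
rewrite {1}[z]cE cplxE; apply: le_trans (ncD _ _) _.
by rewrite ncM nc_i mul1r !nc_real.
Qed.
Lemma nc_sum (I : Type) (r : seq I) (Q : pred I) (F : I -> R[i]) :
  nc (\sum_(i <- r | Q i) F i) <= \sum_(i <- r | Q i) nc (F i).
Proof.
elim/big_ind2 : _ => [|x1 x2 y1 y2 h1 h2|//]; first by rewrite nc0.
by apply: le_trans (ncD _ _) _; rewrite lerD.
Qed.
Lemma nc_prod (I : Type) (r : seq I) (Q : pred I) (F : I -> R[i]) :
  nc (\prod_(i <- r | Q i) F i) = \prod_(i <- r | Q i) nc (F i).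
Proof. by elim/big_rec2 : _ => [|i x y _ <-]; rewrite ?nc1 ?ncM. Qed.

Lemma Re_conj z : Re z^* = Re z. Proof. by case: z. Qed.
Lemma Im_conj z : Im z^* = - Im z. Proof. by case: z. Qed.
Lemma conjMC z w : (z * w)^* = z^* * w^*. Proof. exact: rmorphM. Qed.
Lemma conjDC z w : (z + w)^* = z^* + w^*. Proof. exact: rmorphD. Qed.
Lemma conjCR x : (x%:C)^* = x%:C. Proof. by apply: c_eq; rewrite //= oppr0. Qed.
Lemma conjVC z : (z^-1)^* = (z^*)^-1. Proof. exact: fmorphV. Qed.

Lemma pC_conj (p : {poly R}) z : ((pC p).[z])^* = (pC p).[z^*].
Proof.
have -> : (pC p).[z^*] = (map_poly (@conjc R) (pC p)).[z^*].
  rewrite -map_poly_comp; congr (_.[_]); apply: eq_map_poly => x /=.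
  by rewrite oppr0.
by rewrite horner_map.
Qed.
Lemma pC_real (p : {poly R}) x : (pC p).[x%:C] = (p.[x])%:C.
Proof. by rewrite horner_map. Qed.
Lemma pC_rV (p : {poly R}) n z : (size p <= n)%N ->
  (pC p).[z] = \sum_(i < n) (p`_i)%:C * z ^+ i.
Proof.
move=> h; rewrite (@horner_coef_wide _ n) ?size_map_poly//.
by apply: eq_bigr => i _; rewrite coef_map.
Qed.

(** Complex functions are differentiated only along real curves, so the pair of real derivatives
    suffices and the real mean value and integration theorems apply to each component. *)
Definition cder (f : R -> R[i]) (t : R) (l : R[i]) : Prop :=
  is_derive t 1 (fun s => Re (f s)) (Re l) /\
  is_derive t 1 (fun s => Im (f s)) (Im l).

Lemma cder_eq f t l l' : cder f t l -> l = l' -> cder f t l'.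
Proof. by move=> h <-. Qed.
Lemma cder_ext f h t l : f =1 h -> cder f t l -> cder h t l.
Proof. by move=> /funext ->. Qed.
Lemma cder_cst z t : cder (fun=> z) t 0.
Proof. by split; exact: is_derive_cst. Qed.
Lemma cderD f h t l m : cder f t l -> cder h t m -> cder (fun s => f s + h s) t (l + m).
Proof.
move=> [f1 f2] [h1 h2]; split; rewrite ?ReD ?ImD.
  under eq_fun do rewrite ReD; exact: is_deriveD.
by under eq_fun do rewrite ImD; exact: is_deriveD.
Qed.
Lemma cderN f t l : cder f t l -> cder (fun s => - f s) t (- l).
Proof.
move=> [f1 f2]; split; rewrite ?ReN ?ImN.
  under eq_fun do rewrite ReN; exact: is_deriveN.
by under eq_fun do rewrite ImN; exact: is_deriveN.
Qed.
Lemma cderB f h t l m : cder f t l -> cder h t m -> cder (fun s => f s - h s) t (l - m).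
Proof. by move=> ? ?; apply: cderD => //; exact: cderN. Qed.
Lemma is_derive_eq' (V W : normedModType R) (f : V -> W) t (v : V) l l' :
  is_derive t v f l -> l = l' -> is_derive t v f l'.
Proof. by move=> h <-. Qed.
Lemma cderM f h t l m : cder f t l -> cder h t m ->
  cder (fun s => f s * h s) t (l * h t + f t * m).
Proof.
move=> [f1 f2] [h1 h2]; split.
  under eq_fun do rewrite ReM.
  apply: (@is_derive_eq' _ _ _ _ _ _ _ (is_deriveB (is_deriveM f1 h1) (is_deriveM f2 h2))).
  by rewrite ReD !ReM /GRing.scale /=; ring.
under eq_fun do rewrite ImM.
apply: (@is_derive_eq' _ _ _ _ _ _ _ (is_deriveD (is_deriveM f1 h2) (is_deriveM f2 h1))).
by rewrite ImD !ImM /GRing.scale /=; ring.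
Qed.
End ComplexBasics.

Section CurveDerivative.
Variable R : realType.
Implicit Types (z w : R[i]) (x y : R).

Lemma ReV z : Re z^-1 = Re z / (Re z ^+ 2 + Im z ^+ 2).
Proof. by case: z. Qed.
Lemma ImV z : Im z^-1 = - Im z / (Re z ^+ 2 + Im z ^+ 2).
Proof. by case: z => a b /=; rewrite mulNr. Qed.
Lemma sqr_norm_neq0 z : z != 0 -> Re z ^+ 2 + Im z ^+ 2 != 0.
Proof. by rewrite -sqr_nc sqrf_eq0 nc_eq0. Qed.

Lemma cderV (f : R -> R[i]) t l : f t != 0 -> cder f t l ->
  cder (fun s => (f s)^-1) t (- l / f t ^+ 2).
Proof.
move=> f0 [f1 f2].
have n0 := sqr_norm_neq0 f0.
pose n s := Re (f s) * Re (f s) + Im (f s) * Im (f s).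
have dn0 : is_derive t 1 n _ := is_deriveD (is_deriveM f1 f1) (is_deriveM f2 f2).
have nE s : Re (f s) ^+ 2 + Im (f s) ^+ 2 = n s by rewrite /n !expr2.
have dn := @is_deriveV _ n t _ 1 _ dn0; rewrite -nE in dn; have {}dn := dn n0.
set u := f t in n0 f0 dn *.
have e2 : u ^+ 2 != 0 by rewrite expf_neq0.
split.
  under eq_fun do rewrite ReV nE.
  apply: (is_derive_eq' (is_deriveM f1 dn)).
  rewrite /GRing.scale /= -/u -nE ReM ReV ImV ReN ImN expr2 !ReM !ImM.
  by field; rewrite n0 -!expr2 -!(ReM,ImM) sqr_norm_neq0.
under eq_fun do rewrite ImV nE.
have f2' : is_derive t 1 (fun s => - Im (f s)) (- Im l) := is_deriveN f2.
apply: (is_derive_eq' (is_deriveM f2' dn)).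
rewrite /GRing.scale /= -/u -nE ImM ReV ImV ReN ImN expr2 !ReM !ImM.
by field; rewrite n0 -!expr2 -!(ReM,ImM) sqr_norm_neq0.
Qed.

Lemma cder_line z v t : cder (fun s => z + s%:C * v) t v.
Proof.
split.
  under eq_fun do rewrite ReD ReCM.
  apply: (is_derive_eq' (is_deriveD (is_derive_cst _ _ _) (is_deriveM (is_derive_id _ _) (is_derive_cst _ _ _)))).
  by rewrite /GRing.scale /=; ring.
under eq_fun do rewrite ImD ImCM.
apply: (is_derive_eq' (is_deriveD (is_derive_cst _ _ _) (is_deriveM (is_derive_id _ _) (is_derive_cst _ _ _)))).
by rewrite /GRing.scale /=; ring.
Qed.

Lemma cder_poly (p : {poly R[i]}) (f : R -> R[i]) t l : cder f t l ->
  cder (fun s => p.[f s]) t (p^`().[f t] * l).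
Proof.
move=> df; elim/poly_ind: p => [|p c IH].
  apply: (cder_ext (f := fun=> 0)) => [s|]; first by rewrite horner0.
  by apply: cder_eq (cder_cst _ _) _; rewrite deriv0 horner0 mul0r.
apply: (cder_ext (f := fun s => p.[f s] * f s + c)) => [s|].
  by rewrite hornerD hornerMX hornerC.
apply: cder_eq (cderD (cderM IH df) (cder_cst c t)) _.
rewrite derivD derivM derivC derivX !hornerE; ring.
Qed.

Lemma is_derive_le (f g f' g' : R -> R) (a b : R) : a <= b ->
  (forall t : R, t \in `[a, b] -> is_derive t 1 f (f' t)) ->
  (forall t : R, t \in `[a, b] -> is_derive t 1 g (g' t)) ->
  (forall t : R, t \in `[a, b] -> f' t <= g' t) -> f b - f a <= g b - g a.
Proof.
move=> ab df dg fg.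
have dgf (x : R) : x \in `[a, b] -> is_derive x 1 (fun x => g x - f x) (g' x - f' x).
  by move=> xab; apply: is_deriveB; [exact: dg|exact: df].
pose h x := g x - f x; pose h' x := g' x - f' x.
have dh (x : R) : x \in `]a, b[ -> is_derive x 1 h (h' x).
  by move=> xab; apply: dgf; exact: subset_itv_oo_cc.
have ch : {within `[a, b], continuous h}.
  by apply: derivable_within_continuous => x xab; have [] := dgf _ xab.
have [c cab H] := MVT_segment ab dh ch.
rewrite /h /h' in H.
have : 0 <= (g' c - f' c) * (b - a) by rewrite mulr_ge0// subr_ge0 ?fg.
by rewrite -H => ?; lra.
Qed.

(** A complex curve has no mean value point, so real and imaginary parts are compared with [g]
    separately; this costs the factor 2. *)
Lemma cder_le (f f' : R -> R[i]) (g g' : R -> R) (a b : R) : a <= b ->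
  (forall t : R, t \in `[a, b] -> cder f t (f' t)) ->
  (forall t : R, t \in `[a, b] -> is_derive t 1 g (g' t)) ->
  (forall t : R, t \in `[a, b] -> nc (f' t) <= g' t) ->
  nc (f b - f a) <= 2 * (g b - g a).
Proof.
move=> ab df dg fg.
apply: le_trans (nc_le _) _; rewrite ReB ImB.
have H (h h' : R -> R) : (forall t : R, t \in `[a, b] -> is_derive t 1 h (h' t)) ->
    (forall t, `|h' t| <= nc (f' t)) -> `|h b - h a| <= g b - g a.
  move=> dh hh; rewrite ler_norml; apply/andP; split; last first.
    apply: (is_derive_le ab dh dg) => t tab; apply: le_trans (fg _ tab).
    by apply: le_trans (hh t); rewrite ler_norm.
  have dNh (t : R) : t \in `[a, b] -> is_derive t 1 (fun x => - h x) (- h' t).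
    by move=> tab; apply: is_deriveN; exact: dh.
  rewrite lerNl opprB addrC -[h a]opprK.
  apply: (is_derive_le ab dNh dg) => t tab; apply: le_trans (fg _ tab).
  by apply: le_trans (hh t); rewrite -normrN ler_norm.
have h1 := H _ _ (fun t tab => (df t tab).1) (fun t => Re_le_nc _).
have h2 := H _ _ (fun t tab => (df t tab).2) (fun t => Im_le_nc _).
by lra.
Qed.

Lemma cder_lip (f f' : R -> R[i]) K (a b : R) : a <= b ->
  (forall t : R, t \in `[a, b] -> cder f t (f' t)) ->
  (forall t : R, t \in `[a, b] -> nc (f' t) <= K) ->
  nc (f b - f a) <= 2 * (K * (b - a)).
Proof.
move=> ab df h.
have := @cder_le f f' (fun x => K * x) (fun=> K) a b ab df.
rewrite -mulrBr; apply => //.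
move=> t _; apply: (is_derive_eq' (is_deriveM (is_derive_cst _ _ _) (is_derive_id _ _))).
by rewrite /GRing.scale /= mulr0 addr0 mulr1.
Qed.

Lemma sqrtc_sqr z : sqrtc z ^+ 2 = z. Proof. exact: sqr_sqrtc. Qed.
Lemma Re_sqrtc_ge0 z : 0 <= Re (sqrtc z).
Proof. by case: z => a b /=; rewrite sqrtr_ge0. Qed.
Lemma Im_sqrtc_ge0 z : 0 <= Im z -> 0 <= Im (sqrtc z).
Proof.
case: z => a b /= b0; rewrite mulr_ge0 ?sqrtr_ge0//.
by case: ifP => // _; rewrite sgr_ge0.
Qed.
Lemma sqrtc_conj z : Im z != 0 -> sqrtc z^* = (sqrtc z)^*.
Proof.
case: z => a b /= b0; apply: c_eq => //=; rewrite ?sqrrN//.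
by rewrite oppr_eq0 (negbTE b0) sgrN mulNr.
Qed.
Lemma nc_sqrtc z : nc (sqrtc z) = Num.sqrt (nc z).
Proof. by rewrite -{2}(sqrtc_sqr z) ncX sqrtr_sqr ger0_norm ?nc_ge0. Qed.
Lemma sqrtc_real x : sqrtc x%:C =
  if 0 <= x then (Num.sqrt x)%:C else 'i * (Num.sqrt (- x))%:C.
Proof.
case: ifPn => [x0|]; first by rewrite sqrtc_sqrtr// lecR.
rewrite -ltNge => x0; rewrite /sqrtc/= eqxx expr0n addr0 sqrtr_sqr ltr0_norm//.
apply: c_eq => /=; rewrite ?(mul0r,mulr0,mul1r,addr0,subr0,add0r).
  by rewrite addNr mul0r sqrtr0 oppr0.
by congr (Num.sqrt _); field.
Qed.
(** Over the closed upper half plane the roots lie in the closed first quadrant, where a difference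
    is no longer than the corresponding sum; difference times sum is z - w. This gives continuity of
    the root from above, up to and on the cut. *)
Lemma sqrtc_dist z w : 0 <= Im z -> 0 <= Im w ->
  nc (sqrtc z - sqrtc w) ^+ 2 <= nc (z - w).
Proof.
move=> z0 w0; rewrite -{2}(sqrtc_sqr z) -{2}(sqrtc_sqr w) subr_sqr ncM expr2.
apply: ler_wpM2l; first exact: nc_ge0.
rewrite -ler_sqr ?nnegrE ?nc_ge0 // !sqr_nc !(ReB,ReD,ImB,ImD).
have := Re_sqrtc_ge0 z; have := Re_sqrtc_ge0 w.
have := Im_sqrtc_ge0 z0; have := Im_sqrtc_ge0 w0; nra.
Qed.

Lemma cder_uniq (f : R -> R[i]) t l m : cder f t l -> cder f t m -> l = m.
Proof.
move=> [f1 f2] [g1 g2]; apply: c_eq.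
  by rewrite -(derive_val (is_derive := f1)) -(derive_val (is_derive := g1)).
by rewrite -(derive_val (is_derive := f2)) -(derive_val (is_derive := g2)).
Qed.

Lemma cder_ex (f : R -> R[i]) (t a b : R) :
  is_derive t 1 (fun s => Re (f s)) a -> is_derive t 1 (fun s => Im (f s)) b ->
  cder f t (a +i* b).
Proof. by []. Qed.

Lemma cder_sqrt (f : R -> R[i]) t l : 0 < Im (f t) -> cder f t l ->
  cder (fun s => sqrtc (f s)) t (l / (2 * sqrtc (f t))).
Proof.
move=> f0 [f1 f2].
set x := Re (f t); set y := Im (f t).
have n0 : 0 < x ^+ 2 + y ^+ 2 by rewrite ltr_wpDl ?sqr_ge0// exprn_gt0.
pose r := Num.sqrt (x ^+ 2 + y ^+ 2).
have r0 : 0 < r by rewrite sqrtr_gt0.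
have r2 : r ^+ 2 = x ^+ 2 + y ^+ 2 by rewrite sqr_sqrtr// ltW.
have ff : 0 < y ^+ 2 by rewrite exprn_gt0.
have rx : 0 < (r + x) / 2 by nra.
have rx' : 0 < (r - x) / 2 by nra.
pose n s := Re (f s) * Re (f s) + Im (f s) * Im (f s).
have dn : is_derive t 1 n _ := is_deriveD (is_deriveM f1 f1) (is_deriveM f2 f2).
have nE s : Re (f s) ^+ 2 + Im (f s) ^+ 2 = n s by rewrite /n !expr2.
have nt0 : 0 < n t by rewrite -nE.
have dr := is_derive1_comp (is_derive1_sqrt nt0) dn.
have d1 := is_deriveM (is_deriveD dr f1) (is_derive_cst (2^-1 : R) t 1).
have d2 := is_deriveM (is_deriveB dr f1) (is_derive_cst (2^-1 : R) t 1).
have rE0 : r = Num.sqrt (n t) by rewrite /r nE.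
rewrite /= in d1 d2.
have d3 := fun h => is_derive1_comp (is_derive1_sqrt h) d1.
have d4 := fun h => is_derive1_comp (is_derive1_sqrt h) d2.
rewrite /= -rE0 -/x in d3 d4; have {}d3 := d3 rx; have {}d4 := d4 rx'.
have nr : \forall s \near t, 0 < Im (f s).
  have := differentiable_continuous ((derivable1_diffP _ _).1 (ex_derive (is_derive := f2))).
  by move/cvgr_gt; apply.
have d3' : is_derive t 1 (fun v => Num.sqrt ((Num.sqrt (n v) + Re (f v)) / 2)) _ := d3.
have d4' : is_derive t 1 (fun v => Num.sqrt ((Num.sqrt (n v) - Re (f v)) / 2)) _ := d4.
have n1 : \forall v \near t, Num.sqrt ((Num.sqrt (n v) + Re (f v)) / 2) = Re (sqrtc (f v)).
  by near=> v; rewrite -nE; case: (f v).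
have n2 : \forall v \near t, Num.sqrt ((Num.sqrt (n v) - Re (f v)) / 2) = Im (sqrtc (f v)).
  near=> v; rewrite -nE.
  have : 0 < Im (f v) by near: v.
  by case: (f v) => a b /= b0; rewrite gt_eqF// gtr0_sg// mul1r.
have e1 := near_eq_is_derive n1 d3'.
have e2 := near_eq_is_derive n2 d4'.
(* The explicit formulas for the components are used only for differentiability; the value of the
   derivative comes from differentiating the square of the root. *)
have [d dd] : exists d, cder (fun s => sqrtc (f s)) t d.
  by eexists; exact: (cder_ex e1 e2).
have /(cder_uniq (conj f1 f2 : cder f t l)) -> : cder f t (d * sqrtc (f t) + sqrtc (f t) * d).
  by apply: cder_ext (cderM dd dd) => s; rewrite -expr2 sqrtc_sqr.
apply: cder_eq dd _.
have s0 : sqrtc (f t) != 0.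
  by rewrite sqrtc_eq0; apply: contraTneq f0 => ->; rewrite ltxx.
by field.
Unshelve. all: by end_near. Qed.
End CurveDerivative.

(** * Primitives of holomorphic functions and improper integrals *)

Section Primitive.
Variable R : realType.
Implicit Types (z w v : R[i]) (x y : R).

Lemma Rint_FTC (f F : R -> R) (a b : R) : a <= b ->
  (forall t : R, t \in `[a, b] -> is_derive t 1 F (f t)) ->
  {within `[a, b], continuous f} ->
  (\int[lebesgue_measure]_(x in `[a, b]) f x) = F b - F a.
Proof.
rewrite le_eqVlt => /predU1P[<- _ _|ab dF cf].
  by rewrite subrr set_itv1 Rintegral_set1.
have dF' : derivable_oo_LRcontinuous F a b.
  split.
  - by move=> x /subset_itv_oo_cc xab; have [] := dF _ xab.
  - apply: cvg_at_right_filter; apply: differentiable_continuous.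
    by apply/derivable1_diffP; have [|//] := dF a; rewrite in_itv/= lexx ltW.
  - apply: cvg_at_left_filter; apply: differentiable_continuous.
    by apply/derivable1_diffP; have [|//] := dF b; rewrite in_itv/= lexx ltW.
have Ff : {in `]a, b[, F^`()%classic =1 f}.
  by move=> x /subset_itv_oo_cc xab; rewrite derive1E; have [] := dF _ xab.
by rewrite /Rintegral (continuous_FTC2 ab cf dF' Ff).
Qed.

(** Holomorphy on the upper half plane in the form of a chain rule: [h'] is the factor picked up
    along every real curve. *)
Definition holo (h h' : R[i] -> R[i]) := forall (f : R -> R[i]) t l,
  0 < Im (f t) -> cder f t l -> cder (fun s => h (f s)) t (h' (f t) * l).

(** The sets Im z >= e, |z| <= r exhaust the upper half plane by compact sets; the bounds on them
    dominate the integrands when differentiating under the integral. *)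
Definition locbd (h : R[i] -> R[i]) := forall e r : R, 0 < e ->
  exists K, forall z, e <= Im z -> nc z <= r -> nc (h z) <= K.

Lemma is_derive_within (f f' : R -> R) (a b : R) :
  (forall t : R, t \in `[a, b] -> is_derive t 1 f (f' t)) ->
  {within `[a, b], continuous f}.
Proof.
by move=> h; apply: derivable_within_continuous => x xab; have [] := h _ xab.
Qed.

Lemma under_int (u d : R -> R -> R) (t0 e K : R) : 0 < e ->
  (forall s t : R, s \in `]t0 - e, t0 + e[ -> t \in `[0, 1] ->
    is_derive s 1 (u ^~ t) (d s t)) ->
  (forall s : R, s \in `]t0 - e, t0 + e[ -> {within `[0, 1], continuous (u s)}) ->
  (forall s t : R, s \in `]t0 - e, t0 + e[ -> t \in `[0, 1] -> `|d s t| <= K) ->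
  is_derive t0 1 (fun s => \int[lebesgue_measure]_(t in `[0, 1]) u s t)
    (\int[lebesgue_measure]_(t in `[0, 1]) d t0 t).
Proof.
move=> e0 du cu dK.
pose mu := @lebesgue_measure R.
have m01 : measurable (`[0, 1]%classic : set (measurableTypeR R)) by [].
have Ia : (`]t0 - e, t0 + e[%classic : set R) t0 by rewrite /= in_itv/=; apply/andP; split; lra.
have intu (s : R) : (`]t0 - e, t0 + e[%classic : set R) s ->
    mu.-integrable `[0, 1] (EFin \o u s).
  by move=> Is; apply: continuous_compact_integrable; [exact: segment_compact|exact: cu].
have dE (s t : R) : (`]t0 - e, t0 + e[%classic : set R) s -> (`[0, 1]%classic : set R) t ->
    (u ^~ t)^`()%classic s = d s t.
  by move=> Is It; rewrite derive1E; have [] := du _ _ Is It.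
have K0 : 0 <= K.
  by apply: le_trans (dK t0 0 Ia _) => //; rewrite in_itv/= lexx ler01.
have intK : mu.-integrable `[0, 1] (EFin \o cst K).
  by apply: continuous_compact_integrable; [exact: segment_compact|exact: cst_continuous].
have duI (s t : R) : (`]t0 - e, t0 + e[%classic : set R) s -> (`[0, 1]%classic : set R) t ->
    derivable (u ^~ t) s 1.
  by move=> Is It; have [] := du _ _ Is It.
have dKI (s t : R) : (`]t0 - e, t0 + e[%classic : set R) s -> (`[0, 1]%classic : set R) t ->
    `|(u ^~ t)^`()%classic s| <= cst K t.
  by move=> Is It; rewrite dE// dK.
have H1 := derivable_under_integral m01 Ia intu duI (fun=> K0) intK dKI.
have H2 := differentiation_under_integral m01 Ia intu duI (fun=> K0) intK dKI.
apply: DeriveDef => //; rewrite -derive1E H2.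
by apply: eq_Rintegral => t; rewrite inE /partial1of2 => It; rewrite dE.
Qed.

(** All later paths are made of straight lines, so a primitive is tested only along these. *)
Definition line_primitive (P h : R[i] -> R[i]) := forall z v (t : R),
  0 < Im (z + t%:C * v) -> cder (fun s => P (z + s%:C * v)) t (h (z + t%:C * v) * v).

Lemma cder_within (f f' : R -> R[i]) (a b : R) :
  (forall t : R, t \in `[a, b] -> cder f t (f' t)) ->
  {within `[a, b], continuous (fun t => Re (f t))} /\
  {within `[a, b], continuous (fun t => Im (f t))}.
Proof.
move=> h; split.
  by apply: (@is_derive_within _ (fun t => Re (f' t))) => t /h[].
by apply: (@is_derive_within _ (fun t => Im (f' t))) => t /h[].
Qed.

(** The upper half plane is star-shaped about i, so the candidate is the integral of [h] along the
    segment from i to w. Differentiating in w under the integral yields exactly the t-derivative of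
    t h(i + t (w - i)), which integrates to h(w). *)
Lemma primitive (h h' h'' : R[i] -> R[i]) : holo h h' -> holo h' h'' ->
  locbd h -> locbd h' -> exists P : R[i] -> R[i], line_primitive P h.
Proof.
move=> dh dh' bh bh'.
pose pt (w : R[i]) (t : R) := 'i + t%:C * (w - 'i).
pose U w t := (w - 'i) * h (pt w t).
exists (fun w => cint `[0, 1] (U w)) => z v t0.
set w0 := z + t0%:C * v => w00.
pose e := Im w0 / (2 * (1 + `|Im v|)).
have v1 : 0 < 1 + `|Im v| by rewrite ltr_pwDl.
have e0 : 0 < e by rewrite divr_gt0// mulr_gt0.
pose W (s : R) := z + s%:C * v.
pose rho := nc z + (`|t0| + e) * nc v.
have Wim (s : R) : s \in `]t0 - e, t0 + e[ -> Im w0 / 2 <= Im (W s).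
  rewrite in_itv/= => /andP[s1 s2].
  have -> : Im (W s) = Im w0 + (s - t0) * Im v by rewrite /W /w0 !ImD !ImCM; ring.
  have : `|(s - t0) * Im v| <= e * (1 + `|Im v|).
    rewrite normrM ler_pM// ?lerDr// ler_norml; apply/andP; split; lra.
  have -> : e * (1 + `|Im v|) = Im w0 / 2 by rewrite /e; field; rewrite gt_eqF.
  by move=> /ler_normlP[]; lra.
have Wnc (s : R) : s \in `]t0 - e, t0 + e[ -> nc (W s) <= rho.
  rewrite in_itv/= => /andP[s1 s2]; apply: le_trans (ncD _ _) _.
  rewrite lerD2l ncM nc_real ler_wpM2r ?nc_ge0//.
  by rewrite -lerBlDl; apply: le_trans (lerB_dist _ _) _; rewrite ler_norml; apply/andP; split; lra.
pose eta := Num.min 1 (Im w0 / 2).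
have eta0 : 0 < eta by rewrite /eta lt_min ltr01 divr_gt0.
have ptIm (s t : R) : s \in `]t0 - e, t0 + e[ -> t \in `[0, 1] -> eta <= Im (pt (W s) t).
  move=> sI; have h1 := Wim _ sI; rewrite in_itv/= => /andP[t1 t2].
  have -> : Im (pt (W s) t) = (1 - t) * 1 + t * Im (W s).
    by rewrite /pt ImD ImCM ImB /=; ring.
  have g1 : eta <= 1 by rewrite ge_min lexx.
  have g2 : eta <= Im (W s) by apply: le_trans h1; rewrite ge_min lexx orbT.
  nra.
have ptIm0 (s t : R) : s \in `]t0 - e, t0 + e[ -> t \in `[0, 1] -> 0 < Im (pt (W s) t).
  by move=> ? ?; apply: lt_le_trans eta0 _; exact: ptIm.
have ptnc (s t : R) : s \in `]t0 - e, t0 + e[ -> t \in `[0, 1] -> nc (pt (W s) t) <= 1 + rho.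
  move=> sI; have h1 := Wnc _ sI; rewrite in_itv/= => /andP[t1 t2].
  have -> : pt (W s) t = (1 - t)%:C * 'i + t%:C * W s.
    by rewrite /pt rmorphB /=; ring.
  apply: le_trans (ncD _ _) _; rewrite !ncM !nc_real nc_i mulr1 !ger0_norm ?subr_ge0//.
  have := nc_ge0 (W s); nra.
have [K1 hK1] := bh eta (1 + rho) eta0.
have [K2 hK2] := bh' eta (1 + rho) eta0.
pose D s t := v * h (pt (W s) t) + (W s - 'i) * (h' (pt (W s) t) * (t%:C * v)).
have dW (s : R) : cder W s v by exact: cder_line.
have dU (s t : R) : s \in `]t0 - e, t0 + e[ -> t \in `[0, 1] ->
    cder (fun s => U (W s) t) s (D s t).
  move=> sI tI; apply: cderM.
    by apply: cder_eq (cderB (dW s) (cder_cst 'i s)) _; rewrite subr0.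
  apply: dh; first exact: ptIm0.
  apply: cder_eq (cderD (cder_cst 'i s) (cderM (cder_cst t%:C s) (cderB (dW s) (cder_cst 'i s)))) _.
  by rewrite mul0r !add0r subr0.
have dpt (s t : R) : cder (fun t => pt (W s) t) t (W s - 'i) by exact: cder_line.
have dUt (s t : R) : s \in `]t0 - e, t0 + e[ -> t \in `[0, 1] ->
    cder (fun t => U (W s) t) t ((W s - 'i) * (h' (pt (W s) t) * (W s - 'i))).
  move=> sI tI; apply: cder_eq (cderM (cder_cst _ _) (dh _ _ _ (ptIm0 _ _ sI tI) (dpt s t))) _.
  by rewrite mul0r add0r.
have dK (s t : R) : s \in `]t0 - e, t0 + e[ -> t \in `[0, 1] ->
    nc (D s t) <= nc v * K1 + (rho + 1) * (K2 * nc v).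
  move=> sI tI; apply: le_trans (ncD _ _) _; rewrite !ncM nc_real lerD//.
    by rewrite ler_wpM2l ?nc_ge0// hK1// ?ptIm ?ptnc.
  rewrite ler_pM ?mulr_ge0 ?nc_ge0 ?normr_ge0//.
    by apply: le_trans (ncB _ _) _; rewrite nc_i lerD2r Wnc.
  rewrite ler_pM ?mulr_ge0 ?nc_ge0 ?normr_ge0//.
    by rewrite hK2// ?ptIm ?ptnc.
  move: tI; rewrite in_itv/= => /andP[t1 t2].
  by rewrite ler_piMl ?nc_ge0// ger0_norm.
have t0I : t0 \in `]t0 - e, t0 + e[ by rewrite in_itv/=; apply/andP; split; lra.
(* The t-derivative of [V] is the s-derivative [D t0] of the integrand, so the integral of the
   latter is a boundary term. *)
pose V (t : R) := t%:C * v * h (pt w0 t).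
have dV (t : R) : t \in `[0, 1] -> cder V t (D t0 t).
  move=> tI; apply: cder_eq (cderM (cderM (_ : cder (fun t => t%:C) t 1) (cder_cst v t)) (dh _ _ _ (ptIm0 _ _ t0I tI) (dpt t0 t))) _.
    apply: cder_ext (cder_line 0 1 t) => s; by rewrite add0r mulr1.
  by rewrite /D; ring.
have dD (t : R) : t \in `[0, 1] -> exists l, cder (D t0) t l.
  move=> tI; eexists; apply: cderD; first apply: cderM.
  - exact: cder_cst.
  - exact: dh (ptIm0 _ _ t0I tI) (dpt t0 t).
  - apply: cderM; first exact: cder_cst.
    apply: cderM; first exact: dh' (ptIm0 _ _ t0I tI) (dpt t0 t).
    apply: cderM; last exact: cder_cst.
    by apply: cder_ext (cder_line 0 1 t) => s; rewrite add0r mulr1.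
have [D' dD'] : exists D', forall t : R, t \in `[0, 1] -> cder (D t0) t (D' t).
  exists (fun t => if pselect (t \in `[0, 1]) is left p then projT1 (cid (dD t p)) else 0).
  by move=> t tI; case: pselect => // p; case: cid.
have [cD1 cD2] := cder_within dD'.
have bnd : (0 : R) \in `[0, 1] /\ (1 : R) \in `[0, 1] by rewrite !in_itv/= lexx ler01 lexx.
have VE : V 1 - V 0 = h w0 * v.
  by rewrite /V /pt !mul0r subr0 !mul1r mulrC; congr (h _ * v); ring.
split; rewrite -VE ?ReB ?ImB.
  have EI : \int[lebesgue_measure]_(t in `[0, 1]) Re (D t0 t) = Re (V 1) - Re (V 0).
    apply: (@Rint_FTC (fun t => Re (D t0 t)) (fun t => Re (V t)) 0 1 ler01) => // t tI.
    exact: (dV _ tI).1.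
  rewrite -EI.
    apply: (@under_int (fun s t => Re (U (W s) t)) (fun s t => Re (D s t)) t0 e _ e0).
    - by move=> s t sI tI; exact: (dU _ _ sI tI).1.
    - by move=> s sI; exact: (cder_within (dUt _ ^~ sI)).1.
    - by move=> s t sI tI; apply: le_trans (Re_le_nc _) (dK _ _ sI tI).
have EI : \int[lebesgue_measure]_(t in `[0, 1]) Im (D t0 t) = Im (V 1) - Im (V 0).
    apply: (@Rint_FTC (fun t => Im (D t0 t)) (fun t => Im (V t)) 0 1 ler01) => // t tI.
    exact: (dV _ tI).2.
  rewrite -EI.
  apply: (@under_int (fun s t => Im (U (W s) t)) (fun s t => Im (D s t)) t0 e _ e0).
  - by move=> s t sI tI; exact: (dU _ _ sI tI).2.
  - by move=> s sI; exact: (cder_within (fun t => dUt s t sI)).2.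
  - by move=> s t sI tI; apply: le_trans (Im_le_nc _) (dK _ _ sI tI).
Qed.

(** The closed intervals exhaust the open one with harmonic margins; the theorem holds on each of
    them, and nonnegativity permits monotone convergence. *)
Lemma ge0_improper_FTC (f F : R -> R) (a b : R) : a < b ->
  (forall t : R, t \in `]a, b[ -> is_derive t 1 F (f t)) ->
  {within `[a, b], continuous F} -> {in `]a, b[, continuous f} ->
  (forall t : R, t \in `]a, b[ -> 0 <= f t) ->
  (\int[lebesgue_measure]_(t in `]a, b[) (f t)%:E = (F b - F a)%:E)%E.
Proof.
move=> ab dF cF cf f0.
pose u (n : nat) : R := (b - a) / 2 * harmonic n.
have h1 (n : nat) : @harmonic R n <= 1.
  by rewrite /harmonic /= invf_le1// ?ler1n.
have h0 (n : nat) : 0 < @harmonic R n by rewrite /harmonic /= invr_gt0.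
have u0 n : 0 < u n by rewrite mulr_gt0// divr_gt0// subr_gt0.
have u1 n : a + u n <= b - u n.
  have := h1 n; rewrite /u => ?; nra.
pose I n : set R := `[a + u n, b - u n]%classic.
have sI n : I n `<=` `]a, b[.
  by move=> x; rewrite /I /= !in_itv/= => /andP[]; have := u0 n; lra.
have uc : u n @[n --> \oo] --> 0.
  by rewrite -(mulr0 ((b - a) / 2)); apply: cvgM; [exact: cvg_cst|exact: cvg_harmonic].
have bI : \bigcup_n I n = `]a, b[%classic.
  apply/seteqP; split => [x [n _]|x]; first exact: sI.
  rewrite /= in_itv/= => /andP[ax xb].
  have m0 : 0 < Num.min (x - a) (b - x) by rewrite lt_min !subr_gt0 ax.
  have /cvgrPdist_lt/(_ _ m0)[N _ /(_ N (leqnn _))] := uc.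
  rewrite sub0r normrN gtr0_norm// lt_min => /andP[p1 p2].
  by exists N => //; rewrite /I /= in_itv/=; lra.
have cF' : F (a + u n) @[n --> \oo] --> F a /\ F (b - u n) @[n --> \oo] --> F b.
  have [_ ca cb] := (continuous_within_itvP _ ab).1 cF; split.
    move/cvg_at_rightP : ca; apply; split => [n|]; first by rewrite ltrDl.
    by rewrite -[X in _ --> X]addr0; apply: cvgD => //; exact: cvg_cst.
  move/cvg_at_leftP : cb; apply; split => [n|]; first by rewrite gtrBl.
  by rewrite -[X in _ --> X]subr0; apply: cvgB => //; exact: cvg_cst.
have mf : measurable_fun (`]a, b[ : set (measurableTypeR R)) (EFin \o (f : measurableTypeR R -> R)).
  apply/measurable_EFinP; apply: open_continuous_measurable_fun => //.
  by move=> x; rewrite inE; exact: cf.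
have ndI : nondecreasing_seq I.
  apply/nondecreasing_seqP => n; rewrite subsetEset => x; rewrite /I /= !in_itv/=.
  have : u n.+1 <= u n.
    rewrite /u ler_pM2l ?divr_gt0 ?subr_gt0//.
    by rewrite /harmonic /= lef_pV2 ?posrE ?ltr0n// ler_nat.
  by move=> ? /andP[? ?]; apply/andP; split; lra.
have mI n : measurable (I n : set (measurableTypeR R)) by exact: measurable_itv.
have mfI n : measurable_fun (I n : set (measurableTypeR R)) (EFin \o (f : measurableTypeR R -> R)).
  by apply: measurable_funS mf => //; exact: sI.
have := @ge0_nondecreasing_set_cvg_integral _ (measurableTypeR R) R I (EFin \o (f : measurableTypeR R -> R))
  lebesgue_measure ndI mI mfI (fun n x Ix => f0 x (sI n x Ix)).
rewrite bI => H; apply: (cvg_unique _ H) => //.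
have FE n : (\int[lebesgue_measure]_(x in I n) (EFin \o f) x)%E = (F (b - u n) - F (a + u n))%:E.
  have dFI (t : R) : t \in `[a + u n, b - u n] -> is_derive t 1 F (f t).
    by move=> tI; apply: dF; exact: (sI n t tI).
  have cfI : {within `[a + u n, b - u n], continuous f}.
    apply: continuous_in_subspaceT => x; rewrite inE => xI.
    by apply: cf; exact: (sI n x xI).
  rewrite -(Rint_FTC (u1 n) dFI cfI) /Rintegral fineK//.
  apply: integrable_fin_num => //.
  by apply: continuous_compact_integrable => //; exact: segment_compact.
rewrite (_ : (fun n => _) = EFin \o (fun n => F (b - u n) - F (a + u n))); last first.
  by apply/funext => n; rewrite FE.
by apply: cvg_EFin; [exact: nearW|apply: cvgB; [exact: cF'.2|exact: cF'.1]].
Qed.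

(** The bound [g] has inverse square-root singularities at both ends and the explicit primitive [G].
    The nonnegative case applies to [g] and to [f + g]; subtraction gives [f]. *)
Lemma improper_FTC (f F : R -> R) (a b K : R) : a < b ->
  (forall t : R, t \in `]a, b[ -> is_derive t 1 F (f t)) ->
  {within `[a, b], continuous F} -> {in `]a, b[, continuous f} ->
  (forall t : R, t \in `]a, b[ ->
     `|f t| <= K / (2 * Num.sqrt (t - a)) + K / (2 * Num.sqrt (b - t))) ->
  lebesgue_measure.-integrable `[a, b] (EFin \o f) /\
  \int[lebesgue_measure]_(t in `[a, b]) f t = F b - F a.
Proof.
move=> ab dF cF cf fK.
pose g t := K / (2 * Num.sqrt (t - a)) + K / (2 * Num.sqrt (b - t)).
pose G t := K * Num.sqrt (t - a) - K * Num.sqrt (b - t).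
have dG (t : R) : t \in `]a, b[ -> is_derive t 1 G (g t).
  rewrite in_itv/= => /andP[at_ tb].
  have ta0 : 0 < t - a by rewrite subr_gt0.
  have tb0 : 0 < b - t by rewrite subr_gt0.
  have d1 : is_derive t 1 (fun t => t - a) _ := is_deriveB (is_derive_id t 1) (is_derive_cst a t 1).
  have d2 : is_derive t 1 (fun t => b - t) _ := is_deriveB (is_derive_cst b t 1) (is_derive_id t 1).
  have d3 := is_derive1_comp (f := Num.sqrt) (g := fun t => t - a) (is_derive1_sqrt ta0) d1.
  have d4 := is_derive1_comp (f := Num.sqrt) (g := fun t => b - t) (is_derive1_sqrt tb0) d2.
  have := is_deriveB (is_deriveM (is_derive_cst K t 1) d3) (is_deriveM (is_derive_cst K t 1) d4).
  move/is_derive_eq'; apply; rewrite /g /GRing.scale /=.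
  by field; rewrite !gt_eqF ?sqrtr_gt0.
have cG : {within `[a, b], continuous G}.
  apply: continuous_subspaceT => x; apply: cvgB; apply: cvgM; try exact: cvg_cst.
    by apply: continuous_comp; [apply: cvgB; [exact: cvg_id|exact: cvg_cst]|exact: sqrt_continuous].
  by apply: continuous_comp; [apply: cvgB; [exact: cvg_cst|exact: cvg_id]|exact: sqrt_continuous].
have cg : {in `]a, b[, continuous g}.
  move=> t; rewrite in_itv/= => /andP[at_ tb].
  apply: cvgD; apply: cvgM; try exact: cvg_cst; apply: cvgV.
  - by rewrite mulf_neq0// gt_eqF// sqrtr_gt0 subr_gt0.
  - apply: cvgM; first exact: cvg_cst.
    by apply: continuous_comp; [apply: cvgB; [exact: cvg_id|exact: cvg_cst]|exact: sqrt_continuous].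
  - by rewrite mulf_neq0// gt_eqF// sqrtr_gt0 subr_gt0.
  - apply: cvgM; first exact: cvg_cst.
    by apply: continuous_comp; [apply: cvgB; [exact: cvg_cst|exact: cvg_id]|exact: sqrt_continuous].
have g0 (t : R) : t \in `]a, b[ -> 0 <= g t.
  by move=> /fK; apply: le_trans; rewrite normr_ge0.
have h1 := ge0_improper_FTC ab dG cG cg g0.
have h2 := @ge0_improper_FTC (fun t => f t + g t) (fun t => F t + G t) a b ab.
have {}h2 : (\int[lebesgue_measure]_(t in `]a, b[) (f t + g t)%:E = ((F b + G b) - (F a + G a))%:E)%E.
  apply: h2.
  - by move=> t tI; apply: is_deriveD; [exact: dF|exact: dG].
  - by move=> t; apply: cvgD; [exact: cF|exact: cG].
  - by move=> t tI; apply: cvgD; [exact: cf|exact: cg].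
  - by move=> t tI; have /ler_normlP[] := fK _ tI; rewrite -/(g t); lra.
have mI : measurable (`]a, b[ : set (measurableTypeR R)) by exact: measurable_itv.
have mc (k : R -> R) : {in `]a, b[, continuous k} ->
    measurable_fun (`]a, b[ : set (measurableTypeR R)) k.
  by move=> ck; apply: open_continuous_measurable_fun => // x; rewrite inE; exact: ck.
have int0 (k : R -> R) (l : R) : {in `]a, b[, continuous k} ->
    (forall t : R, t \in `]a, b[ -> 0 <= k t) ->
    (\int[lebesgue_measure]_(t in `]a, b[) (k t)%:E = l%:E)%E ->
    lebesgue_measure.-integrable `]a, b[ (EFin \o k).
  move=> ck k0 kl; apply/integrableP; split; first by apply/measurable_EFinP; exact: mc.
  rewrite (_ : (\int[_]_(_ in _) _)%E = l%:E) ?ltry// -kl.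
  by apply: eq_integral => x; rewrite inE => xI /=; rewrite ger0_norm ?k0.
have i1 := int0 _ _ cg g0 h1.
have i2 : lebesgue_measure.-integrable `]a, b[ (EFin \o (fun t => f t + g t)).
  apply: int0 h2.
  - by move=> t tI; apply: cvgD; [exact: cf|exact: cg].
  - by move=> t tI; have /ler_normlP[] := fK _ tI; rewrite -/(g t); lra.
have fE : f = (fun t => (f t + g t) - g t) by apply/funext => t; rewrite addrK.
have i3 : lebesgue_measure.-integrable `]a, b[ (EFin \o f).
  have := integrableB mI i2 i1; congr (integrable _ _ _).
  by apply/funext => t /=; rewrite -EFinB addrK.
have mcc : measurable_fun (`]a, b[ : set (measurableTypeR R)) f by exact: mc.
have i0 : lebesgue_measure.-integrable `[a, b] (EFin \o f).
  apply/integrableP; split.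
    apply/measurable_EFinP; apply/measurable_fun_itv_obnd_cbndP.
    by apply/measurable_fun_itv_bndo_bndcP.
  have /integrableP[_] := i3.
  rewrite integral_itv_bndo_bndc ?integral_itv_obnd_cbnd//.
    apply: measurableT_comp => //; apply/measurable_EFinP.
    by apply/measurable_fun_itv_bndo_bndcP.
  by apply: measurableT_comp => //; apply/measurable_EFinP.
split => //.
have i4 : lebesgue_measure.-integrable `]a, b] (EFin \o f).
  by apply: integrableS i0 => //; exact: subset_itv_oc_cc.
rewrite -Rintegral_itv_obnd_cbnd// -Rintegral_itv_bndo_bndc//.
by rewrite fE RintegralB// /Rintegral h1 h2 /=; lra.
Qed.
End Primitive.

(** * The square root of R and boundary values *)

Section BranchRoot.
Variables (R : realType) (g : nat) (E : nat -> R).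
Hypothesis hE : band_edges g E.
Implicit Types (z w v : R[i]) (x y : R) (p q : {poly R}).

Let N := g.*2.+2.
Local Notation rt := (Rhalf g E).
Definition edge_poly : {poly R} := \prod_(0 <= j < g.*2.+2) ('X - (E j)%:P).
Definition fdens (p : {poly R}) (z : R[i]) : R[i] := (pC p).[z] / rt z.

Lemma edges_lt i j : (i < j < g.*2.+2)%N -> E i < E j.
Proof.
case/andP; elim: j => // j IH; rewrite ltnS leq_eqVlt => /predU1P[->|ij] jN.
  exact: hE.
by apply: lt_trans (IH ij (ltnW jN)) _; exact: hE.
Qed.

Lemma edges_le i j : (i <= j < g.*2.+2)%N -> E i <= E j.
Proof.
by case/andP; rewrite leq_eqVlt => /predU1P[->//|ij jN]; rewrite ltW ?edges_lt ?ij.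
Qed.

Lemma rt_sqr z : rt z ^+ 2 = (pC edge_poly).[z].
Proof.
rewrite /Rhalf sqrrN /edge_poly rmorph_prod horner_prod -prodrXl.
by apply: eq_bigr => j _; rewrite sqrtc_sqr rmorphB /= map_polyX map_polyC hornerXsubC.
Qed.

Lemma rt_conj z : Im z != 0 -> rt z^* = (rt z)^*.
Proof.
move=> z0; rewrite /Rhalf rmorphN rmorph_prod; congr (- _).
apply: eq_bigr => j _; transitivity ((sqrtc (z - (E j)%:C))^*) => //.
by rewrite -sqrtc_conj ?rmorphB /= ?oppr0// ImB subr0.
Qed.

Lemma nc_rt z : nc (rt z) = \prod_(0 <= j < g.*2.+2) Num.sqrt (nc (z - (E j)%:C)).
Proof. by rewrite /Rhalf ncN nc_prod; apply: eq_bigr => j _; rewrite nc_sqrtc. Qed.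

Lemma rt_neq0 z : Im z != 0 -> rt z != 0.
Proof.
move=> z0; rewrite /Rhalf oppr_eq0; rewrite prodf_seq_neq0; apply/allP => j _ /=.
rewrite sqrtc_eq0; apply: contra z0 => /eqP h.
by have := congr1 (@Im R) h; rewrite ImB /= subr0 => ->.
Qed.

Lemma rt_real_neq0 x : (forall j, (j < g.*2.+2)%N -> x != E j) -> rt x%:C != 0.
Proof.
move=> h; rewrite /Rhalf oppr_eq0 prodf_seq_neq0; apply/allP => j.
rewrite mem_index_iota => /andP[_ jN]; apply/implyP => _.
by rewrite sqrtc_eq0 -(rmorphB (real_complex R)) fmorph_eq0 subr_eq0 h.
Qed.

Definition rt' z := (pC edge_poly^`()).[z] / (2 * rt z).

Lemma holo_poly p : holo (fun z => (pC p).[z]) (fun z => (pC p^`()).[z]).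
Proof.
by move=> f t l _ df; apply: cder_eq (cder_poly _ df) _; rewrite deriv_map.
Qed.

Lemma holo_rt : holo rt rt'.
Proof.
move=> f t l f0 df.
(* Induction over the factors yields some derivative; its value follows by differentiating the
   square, which is a polynomial. *)
have [d dd] : exists d, cder (fun s => rt (f s)) t d.
  rewrite /Rhalf; elim: (index_iota _ _) => [|j s [d IH]].
    exists 0; apply: (cder_ext (f := fun=> -1)) (cder_cst _ _) => s.
    by rewrite big_nil.
  have dj : cder (fun s => f s - (E j)%:C) t l.
    by apply: cder_eq (cderB df (cder_cst _ _)) _; rewrite subr0.
  eexists; apply: cder_ext (cderM (cder_sqrt _ dj) IH) => [u|].
    by rewrite big_cons mulrN.
  by rewrite ImB /= subr0.
apply: (cder_eq dd).
have r0 : rt (f t) != 0 by rewrite rt_neq0// gt_eqF.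
have h : d * rt (f t) + rt (f t) * d = (pC edge_poly^`()).[f t] * l.
  apply: (cder_uniq (cderM dd dd)).
  by apply: cder_ext (holo_poly edge_poly f0 df) => s; rewrite -rt_sqr expr2.
rewrite /rt'; apply: (mulIf (mulf_neq0 (_ : 2 != 0) r0)); first by rewrite pnatr_eq0.
transitivity (d * rt (f t) + rt (f t) * d); first by ring.
by rewrite h; field.
Qed.

Lemma holoM h1 h1' h2 h2' : holo (R := R) h1 h1' -> holo h2 h2' ->
  holo (fun z => h1 z * h2 z) (fun z => h1' z * h2 z + h1 z * h2' z).
Proof.
move=> H1 H2 f t l f0 df; apply: cder_eq (cderM (H1 _ _ _ f0 df) (H2 _ _ _ f0 df)) _.
by ring.
Qed.
Lemma holoD h1 h1' h2 h2' : holo (R := R) h1 h1' -> holo h2 h2' ->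
  holo (fun z => h1 z + h2 z) (fun z => h1' z + h2' z).
Proof.
move=> H1 H2 f t l f0 df; apply: cder_eq (cderD (H1 _ _ _ f0 df) (H2 _ _ _ f0 df)) _.
by ring.
Qed.
Lemma holoV h1 h1' : (forall z, 0 < Im z -> h1 z != 0) -> holo (R := R) h1 h1' ->
  holo (fun z => (h1 z)^-1) (fun z => - h1' z / h1 z ^+ 2).
Proof.
move=> h0 H1 f t l f0 df; apply: cder_eq (cderV (h0 _ f0) (H1 _ _ _ f0 df)) _.
by rewrite !mulNr mulrAC.
Qed.

Lemma rt_neq0H z : 0 < Im z -> rt z != 0.
Proof. by move=> h; rewrite rt_neq0// gt_eqF. Qed.

Definition fdens' p z := (pC p^`()).[z] / rt z + (pC p).[z] * (- rt' z / rt z ^+ 2).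
Lemma holo_fdens p : holo (fdens p) (fdens' p).
Proof. exact: holoM (holo_poly p) (holoV rt_neq0H holo_rt). Qed.

(** The second derivative serves to make the integrand in [primitive] continuous after one
    differentiation. *)
Lemma ex_holo_fdens' p : exists h'', holo (fdens' p) h''.
Proof.
pose c := (pC edge_poly).
exists (fun z => let r' := rt' in
 ((pC p^`()^`()).[z] / rt z + (pC p^`()).[z] * (- rt' z / rt z ^+ 2)) +
 ((pC p^`()).[z] * (- rt' z / rt z ^+ 2) + (pC p).[z] *
   (- ((pC edge_poly^`()^`()).[z] * (2 * rt z)^-1
       + (pC edge_poly^`()).[z] * (- (0 * rt z + 2 * rt' z) / (2 * rt z) ^+ 2))
      * (rt z ^+ 2)^-1
    + (- rt' z) * (- (rt' z * rt z + rt z * rt' z) / (rt z ^+ 2) ^+ 2)))).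
apply: holoD; first exact: (holo_fdens p^`()).
apply: holoM; first exact: holo_poly.
have r0 := rt_neq0H.
have d1 : holo rt' (fun z => (pC edge_poly^`()^`()).[z] * (2 * rt z)^-1
       + (pC edge_poly^`()).[z] * (- (0 * rt z + 2 * rt' z) / (2 * rt z) ^+ 2)).
  apply: holoM; first exact: holo_poly.
  apply: holoV => [z z0|]; first by rewrite mulf_neq0 ?r0// pnatr_eq0.
  by apply: holoM holo_rt => f t l _ _; rewrite mul0r; exact: cder_cst.
apply: holoM.
  by move=> f t l f0 df; apply: (cder_eq (cderN (d1 _ _ _ f0 df))); rewrite !mulNr.
apply: (holoV (h1 := fun z => rt z ^+ 2)) => [z z0|]; first by rewrite expf_neq0// r0.
by move=> f t l f0 df; apply: cder_eq _ _; first exact: (holoM holo_rt holo_rt f0 df).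
Qed.

Lemma nc_nat n : nc (n%:R : R[i]) = n%:R.
Proof. by rewrite -(rmorph_nat (real_complex R)) nc_real normr_nat. Qed.

Lemma poly_bound (p : {poly R}) (r : R) : exists2 K, 0 <= K &
  forall z, nc z <= r -> nc (pC p).[z] <= K.
Proof.
exists (\sum_(i < size p) `|p`_i| * `|r| ^+ i).
  by apply: sumr_ge0 => i _; rewrite mulr_ge0// exprn_ge0.
move=> z zr; rewrite (pC_rV z (leqnn _)); apply: le_trans (nc_sum _ _ _) _.
apply: ler_sum => i _; rewrite ncM nc_real ncX ler_wpM2l//.
by rewrite lerXn2r ?nnegrE ?nc_ge0// (le_trans zr)// ler_norm.
Qed.

Lemma nc_rt_ge e z : 0 <= e -> e <= `|Im z| -> e ^+ g.+1 <= nc (rt z).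
Proof.
move=> e0 ez; rewrite nc_rt.
have -> : e ^+ g.+1 = \prod_(0 <= j < g.*2.+2) Num.sqrt e.
  rewrite big_const_nat subn0 iter_mulr_1 -{1}(sqr_sqrtr e0) -exprM.
  by congr (_ ^+ _); rewrite mul2n doubleS.
apply: ler_prod => j _; rewrite sqrtr_ge0/= ler_sqrt ?nc_ge0//.
by apply: le_trans ez (le_trans _ (Im_le_nc _)); rewrite ImB /= subr0.
Qed.

Lemma fdens_locbd p : locbd (fdens p) /\ locbd (fdens' p).
Proof.
split=> e r e0.
  have [K K0 hK] := poly_bound p r.
  exists (K / e ^+ g.+1) => z ez zr; rewrite ncf ler_pM ?nc_ge0 ?invr_ge0 ?nc_ge0 ?hK//.
  have h : e ^+ g.+1 <= nc (rt z).
    by apply: nc_rt_ge; [exact: ltW|rewrite ger0_norm// (le_trans _ ez)// ltW].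
  by rewrite lef_pV2 ?posrE ?exprn_gt0// (lt_le_trans _ h)// exprn_gt0.
have [K1 K10 hK1] := poly_bound p r.
have [K2 K20 hK2] := poly_bound p^`() r.
have [K3 K30 hK3] := poly_bound edge_poly^`() r.
pose d := (e ^+ g.+1)^-1.
exists (K2 * d + K1 * (K3 * (2^-1 * d) * d ^+ 2)) => z ez zr.
have h : e ^+ g.+1 <= nc (rt z).
  by apply: nc_rt_ge; [exact: ltW|rewrite ger0_norm// (le_trans _ ez)// ltW].
have h1 : (nc (rt z))^-1 <= d.
  by rewrite lef_pV2 ?posrE ?exprn_gt0// (lt_le_trans _ h)// exprn_gt0.
have d0 : 0 <= d by rewrite invr_ge0 exprn_ge0// ltW.
have n0 : 0 <= (nc (rt z))^-1 by rewrite invr_ge0 nc_ge0.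
apply: le_trans (ncD _ _) _; apply: lerD.
  by rewrite ncf ler_pM ?nc_ge0 ?hK2.
rewrite ncM ler_pM ?nc_ge0 ?hK1// ncM ncN ler_pM ?nc_ge0//.
  rewrite /rt' ncf ler_pM ?nc_ge0 ?hK3 ?invr_ge0 ?nc_ge0//.
  by rewrite ncM invfM nc_nat ler_wpM2l.
by rewrite ncV ncX -exprVn lerXn2r ?nnegrE.
Qed.

Lemma ex_fprim p : exists P : R[i] -> R[i], line_primitive P (fdens p).
Proof.
have [h'' Hh] := ex_holo_fdens' p; have [b1 b2] := fdens_locbd p.
exact: primitive (@holo_fdens p) Hh b1 b2.
Qed.
End BranchRoot.

(** * Limits of complex-valued functions *)

Section ComplexLimits.
Variable R : realType.
Implicit Types (z w v : R[i]) (x y : R).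

(** Convergence is taken componentwise so that the real limit rules apply; [ctends_cvg] returns to
    the topology of [R[i]^o] used by the definitions of the statement. *)
Definition ctends {T : Type} (F : set_system T) (f : T -> R[i]) (l : R[i]) :=
  (fun t => Re (f t)) @ F --> Re l /\ (fun t => Im (f t)) @ F --> Im l.

Section Rules.
Context {T : Type} (F : set_system T) {FF : Filter F}.
Implicit Types f h : T -> R[i].
Lemma ctendsP f l : ctends F f l <-> forall e : R, 0 < e -> \forall t \near F, nc (l - f t) < e.
Proof.
split=> [[/cvgrPdist_lt h1 /cvgrPdist_lt h2] e e0|h].
  have e2 : 0 < e / 2 by rewrite divr_gt0.
  near=> t; apply: le_lt_trans (nc_le _) _; rewrite ReB ImB.
  have h1' : `|Re l - Re (f t)| < e / 2 by near: t; exact: h1.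
  have h2' : `|Im l - Im (f t)| < e / 2 by near: t; exact: h2.
  by lra.
split; apply/cvgrPdist_lt => e e0; near=> t.
  by rewrite -ReB; apply: le_lt_trans (Re_le_nc _) _; near: t; exact: h.
by rewrite -ImB; apply: le_lt_trans (Im_le_nc _) _; near: t; exact: h.
Unshelve. all: by end_near. Qed.
Lemma ctends_cst l : ctends F (fun=> l) l.
Proof. by split; exact: cvg_cst. Qed.
Lemma ctendsD f h a b : ctends F f a -> ctends F h b -> ctends F (fun t => f t + h t) (a + b).
Proof.
move=> [f1 f2] [h1 h2]; split; [under eq_fun do rewrite ReD|under eq_fun do rewrite ImD].
  by rewrite ReD; exact: cvgD.
by rewrite ImD; exact: cvgD.
Qed.
Lemma ctendsN f a : ctends F f a -> ctends F (fun t => - f t) (- a).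
Proof.
move=> [f1 f2]; split; [under eq_fun do rewrite ReN|under eq_fun do rewrite ImN].
  by rewrite ReN; exact: cvgN.
by rewrite ImN; exact: cvgN.
Qed.
Lemma ctendsB f h a b : ctends F f a -> ctends F h b -> ctends F (fun t => f t - h t) (a - b).
Proof. by move=> ? ?; apply: ctendsD => //; exact: ctendsN. Qed.
Lemma ctendsM f h a b : ctends F f a -> ctends F h b -> ctends F (fun t => f t * h t) (a * b).
Proof.
move=> [f1 f2] [h1 h2]; split; [under eq_fun do rewrite ReM|under eq_fun do rewrite ImM].
  by rewrite ReM; apply: cvgB; exact: cvgM.
by rewrite ImM; apply: cvgD; exact: cvgM.
Qed.
Lemma ctendsV f a : a != 0 -> ctends F f a -> ctends F (fun t => (f t)^-1) a^-1.
Proof.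
move=> a0 [f1 f2].
have n : (fun t => (Re (f t) ^+ 2 + Im (f t) ^+ 2)^-1) @ F --> (Re a ^+ 2 + Im a ^+ 2)^-1.
  apply: cvgV; first exact: sqr_norm_neq0.
  rewrite !expr2; under eq_fun do rewrite !expr2.
  by apply: cvgD; exact: cvgM.
split; [under eq_fun do rewrite ReV|under eq_fun do rewrite ImV].
  by rewrite ReV; exact: cvgM.
by rewrite ImV; apply: cvgM => //; exact: cvgN.
Qed.
Lemma ctends_sqrt f l : (\forall t \near F, 0 <= Im (f t)) -> 0 <= Im l ->
  ctends F f l -> ctends F (fun t => sqrtc (f t)) (sqrtc l).
Proof.
move=> f0 l0 /ctendsP h; apply/ctendsP => e e0.
near=> t.
have : nc (l - f t) < e ^+ 2 by near: t; apply: h; rewrite exprn_gt0.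
have ft : 0 <= Im (f t) by near: t.
move/(le_lt_trans (sqrtc_dist l0 ft)).
by rewrite ltr_sqr ?nnegrE ?nc_ge0 ?ltW.
Unshelve. all: by end_near. Qed.
Lemma ctends_poly f l (p : {poly R[i]}) : ctends F f l -> ctends F (fun t => p.[f t]) p.[l].
Proof.
move=> h; elim/poly_ind: p => [|p c IH].
  by under eq_fun do rewrite horner0; rewrite horner0; exact: ctends_cst.
under eq_fun do rewrite hornerD hornerMX hornerC.
by rewrite hornerD hornerMX hornerC; exact: ctendsD (ctendsM IH h) (ctends_cst _).
Qed.
End Rules.

Lemma ctends_cvg {T : Type} (F : set_system T) {FF : Filter F} (f : T -> R[i]) (l : R[i]) :
  ctends F f l -> (fun t => f t : R[i]^o) @ F --> (l : R[i]^o).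
Proof.
have nE z : `|z| = (nc z)%:C by case: z.
move/ctendsP=> h; apply/cvgrPdist_lt => -[e e']; rewrite ltcE /= => /andP[/eqP -> e0].
have -> : e +i* 0 = e%:C by [].
by near do rewrite nE ltcR; exact: h.
Unshelve. all: by end_near. Qed.

Lemma ctends_lim {T : Type} (F : set_system T) {FF : ProperFilter F} (f : T -> R[i]) (l : R[i]) :
  ctends F f l -> lim ((f t : R[i]^o) @[t --> F]) = l.
Proof. by move/ctends_cvg => h; apply: (cvg_lim (@norm_hausdorff _ _) h). Qed.

Lemma le_sqrt_limit (a b K y : R) : 0 < y ->
  (forall y', 0 < y' -> y' <= y -> a <= b + K * Num.sqrt y') -> a <= b.
Proof.
move=> y0 H; apply/ler_addgt0Pr => e e0.
set M := `|K| + 1; have M0 : 0 < M by rewrite /M; have := normr_ge0 K; lra.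
pose y' := Num.min y ((e / M) ^+ 2).
have y0' : 0 < y' by rewrite lt_min y0 exprn_gt0// divr_gt0.
have y1 : y' <= y by rewrite ge_min lexx.
have ys : Num.sqrt y' <= e / M.
  rewrite -ler_sqr ?nnegrE ?sqrtr_ge0 ?divr_ge0 ?(ltW e0) ?(ltW M0)//.
  by rewrite sqr_sqrtr ?(ltW y0')// ge_min lexx orbT.
apply: le_trans (H _ y0' y1) _; rewrite lerD2l.
have -> : e = M * (e / M) by field; rewrite gt_eqF.
apply: (@le_trans _ _ (M * Num.sqrt y')); last by rewrite ler_wpM2l// ltW.
by rewrite ler_wpM2r ?sqrtr_ge0// /M; have := ler_norm K; lra.
Qed.

Lemma is_derive_epsP (h : R -> R) (x l : R) :
  (forall e : R, 0 < e -> exists2 d : R, 0 < d & forall x', `|x' - x| < d ->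
     `|h x' - h x - (x' - x) * l| <= e * `|x' - x|) -> is_derive x 1 h l.
Proof.
move=> H.
have C : (fun t : R => t^-1 *: ((h \o shift x) (t *: 1) - h x)) @ (0 : R)^' --> l.
  apply/cvgrPdist_le => e e0; have [d d0 hd] := H e e0.
  near=> t.
  have t0 : t != 0 by near: t; exact: nbhs_dnbhs_neq.
  have td : `|t| < d.
    near: t; apply: dnbhs0_lt; exact: d0.
  have := hd (t + x); rewrite addrK => /(_ td) ht.
  rewrite /= /GRing.scale /= mulr1.
  have -> : l - t^-1 * (h (t + x) - h x) = - (t^-1 * (h (t + x) - h x - t * l)).
    by field.
  rewrite normrN normrM normfV mulrC ler_pdivrMr ?normr_gt0//.
apply: DeriveDef; first by apply/cvg_ex; exists l.
by apply: (cvg_lim (@norm_hausdorff _ _) C).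
Unshelve. all: by end_near. Qed.

(** As y decreases to 0, h y - K sqrt y increases and h y + K sqrt y decreases; the limit is the
    supremum of the former. *)
Lemma half_holder_limit (h : R -> R) (K : R) :
  (forall y y', 0 < y -> y <= y' -> y' <= 1 ->
     `|h y' - h y| <= K * (Num.sqrt y' - Num.sqrt y)) ->
  exists l, forall y, 0 < y -> y <= 1 -> `|h y - l| <= K * Num.sqrt y.
Proof.
move=> H; pose A := [set u | exists2 y, 0 < y <= 1 & u = h y - K * Num.sqrt y].
have K0 : 0 <= K.
  have := H (4^-1) 1; rewrite sqrtr1 => /(_ _ _ _); rewrite invr_gt0 ltr0n invf_le1 ?ltr0n//.
  rewrite ler1n => /(_ isT isT (lexx _)) /(le_trans (normr_ge0 _)).
  have -> : 4^-1 = (2^-1) ^+ 2 :> R by rewrite expr2; field.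
  by rewrite sqrtr_sqr ger0_norm ?invr_ge0//; nra.
have ub y y' : 0 < y <= 1 -> 0 < y' <= 1 -> h y - K * Num.sqrt y <= h y' + K * Num.sqrt y'.
  move=> /andP[y0 y1] /andP[y0' y1'].
  have [s0 s1] : 0 <= Num.sqrt y /\ 0 <= Num.sqrt y' by rewrite !sqrtr_ge0.
  have [yy|/ltW yy] := leP y y'.
    by have /ler_normlP[] := H y y' y0 yy y1'; nra.
  by have /ler_normlP[] := H y' y y0' yy y1; nra.
have A0 : A !=set0 by exists (h 1 - K * Num.sqrt 1), 1 => //; rewrite ltr01 lexx.
exists (sup A) => y y0 y1.
have hy : 0 < y <= 1 by rewrite y0.
have u1 : sup A <= h y + K * Num.sqrt y.
  by apply: sup_le_ub => // _ [y' hy' ->]; exact: ub.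
have u2 : h y - K * Num.sqrt y <= sup A.
  apply: sup_upper_bound; last by exists y.
  by split => //; exists (h y + K * Num.sqrt y) => _ [y' hy' ->]; exact: ub.
by rewrite ler_norml; apply/andP; split; lra.
Qed.
End ComplexLimits.

(** * Boundary values of primitives of p / R^(1/2) on the real axis *)

Section BoundaryValues.
Variables (R : realType) (g : nat) (E : nat -> R).
Hypothesis hE : band_edges g E.
Implicit Types (z w v : R[i]) (x y : R) (p q : {poly R}).
Local Notation rt := (Rhalf g E).

Lemma ctends_rt {T : Type} (F : set_system T) {FF : Filter F} (f : T -> R[i]) l :
  (\forall t \near F, 0 <= Im (f t)) -> 0 <= Im l ->
  ctends F f l -> ctends F (fun t => rt (f t)) (rt l).
Proof.
move=> f0 l0 h; rewrite /Rhalf; apply: ctendsN.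
elim: (index_iota _ _) => [|j s IH].
  by under eq_fun do rewrite big_nil; rewrite big_nil; exact: ctends_cst.
under eq_fun do rewrite big_cons; rewrite big_cons.
apply: ctendsM IH; apply: ctends_sqrt.
- by near=> t; rewrite ImB /= subr0; near: t.
- by rewrite ImB /= subr0.
- by apply: ctendsB h _; exact: ctends_cst.
Unshelve. all: by end_near. Qed.

Lemma ctends_fdens {T : Type} (F : set_system T) {FF : Filter F} (f : T -> R[i]) l p :
  (\forall t \near F, 0 <= Im (f t)) -> 0 <= Im l -> rt l != 0 ->
  ctends F f l -> ctends F (fun t => fdens g E p (f t)) (fdens g E p l).
Proof.
move=> f0 l0 rl h; apply: ctendsM; first exact: ctends_poly.
by apply: ctendsV => //; exact: ctends_rt.
Qed.

Lemma edge_gap : exists2 d : R, 0 < d & forall i j, (i < j < g.*2.+2)%N -> d <= E j - E i.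
Proof.
have [d d0 hd] : exists2 d : R, 0 < d & forall j, (j < g.*2.+1)%N -> d <= E j.+1 - E j.
  have : forall j, (j < g.*2.+1)%N -> 0 < E j.+1 - E j by move=> j /hE; rewrite subr_gt0.
  elim: (g.*2.+1) => [_|n IH H]; first by exists 1.
  have [d d0 hd] := IH (fun j jn => H j (ltnW jn)).
  exists (Num.min d (E n.+1 - E n)); first by rewrite lt_min d0 H.
  move=> j; rewrite ltnS leq_eqVlt => /predU1P[->|jn]; first by rewrite ge_min lexx orbT.
  by rewrite ge_min hd.
exists d => // i j /andP[ij jN].
have := hd i (leq_trans ij (_ : (j <= g.*2.+1)%N)); rewrite -ltnS => /(_ jN).
by have := @edges_le _ _ _ hE i.+1 j; rewrite ij jN => /(_ isT); lra.
Qed.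

(** Distinct edges are at least d apart and e <= d / 2, so at most one of them is within e of z. Its
    factor is at least the square root of Im z, and the others are at least sqrt e >= e. *)
Lemma rt_lower : exists2 c : R, 0 < c & forall z, 0 <= Im z -> Im z <= 1 ->
  c * Num.sqrt (Im z) <= nc (rt z).
Proof.
have [d d0 hd] := edge_gap.
pose e := Num.min 1 (d / 2).
have e0 : 0 < e by rewrite lt_min ltr01 divr_gt0.
have e1 : e <= 1 by rewrite ge_min lexx.
have e2 : e <= d / 2 by rewrite ge_min lexx orbT.
exists (e ^+ g.*2.+2); first by rewrite exprn_gt0.
move=> z z0 z1; rewrite nc_rt.
have sz1 : Num.sqrt (Im z) <= 1 by rewrite -[leRHS]sqrtr1 ler_sqrt.
have fe j : e <= nc (z - (E j)%:C) -> e <= Num.sqrt (nc (z - (E j)%:C)).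
  move=> h; apply: (@le_trans _ _ (Num.sqrt e)); last by rewrite ler_sqrt ?nc_ge0.
  rewrite -{1}(sqr_sqrtr (ltW e0)) expr2 ler_piMl ?sqrtr_ge0//.
  by rewrite -[leRHS]sqrtr1 ler_sqrt.
have [[j0 j0N hj0]|hn] := pselect (exists2 j, (j < g.*2.+2)%N & nc (z - (E j)%:C) < e).
  have far j : (j < g.*2.+2)%N -> j != j0 -> e <= nc (z - (E j)%:C).
    move=> jN jj; rewrite leNgt; apply/negP => hj.
    have : `|E j - E j0| < d.
      rewrite -nc_real rmorphB.
      have -> : (E j)%:C - (E j0)%:C = (z - (E j0)%:C) - (z - (E j)%:C) by ring.
      apply: le_lt_trans (ncB _ _) _; lra.
    case: (ltngtP j j0) jj => // jj _.
      by have := hd j j0; rewrite jj j0N => /(_ isT) ?; rewrite ltr_norml; lra.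
    by have := hd j0 j; rewrite jj jN => /(_ isT) ?; rewrite ltr_norml; lra.
  rewrite (big_cat_nat (n := j0)) //=; last exact: ltnW.
  rewrite (big_ltn j0N) /=.
  have gE : g.*2.+2 = (j0 + (g.*2.+2 - j0.+1).+1)%N by rewrite -subSn// subSS subnKC// ltnW.
  rewrite [X in e ^+ X]gE exprD exprS.
  have p1 : e ^+ j0 <= \prod_(0 <= j < j0) Num.sqrt (nc (z - (E j)%:C)).
    rewrite -[X in e ^+ X]subn0 -[leLHS]mulr1 -iter_mulr -big_const_nat.
    rewrite big_nat [leRHS]big_nat; apply: ler_prod => j /andP[_ jj].
    by rewrite ltW//= fe// far ?(ltn_trans jj)// ltn_eqF.
  have p2 : e ^+ (g.*2.+2 - j0.+1) <= \prod_(j0.+1 <= j < g.*2.+2) Num.sqrt (nc (z - (E j)%:C)).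
    rewrite -[leLHS]mulr1 -iter_mulr -big_const_nat.
    rewrite big_nat [leRHS]big_nat; apply: ler_prod => j /andP[jj jN].
    by rewrite ltW//= fe// far// gtn_eqF.
  have q0 n : 0 <= e ^+ n by rewrite exprn_ge0// ltW.
  apply: (@le_trans _ _ (e ^+ j0 * (Num.sqrt (Im z) * e ^+ (g.*2.+2 - j0.+1)))).
    rewrite -mulrA ler_wpM2l// mulrC mulrCA ler_piMl// mulr_ge0 ?sqrtr_ge0//.
  rewrite ler_pM ?mulr_ge0 ?sqrtr_ge0//.
  rewrite ler_pM ?mulr_ge0 ?sqrtr_ge0// ler_sqrt ?nc_ge0//.
  by apply: le_trans (le_trans (ler_norm _) (Im_le_nc _)); rewrite ImB /= subr0.
apply: (@le_trans _ _ (e ^+ g.*2.+2)).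
  by rewrite ler_piMr// exprn_ge0// ltW.
rewrite -[X in e ^+ X]subn0 -[leLHS]mulr1 -iter_mulr -big_const_nat.
rewrite big_nat [leRHS]big_nat; apply: ler_prod => j /andP[_ jj].
rewrite ltW//= fe// leNgt; apply/negP => hj; apply: hn; by exists j.
Qed.

(** The bound is written as the derivative of C sqrt y, so that integration along vertical lines
    gives a half-Hölder estimate. *)
Lemma fdens_strip p (X : R) : exists2 C : R, 0 <= C & forall z, `|Re z| <= X ->
  0 < Im z -> Im z <= 1 -> nc (fdens g E p z) <= C / (2 * Num.sqrt (Im z)).
Proof.
have [c c0 hc] := rt_lower; have [K K0 hK] := poly_bound p (X + 1).
exists (2 * (K / c)); first by rewrite mulr_ge0// divr_ge0// ltW.
move=> z zX z0 z1; rewrite /fdens ncf.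
have s0 : 0 < Num.sqrt (Im z) by rewrite sqrtr_gt0.
have -> : 2 * (K / c) / (2 * Num.sqrt (Im z)) = K / (c * Num.sqrt (Im z)).
  by field; rewrite !gt_eqF.
have zn : nc z <= X + 1.
  by apply: le_trans (nc_le _) _; rewrite lerD// ger0_norm// ltW.
have h := hc z (ltW z0) z1.
rewrite ler_pM ?nc_ge0 ?invr_ge0 ?nc_ge0 ?hK//.
by rewrite lef_pV2 ?posrE ?mulr_gt0// (lt_le_trans _ h)// mulr_gt0.
Qed.

Variables (p : {poly R}) (P : R[i] -> R[i]).
Hypothesis hP : line_primitive P (fdens g E p).

Lemma prim_vert (x y y' C X : R) : 0 <= C -> (forall z, `|Re z| <= X ->
  0 < Im z -> Im z <= 1 -> nc (fdens g E p z) <= C / (2 * Num.sqrt (Im z))) ->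
  `|x| <= X -> 0 < y -> y <= y' -> y' <= 1 ->
  nc (P (x +i* y') - P (x +i* y)) <= 2 * (C * Num.sqrt y' - C * Num.sqrt y).
Proof.
move=> C0 hC xX y0 yy y1.
have pE (t : R) : x +i* t = x%:C + t%:C * 'i by apply: c_eq; rewrite ?ReD ?ImD ?ReM ?ImM /=; ring.
apply: (@cder_le R (fun t => P (x +i* t)) (fun t => fdens g E p (x +i* t) * 'i)
  (fun t => C * Num.sqrt t) (fun t => C / (2 * Num.sqrt t)) y y' yy) => t; rewrite in_itv/= => /andP[t1 t2].
- have t0 : 0 < Im (x%:C + t%:C * 'i) by rewrite -pE /= (lt_le_trans y0).
  by rewrite pE; apply: cder_ext (hP t0) => s; rewrite pE.
- have t0 : 0 < t by rewrite (lt_le_trans y0).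
  apply: (is_derive_eq' (is_deriveM (is_derive_cst C t 1) (is_derive1_sqrt t0))).
  by rewrite /GRing.scale /= mulr0 addr0.
- by rewrite ncM nc_i mulr1; apply: hC => //=; [apply: lt_le_trans t1|apply: le_trans t2 _].
Qed.

Lemma prim_horiz (x x' y C X : R) : 0 <= C -> (forall z, `|Re z| <= X ->
  0 < Im z -> Im z <= 1 -> nc (fdens g E p z) <= C / (2 * Num.sqrt (Im z))) ->
  `|x| <= X -> `|x'| <= X -> 0 < y -> y <= 1 ->
  nc (P (x' +i* y) - P (x +i* y)) <= C / Num.sqrt y * `|x' - x|.
Proof.
move=> C0 hC; wlog xx : x x' / x <= x'.
  move=> H xX xX' y0 y1; have [xx|/ltW xx] := leP x x'; first exact: H.
  by rewrite ncBC distrC; apply: H.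
move=> xX xX' y0 y1.
have pE (t : R) : t +i* y = (0 +i* y) + t%:C * 1 by apply: c_eq; rewrite ?ReD ?ImD ?ReM ?ImM /=; ring.
have s0 : 0 < Num.sqrt y by rewrite sqrtr_gt0.
have := @cder_lip R (fun t => P (t +i* y)) (fun t => fdens g E p (t +i* y) * 1) (C / (2 * Num.sqrt y)) x x' xx.
rewrite ger0_norm ?subr_ge0//.
have -> : C / Num.sqrt y * (x' - x) = 2 * (C / (2 * Num.sqrt y) * (x' - x)) by field; rewrite gt_eqF.
apply=> t; rewrite in_itv/= => /andP[t1 t2].
- have t0 : 0 < Im ((0 +i* y) + t%:C * 1) by rewrite -pE.
  by rewrite pE; apply: cder_ext (hP t0) => s; rewrite pE.
- rewrite mulr1; apply: hC => //=.
  move: xX xX'; rewrite !ler_norml => /andP[? ?] /andP[? ?]; apply/andP; split; lra.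
Qed.

Definition strip_bound (C X : R) := forall z, `|Re z| <= X ->
  0 < Im z -> Im z <= 1 -> nc (fdens g E p z) <= C / (2 * Num.sqrt (Im z)).

(** Vertical increments are half-Hölder, so the limit at the axis exists with a rate. One [l] serves
    all admissible [C] and [X], which makes [bval] independent of constants. *)
Lemma ex_boundary_value x : exists l, forall C X : R, 0 <= C -> strip_bound C X ->
  `|x| <= X -> forall y, 0 < y -> y <= 1 -> nc (P (x +i* y) - l) <= 2 * C * Num.sqrt y.
Proof.
have [C1 C10 hC1] := fdens_strip p `|x|.
have H (y y' : R) : 0 < y -> y <= y' -> y' <= 1 ->
    `|Re (P (x +i* y')) - Re (P (x +i* y))| <= 2 * C1 * (Num.sqrt y' - Num.sqrt y) /\
    `|Im (P (x +i* y')) - Im (P (x +i* y))| <= 2 * C1 * (Num.sqrt y' - Num.sqrt y).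
  move=> y0 yy y1; rewrite -ReB -ImB.
  have := prim_vert C10 hC1 (lexx _) y0 yy y1; rewrite -mulrBr mulrA => h.
  by split; apply: le_trans h; [exact: Re_le_nc|exact: Im_le_nc].
have [l1 hl1] : exists l1, forall y, 0 < y -> y <= 1 ->
    `|Re (P (x +i* y)) - l1| <= 2 * C1 * Num.sqrt y.
  by apply: half_holder_limit => y y' y0 yy y1; exact: (H y y' y0 yy y1).1.
have [l2 hl2] : exists l2, forall y, 0 < y -> y <= 1 ->
    `|Im (P (x +i* y)) - l2| <= 2 * C1 * Num.sqrt y.
  by apply: half_holder_limit => y y' y0 yy y1; exact: (H y y' y0 yy y1).2.
exists (l1 +i* l2) => C X C0 hC xX y y0 y1.
apply: (@le_sqrt_limit _ _ _ (4 * C1) y y0) => y' y0' yy.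
have -> : P (x +i* y) - l1 +i* l2 = (P (x +i* y) - P (x +i* y')) + (P (x +i* y') - l1 +i* l2) by ring.
apply: le_trans (ncD _ _) _; apply: lerD.
  apply: le_trans (prim_vert C0 hC xX y0' yy y1) _.
  by rewrite -mulrBr mulrA ler_wpM2l ?mulr_ge0// lerBlDr lerDl sqrtr_ge0.
apply: le_trans (nc_le _) _; rewrite ReB ImB /=.
have := hl1 y' y0' (le_trans yy y1); have := hl2 y' y0' (le_trans yy y1); lra.
Qed.

Definition bval x : R[i] := xget 0 [set l | forall C X : R, 0 <= C -> strip_bound C X ->
  `|x| <= X -> forall y, 0 < y -> y <= 1 -> nc (P (x +i* y) - l) <= 2 * C * Num.sqrt y].

Lemma bvalP x C X y : 0 <= C -> strip_bound C X -> `|x| <= X -> 0 < y -> y <= 1 ->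
  nc (P (x +i* y) - bval x) <= 2 * C * Num.sqrt y.
Proof.
move=> C0 hC xX y0 y1; rewrite /bval; case: xgetP => [l _ /(_ C X)|]; first exact.
by have [l hl] := ex_boundary_value x => /(_ l).
Qed.

(** Boundary values at distance d are compared through the points at height d above them: the two
    vertical legs and the horizontal one each cost a multiple of sqrt d. The case y = 0 treats
    boundary and interior points in one statement. *)
Lemma bval_holder X : exists2 C : R, 0 <= C & forall x x' y, `|x| <= X -> `|x'| <= X ->
  0 <= y -> y <= 1 -> `|x' - x| <= 1 ->
  nc ((if y == 0 then bval x' else P (x' +i* y)) - bval x)
    <= C * (Num.sqrt `|x' - x| + Num.sqrt y).
Proof.
have [C C0 hC] := fdens_strip p X; exists (5 * C); first by rewrite mulr_ge0.
have A x x' : `|x| <= X -> `|x'| <= X -> `|x' - x| <= 1 ->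
    nc (bval x' - bval x) <= 5 * C * Num.sqrt `|x' - x|.
  move=> xX xX' d1.
  have [->|xx] := eqVneq x' x; first by rewrite subrr nc0 mulr_ge0 ?mulr_ge0 ?sqrtr_ge0.
  have d0 : 0 < `|x' - x| by rewrite normr_gt0 subr_eq0.
  set d := `|x' - x| in d0 d1 *.
  have -> : bval x' - bval x = - (P (x' +i* d) - bval x') + (P (x' +i* d) - P (x +i* d))
      + (P (x +i* d) - bval x) by ring.
  apply: le_trans (ncD _ _) _; apply: le_trans (lerD (ncD _ _) (lexx _)) _.
  rewrite ncN; have := bvalP C0 hC xX d0 d1; have := bvalP C0 hC xX' d0 d1.
  have := prim_horiz C0 hC xX xX' d0 d1.
  have -> : C / Num.sqrt d * d = C * Num.sqrt d.
    by rewrite -{2}(sqr_sqrtr (ltW d0)) expr2 mulrA divfK// gt_eqF// sqrtr_gt0.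
  by lra.
move=> x x' y xX xX' y0 y1 d1.
case: eqP => [->|/eqP y00]; first by rewrite sqrtr0 addr0 A.
have -> : P (x' +i* y) - bval x = (P (x' +i* y) - bval x') + (bval x' - bval x) by ring.
apply: le_trans (ncD _ _) _.
have y0' : 0 < y by rewrite lt0r y00.
have := bvalP C0 hC xX' y0' y1; have := A _ _ xX xX' d1.
have : 0 <= C * Num.sqrt y by rewrite mulr_ge0// sqrtr_ge0.
by lra.
Qed.

(** Away from the edges the density extends continuously to the axis, so the increments of the
    primitive at height y are linear up to a small relative error that is uniform in y; then y tends
    to 0. *)
Lemma bval_der x : rt x%:C != 0 -> cder bval x (fdens g E p x%:C).
Proof.
move=> rx; set l := fdens g E p x%:C.
have main (e : R) : 0 < e -> exists2 d : R, 0 < d & forall x', `|x' - x| < d ->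
    nc (bval x' - bval x - (x' - x)%:C * l) <= e * `|x' - x|.
  move=> e0.
  (* These are the neighbourhoods of x within the closed upper half plane: on the cuts the root is
     continuous only from above. *)
  pose F : set_system R[i] := filter_from [set d : R | 0 < d]
     (fun d => [set z | nc (z - x%:C) < d /\ 0 <= Im z]).
  have FF : Filter F.
    apply: filter_from_filter; first by exists 1; rewrite /= ltr01.
    move=> d1 d2 /= d10 d20; exists (Num.min d1 d2); first by rewrite /= lt_min d10.
    by move=> z /= []; rewrite lt_min => /andP[].
  have F0 : \forall z \near F, 0 <= Im z by exists 1; rewrite /= ?ltr01// => z [].
  have Fx : ctends F id x%:C.
    by apply/ctendsP => d d0; exists d => // z [] /= h _; rewrite ncBC.
  have e2 : 0 < e / 2 by rewrite divr_gt0.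
  have x00 : 0 <= Im (x%:C : R[i]) by [].
  have fx : ctends F (fun z => fdens g E p z) l by exact: ctends_fdens.
  have [d /= d0 hd] := (ctendsP _ _).1 fx _ e2.
  exists (Num.min (d / 2) 1); first by rewrite lt_min divr_gt0 ?ltr01.
  move=> x' ; rewrite lt_min => /andP[xd x1].
  have dl (s y : R) : `|s - x| <= `|x' - x| -> 0 < y -> y < d / 2 -> nc (fdens g E p (s +i* y) - l) <= e / 2.
    move=> sx y0 yd; rewrite ncBC ltW//; apply: hd; split; last exact: ltW.
    apply: le_lt_trans (nc_le _) _; rewrite ReB ImB /= subr0 (gtr0_norm y0); lra.
  have step (y : R) : 0 < y -> y < d / 2 ->
      nc (P (x' +i* y) - P (x +i* y) - (x' - x)%:C * l) <= e * `|x' - x|.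
    move=> y0 yd.
    have dP (s : R) : cder (fun s => P (s +i* y) - s%:C * l) s (fdens g E p (s +i* y) - l).
      have pE (t : R) : t +i* y = (0 +i* y) + t%:C * 1 by apply: c_eq; rewrite ?ReD ?ImD ?ReM ?ImM /=; ring.
      apply: cderB.
        apply: (@cder_eq _ _ _ (fdens g E p ((0 +i* y) + s%:C * 1) * 1)); last by rewrite -pE mulr1.
        by apply: cder_ext (hP _) => [t|]; [rewrite pE|rewrite -pE].
      by apply: cder_ext (cder_line 0 l s) => t; rewrite add0r.
    have -> : P (x' +i* y) - P (x +i* y) - (x' - x)%:C * l =
       (P (x' +i* y) - x'%:C * l) - (P (x +i* y) - x%:C * l) by rewrite rmorphB /=; ring.
    have -> : e * `|x' - x| = 2 * (e / 2 * `|x' - x|) by field.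
    have [xx|/ltW xx] := leP x x'.
      rewrite (ger0_norm (_ : 0 <= x' - x)) ?subr_ge0//.
      apply: (cder_lip xx (fun t _ => dP t)) => t; rewrite in_itv/= => /andP[t1 t2].
      by apply: dl => //; rewrite !ger0_norm ?subr_ge0//; lra.
    rewrite ncBC distrC (ger0_norm (_ : 0 <= x - x')) ?subr_ge0//.
    apply: (cder_lip xx (fun t _ => dP t)) => t; rewrite in_itv/= => /andP[t1 t2].
    by apply: dl => //; rewrite !ler0_norm ?subr_le0//; lra.
  have [C C0 hC] := fdens_strip p (`|x| + 1).
  have xX : `|x| <= `|x| + 1 by lra.
  have xX' : `|x'| <= `|x| + 1.
    by rewrite -(subrK x x'); apply: le_trans (ler_normD _ _) _; rewrite addrC lerD2l ltW.
  have y00 : 0 < Num.min (d / 4) 1 by rewrite lt_min divr_gt0 ?ltr01.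
  apply: (@le_sqrt_limit _ _ _ (4 * C) _ y00) => y y0; rewrite le_min => /andP[yd y1].
  have -> : bval x' - bval x - (x' - x)%:C * l = (P (x' +i* y) - P (x +i* y) - (x' - x)%:C * l)
      - (P (x' +i* y) - bval x') + (P (x +i* y) - bval x) by ring.
  apply: le_trans (ncD _ _) _; apply: le_trans (lerD (ncB _ _) (lexx _)) _.
  have yd2 : y < d / 2 by lra.
  have := step _ y0 yd2; have := bvalP C0 hC xX y0 y1; have := bvalP C0 hC xX' y0 y1.
  by lra.
split; apply: is_derive_epsP => e e0; have [d d0 hd] := main e e0; exists d => // x' /hd h.
  by rewrite -ReB -ReCM -ReB; apply: le_trans (Re_le_nc _) h.
by rewrite -ImB -ImCM -ImB; apply: le_trans (Im_le_nc _) h.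
Qed.

Lemma bval_lim x : ctends 0^'+ (fun y => P (x +i* y)) (bval x).
Proof.
have [C C0 hC] := bval_holder `|x|.
apply/ctendsP => e e0.
have : (fun y => C * Num.sqrt y) @ 0^'+ --> (0 : R).
  rewrite -[X in _ --> X](mulr0 C) -[X in _ * X](@sqrtr0 R).
  apply: cvgM; first exact: cvg_cst.
  by apply: cvg_at_right_filter; exact: sqrt_continuous.
move/cvgrPdist_lt => /(_ _ e0) h.
near=> y.
have y0 : 0 < y by near: y; exact: nbhs_right_gt.
have y1 : y <= 1 by near: y; apply: nbhs_right_le.
have := hC x x y (lexx _) (lexx _) (ltW y0) y1; rewrite subrr normr0 sqrtr0 add0r ler01 => /(_ isT).
rewrite gt_eqF// ncBC => /le_lt_trans; apply.
have : `|0 - C * Num.sqrt y| < e by near: y.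
by rewrite sub0r normrN ger0_norm// mulr_ge0// sqrtr_ge0.
Unshelve. all: by end_near. Qed.

Lemma bval_continuous : continuous (fun x => Re (bval x)) /\ continuous (fun x => Im (bval x)).
Proof.
have H (x : R) : ctends (nbhs x) bval (bval x).
  have [C C0 hC] := bval_holder (`|x| + 1).
  apply/ctendsP => e e0.
  have : (fun x' => C * Num.sqrt `|x' - x|) @ x --> (0 : R).
    rewrite -[X in _ --> X](mulr0 C) -[X in _ * X](@sqrtr0 R).
    apply: cvgM; first exact: cvg_cst.
    apply: (cvg_comp (fun x' => `|x' - x|) (fun u => Num.sqrt u)); last exact: sqrt_continuous.
    apply/cvgrPdist_lt => d d0; near=> x'; rewrite sub0r normrN normr_id distrC.
    by near: x'; apply: cvgr_dist_lt => //; exact: cvg_id.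
  move/cvgrPdist_lt => /(_ _ e0) h.
  near=> x'.
  have x1 : `|x' - x| <= 1.
    by rewrite distrC; near: x'; apply: cvgr_dist_le; [exact: cvg_id|exact: ltr01].
  have xX : `|x| <= `|x| + 1 by lra.
  have xX' : `|x'| <= `|x| + 1.
    by rewrite -(subrK x x'); apply: le_trans (ler_normD _ _) _; rewrite addrC lerD2l.
  have := hC x x' 0 xX xX' (lexx _) ler01 x1.
  rewrite eqxx sqrtr0 addr0 ncBC => /le_lt_trans; apply.
  have : `|0 - C * Num.sqrt `|x' - x| | < e by near: x'.
  by rewrite sub0r normrN ger0_norm// mulr_ge0// sqrtr_ge0.
by split => x; have [] := H x.
Unshelve. all: by end_near. Qed.
End BoundaryValues.

(** * Signs on bands and gaps, and the residue at infinity *)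

Section RealAxis.
Variables (R : realType) (g : nat) (E : nat -> R).
Hypothesis hE : band_edges g E.
Implicit Types (z w v : R[i]) (x y : R) (p q : {poly R}).
Local Notation rt := (Rhalf g E).

Definition absrt x : R := \prod_(0 <= j < g.*2.+2) Num.sqrt `|x - E j|.

Lemma absrt_nc x : absrt x = nc (rt x%:C).
Proof.
rewrite nc_rt; apply: eq_bigr => j _.
by rewrite -(rmorphB (real_complex R)) nc_real.
Qed.

(** Each edge to the right of x contributes a factor i, the value of the principal root on its
    cut. *)
Lemma rt_position x k : (k <= g.*2.+2)%N -> (forall j, (j < k)%N -> E j <= x) ->
  (forall j, (k <= j < g.*2.+2)%N -> x < E j) ->
  rt x%:C = - ('i ^+ (g.*2.+2 - k) * (absrt x)%:C).
Proof.
move=> kN h1 h2; congr (- _); rewrite /absrt.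
have e1 : \prod_(0 <= j < k) sqrtc (x%:C - (E j)%:C) =
    (\prod_(0 <= j < k) Num.sqrt `|x - E j|)%:C.
  rewrite rmorph_prod big_nat [RHS]big_nat; apply: eq_bigr => j /andP[_ jk].
  by rewrite -(rmorphB (real_complex R)) sqrtc_real subr_ge0 h1// ger0_norm// subr_ge0 h1.
have e2 : \prod_(k <= j < g.*2.+2) sqrtc (x%:C - (E j)%:C) =
    'i ^+ (g.*2.+2 - k) * (\prod_(k <= j < g.*2.+2) Num.sqrt `|x - E j|)%:C.
  rewrite rmorph_prod -[in RHS](@prodr_const_nat _ k _ 'i) -big_split.
  rewrite big_nat [RHS]big_nat; apply: eq_bigr => j jk.
  by rewrite -(rmorphB (real_complex R)) sqrtc_real subr_ge0 leNgt h2// ltr0_norm ?subr_lt0 ?h2.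
rewrite (big_cat_nat (n := k))// [in RHS](big_cat_nat (n := k))//.
by rewrite e1 e2 rmorphM /=; ring.
Qed.

Lemma ex_position x : exists k, [/\ (k <= g.*2.+2)%N, (forall j, (j < k)%N -> E j <= x) &
  (forall j, (k <= j < g.*2.+2)%N -> x < E j)].
Proof.
have H n : (n <= g.*2.+2)%N -> exists k, [/\ (k <= n)%N, (forall j, (j < k)%N -> E j <= x) &
  (forall j, (k <= j < n)%N -> x < E j)].
  elim: n => [|n IH] nN; first by exists 0%N; split => // j /andP[].
  have [k [kn h1 h2]] := IH (ltnW nN).
  have [xn|nx] := ltP x (E n).
    exists k; split => //; first exact: leqW.
    move=> j /andP[kj]; rewrite ltnS leq_eqVlt => /predU1P[->//|jn].
    by apply: h2; rewrite kj.
  exists n.+1; split => // j; last by move=> /andP[a b]; have := leq_trans b a; rewrite ltnn.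
  rewrite ltnS => jn; apply: le_trans nx; apply: (edges_le hE).
  by rewrite jn nN.
by have [k [a b c]] := H _ (leqnn _); exists k.
Qed.

Definition in_band k x := E k.*2 < x < E k.*2.+1.

Lemma ipow_even n : 'i ^+ n.*2 = ((-1) ^+ n)%:C :> R[i].
Proof.
rewrite -mul2n exprM; have -> : 'i ^+ 2 = (-1)%:C :> R[i].
  by apply: c_eq; rewrite expr2 ?ReM ?ImM /=; ring.
by rewrite rmorphXn.
Qed.

(** Off the bands an even number of edges lies to the right of x, so the power of i is real. *)
Lemma Im_rt_gap x : (forall k, (k <= g)%N -> ~~ in_band k x) -> Im (rt x%:C) = 0.
Proof.
move=> nb; have [k [kN h1 h2]] := ex_position x.
rewrite (rt_position kN h1 h2).
have [ok|ek] := boolP (odd k); last first.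
  have -> : (g.*2.+2 - k)%N = ((g.+1 - k./2)).*2.
    by rewrite -[in LHS](even_halfK ek) -doubleS doubleB.
  by rewrite ipow_even ImN ImCM mulr0 oppr0.
have kE : k = k./2.*2.+1 by rewrite -[LHS]odd_double_half ok.
set j := k./2 in kE.
have jg : (j <= g)%N by move: kN; rewrite kE ltnS -leq_double; lia.
have := nb j jg; rewrite /in_band.
have -> : x < E j.*2.+1 by apply: h2; rewrite -kE leqnn kE ltnS ltnS leq_double.
rewrite andbT -leNgt => xj.
(* [in_band] is the open band, so an odd position leaves the left end point of a band, where the
   root vanishes. *)
have {}xj : x = E j.*2.
  by apply/eqP; rewrite eq_le xj h1//; rewrite kE.
suff -> : absrt x = 0 by rewrite mulr0 oppr0.
apply/eqP; rewrite /absrt prodf_seq_eq0; apply/hasP; exists j.*2.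
  by rewrite mem_index_iota /= ltnS ltnW// ltnS leq_double.
by rewrite /= xj subrr normr0 sqrtr0.
Qed.

Lemma rt_band k x : (k <= g)%N -> in_band k x ->
  rt x%:C = 'i * (- (-1) ^+ (g - k) * absrt x)%:C.
Proof.
move=> kg /andP[x1 x2].
have kN : (k.*2.+1 <= g.*2.+2)%N by rewrite ltnS ltnW// ltnS leq_double.
rewrite (rt_position kN).
- rewrite subSS subSn ?leq_double// -doubleB exprS ipow_even !rmorphM rmorphN; ring.
- move=> j; rewrite ltnS => jk; apply: le_trans (ltW x1).
  by apply: (edges_le hE); rewrite jk ltnS ltnW// ltnS leq_double.
- by move=> j jk; apply: (lt_le_trans x2); apply: (edges_le hE).
Qed.

Lemma absrt_gt0 x : (forall j, (j < g.*2.+2)%N -> x != E j) -> 0 < absrt x.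
Proof. by move=> h; rewrite absrt_nc nc_gt0 rt_real_neq0. Qed.

Lemma band_not_edge k x : (k <= g)%N -> in_band k x ->
  forall j, (j < g.*2.+2)%N -> x != E j.
Proof.
move=> kg /andP[x1 x2] j jN.
have [jk|kj] := leqP j k.*2.
  rewrite gt_eqF//; apply: le_lt_trans x1; apply: (edges_le hE); rewrite jk ltnS ltnW//.
  by rewrite ltnS leq_double.
by rewrite lt_eqF//; apply: (lt_le_trans x2); apply: (edges_le hE); rewrite kj.
Qed.

Lemma sqr_absrt x : (absrt x ^+ 2) = `|(edge_poly g E).[x]|.
Proof.
rewrite /absrt /edge_poly horner_prod -prodrXl normr_prod; apply: eq_bigr => j _.
by rewrite sqr_sqrtr// hornerXsubC.
Qed.

Lemma Re_fdens_band p k x : (k <= g)%N -> in_band k x -> Re (fdens g E p x%:C) = 0.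
Proof.
move=> kg kx; rewrite /fdens pC_real ReCM (rt_band kg kx) ReV ReM /=.
by rewrite !(mul0r, mulr0, subrr).
Qed.
Lemma Im_fdens_gap p x : (forall k, (k <= g)%N -> ~~ in_band k x) -> Im (fdens g E p x%:C) = 0.
Proof.
by move=> h; rewrite /fdens pC_real ImCM ImV Im_rt_gap// oppr0 mul0r mulr0.
Qed.
Lemma Im_fdens_band p k x : (k <= g)%N -> in_band k x ->
  Im (fdens g E p x%:C) = (-1) ^+ (g - k) * p.[x] / absrt x.
Proof.
move=> kg kx; have a0 := absrt_gt0 (band_not_edge kg kx).
rewrite /fdens pC_real ImCM (rt_band kg kx) ImV !ReM !ImM /=.
have : ((-1) ^+ (g - k)) ^+ 2 = 1 :> R by rewrite sqrr_sign.
set s := (-1) ^+ (g - k) => s2; have s0 : s != 0 by rewrite signr_eq0.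
have si : s^-1 = s by apply: (mulfI s0); rewrite divff// -expr2 s2.
transitivity (p.[x] / (s * absrt x)); first by field; rewrite s0 gt_eqF.
by rewrite invfM si; ring.
Qed.

Lemma is_derive_lip (f f' : R -> R) (K a b : R) : a <= b ->
  (forall t : R, t \in `[a, b] -> is_derive t 1 f (f' t)) ->
  (forall t : R, t \in `[a, b] -> `|f' t| <= K) -> `|f b - f a| <= K * (b - a).
Proof.
move=> ab df h.
have dK (t : R) : t \in `[a, b] -> is_derive t 1 (fun t => K * t) K.
  move=> _; apply: (is_derive_eq' (is_deriveM (is_derive_cst K t 1) (is_derive_id t 1))).
  by rewrite /GRing.scale /= mulr0 addr0 mulr1.
have dN (t : R) : t \in `[a, b] -> is_derive t 1 (fun t => - f t) (- f' t).
  by move=> /df ?; exact: is_deriveN.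
have h1 := is_derive_le ab df dK (fun t tI => le_trans (ler_norm _) (h t tI)).
have h2 := is_derive_le ab dN dK (fun t tI => le_trans (ler_norm _) (eq_ind _ (fun u => u <= K) (h t tI) _ (esym (normrN _)))).
rewrite mulrBr ler_norml; apply/andP; split; lra.
Qed.

Lemma is_derive_const (f : R -> R) (a b : R) : a <= b ->
  (forall t : R, t \in `]a, b[ -> is_derive t 1 f 0) ->
  {within `[a, b], continuous f} -> f b = f a.
Proof.
move=> ab df cf.
have [c _] := MVT_segment ab df cf.
by rewrite mul0r => /eqP; rewrite subr_eq0 => /eqP.
Qed.

Variables (p : {poly R}) (P : R[i] -> R[i]).
Hypothesis hP : line_primitive P (fdens g E p).
Local Notation B := (bval g E p P).

(** The density is imaginary on the bands, so only the imaginary part of a boundary value varies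
    there; on the gaps it is real and the roles are exchanged. *)
Lemma Re_bval_band k x x' : (k <= g)%N -> E k.*2 <= x <= E k.*2.+1 ->
  E k.*2 <= x' <= E k.*2.+1 -> Re (B x') = Re (B x).
Proof.
move=> kg; wlog xx : x x' / x <= x'.
  by move=> H; have [xx|/ltW xx] := leP x x'; [exact: H|move=> h1 h2; apply/esym; exact: H].
move=> /andP[x1 x2] /andP[x3 x4].
apply: (@is_derive_const (fun x => Re (B x)) x x' xx) => [t|].
  rewrite in_itv/= => /andP[t1 t2].
  have kt : in_band k t by rewrite /in_band (le_lt_trans x1)// (lt_le_trans t2).
  have /(bval_der hE hP)[+ _] := rt_real_neq0 (band_not_edge kg kt).
  by rewrite (Re_fdens_band _ kg kt).
by apply: continuous_subspaceT; exact: (bval_continuous hE hP).1.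
Qed.

Lemma Im_bval_gap x x' : x <= x' ->
  (forall t j, x < t < x' -> (j < g.*2.+2)%N -> t != E j) ->
  (forall t k, x < t < x' -> (k <= g)%N -> ~~ in_band k t) -> Im (B x') = Im (B x).
Proof.
move=> xx h1 h2.
apply: (@is_derive_const (fun x => Im (B x)) x x' xx) => [t|].
  rewrite in_itv/= => tI.
  have /(bval_der hE hP)[_] := rt_real_neq0 (fun j => h1 t j tI).
  by rewrite Im_fdens_gap// => k; exact: h2.
by apply: continuous_subspaceT; exact: (bval_continuous hE hP).2.
Qed.

Lemma gap_position j t : (1 <= j <= g)%N -> E j.*2.-1 < t < E j.*2 ->
  (forall i, (i < g.*2.+2)%N -> t != E i) /\ (forall k, (k <= g)%N -> ~~ in_band k t).
Proof.
move=> /andP[j1 jg] /andP[t1 t2].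
have j2 : (j.*2 < g.*2.+2)%N by rewrite ltnS ltnW// ltnS leq_double.
have Ej i : (i < g.*2.+2)%N -> (i < j.*2)%N -> E i < t.
  move=> iN ij; apply: le_lt_trans t1; apply: (edges_le hE); lia.
have Ej' i : (i < g.*2.+2)%N -> (j.*2 <= i)%N -> t < E i.
  by move=> iN ij; apply: (lt_le_trans t2); apply: (edges_le hE); rewrite ij.
split=> [i iN|k kg].
  by have [ij|ij] := ltnP i j.*2; [rewrite gt_eqF// Ej|rewrite lt_eqF// Ej'].
rewrite /in_band negb_and -!leNgt; have [kj|kj] := ltnP k j.
  by rewrite [X in _ || X]ltW ?orbT// Ej//; lia.
by rewrite [X in X || _]ltW// Ej'//; lia.
Qed.

Lemma Im_bval_gap_edges j : (1 <= j <= g)%N -> Im (B (E j.*2)) = Im (B (E j.*2.-1)).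
Proof.
move=> jg; apply: Im_bval_gap => [|t i|t k].
- by apply: (edges_le hE); lia.
- by move=> /(gap_position jg)[+ _]; exact.
- by move=> /(gap_position jg)[_]; exact.
Qed.

Lemma Im_bval_left x : x <= E 0%N -> Im (B x) = Im (B (E 0%N)).
Proof.
move=> x0; apply/esym; apply: Im_bval_gap => // t j /andP[_ t0] jg.
  rewrite lt_eqF//; apply: (lt_le_trans t0); exact: (edges_le hE).
rewrite /in_band negb_and -!leNgt ltW//; apply: (lt_le_trans t0).
by apply: (edges_le hE); lia.
Qed.
Lemma Im_bval_right x : E g.*2.+1 <= x -> Im (B x) = Im (B (E g.*2.+1)).
Proof.
move=> x0; apply: Im_bval_gap => // t j /andP[t0 _] jg.
  rewrite gt_eqF//; apply: le_lt_trans t0; apply: (edges_le hE); lia.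
rewrite /in_band negb_and -!leNgt orbC ltW//; apply: le_lt_trans t0.
by apply: (edges_le hE); lia.
Qed.

Definition antideriv q : {poly R} :=
  \poly_(i < (size q).+1) (if i is j.+1 then q`_j / j.+1%:R else 0).
Lemma deriv_antideriv q : (antideriv q)^`() = q.
Proof.
apply/polyP => i; rewrite coef_deriv coef_poly ltnS.
case: ltnP => [iq|iq]; last by rewrite mul0rn nth_default.
by rewrite -[LHS]mulr_natr divfK// pnatr_eq0.
Qed.

(** This is the line through [om] perpendicular to its radius. Along it c / z integrates to c log(1
    + i u), whose imaginary part is c atan u; [ray_defect] removes this and the polynomial part from
    the primitive. *)
Definition ray (om : R[i]) (u : R) := om * (1 + 'i * u%:C).
Definition ray_defect q (c : R) (om : R[i]) (u : R) :=
  Im (P (ray om u) - (pC (antideriv q)).[ray om u]) - c * atan u.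

Lemma residue_segment q (c C X0 : R) (om : R[i]) (a b : R) : 0 <= C ->
  (forall z, 0 < Im z -> X0 <= nc z ->
    nc (fdens g E p z - (pC q).[z] - c%:C / z) <= C / nc z ^+ 2) ->
  0 < nc om -> X0 <= nc om -> a <= b ->
  (forall u, u \in `[a, b] -> 0 < Im (ray om u)) ->
  `|ray_defect q c om b - ray_defect q c om a| <= C / nc om * (b - a).
Proof.
move=> C0 H om0 omX ab zIm; pose z := ray om; pose k := ray_defect q c om.
have zE u : z u = om + u%:C * ('i * om) by rewrite /z /ray; ring.
have z0 u : u \in `[a, b] -> 0 < Im (om + u%:C * ('i * om)) by rewrite -zE; exact: zIm.
pose k' u := Im ((fdens g E p (z u) - (pC q).[z u] - c%:C / z u) * ('i * om)).
have z1 u : u \in `[a, b] -> z u != 0.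
  by move=> /zIm; apply: contraTneq; rewrite -/(z u) => ->; rewrite ltxx.
have om1 : om != 0 by rewrite -nc_gt0.
have zn u : nc om <= nc (z u).
  rewrite /z /ray ncM ler_peMr ?nc_ge0//.
  apply: le_trans (le_trans (ler_norm _) (Re_le_nc _)).
  by rewrite ReD ReM /= mul0r mul1r sub0r oppr0 addr0.
apply: (@is_derive_lip k k') => // u uI; last first.
  apply: le_trans (Im_le_nc _) _; rewrite !ncM nc_i mul1r.
  have := H _ (zIm _ uI) (le_trans omX (zn u)).
  move=> h; apply: (@le_trans _ _ (C / nc om ^+ 2 * nc om)).
    rewrite ler_wpM2r ?nc_ge0//; apply: le_trans h _.
    rewrite ler_wpM2l// lef_pV2 ?posrE ?exprn_gt0 ?(lt_le_trans om0 (zn u))//.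
    by rewrite ler_sqr ?nnegrE ?nc_ge0.
  by rewrite expr2 invfM mulrA divfK// gt_eqF.
have d1 := cderB (hP (z0 _ uI)) (cder_poly (pC (antideriv q)) (cder_line om ('i * om) u)).
have [_ d2] := d1.
have d3 := is_deriveB d2 (is_deriveM (is_derive_cst c u 1) (is_derive1_atan u)).
have kE : k = (fun s => Im (P (om + s%:C * ('i * om)) - (pC (antideriv q)).[om + s%:C * ('i * om)]) - c * atan s).
  by apply/funext => s; rewrite /k /ray_defect -/(z s) zE.
rewrite -/k kE; apply: (is_derive_eq' d3).
rewrite /GRing.scale /= mulr0 addr0 /k' -!zE deriv_map deriv_antideriv.
rewrite -mulrBl [X in _ = Im X]mulrBl [RHS]ImB; congr (_ - _).
have -> : c%:C / z u * ('i * om) = c%:C * ('i / (1 + 'i * u%:C)).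
  have i1 : 1 + 'i * u%:C != 0.
    by have := z1 _ uI; rewrite /z /ray mulf_eq0 negb_or => /andP[].
  by rewrite /z /ray; field; rewrite om1 i1.
rewrite ImCM; congr (_ * _); rewrite ImM ReV ImV ReD ImD ReM ImM /=.
by rewrite !(mul0r,mul1r,mulr0,addr0,sub0r,subr0,add0r,oppr0) expr1n.
Qed.

Lemma bval_curve (z : R -> R[i]) (F : set_system R) {FF : Filter F} x :
  ctends F z x%:C -> (\forall u \near F, 0 < Im (z u)) ->
  ctends F (fun u => P (z u)) (B x).
Proof.
move=> zx z0; have [C C0 hC] := bval_holder hE hP (`|x| + 1).
apply/ctendsP => e e0.
pose d := Num.min 1 ((e / (4 * (C + 1))) ^+ 2).
have C1 : 0 < C + 1 by rewrite ltr_wpDl.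
have q0 : 0 < e / (4 * (C + 1)) by rewrite divr_gt0// mulr_gt0.
have d0 : 0 < d by rewrite lt_min ltr01 exprn_gt0.
near=> u.
have zu0 : 0 < Im (z u) by near: u.
have zud : nc (x%:C - z u) < d by near: u; exact: ((ctendsP _ _).1 zx).
have a1 : `|Re (z u) - x| < d.
  by apply: le_lt_trans zud; rewrite distrC; apply: le_trans (Re_le_nc _); rewrite ReB.
have a2 : Im (z u) < d.
  apply: le_lt_trans zud; apply: le_trans (ler_norm _) _; apply: le_trans (Im_le_nc _).
  by rewrite ImB /= sub0r normrN.
have d1 : d <= 1 by rewrite ge_min lexx.
have sd (t : R) : 0 <= t -> t < d -> Num.sqrt t <= e / (4 * (C + 1)).
  move=> t0 td; rewrite -ler_sqr ?nnegrE ?sqrtr_ge0 ?(ltW q0)// sqr_sqrtr//.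
  by apply: le_trans (ltW td) _; rewrite ge_min lexx orbT.
have xX : `|x| <= `|x| + 1 by lra.
have xX' : `|Re (z u)| <= `|x| + 1.
  by rewrite -(subrK x (Re (z u))); apply: le_trans (ler_normD _ _) _; lra.
have h1 : Im (z u) <= 1 by lra.
have h2 : `|Re (z u) - x| <= 1 by lra.
have := hC x (Re (z u)) (Im (z u)) xX xX' (ltW zu0) h1 h2.
rewrite gt_eqF// -cE ncBC => /le_lt_trans; apply.
have s1 := sd _ (normr_ge0 _) a1; have s2 := sd _ (ltW zu0) a2.
apply: (@le_lt_trans _ _ (C * (e / (4 * (C + 1)) + e / (4 * (C + 1))))).
  by rewrite ler_wpM2l// lerD.
have -> : C * (e / (4 * (C + 1)) + e / (4 * (C + 1))) = e * (C / (2 * (C + 1))).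
  by field; rewrite gt_eqF.
rewrite gtr_pMr// ltr_pdivrMr ?mulr_gt0//; lra.
Unshelve. all: by end_near. Qed.

Lemma ray_limit (om : R[i]) (a : R) (F : set_system R) {FF : Filter F} x :
  F --> a -> ray om a = x%:C -> (\forall u \near F, 0 < Im (ray om u)) ->
  forall q c, ray_defect q c om u @[u --> F] --> Im (B x) - c * atan a.
Proof.
move=> Fa omx z0 q c.
have zx : ctends F (ray om) x%:C.
  rewrite -omx; apply: ctendsM; first exact: ctends_cst.
  apply: ctendsD; first exact: ctends_cst.
  by apply: ctendsM; [exact: ctends_cst|split => //=; exact: cvg_cst].
have [_ h1] := bval_curve zx z0.
have h2 : Im ((pC (antideriv q)).[ray om u]) @[u --> F] --> (0 : R).
  have [_] := ctends_poly (pC (antideriv q)) zx.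
  by rewrite pC_real.
rewrite /ray_defect -[Im (B x)]subr0.
apply: cvgB; last by apply: cvgM; [exact: cvg_cst|apply: cvg_comp Fa _; exact: continuous_atan].
by under eq_fun do rewrite ImB; exact: cvgB.
Qed.

Lemma cvg_dist_le (f : R -> R) (F : set_system R) {FF : ProperFilter F} (l b K : R) :
  f @ F --> l -> (\forall u \near F, `|b - f u| <= K) -> `|b - l| <= K.
Proof.
move=> fl h; apply/ler_addgt0Pr => e e0.
have [u [h1 h2]] : exists u, `|b - f u| <= K /\ `|l - f u| < e.
  near F => u; exists u; split; near: u => //.
  by move/cvgrPdist_lt : fl; apply.
have -> : b - l = (b - f u) - (l - f u) by ring.
by apply: le_trans (ler_normB _ _) _; lra.
Unshelve. all: by end_near. Qed.

(** The large half circle is replaced by the segments from X to i X and from i X to -X, each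
    contributing the angle pi / 2 through atan; the O(1/z^2) remainder costs O(1/X). Beyond the
    outer edges the imaginary part of the boundary value no longer changes, so X may tend to
    infinity. *)
Lemma residue_at_infinity q (c C X0 : R) : 0 <= C ->
  (forall z, 0 < Im z -> X0 <= nc z ->
    nc (fdens g E p z - (pC q).[z] - c%:C / z) <= C / nc z ^+ 2) ->
  Im (B (E g.*2.+1)) - Im (B (E 0%N)) = - (pi * c).
Proof.
move=> C0 H.
pose X1 := 1 + 2 * `|X0| + `|E 0%N| + `|E g.*2.+1|.
have n1 := normr_ge0 X0; have n2 := normr_ge0 (E 0%N); have n3 := normr_ge0 (E g.*2.+1).
suff main X : X1 <= X -> `|Im (B (E g.*2.+1)) - Im (B (E 0%N)) + pi * c| <= 8 * C / X.
  apply/eqP; rewrite -addr_eq0 -normr_le0; apply/ler_addgt0Pr => e e0; rewrite add0r.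
  have X10 : 0 < X1 by rewrite /X1; lra.
  pose X : R := Num.max X1 (8 * C / e).
  have XX : X1 <= X by rewrite le_max lexx.
  have X0' : 0 < X by apply: lt_le_trans XX.
  have XC : 8 * C / e <= X by rewrite le_max lexx orbT.
  apply: le_trans (main X XX) _.
  by rewrite ler_pdivrMr// -ler_pdivrMl// mulrC.
move=> XX; pose h := X / 2.
have X0' : 0 < X by rewrite /X1 in XX; lra.
have h0 : 0 < h by rewrite /h; lra.
(* These are the midpoints of the two segments, which [ray] parametrizes by -1 <= u <= 1. *)
pose om1 : R[i] := h%:C * (1 + 'i); pose om2 : R[i] := h%:C * (-1 + 'i).
have Im1 u : Im (ray om1 u) = h * (1 + u) by rewrite /ray /om1 !(ReM,ImM,ReD,ImD) /=; ring.
have Im2 u : Im (ray om2 u) = h * (1 - u) by rewrite /ray /om2 !(ReM,ImM,ReD,ImD,ReN,ImN) /=; ring.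
have nom om : Im om = h -> 0 < nc om /\ X0 <= nc om /\ C / nc om * 2 <= 4 * C / X.
  move=> oh; have hn : h <= nc om by rewrite -oh; apply: le_trans (ler_norm _) (Im_le_nc _).
  split; first exact: lt_le_trans hn.
  split; first by apply: le_trans (ler_norm _) (le_trans _ hn); rewrite /X1 in XX; rewrite /h; lra.
  have -> : 4 * C / X = C / h * 2 by rewrite /h; field; rewrite gt_eqF.
  rewrite ler_wpM2r// ler_wpM2l// lef_pV2 ?posrE//; exact: lt_le_trans hn.
have [|o1 [ob1 oc1]] := nom om1.
  by rewrite /om1 ImM ReD ImD /=; ring.
have [|o2 [ob2 oc2]] := nom om2.
  by rewrite /om2 ImM ReD ImD ReN ImN /=; ring.
have e1 : ray om1 (-1) = X%:C.
  by rewrite /ray /om1; apply: c_eq; rewrite !(ReM,ImM,ReD,ImD,ReN,ImN) /= /h; field.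
have e2 : ray om2 1 = (- X)%:C.
  by rewrite /ray /om2; apply: c_eq; rewrite !(ReM,ImM,ReD,ImD,ReN,ImN) /= /h; field.
have e12 : ray om1 1 = ray om2 (-1).
  by rewrite /ray /om1 /om2; apply: c_eq; rewrite !(ReM,ImM,ReD,ImD,ReN,ImN) /=; ring.
have l1 : `|ray_defect q c om1 1 - (Im (B X) - c * atan (-1))| <= 4 * C / X.
  have z0 : \forall u \near (-1 : R)^'+, 0 < Im (ray om1 u).
    by near=> u; rewrite Im1 mulr_gt0// -ltrBlDl sub0r; near: u; exact: nbhs_right_gt.
  have F1 : ((-1 : R)^'+) --> (-1 : R) by apply: cvg_at_right_filter; exact: cvg_id.
  have rl : ray_defect q c om1 u @[u --> (-1 : R)^'+] --> Im (B X) - c * atan (-1).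
    exact: ray_limit F1 e1 z0 q c.
  apply: (cvg_dist_le rl); near=> u.
  have u1 : -1 < u by near: u; exact: nbhs_right_gt.
  have u2 : u <= 1 by near: u; apply: nbhs_right_le; lra.
  apply: le_trans (residue_segment C0 H o1 ob1 u2 _) _.
    by move=> v; rewrite Im1 in_itv/= => /andP[v1 v2]; rewrite mulr_gt0//; lra.
  apply: (le_trans _ oc1); rewrite ler_wpM2l ?divr_ge0 ?nc_ge0//; lra.
have l2 : `|ray_defect q c om2 (-1) - (Im (B (- X)) - c * atan 1)| <= 4 * C / X.
  have z0 : \forall u \near (1 : R)^'-, 0 < Im (ray om2 u).
    by near=> u; rewrite Im2 mulr_gt0// subr_gt0; near: u; exact: nbhs_left_lt.
  have F1 : ((1 : R)^'-) --> (1 : R) by apply: cvg_at_left_filter; exact: cvg_id.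
  have rl : ray_defect q c om2 u @[u --> (1 : R)^'-] --> Im (B (- X)) - c * atan 1.
    exact: ray_limit F1 e2 z0 q c.
  apply: (cvg_dist_le rl); near=> u.
  have u1 : u < 1 by near: u; exact: nbhs_left_lt.
  have u2 : -1 <= u by near: u; apply: nbhs_left_ge; lra.
  rewrite distrC; apply: le_trans (residue_segment C0 H o2 ob2 u2 _) _.
    by move=> v; rewrite Im2 in_itv/= => /andP[v1 v2]; rewrite mulr_gt0//; lra.
  apply: (le_trans _ oc2); rewrite ler_wpM2l ?divr_ge0 ?nc_ge0//; lra.
have bX : Im (B X) = Im (B (E g.*2.+1)).
  by apply: Im_bval_right; have := ler_norm (E g.*2.+1); rewrite /X1 in XX; lra.
have bX' : Im (B (- X)) = Im (B (E 0%N)).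
  by apply: Im_bval_left; have := ler_norm (- E 0%N); rewrite normrN; rewrite /X1 in XX; lra.
move: l1 l2; rewrite bX bX' /ray_defect e12 atanN atan1.
set N := Im (_ - _); move=> l1 l2.
have -> : 8 * C / X = 4 * C / X + 4 * C / X by field; rewrite gt_eqF.
move: l1 l2; rewrite !ler_norml => /andP[a1 a2] /andP[a3 a4].
by apply/andP; split; lra.
Unshelve. all: by end_near. Qed.
End RealAxis.

(** * The moment functional *)

Section MomentFunctional.
Variables (R : realType) (g : nat) (E : nat -> R).
Hypothesis hE : band_edges g E.
Implicit Types (z w v : R[i]) (x y : R) (p q : {poly R}).
Local Notation rt := (Rhalf g E).
Local Notation fd := (fdens g E).

Lemma primitive_unique (P1 P2 h : R[i] -> R[i]) z w : line_primitive P1 h -> line_primitive P2 h ->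
  0 < Im z -> 0 < Im w -> P1 z - P1 w = P2 z - P2 w.
Proof.
move=> h1 h2 z0 w0.
have d (t : R) : t \in `[0, 1] -> cder (fun s => P1 (w + s%:C * (z - w)) - P2 (w + s%:C * (z - w))) t 0.
  rewrite in_itv/= => /andP[t0 t1].
  have p0 : 0 < Im (w + t%:C * (z - w)).
    rewrite ImD ImCM ImB; nra.
  by apply: cder_eq (cderB (h1 _ _ _ p0) (h2 _ _ _ p0)) _; rewrite subrr.
have H : nc ((P1 (w + 1%:C * (z - w)) - P2 (w + 1%:C * (z - w))) -
     (P1 (w + 0%:C * (z - w)) - P2 (w + 0%:C * (z - w)))) <= 2 * (0 * (1 - 0)).
  by apply: (cder_lip ler01 d) => t _; rewrite nc0.
have /eqP : nc (P1 z - P2 z - (P1 w - P2 w)) == 0.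
  rewrite eq_le nc_ge0 andbT; apply: (le_trans _ (le_trans H _)); last by rewrite mul0r mulr0.
  have e0 : w + 0%:C * (z - w) = w by rewrite rmorph0 mul0r addr0.
  have e1 : w + 1%:C * (z - w) = z by rewrite rmorph1 mul1r addrC subrK.
  by rewrite e0 e1.
move/eqP; rewrite nc_eq0 subr_eq0 => /eqP e.
have -> : P1 z = P1 z - P2 z + P2 z by rewrite subrK.
by rewrite e; ring.
Qed.

Lemma ctends_unique (T : Type) (F : set_system T) {FF : ProperFilter F} (f : T -> R[i]) l l' :
  ctends F f l -> ctends F f l' -> l = l'.
Proof.
move=> [a1 a2] [b1 b2]; apply: c_eq.
  exact: (cvg_unique _ a1 b1).
exact: (cvg_unique _ a2 b2).
Qed.

Lemma bval_unique p P1 P2 x x' : line_primitive P1 (fd p) -> line_primitive P2 (fd p) ->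
  bval g E p P1 x - bval g E p P1 x' = bval g E p P2 x - bval g E p P2 x'.
Proof.
move=> h1 h2.
have cl P' u : line_primitive P' (fd p) -> ctends (0 : R)^'+ (fun y => P' (u +i* y)) (bval g E p P' u).
  by move=> h; exact: bval_lim.
have c1 : ctends (0 : R)^'+ (fun y => P1 (x +i* y) - P1 (x' +i* y))
    (bval g E p P1 x - bval g E p P1 x').
  by apply: ctendsB; exact: cl.
have c2 : ctends (0 : R)^'+ (fun y => P2 (x +i* y) - P2 (x' +i* y))
    (bval g E p P2 x - bval g E p P2 x').
  by apply: ctendsB; exact: cl.
apply: (ctends_unique c1).
have [c21 c22] := c2; split.
  apply: cvg_trans c21; apply: near_eq_cvg; near=> y.
  rewrite (primitive_unique (z := x +i* y) (w := x' +i* y) h1 h2)//=; near: y; exact: nbhs_right_gt.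
apply: cvg_trans c22; apply: near_eq_cvg; near=> y.
rewrite (primitive_unique (z := x +i* y) (w := x' +i* y) h1 h2)//=; near: y; exact: nbhs_right_gt.
Unshelve. all: by end_near. Qed.

(** A primitive is determined up to a constant, so the quantities built from it are differences of
    boundary values, which do not depend on the choice made here. *)
Definition fprim p : R[i] -> R[i] := projT1 (cid (ex_fprim g E p)).
Lemma fprimP p : line_primitive (fprim p) (fd p).
Proof. by rewrite /fprim; case: cid. Qed.
Definition bv p x := bval g E p (fprim p) x.

Lemma bv_lin (c : R) p q x x' : bv (c *: p + q) x - bv (c *: p + q) x' =
  c%:C * (bv p x - bv p x') + (bv q x - bv q x').
Proof.
pose P z := c%:C * fprim p z + fprim q z.
have hP : line_primitive P (fd (c *: p + q)).
  move=> z v t t0.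
  apply: cder_eq (cderD (cderM (cder_cst c%:C t) (@fprimP p _ _ _ t0)) (@fprimP q _ _ _ t0)) _.
  by rewrite /fdens rmorphD /= map_polyZ hornerD hornerZ; ring.
rewrite /bv (bval_unique x x' (@fprimP (c *: p + q)) hP).
have bE u : bval g E (c *: p + q) P u = c%:C * bval g E p (fprim p) u + bval g E q (fprim q) u.
  have hl : ctends (0 : R)^'+ (fun y => P (u +i* y)) (bval g E (c *: p + q) P u) by exact: bval_lim.
  have cl p' : ctends (0 : R)^'+ (fun y => fprim p' (u +i* y)) (bval g E p' (fprim p') u).
    by apply: bval_lim => //; exact: fprimP.
  apply: (ctends_unique hl); apply: ctendsD; last exact: cl.
  by apply: ctendsM; [exact: ctends_cst|exact: cl].
by rewrite !bE; ring.
Qed.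

(** Imaginary parts of boundary values are constant across the gaps, so the increment from the first
    edge to the last is the integral over the upper side of the spectrum. *)
Definition moment p : R := (Im (bv p (E g.*2.+1)) - Im (bv p (E 0%N))) / pi.

Lemma moment_lin c p q : moment (c *: p + q) = c * moment p + moment q.
Proof. by rewrite /moment -!ImB bv_lin (ImD (_ * _)) ImCM; ring. Qed.
Lemma moment0 : moment 0 = 0.
Proof. by have := moment_lin 1 0 0; rewrite scaler0 addr0; lra. Qed.
Lemma momentD p q : moment (p + q) = moment p + moment q.
Proof. by rewrite -[p in LHS]scale1r moment_lin mul1r. Qed.
Lemma momentZ c p : moment (c *: p) = c * moment p.
Proof. by rewrite -[c *: p]addr0 moment_lin moment0 addr0. Qed.
Lemma momentB p q : moment (p - q) = moment p - moment q.
Proof. by rewrite addrC -scaleN1r moment_lin; ring. Qed.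

Lemma moment_eq p q (c C X0 : R) : 0 <= C ->
  (forall z, 0 < Im z -> X0 <= nc z ->
    nc (fd p z - (pC q).[z] - c%:C / z) <= C / nc z ^+ 2) -> moment p = - c.
Proof.
move=> C0 H; rewrite /moment (residue_at_infinity hE (@fprimP p) C0 H).
by rewrite mulrC mulrN mulKf // gt_eqF // pi_gt0.
Qed.

Lemma nc_rt_large : exists2 X0, 0 < X0 & forall z, X0 <= nc z ->
  (2^-1 * nc z) ^+ g.+1 <= nc (rt z).
Proof.
pose S := \sum_(0 <= j < g.*2.+2) `|E j|.
have S0 : 0 <= S by rewrite sumr_ge0.
have Sj j : (j < g.*2.+2)%N -> `|E j| <= S.
  move=> jN; rewrite /S (big_nat_widenl 0%N 0%N)//= big_mkord (bigD1 (Ordinal jN))//=.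
  by rewrite lerDl sumr_ge0.
exists (2 * S + 1); first lra.
move=> z zS; rewrite nc_rt.
have z0 : 0 <= 2^-1 * nc z by lra.
have -> : (2^-1 * nc z) ^+ g.+1 = \prod_(0 <= j < g.*2.+2) Num.sqrt (2^-1 * nc z).
  rewrite prodr_const_nat subn0 -{1}(sqr_sqrtr z0) -exprM.
  by congr (_ ^+ _); rewrite mul2n doubleS.
rewrite big_nat [leRHS]big_nat; apply: ler_prod => j /andP[_ jN].
rewrite sqrtr_ge0/= ler_sqrt ?nc_ge0//.
have := le_nc_dist z (E j)%:C; rewrite nc_real; have := Sj j jN; lra.
Qed.

Lemma poly_growth q n : (size q <= n.+1)%N -> exists2 C, 0 <= C &
  forall z, 1 <= nc z -> nc (pC q).[z] <= C * nc z ^+ n.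
Proof.
move=> qn; exists (\sum_(i < n.+1) `|q`_i|); first by rewrite sumr_ge0.
move=> z z1; rewrite (pC_rV z qn); apply: le_trans (nc_sum _ _ _) _.
rewrite mulr_suml; apply: ler_sum => i _; rewrite ncM nc_real ncX ler_wpM2l//.
by apply: ler_weXn2l => //; rewrite -ltnS.
Qed.

Lemma poly_lower q : q != 0 -> exists2 c, 0 < c & exists2 X0, 1 <= X0 &
  forall z, X0 <= nc z -> c * nc z ^+ (size q).-1 <= nc (pC q).[z].
Proof.
move=> q0; set n := (size q).-1.
have sq : size q = n.+1 by rewrite prednK// size_poly_gt0.
have l0 : 0 < `|lead_coef q| by rewrite normr_gt0 lead_coef_eq0.
pose S := \sum_(i < n) `|q`_i|.
have S0 : 0 <= S by rewrite sumr_ge0.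
exists (`|lead_coef q| / 2); first by rewrite divr_gt0.
exists (1 + 2 * S / `|lead_coef q|); first by rewrite lerDl divr_ge0// mulr_ge0.
move=> z zX; have z1 : 1 <= nc z by apply: le_trans zX; rewrite lerDl divr_ge0// mulr_ge0.
have z0 : 0 < nc z by lra.
rewrite (@pC_rV R q n.+1 z) ?sq// big_ord_recr /=.
have -> : q`_n = lead_coef q by rewrite /lead_coef sq.
have h : nc (\sum_(i < n) (q`_i)%:C * z ^+ i) <= S * nc z ^+ n / nc z.
  apply: le_trans (nc_sum _ _ _) _; rewrite -mulrA mulr_suml; apply: ler_sum => i _.
  rewrite ncM nc_real ncX ler_wpM2l//; case: n i {sq S S0 zX} => [[]//|n i].
  by rewrite exprS mulrAC divff ?gt_eqF// mul1r; apply: ler_weXn2l => //; rewrite -ltnS.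
rewrite addrC; set r := \sum_(i < n) _ in h *.
have := le_nc_dist ((lead_coef q)%:C * z ^+ n) (- r); rewrite opprK ncN ncM nc_real ncX.
have : S * nc z ^+ n / nc z <= `|lead_coef q| / 2 * nc z ^+ n.
  rewrite mulrAC ler_wpM2r ?exprn_ge0 ?(ltW z0)// ler_pdivrMr//.
  have : 2 * S / `|lead_coef q| <= nc z by lra.
  rewrite ler_pdivrMr//; lra.
by lra.
Qed.

(** The positive imaginary axis suffices as a test set, since a nonzero polynomial grows there with
    its full degree. *)
Lemma size_growth q n (C X0 : R) :
  (forall y, X0 <= y -> nc (pC q).['i * y%:C] * y <= C * y ^+ n) -> (size q <= n)%N.
Proof.
move=> H; have [->|q0] := eqVneq q 0; first by rewrite size_poly0.
have [c c0 [X1 X11 h1]] := poly_lower q0.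
rewrite leqNgt; apply/negP => nq.
have nq' : (n <= (size q).-1)%N by rewrite -ltnS prednK// size_poly_gt0.
pose y := Num.max (Num.max X0 X1) (`|C| / c + 1).
have y0 : X0 <= y by rewrite !le_max lexx.
have y1 : X1 <= y by rewrite !le_max lexx orbT.
have y2 : `|C| / c + 1 <= y by rewrite !le_max lexx orbT.
have yy : 0 < y by lra.
have nzy : nc ('i * y%:C) = y by rewrite ncM nc_i mul1r nc_real gtr0_norm.
have := h1 ('i * y%:C); rewrite nzy => /(_ y1) h.
have : c * y ^+ n * y <= C * y ^+ n.
  apply: le_trans (H y y0); rewrite ler_wpM2r ?(ltW yy)//; apply: le_trans h.
  by rewrite ler_wpM2l ?(ltW c0)//; apply: ler_weXn2l => //; lra.
rewrite mulrAC ler_pM2r ?exprn_gt0// leNgt => /negP; apply.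
rewrite mulrC -ltr_pdivrMr//; apply: le_lt_trans (_ : `|C| / c < _); last lra.
by rewrite ler_pM2r ?invr_gt0// ler_norm.
Qed.
End MomentFunctional.

Lemma int_updown (P : int -> Prop) : P 0 -> (forall n, P n -> P (n + 1)) ->
  (forall n, P n -> P (n - 1)) -> forall n, P n.
Proof.
move=> h0 h1 h2; case=> n.
  by elim: n => // n IH; rewrite -addn1 PoszD; exact: h1.
elim: n => [|n IH]; first by have := h2 _ h0; rewrite sub0r.
by have := h2 _ IH; rewrite !NegzE => e; congr (P _): e; lia.
Qed.

(** * Baker-Akhiezer functions *)

Section ThreeTerm.
Variables (R : realType) (V : lmodType R) (X : V -> V) (a b : int -> R).
Hypothesis a0 : forall n, a n != 0.

(** The recursion acts on pairs of values at n and n + 1. The space and the operator [X] stay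
    abstract; polynomial pairs are substituted later, for the background and for its truncated
    perturbations. *)
Definition tt_up (n : int) (u : V * V) : V * V :=
  (u.2, (a (n + 1))^-1 *: (X u.2 - b (n + 1) *: u.2 - a n *: u.1)).
Definition tt_down (n : int) (u : V * V) : V * V :=
  ((a (n - 1))^-1 *: (X u.1 - b n *: u.1 - a n *: u.2), u.1).
Fixpoint tt_fwd u k := if k is k'.+1 then tt_up k'%:Z (tt_fwd u k') else u.
Fixpoint tt_bwd u k := if k is k'.+1 then tt_down (- k'%:Z) (tt_bwd u k') else u.
Definition tt_pair u (n : int) :=
  match n with Posz k => tt_fwd u k | Negz k => tt_bwd u k.+1 end.
Definition tt_sol u n := (tt_pair u n).1.

Lemma tt_downK n u : tt_up (n - 1) (tt_down n u) = u.
Proof.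
case: u => x y; rewrite /tt_up /tt_down /= subrK; congr pair.
by rewrite scalerA divff// scale1r subKr scalerA mulVf// scale1r.
Qed.

Lemma tt_pairS u n : tt_pair u (n + 1) = tt_up n (tt_pair u n).
Proof.
case: n => n; first by rewrite -PoszD addn1.
have -> : Negz n = - n%:Z - 1 by rewrite NegzE -addn1 PoszD opprD.
rewrite subrK; have -> : - n%:Z - 1 = Negz n by rewrite NegzE -addn1 PoszD opprD.
rewrite /= NegzE -addn1 PoszD opprD tt_downK.
by case: n.
Qed.

Lemma tt_pair2 u n : (tt_pair u n).2 = tt_sol u (n + 1).
Proof. by rewrite /tt_sol tt_pairS. Qed.

Lemma tt_solP u n : a n *: tt_sol u (n + 1) + a (n - 1) *: tt_sol u (n - 1) + b n *: tt_sol u n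
  = X (tt_sol u n).
Proof.
have := tt_pairS u n; have := tt_pairS u (n - 1).
rewrite -[in RHS](subrK 1 n) => /(congr1 snd); rewrite subrK tt_pair2 /= => e _.
have h : (tt_pair u (n - 1)).2 = tt_sol u n by rewrite tt_pair2 subrK.
rewrite e subrK h scalerA divff// scale1r -/(tt_sol u (n - 1)).
rewrite subrK. by rewrite subrK.
Qed.

Lemma tt_sol0 u : tt_sol u 0 = u.1. Proof. by []. Qed.
Lemma tt_sol1 u : tt_sol u 1 = u.2. Proof. by []. Qed.
End ThreeTerm.

Section JacobiSolutions.
Variable R : realType.
Implicit Types (a b : int -> R) (u v : int -> R[i]) (z : R[i]).

Definition reflect (T : Type) (f : int -> T) : int -> T := fun n => f (- n).
(** The coefficient a(n) belongs to the bond between n and n + 1, which n -> -n sends to the bond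
    between -n - 1 and -n. *)
Definition reflect_a (T : Type) (f : int -> T) : int -> T := fun n => f (- n - 1).

Lemma jacobi_reflect a b u n :
  jacobi (reflect_a a) (reflect b) (reflect u) n = jacobi a b u (- n).
Proof.
rewrite /jacobi /reflect_a /reflect.
have -> : - (n - 1) - 1 = - n by ring.
have -> : - (n + 1) = - n - 1 by ring.
have -> : - (n - 1) = - n + 1 by ring.
by ring.
Qed.

Lemma solves_reflect a b u z : solves a b z u -> solves (reflect_a a) (reflect b) z (reflect u).
Proof. by move=> h n; rewrite jacobi_reflect h. Qed.

Lemma solves_unique a b z u v : (forall n, a n != 0) -> solves a b z u -> solves a b z v ->
  u 0 = v 0 -> u 1 = v 1 -> u =1 v.
Proof.
move=> a0 hu hv e0 e1.
have aC n : (a n)%:C != 0 :> R[i] by rewrite fmorph_eq0.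
have H n : u n = v n /\ u (n + 1) = v (n + 1).
  elim/int_updown: n => [//|n [h1 h2]|n [h1 h2]].
    split => //; have := hu (n + 1); have := hv (n + 1); rewrite /jacobi addrK h1 h2.
    move=> e e'; apply: (mulfI (aC (n + 1))).
    by have := etrans e' (esym e); move/addIr/addIr.
  rewrite subrK; split => //; have := hu n; have := hv n; rewrite /jacobi h1 h2.
  move=> e e'; apply: (mulfI (aC (n - 1))).
  by have := etrans e' (esym e); move/addIr/addrI.
by move=> n; have [] := H n.
Qed.

Definition tends0 u := forall e : R, 0 < e -> exists N : int, forall n, N <= n -> nc (u n) <= e.

(** A violation at one site makes the solution at least double at the next, because |z| / 2 - M >= 2
    M; since 2 M / |z| <= 1/2, the violation then repeats at that site. The resulting growth
    contradicts decay. *)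
Lemma decay_step a b (M : R) z u : (forall n, 0 < a n) ->
  (forall n, `|a n| <= M /\ `|b n| <= M) -> solves a b z u -> tends0 u ->
  6 * M <= nc z -> forall n, nc (u (n + 1)) <= 2 * M / nc z * nc (u n).
Proof.
move=> a0 hM hu u0 zM n0; have M0 : 0 < M.
  by apply: lt_le_trans (a0 0) _; apply: le_trans (ler_norm _) (hM 0).1.
have z0 : 0 < nc z by apply: lt_le_trans zM; rewrite mulr_gt0.
rewrite leNgt; apply/negP => h0.
have step n : 2 * M / nc z * nc (u n) < nc (u (n + 1)) -> 2 * nc (u (n + 1)) <= nc (u (n + 1 + 1)).
  move=> h.
  have e : (a (n + 1))%:C * u (n + 1 + 1) = (z - (b (n + 1))%:C) * u (n + 1) - (a n)%:C * u n.
    by have := hu (n + 1); rewrite /jacobi addrK => E; rewrite mulrBl -E; ring.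
  have [ha hb] := hM (n + 1); have [ha' _] := hM n.
  have l1 : (nc z - M) * nc (u (n + 1)) - M * nc (u n) <= M * nc (u (n + 1 + 1)).
    apply: (@le_trans _ _ (nc ((a (n + 1))%:C * u (n + 1 + 1)))); last first.
      by rewrite ncM nc_real ler_wpM2r ?nc_ge0.
    rewrite e; apply: le_trans (le_nc_dist _ _); rewrite !ncM !nc_real.
    apply: lerB; rewrite ler_wpM2r ?nc_ge0//.
    by apply: le_trans (le_nc_dist _ _); rewrite nc_real lerB.
  have l2 : M * nc (u n) <= nc z / 2 * nc (u (n + 1)).
    have : nc z * (2 * M / nc z * nc (u n)) <= nc z * nc (u (n + 1)) by rewrite ler_pM2l// ltW.
    have -> : nc z * (2 * M / nc z * nc (u n)) = 2 * M * nc (u n) by field; rewrite gt_eqF.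
    by move=> h3; lra.
  have l3 : 2 * M * nc (u (n + 1)) <= (nc z / 2 - M) * nc (u (n + 1)).
    by rewrite ler_wpM2r ?nc_ge0//; lra.
  by rewrite -(ler_pM2l M0); lra.
have th : 2 * M / nc z <= 2^-1 by rewrite ler_pdivrMr//; lra.
have un0 : 0 < nc (u (n0 + 1)).
  by apply: le_lt_trans h0; rewrite mulr_ge0 ?nc_ge0// divr_ge0 ?nc_ge0// mulr_ge0// ltW.
have grow (k : nat) : nc (u (n0 + 1)) <= nc (u (n0 + 1 + k%:Z)) /\
    2 * M / nc z * nc (u (n0 + k%:Z)) < nc (u (n0 + k%:Z + 1)).
  elim: k => [|k [IH1 IH2]]; first by rewrite !addr0.
  have s := step _ IH2.
  have -> : n0 + 1 + k.+1%:Z = n0 + k%:Z + 1 + 1 by rewrite -addn1 PoszD; ring.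
  have -> : n0 + k.+1%:Z = n0 + k%:Z + 1 by rewrite -addn1 PoszD; ring.
  have e1 : n0 + 1 + k%:Z = n0 + k%:Z + 1 by ring.
  rewrite e1 in IH1.
  have p0 : 0 < nc (u (n0 + k%:Z + 1)) by apply: lt_le_trans IH1.
  split; first lra.
  apply: (@le_lt_trans _ _ (2^-1 * nc (u (n0 + k%:Z + 1)))); last lra.
  by rewrite ler_wpM2r ?nc_ge0.
have e20 : 0 < nc (u (n0 + 1)) / 2 by lra.
have [N hN] := u0 _ e20.
pose k := absz (N - (n0 + 1))%R.
have [h1 _] := grow k.
have hk : N <= n0 + 1 + k%:Z by rewrite -lerBlDl abszE ler_norm.
have := hN _ hk; lra.
Qed.

Lemma back_step a b (M : R) z u : (forall n, 0 < a n) ->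
  (forall n, `|a n| <= M /\ `|b n| <= M) -> solves a b z u -> tends0 u ->
  6 * M <= nc z -> forall n, nc (u (n - 1)) <= 2 / a (n - 1) * nc z * nc (u n).
Proof.
move=> a0 hM hu u0 zM n; have M0 : 0 < M.
  by apply: lt_le_trans (a0 0) _; apply: le_trans (ler_norm _) (hM 0).1.
have z0 : 0 < nc z by apply: lt_le_trans zM; rewrite mulr_gt0.
have e : (a (n - 1))%:C * u (n - 1) = (z - (b n)%:C) * u n - (a n)%:C * u (n + 1).
  by have := hu n; rewrite /jacobi => E; rewrite mulrBl -E; ring.
have := congr1 (fun w : R[i] => nc w) e; rewrite /= ncM nc_real gtr0_norm// => e'.
have -> : 2 / a (n - 1) * nc z * nc (u n) = (2 * nc z * nc (u n)) / a (n - 1).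
  by rewrite -!mulrA; congr (_ * _); ring.
rewrite ler_pdivlMr// mulrC e'.
have [ha hb] := hM n.
have l1 : nc ((z - (b n)%:C) * u n - (a n)%:C * u (n + 1)) <= (nc z + M) * nc (u n) + M * nc (u (n + 1)).
  apply: le_trans (ncB _ _) _; rewrite !ncM !nc_real; apply: lerD; rewrite ler_wpM2r ?nc_ge0//.
  by apply: le_trans (ncB _ _) _; rewrite nc_real lerD.
have l2 := decay_step a0 hM hu u0 zM n.
have th : 2 * M / nc z <= 2^-1 by rewrite ler_pdivrMr//; lra.
have l3 : 2 * M / nc z * nc (u n) <= 2^-1 * nc (u n) by rewrite ler_wpM2r ?nc_ge0.
have l4 : M * nc (u (n + 1)) <= M * (2^-1 * nc (u n)) by rewrite ler_wpM2l ?(ltW M0)//; lra.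
have := nc_ge0 (u n); nra.
Qed.

(** Each step to the right gains a factor 1 / |z| and each step to the left loses one, so the order
    at infinity of the normalized Weyl solution is read off from n. *)
Lemma decay_bound a b (M : R) (u : R[i] -> int -> R[i]) : (forall n, 0 < a n) ->
  (forall n, `|a n| <= M /\ `|b n| <= M) ->
  (forall z, Im z != 0 -> [/\ solves a b z (u z), tends0 (u z) & u z 0 = 1]) ->
  forall n, exists2 C, 0 <= C & forall z, Im z != 0 -> 6 * M <= nc z ->
    nc (u z n) <= C * nc z ^ (- n).
Proof.
move=> a0 hM hu n; have M0 : 0 < M.
  by apply: lt_le_trans (a0 0) _; apply: le_trans (ler_norm _) (hM 0).1.
elim/int_updown: n => [|n [C C0 hC]|n [C C0 hC]].
- by exists 1 => // z /hu[_ _ ->] _; rewrite nc1 oppr0 expr0z mulr1.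
- exists (2 * M * C) => [|z zi zM]; first by rewrite !mulr_ge0// ltW.
  have [s t _] := hu z zi; have z0 : nc z != 0 by rewrite gt_eqF// (lt_le_trans _ zM)// mulr_gt0.
  have Cn : 2 * M / nc z * nc (u z n) <= 2 * M / nc z * (C * nc z ^ (- n)).
    by rewrite ler_wpM2l ?hC// divr_ge0 ?nc_ge0// mulr_ge0// ltW.
  apply: le_trans (decay_step a0 hM s t zM n) _; apply: le_trans Cn _.
  rewrite opprD expfzDr// exprN1 le_eqVlt; apply/orP; left; apply/eqP; ring.
- exists (2 / a (n - 1) * C) => [|z zi zM]; first by rewrite !mulr_ge0// invr_ge0 ltW.
  have [s t _] := hu z zi; have z0 : nc z != 0 by rewrite gt_eqF// (lt_le_trans _ zM)// mulr_gt0.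
  have Cn : 2 / a (n - 1) * nc z * nc (u z n) <= 2 / a (n - 1) * nc z * (C * nc z ^ (- n)).
    by rewrite ler_wpM2l ?hC// mulr_ge0 ?nc_ge0// divr_ge0// ltW.
  apply: le_trans (back_step a0 hM s t zM n) _; apply: le_trans Cn _.
  have -> : - (n - 1) = - n + 1 by ring.
  rewrite expfzDr// expr1z le_eqVlt; apply/orP; left; apply/eqP; ring.
Qed.
End JacobiSolutions.

Section PolynomialValues.
Variables (R : realType) (z : R[i]).
Implicit Types (p q : {poly R}) (c : R).
Lemma pvD p q : (pC (p + q)).[z] = (pC p).[z] + (pC q).[z]. Proof. by rewrite rmorphD hornerD. Qed.
Lemma pvN p : (pC (- p)).[z] = - (pC p).[z]. Proof. by rewrite rmorphN hornerN. Qed.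
Lemma pvB p q : (pC (p - q)).[z] = (pC p).[z] - (pC q).[z]. Proof. by rewrite pvD pvN. Qed.
Lemma pvM p q : (pC (p * q)).[z] = (pC p).[z] * (pC q).[z]. Proof. by rewrite rmorphM hornerM. Qed.
Lemma pvZ c p : (pC (c *: p)).[z] = c%:C * (pC p).[z]. Proof. by rewrite map_polyZ hornerZ. Qed.
Lemma pvX p n : (pC (p ^+ n)).[z] = (pC p).[z] ^+ n. Proof. by rewrite rmorphXn horner_exp. Qed.
Lemma pvC c : (pC c%:P).[z] = c%:C. Proof. by rewrite map_polyC hornerC. Qed.
Lemma pv0 : (pC (0 : {poly R})).[z] = 0. Proof. by rewrite rmorph0 horner0. Qed.
Lemma pv1 : (pC (1 : {poly R})).[z] = 1. Proof. by rewrite rmorph1 hornerC. Qed.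
Lemma pvXX : (pC ('X : {poly R})).[z] = z. Proof. by rewrite map_polyX hornerX. Qed.
Lemma pvXsubC c : (pC ('X - c%:P)).[z] = z - c%:C. Proof. by rewrite pvB pvXX pvC. Qed.
Lemma pv_sum (I : Type) (r : seq I) (A : pred I) (F : I -> {poly R}) :
  (pC (\sum_(i <- r | A i) F i)).[z] = \sum_(i <- r | A i) (pC (F i)).[z].
Proof. by elim/big_rec2 : _ => [|i x y _ <-]; rewrite ?pv0 ?pvD. Qed.
Lemma pv_prod (I : Type) (r : seq I) (A : pred I) (F : I -> {poly R}) :
  (pC (\prod_(i <- r | A i) F i)).[z] = \prod_(i <- r | A i) (pC (F i)).[z].
Proof. by elim/big_rec2 : _ => [|i x y _ <-]; rewrite ?pv1 ?pvM. Qed.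
End PolynomialValues.

(** [Abil] and [Bbil] are the rational part and the coefficient of R^(1/2) in Q psi_+ psi_- (see
    [ev_prod]), the first symmetric and the second antisymmetric. They are locked so that
    simplification does not expand them. *)
HB.lock Definition Abil (R : realType) (a : int -> R) (P Q U : {poly R})
    (u v : {poly R} * {poly R}) : {poly R} :=
  u.1 * v.1 * Q + (2 * a 0)^-1 *: ((u.1 * v.2 + u.2 * v.1) * P) + (2 * a 0)^-2 *: (u.2 * v.2 * U).
HB.lock Definition Bbil (R : realType) (a : int -> R) (u v : {poly R} * {poly R}) : {poly R} :=
  (2 * a 0)^-1 *: (u.2 * v.1 - u.1 * v.2).

Section BakerAkhiezerAlgebra.
Variables (R : realType) (g : nat) (E : nat -> R) (a b : int -> R) (P Q U : {poly R}).
Local Notation V := ({poly R} * {poly R})%type.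
Local Notation rt := (Rhalf g E).
Implicit Types (u v w : V) (z : R[i]).

Definition mulX (v : V) : V := ('X * v.1, 'X * v.2).
Definition ebas (n : int) : V := tt_sol mulX a b ((1, 0), (0, 1)) n.
Definition val1 (s : bool) (z : R[i]) : R[i] :=
  (2 * (a 0)%:C)^-1 * (((pC P).[z] + (-1) ^+ s * rt z) / (pC Q).[z]).
Definition ev s z v : R[i] := (pC v.1).[z] + (pC v.2).[z] * val1 s z.
Local Notation Abil := (Abil a P Q U).
Local Notation Bbil := (Bbil a).
Definition Fpol n := Abil (ebas n) (ebas n).
Definition Ppol n := (2 * a n) *: Abil (ebas n) (ebas (n + 1)).

Lemma pairD u v : u + v = (u.1 + v.1, u.2 + v.2). Proof. by []. Qed.
Lemma pairZ (c : R) v : c *: v = (c *: v.1, c *: v.2). Proof. by []. Qed.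

Lemma evD s z u v : ev s z (u + v) = ev s z u + ev s z v.
Proof. by rewrite /ev pairD /= !rmorphD !hornerD; ring. Qed.
Lemma evZ s z (c : R) v : ev s z (c *: v) = c%:C * ev s z v.
Proof. by rewrite /ev pairZ /= !map_polyZ !hornerZ; ring. Qed.
Lemma ev0 s z : ev s z 0 = 0.
Proof. by rewrite -(scale0r 0) evZ rmorph0 mul0r. Qed.
Lemma evB s z u v : ev s z (u - v) = ev s z u - ev s z v.
Proof. by rewrite -scaleN1r evD evZ rmorphN1 mulN1r. Qed.
Lemma evX s z v : ev s z (mulX v) = z * ev s z v.
Proof. by rewrite /ev /mulX /= !rmorphM /= !map_polyX !hornerM hornerX; ring. Qed.

Lemma AbilC u v : Abil u v = Abil v u.
Proof. by rewrite Abil.unlock (mulrC u.1) (mulrC u.2 v.2) addrC [in RHS]addrC (mulrC u.1 v.2) (mulrC u.2 v.1) (addrC (v.2 * _)). Qed.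
Lemma Abil_lin (c : R) u v w : Abil (c *: u + v) w = c *: Abil u w + Abil v w.
Proof. by rewrite Abil.unlock pairD !pairZ /= -!mul_polyC; ring. Qed.
Lemma AbilD u v w : Abil (u + v) w = Abil u w + Abil v w.
Proof. by rewrite -[u]scale1r Abil_lin !scale1r. Qed.
Lemma Abil0 w : Abil 0 w = 0.
Proof. by rewrite Abil.unlock /= !(mul0r, add0r, scaler0). Qed.
Lemma AbilZ (c : R) u w : Abil (c *: u) w = c *: Abil u w.
Proof. by rewrite -[c *: u]addr0 Abil_lin Abil0 addr0. Qed.
Lemma AbilM (p : {poly R}) v w : Abil (p * v.1, p * v.2) w = p * Abil v w.
Proof. by rewrite Abil.unlock /= -!mul_polyC; ring. Qed.
Lemma AbilX v w : Abil (mulX v) w = Abil v (mulX w).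
Proof. by rewrite /mulX AbilM AbilC [in RHS]AbilC AbilM AbilC. Qed.

Hypothesis a0 : forall n, 0 < a n.
Hypothesis QU : Q * U = P ^+ 2 - edge_poly g E.

Lemma aC n : (a n)%:C != 0 :> R[i].
Proof. by rewrite fmorph_eq0 gt_eqF. Qed.
Lemma a20 : 2 * a 0 != 0. Proof. by rewrite mulf_neq0 ?pnatr_eq0 ?gt_eqF. Qed.

Lemma ebas0 : ebas 0 = (1, 0). Proof. by []. Qed.
Lemma ebas1 : ebas 1 = (0, 1). Proof. by []. Qed.
Lemma ebasP n : a n *: ebas (n + 1) + a (n - 1) *: ebas (n - 1) + b n *: ebas n = mulX (ebas n).
Proof. by apply: tt_solP => k; rewrite gt_eqF. Qed.

Lemma ev_solves s z : solves a b z (fun n => ev s z (ebas n)).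
Proof. by move=> n; rewrite /jacobi -evX -ebasP !evD !evZ. Qed.
Lemma ev_ebas0 s z : ev s z (ebas 0) = 1.
Proof. by rewrite ebas0 /ev /= rmorph1 rmorph0 hornerC horner0 mul0r addr0. Qed.
Lemma ev_ebas1 s z : ev s z (ebas 1) = val1 s z.
Proof. by rewrite ebas1 /ev /= rmorph1 rmorph0 horner0 hornerC add0r mul1r. Qed.

Lemma ev_prod z u v : (pC Q).[z] != 0 ->
  ev false z u * ev true z v * (pC Q).[z] = (pC (Abil u v)).[z] + (pC (Bbil u v)).[z] * rt z.
Proof.
move=> q0; have := aC 0; set A := (a 0)%:C => A0.
have e : (pC U).[z] = ((pC P).[z] ^+ 2 - rt z ^+ 2) / (pC Q).[z].
  by rewrite rt_sqr -[in LHS](mulKf q0 (pC U).[z]) -hornerM -rmorphM /= QU rmorphB rmorphXn /= hornerD hornerN horner_exp mulrC.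
rewrite /ev /val1 Abil.unlock Bbil.unlock !(pvD, pvN, pvZ, pvM).
rewrite e.
have -> : real_complex R (2 * a 0)^-1 = (2 * A)^-1 by rewrite fmorphV rmorphM rmorph_nat.
have -> : real_complex R ((2 * a 0) ^- 2) = (2 * A) ^- 2 by rewrite fmorphV rmorphXn rmorphM rmorph_nat.
by rewrite expr0 expr1; field; rewrite A0 q0.
Qed.

(** Exchanging the branches changes the sign of R^(1/2), so the left side is a product of two
    conjugates, namely Q^2 times the values of both branches at [u] and at [v]. *)
Lemma Abil_Bbil u v : Abil u v ^+ 2 - Bbil u v ^+ 2 * edge_poly g E = Abil u u * Abil v v.
Proof.
have -> : edge_poly g E = P ^+ 2 - Q * U by rewrite QU subKr.
rewrite Abil.unlock Bbil.unlock -!mul_polyC; have -> : ((2 * a 0)^-2)%:P = ((2 * a 0)^-1)%:P ^+ 2 :> {poly R}.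
  by rewrite -exprVn rmorphXn.
by ring.
Qed.

Lemma Bbil_step n : a (n - 1) *: Bbil (ebas n) (ebas (n - 1)) = a n *: Bbil (ebas (n + 1)) (ebas n).
Proof.
have e := ebasP n.
have e1 := congr1 (@fst _ _) e; have e2 := congr1 (@snd _ _) e.
rewrite /= in e1 e2.
rewrite Bbil.unlock !scalerA !(mulrC _ (2 * a 0)^-1) -!scalerA; congr (_ *: _).
rewrite -!mul_polyC in e1 e2 *.
set x := ebas (n + 1) in e1 e2 *; set y := ebas (n - 1) in e1 e2 *; set w := ebas n in e1 e2 *.
have -> : (a n)%:P * (x.2 * w.1 - x.1 * w.2) = ((a n)%:P * x.2) * w.1 - ((a n)%:P * x.1) * w.2 by ring.
have -> : (a n)%:P * x.2 = 'X * w.2 - (a (n - 1))%:P * y.2 - (b n)%:P * w.2 by rewrite -e2; ring.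
have -> : (a n)%:P * x.1 = 'X * w.1 - (a (n - 1))%:P * y.1 - (b n)%:P * w.1 by rewrite -e1; ring.
by ring.
Qed.

(** Up to the factor 2 this is the coefficient of R^(1/2) in Q times the Wronskian of the two
    branches; it is constant in n and evaluated at n = 0. *)
Lemma Bbil_next n : a n *: Bbil (ebas (n + 1)) (ebas n) = (2^-1)%:P.
Proof.
elim/int_updown: n => [|n IH|n IH].
- rewrite add0r ebas0 ebas1 Bbil.unlock /= mulr1 mul0r subr0 scalerA -alg_polyC; congr (_ *: _).
  by rewrite invfM mulrC mulfVK// gt_eqF.
- by rewrite -Bbil_step addrK.
- by rewrite subrK Bbil_step.
Qed.

Lemma BbilN u v : Bbil v u = - Bbil u v.
Proof. by rewrite Bbil.unlock -scalerN; congr (_ *: _); ring. Qed.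
Lemma Bbilxx u : Bbil u u = 0.
Proof. by rewrite Bbil.unlock [u.1 * _]mulrC subrr scaler0. Qed.

(** This is the norm identity for neighbouring sites. Its main use is a sign: R < 0 inside the bands
    makes F_n F_{n+1} positive there. *)
Lemma FP_identity n : 4 * a n ^+ 2 *: (Fpol n * Fpol (n + 1)) = Ppol n ^+ 2 - edge_poly g E.
Proof.
rewrite /Fpol -Abil_Bbil /Ppol [(_ *: Abil _ _) ^+ 2]exprZn scalerBr; congr (_ - _).
  by rewrite exprMn -natrX.
have e : a n *: Bbil (ebas n) (ebas (n + 1)) = - (2^-1)%:P by rewrite BbilN scalerN Bbil_next.
have -> : 4 * a n ^+ 2 *: (Bbil (ebas n) (ebas (n + 1)) ^+ 2 * edge_poly g E) =
    4%:P * (a n *: Bbil (ebas n) (ebas (n + 1))) ^+ 2 * edge_poly g E.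
  by rewrite -!mul_polyC rmorphM rmorphXn; ring.
rewrite e sqrrN -rmorphXn -rmorphM -[RHS]mul1r; by congr (_%:P * _); field.
Qed.

Lemma Fpol0 : Fpol 0 = Q.
Proof. by rewrite /Fpol ebas0 Abil.unlock /= !(mul0r, mulr0, mul1r, mulr1, add0r, addr0, scaler0). Qed.
Lemma Ppol0 : Ppol 0 = P.
Proof.
rewrite /Ppol ebas0 add0r ebas1 Abil.unlock /= !(mul0r, mulr0, mul1r, mulr1, add0r, addr0, scaler0).
by rewrite scalerA divff ?scale1r ?a20.
Qed.

Lemma ev_next z n : (pC Q).[z] != 0 ->
  2 * (a n)%:C * ev false z (ebas (n + 1)) * (pC (Fpol n)).[z]
    = ((pC (Ppol n)).[z] + rt z) * ev false z (ebas n).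
Proof.
move=> q0; apply: (mulfI q0).
have h1 := @ev_prod z (ebas n) (ebas n) q0; rewrite Bbilxx rmorph0 horner0 mul0r addr0 in h1.
have h2 := @ev_prod z (ebas (n + 1)) (ebas n) q0.
rewrite -/(Fpol n) in h1; rewrite -h1.
have -> : (pC (Ppol n)).[z] + rt z = 2 * (a n)%:C * ((pC (Abil (ebas (n + 1)) (ebas n))).[z]
    + (pC (Bbil (ebas (n + 1)) (ebas n))).[z] * rt z).
  rewrite /Ppol AbilC map_polyZ hornerZ rmorphM rmorph_nat mulrDr; congr (_ + _).
  rewrite mulrA -[2 * _ * _]mulrA; have -> : (a n)%:C * (pC (Bbil (ebas (n + 1)) (ebas n))).[z] = 2^-1.
    by rewrite -hornerZ -map_polyZ Bbil_next map_polyC hornerC /= fmorphV rmorph_nat.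
  by rewrite divff ?mul1r// pnatr_eq0.
by rewrite -h2; ring.
Qed.

End BakerAkhiezerAlgebra.

(** * Orders of growth at infinity *)

Section GrowthAtInfinity.
Variable R : realType.
Implicit Types (f h : R[i] -> R[i]) (k l : int) (z : R[i]).

(** Orders are integers, negative ones included, and only the upper half plane is tested; for a
    polynomial this still bounds the degree ([bigO_size]). *)
Definition bigO f k := exists C : R, exists X0 : R, [/\ 0 <= C, 1 <= X0 &
  forall z, 0 < Im z -> X0 <= nc z -> nc (f z) <= C * nc z ^ k].

Lemma bigO_ext f h k : (forall z, 0 < Im z -> f z = h z) -> bigO f k -> bigO h k.
Proof.
by move=> fh [C [X [C0 X0 H]]]; exists C, X; split => // z z0 zX; rewrite -fh// H.
Qed.

Lemma bigO_le f k l : k <= l -> bigO f k -> bigO f l.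
Proof.
move=> kl [C [X [C0 X0 H]]]; exists C, X; split => // z z0 zX.
apply: le_trans (H z z0 zX) _; rewrite ler_wpM2l// -(subrK k l).
have z1 : 1 <= nc z by apply: le_trans zX.
rewrite expfzDr ?gt_eqF//; last by lra.
rewrite ler_peMl ?exprz_ge0 ?nc_ge0//.
have : 0 <= l - k by rewrite subr_ge0.
by case: (l - k) => // n _; rewrite -exprnP exprn_ege1.
Qed.

Lemma bigOD f h k : bigO f k -> bigO h k -> bigO (fun z => f z + h z) k.
Proof.
move=> [C [X [C0 X0 H]]] [C' [X' [C0' X0' H']]].
exists (C + C'), (Num.max X X'); split => [||z z0]; first exact: addr_ge0.
  by rewrite le_max X0.
rewrite ge_max => /andP[z1 z2]; apply: le_trans (ncD _ _) _.
by rewrite mulrDl lerD ?H ?H'.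
Qed.

Lemma bigOM f h k l : bigO f k -> bigO h l -> bigO (fun z => f z * h z) (k + l).
Proof.
move=> [C [X [C0 X0 H]]] [C' [X' [C0' X0' H']]].
exists (C * C'), (Num.max X X'); split => [||z z0]; first exact: mulr_ge0.
  by rewrite le_max X0.
rewrite ge_max => /andP[z1 z2]; rewrite ncM expfzDr; last by rewrite gt_eqF//; lra.
have -> : C * C' * (nc z ^ k * nc z ^ l) = (C * nc z ^ k) * (C' * nc z ^ l) by ring.
by apply: ler_pM; rewrite ?nc_ge0// ?H// H'.
Qed.

Lemma bigON f k : bigO f k -> bigO (fun z => - f z) k.
Proof. by move=> [C [X [C0 X0 H]]]; exists C, X; split => // z z0 zX; rewrite ncN H. Qed.
Lemma bigOB f h k : bigO f k -> bigO h k -> bigO (fun z => f z - h z) k.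
Proof. by move=> hf hh; apply: bigOD => //; exact: bigON. Qed.

Lemma bigO_poly (p : {poly R}) n : (size p <= n.+1)%N -> bigO (fun z => (pC p).[z]) n.
Proof.
by move=> /poly_growth[C C0 H]; exists C, 1; split => // z _ z1; rewrite -exprnP H.
Qed.
Lemma bigO_id : bigO id 1.
Proof. by exists 1, 1; split => // z _ _; rewrite expr1z mul1r. Qed.
Lemma bigO_inv : bigO (fun z => z^-1) (-1).
Proof. by exists 1, 1; split => // z _ _; rewrite ncV mul1r -exprN1. Qed.
Lemma bigO_cst (c : R[i]) : bigO (fun=> c) 0.
Proof. by exists (nc c), 1; split => [||z _ _] //; rewrite ?nc_ge0// expr0z mulr1. Qed.
Lemma bigO_inv_poly (p : {poly R}) n : size p = n.+1 -> bigO (fun z => (pC p).[z]^-1) (- n%:Z).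
Proof.
move=> sp; have p0 : p != 0 by rewrite -size_poly_gt0 sp.
have [c c0 [X X1 H]] := poly_lower p0; rewrite sp /= in H.
exists c^-1, X; split => [||z z0 zX] //; first by rewrite invr_ge0 ltW.
have z1 : 0 < nc z by lra.
rewrite ncV -exprnN -invfM lef_pV2 ?posrE ?mulr_gt0 ?exprn_gt0//; first exact: H.
by apply: lt_le_trans (H z zX); rewrite mulr_gt0 ?exprn_gt0.
Qed.

Lemma bigO_size (p : {poly R}) n : bigO (fun z => (pC p).[z]) (n%:Z - 1) -> (size p <= n)%N.
Proof.
move=> [C [X [C0 X0 H]]]; apply: (@size_growth _ _ _ C X) => y yX.
have y0 : 0 < y by lra.
have nzy : nc ('i * y%:C) = y by rewrite ncM nc_i mul1r nc_real gtr0_norm.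
have := H ('i * y%:C); rewrite nzy ImM /= mul0r add0r mul1r => /(_ y0 yX).
rewrite expfzDr ?gt_eqF// -exprnP exprN1 mulrA ler_pdivlMr//.
Qed.
End GrowthAtInfinity.

Section RootAtInfinity.
Variables (R : realType) (g : nat) (E : nat -> R).
Hypothesis hE : band_edges g E.
Local Notation rt := (Rhalf g E).
Local Notation moment := (moment g E).

Lemma bigO_inv_rt : bigO (fun z => (rt z)^-1) (- g.+1%:Z).
Proof.
have [X X0 H] := nc_rt_large g E.
exists ((2^-1 ^+ g.+1)^-1), (Num.max 1 X); split => [||z z0].
- by rewrite invr_ge0 exprn_ge0// invr_ge0.
- by rewrite le_max lexx.
rewrite ge_max => /andP[z1 zX]; have zp : 0 < nc z by lra.
rewrite ncV -exprnN -invfM lef_pV2 ?posrE ?mulr_gt0 ?exprn_gt0 ?invr_gt0//.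
  by rewrite -exprMn H.
by rewrite nc_gt0 rt_neq0// gt_eqF.
Qed.

(** A single root has no expansion in integer powers, but a product of two has. With s and t the
    roots, s t - z = s (t - s) - e, and |s| <= |t + s| in the first quadrant gives |s (t - s)| <=
    |e' - e|. *)
Lemma rt_pair_near (e e' : R) : bigO (fun z => sqrtc (z - e%:C) * sqrtc (z - e'%:C) - z) 0.
Proof.
exists (`|e' - e| + `|e|), 1; split => // z z0 _.
rewrite expr0z mulr1.
have i0 (x : R) : 0 < Im (z - x%:C) by rewrite ImB /= subr0.
set s := sqrtc _; set t := sqrtc _.
have es : s ^+ 2 = z - e%:C by rewrite sqrtc_sqr.
have et : t ^+ 2 = z - e'%:C by rewrite sqrtc_sqr.
have -> : s * t - z = s * (t - s) - e%:C by rewrite mulrBr -expr2 es; ring.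
apply: le_trans (ncB _ _) _; rewrite nc_real lerD2r ncM.
have d : nc (t - s) * nc (t + s) = `|e' - e|.
  by rewrite -ncM -subr_sqr et es -nc_real rmorphB -ncN; congr nc; ring.
rewrite -d [leLHS]mulrC; apply: ler_wpM2l; first exact: nc_ge0.
rewrite -ler_sqr ?nnegrE ?nc_ge0// !sqr_nc ReD ImD.
have := Re_sqrtc_ge0 (z - e%:C); have := Re_sqrtc_ge0 (z - e'%:C).
have := Im_sqrtc_ge0 (ltW (i0 e)); have := Im_sqrtc_ge0 (ltW (i0 e')); rewrite -/s -/t; nra.
Qed.

(** The edges are taken in pairs. The minus sign in [Rhalf] makes the leading term -z^(g+1), which
    is why monic polynomials of degree g get moment +1. *)
Lemma rt_monic : bigO (fun z => rt z + z ^+ g.+1) g%:Z.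
Proof.
pose Z k (z : R[i]) := \prod_(0 <= j < k.*2) sqrtc (z - (E j)%:C).
have H k : bigO (fun z => Z k z - z ^+ k) (k%:Z - 1).
  elim: k => [|k IH].
    apply: (@bigO_ext _ (fun=> 0)) => [z _|]; first by rewrite /Z big_geq// subrr.
    by exists 0, 1; split => // z _ _; rewrite nc0 mul0r.
  have h2 := bigOM (bigO_poly (p := 'X^k) (n := k) _) (rt_pair_near (E k.*2) (E k.*2.+1)).
  have h3 := bigOM IH (bigOD (bigO_le (ler01) (rt_pair_near (E k.*2) (E k.*2.+1))) (bigO_id R)).
  rewrite addr0 in h2; have := h2 _; rewrite size_polyXn => /(_ (leqnn _)) {}h2.
  have -> : k.+1%:Z - 1 = k%:Z by lia.
  rewrite subrK in h3; apply: bigO_ext (bigOD h3 h2) => z z0.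
  rewrite /Z doubleS !big_nat_recr//= map_polyXn hornerXn exprSr; ring.
have := bigON (H g.+1); have -> : g.+1%:Z - 1 = g%:Z by lia.
apply: bigO_ext => z z0; rewrite opprB addrC /Rhalf /Z doubleS.
by [].
Qed.

Lemma moment_eqO (p q : {poly R}) (c : R) :
  bigO (fun z => (pC p).[z] / rt z - (pC q).[z] - c%:C / z) (- 2) -> moment p = - c.
Proof.
move=> [C [X [C0 X0 H]]]; apply: (@moment_eq _ _ _ hE p q c C X C0) => z z0 zX.
by apply: le_trans (H z z0 zX) _; rewrite -exprnN.
Qed.

Lemma moment_small (p : {poly R}) : (size p <= g)%N -> moment p = 0.
Proof.
move=> sp; rewrite -oppr0; apply: (@moment_eqO _ 0).
have e : bigO (fun z => (pC p).[z] / rt z) (- 2).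
  case: g sp bigO_inv_rt => [|k] sp h.
    have -> : p = 0 by apply/eqP; rewrite -size_poly_leq0.
    apply: (@bigO_ext _ (fun=> 0)) => [z _|]; first by rewrite pv0 mul0r.
    by exists 0, 1; split => // z _ _; rewrite nc0 mul0r.
  by have := bigOM (bigO_poly sp) h; have -> : k%:Z - k.+2%:Z = - 2 by lia.
by apply: bigO_ext e => z _; rewrite pv0 mul0r !subr0.
Qed.

Lemma moment_monic (p : {poly R}) : p \is monic -> size p = g.+1 -> moment p = 1.
Proof.
move=> pm sp; rewrite -[RHS]opprK; apply: (@moment_eqO _ 0).
have h1 : bigO (fun z => (pC ('X * p - 'X^(g.+1))).[z]) g%:Z.
  apply: bigO_poly; have p0 : p != 0 by rewrite -size_poly_gt0 sp.
  apply/leq_sizeP => j gj; rewrite coefB coefXM coefXn.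
  case: j gj => // j gj /=; rewrite ltnS in gj.
  have [->|jg] := eqVneq j g; first by have := monicP pm; rewrite /lead_coef sp eqxx /= => ->; rewrite subrr.
  by rewrite (negbTE _ : (j.+1 == g.+1) = false) ?eqSS// subr0 nth_default// sp ltn_neqAle eq_sym jg.
have h2 := bigOM (bigOM (bigOD h1 rt_monic) bigO_inv_rt) (bigO_inv R).
have -> : - 2 = g%:Z + - g.+1%:Z - 1 by lia.
apply: bigO_ext h2 => z z0; rewrite pvB pvM pvXX pvX pvXX pv0.
have r0 : rt z != 0 by rewrite rt_neq0// gt_eqF.
have zn : z != 0 by apply: contraTneq z0 => ->; rewrite ltxx.
by rewrite rmorphN1; field; rewrite r0 zn.
Qed.
End RootAtInfinity.

(** * Polynomials with one root in each gap *)

Section Interpolation.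
Variable R : realType.
Implicit Types (p : {poly R}) (x : nat -> R).

Lemma interpolation x n : (0 < n)%N -> injective x -> exists L : nat -> {poly R},
  forall p, (size p <= n)%N -> p = \sum_(i < n) p.[x i] *: L i.
Proof.
move=> n0 xi; exists (fun i => tnth (qpoly.lagrange n x) (insubd (Ordinal n0) i)) => p pn.
rewrite {1}(qpoly.lagrange_gen n0 xi pn); apply: eq_bigr => i _.
by rewrite mul_polyC; congr (_ *: val (tnth _ _)); apply: val_inj; rewrite val_insubd ltn_ord.
Qed.

(** On polynomials of bounded degree all norms are equivalent: values at the integers 0, ..., n - 1
    control values and derivatives on a disc. *)
Lemma deriv_bound n r : exists2 K : R, 0 <= K & forall p c, (size p <= n)%N ->
  (forall x : R, `|x| <= n%:R -> `|p.[x]| <= c) ->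
  (forall z, nc z <= r -> nc (pC p).[z] <= K * c) /\
  (forall z, nc z <= r -> nc (pC p^`()).[z] <= K * c).
Proof.
case: n => [|n].
  exists 0 => // p c; rewrite leqn0 size_poly_eq0 => /eqP -> _.
  by split => z _; rewrite ?deriv0 pv0 nc0 mul0r.
have inj : injective (fun i : nat => i%:R : R) by move=> i j /eqP; rewrite eqr_nat => /eqP.
have [L hL] := interpolation (ltn0Sn n) inj.
have B i : exists K, 0 <= K /\ forall z, nc z <= r -> nc (pC (L i)).[z] <= K /\ nc (pC (L i)^`()).[z] <= K.
  have [K1 K10 h1] := poly_bound (L i) r; have [K2 K20 h2] := poly_bound (L i)^`() r.
  exists (K1 + K2); split => [|z zr]; first exact: addr_ge0.
  by have := h1 z zr; have := h2 z zr; split; lra.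
have [K hK] := choice B.
exists (\sum_(i < n.+1) K i) => [|p c pn pc]; first by rewrite sumr_ge0// => i _; have [] := hK i.
have pi (i : 'I_n.+1) : `|p.[i%:R]| <= c.
  by apply: pc; rewrite normr_nat ler_nat ltnW.
have c0 : 0 <= c by apply: le_trans (pi ord0).
split => z zr.
  rewrite (hL p pn) pv_sum mulr_suml; apply: le_trans (nc_sum _ _ _) _; apply: ler_sum => i _.
  rewrite pvZ ncM nc_real mulrC; apply: ler_pM; rewrite ?nc_ge0//.
  by have [_ /(_ z zr)[]] := hK i.
rewrite {1}(hL p pn) raddf_sum pv_sum mulr_suml; apply: le_trans (nc_sum _ _ _) _; apply: ler_sum => i _.
rewrite /= derivZ pvZ ncM nc_real mulrC; apply: ler_pM; rewrite ?nc_ge0//.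
by have [_ /(_ z zr)[]] := hK i.
Qed.
End Interpolation.

Section GapPolynomials.
Variables (R : realType) (g : nat) (E : nat -> R).
Hypothesis hE : band_edges g E.
Implicit Types (p q : {poly R}) (x y : R).

(** Monic polynomials with one root in each closed gap form a compact family. All diagonal values
    [Fpol] belong to it, which is the origin of the bounds uniform in n. *)
Definition gap_poly p := exists2 mu : nat -> R, p = \prod_(1 <= j < g.+1) ('X - (mu j)%:P) &
  forall j, (1 <= j <= g)%N -> E j.*2.-1 <= mu j <= E j.*2.

Lemma gap_polyP p : gap_poly p -> p \is monic /\ size p = g.+1.
Proof.
move=> [mu -> _]; split; first exact: monic_prod_XsubC.
by rewrite size_prod_XsubC size_iota subn1.
Qed.

Lemma gap_side j k x : (1 <= j <= g)%N -> (k <= g)%N -> in_band E k x ->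
  ((j <= k)%N -> E j.*2 < x) /\ ((k < j)%N -> x < E j.*2.-1).
Proof.
move=> jg kg /andP[x1 x2]; split => jk.
  by apply: le_lt_trans x1; apply: (edges_le hE); lia.
by apply: lt_le_trans x2 _; apply: (edges_le hE); lia.
Qed.

Lemma gap_poly_same_sign p q k x : gap_poly p -> gap_poly q -> (k <= g)%N -> in_band E k x ->
  0 < p.[x] * q.[x].
Proof.
move=> [mu -> hmu] [nu -> hnu] kg xk.
rewrite !horner_prod -big_split /= big_nat; apply: prodr_gt0 => j jg.
rewrite !hornerXsubC; have [h1 h2] := gap_side jg kg xk.
have := hmu j jg; have := hnu j jg => /andP[n1 n2] /andP[m1 m2].
by have [/h1|/h2] := leqP j k; nra.
Qed.

Lemma gap_poly_switch p j x y : gap_poly p -> (1 <= j <= g)%N -> in_band E j.-1 x -> in_band E j y ->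
  p.[x] * p.[y] < 0.
Proof.
move=> [mu -> hmu] jg xj yj.
rewrite !horner_prod -big_split /= (bigD1_seq j) ?mem_index_iota ?iota_uniq//=.
have k1 : (j.-1 <= g)%N by lia.
have k2 : (j <= g)%N by lia.
have [_ h] := gap_side jg k1 xj; have [h' _] := gap_side jg k2 yj.
rewrite pmulr_llt0.
  rewrite !hornerXsubC; have := hmu j jg => /andP[m1 m2].
  have ha : E j.*2 < y by apply: h'.
  have hb : x < E j.*2.-1 by apply: h; lia.
  by nra.
rewrite big_nat_cond; apply: prodr_gt0 => i /andP[ig ij].
rewrite !hornerXsubC; have := hmu i ig => /andP[m1 m2].
have [h1 h2] := gap_side ig k1 xj; have [h3 h4] := gap_side ig k2 yj.
have [lij|] := leqP i j.-1.
  have {}h1 : E i.*2 < x by exact: h1.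
  have {}h3 : E i.*2 < y by apply: h3; clear -lij; lia.
  by nra.
move=> lij; have ji : (j < i)%N by rewrite ltn_neqAle eq_sym ij -(prednK (_ : 0 < j)%N)//; case/andP: jg.
have {}h2 : x < E i.*2.-1 by exact: h2.
have {}h4 : y < E i.*2.-1 by exact: h4.
by nra.
Qed.

Definition midband k : R := (E k.*2 + E k.*2.+1) / 2.
Lemma midbandP k : (k <= g)%N -> in_band E k (midband k).
Proof.
move=> kg; have : E k.*2 < E k.*2.+1 by apply: hE; lia.
by rewrite /in_band /midband => h; apply/andP; split; lra.
Qed.

Lemma edge_poly_band k x : (k <= g)%N -> in_band E k x -> (edge_poly g E).[x] < 0.
Proof.
move=> kg xk; have := rt_sqr g E x%:C; rewrite pC_real (rt_band hE kg xk).
have a0 := absrt_gt0 (band_not_edge hE kg xk); set r := absrt _ _ _ in a0 *.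
rewrite exprMn -rmorphXn => /(congr1 (@complex.Re R)); rewrite expr2 ReM ReM /= => e.
have e2 : ((-1) ^+ (g - k) * r) ^+ 2 = r ^+ 2 by rewrite exprMn sqrr_sign mul1r.
have := e; rewrite mulNr sqrrN e2 => <-.
have : 0 < r ^+ 2 by rewrite exprn_gt0.
by lra.
Qed.

Lemma pred_double j : (1 <= j <= g)%N -> j.-1.*2.+1 = j.*2.-1.
Proof. by case: j. Qed.

(** [q] changes sign from one band to the next, so [p] does too and has a root in between. It cannot
    lie in an open band, where p q > 0, so it lies in the closed gap; these g roots exhaust the
    degree. *)
Lemma gap_poly_intro p q : gap_poly q -> p \is monic -> size p = g.+1 ->
  (forall k x, (k <= g)%N -> in_band E k x -> 0 < p.[x] * q.[x]) -> gap_poly p.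
Proof.
move=> hq pm sp pq.
have ex j : exists r, (1 <= j <= g)%N -> root p r /\ E j.*2.-1 <= r <= E j.*2.
  have [jg|] := boolP (1 <= j <= g)%N; last by exists 0.
  have k1 : (j.-1 <= g)%N by lia.
  have k2 : (j <= g)%N by lia.
  have m1 := midbandP k1; have m2 := midbandP k2.
  have sw := gap_poly_switch hq jg m1 m2.
  have h1 := pq _ _ k1 m1; have h2 := pq _ _ k2 m2.
  have s : p.[midband j.-1] * p.[midband j] <= 0.
    rewrite leNgt; apply/negP => h.
    have := mulr_gt0 h1 h2; have := mulr_gt0 h (_ : 0 < - (q.[midband j.-1] * q.[midband j])).
    by rewrite oppr_gt0 => /(_ sw); nra.
  have o : midband j.-1 <= midband j.
    have /andP[_ u1] := m1; have /andP[u2 _] := m2.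
    apply: le_trans (ltW u1) _; apply: le_trans (ltW u2); rewrite (pred_double jg).
    by apply: (edges_le hE); clear -jg; lia.
  have [r] := polyrcf.poly_ivt o s; rewrite in_itv/= => /andP[r1 r2] rr.
  exists r => _; split => //; apply/andP; split; rewrite leNgt; apply/negP => lr.
    have b : in_band E j.-1 r.
      have /andP[u1 _] := m1; apply/andP; split; first exact: lt_le_trans r1.
      by rewrite (pred_double jg).
    by have := pq _ _ k1 b; rewrite (rootP rr) mul0r ltxx.
  have b : in_band E j r.
    by have /andP[_ u2] := m2; apply/andP; split => //; exact: le_lt_trans u2.
  by have := pq _ _ k2 b; rewrite (rootP rr) mul0r ltxx.
have [mu hmu] := choice ex; exists mu => [|j jg]; last by have [] := hmu j jg.
have -> : p = lead_coef p *: \prod_(z <- [seq mu j | j <- index_iota 1 g.+1]) ('X - z%:P).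
  apply: all_roots_prod_XsubC; first by rewrite size_map size_iota subn1.
    by rewrite all_map; apply/allP => j; rewrite mem_index_iota => jg; have [] := hmu j jg.
  rewrite uniq_rootsE map_inj_in_uniq ?iota_uniq// => i j; rewrite !mem_index_iota => ig jg.
  have [_ /andP[i1 i2]] := hmu i ig; have [_ /andP[j1 j2]] := hmu j jg => e.
  have [ij|ij|//] := ltngtP i j; exfalso.
    have : E i.*2 < E j.*2.-1 by apply: (edges_lt hE); clear -ij ig jg; lia.
    by rewrite e in i2 => h; have := le_lt_trans (le_trans j1 i2) h; rewrite ltxx.
  have : E j.*2 < E i.*2.-1 by apply: (edges_lt hE); clear -ij ig jg; lia.
  by rewrite -e in j2 => h; have := le_lt_trans (le_trans i1 j2) h; rewrite ltxx.
by rewrite (monicP pm) scale1r big_map.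
Qed.

Lemma gap_poly_le r : exists2 C, 0 <= C & forall p z, gap_poly p -> nc z <= r -> nc (pC p).[z] <= C.
Proof.
pose S := `|r| + `|E 0%N| + `|E g.*2.+1|.
exists (S ^+ g) => [|p z [mu -> hmu] zr]; first by rewrite exprn_ge0// !addr_ge0.
rewrite pv_prod nc_prod.
have -> : S ^+ g = \prod_(1 <= j < g.+1) S by rewrite prodr_const_nat subn1.
rewrite big_nat [leRHS]big_nat; apply: ler_prod => j jg; rewrite nc_ge0/=.
rewrite pvXsubC; apply: le_trans (ncB _ _) _; rewrite nc_real.
have /andP[m1 m2] := hmu j jg.
have l1 : E 0%N <= mu j by apply: le_trans m1; apply: (edges_le hE); lia.
have l2 : mu j <= E g.*2.+1 by apply: le_trans m2 _; apply: (edges_le hE); lia.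
have : `|mu j| <= `|E 0%N| + `|E g.*2.+1|.
  rewrite ler_norml; have := ler_norm (E g.*2.+1); have := ler_norm (- E 0%N).
  by have := normr_ge0 (E 0%N); have := normr_ge0 (E g.*2.+1); rewrite normrN => *; apply/andP; split; lra.
by have := ler_norm r; rewrite /S; lra.
Qed.

Lemma gap_poly_ge p z d : gap_poly p -> 0 <= d ->
  (forall j y, (1 <= j <= g)%N -> E j.*2.-1 <= y <= E j.*2 -> d <= nc (z - y%:C)) ->
  d ^+ g <= nc (pC p).[z].
Proof.
move=> [mu -> hmu] d0 H; rewrite pv_prod nc_prod.
have -> : d ^+ g = \prod_(1 <= j < g.+1) d by rewrite prodr_const_nat subn1.
rewrite big_nat [leRHS]big_nat; apply: ler_prod => j jg; rewrite d0/=.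
by rewrite pvXsubC; apply: H (hmu j jg).
Qed.

Lemma gap_poly_neq0 p z : gap_poly p -> Im z != 0 -> (pC p).[z] != 0.
Proof.
move=> hp zi; rewrite -nc_gt0; apply: lt_le_trans (gap_poly_ge hp (normr_ge0 (Im z)) _).
  by rewrite exprn_gt0// normr_gt0.
by move=> j y _ _; have := Im_le_nc (z - y%:C); rewrite ImB subr0.
Qed.

Lemma gap_poly_neq0r p k x : gap_poly p -> (k <= g)%N -> in_band E k x -> p.[x] != 0.
Proof.
move=> hp kg xk; have := gap_poly_same_sign hp hp kg xk.
by apply: contraTneq => ->; rewrite mul0r ltxx.
Qed.
End GapPolynomials.

(** This is the background in algebraic form. Unlike the original data it is visibly stable under n
    -> -n, which exchanges the last two conditions. *)
Record finite_gap (R : realType) (g : nat) (E : nat -> R) (a b : int -> R) (P Q U : {poly R})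
    (M : R) : Prop := FiniteGap {
  fgapE : band_edges g E;
  fgapa : forall n, 0 < a n;
  fgapM : forall n, `|a n| <= M /\ `|b n| <= M;
  fgapU : Q * U = P ^+ 2 - edge_poly g E;
  fgapQ : gap_poly g E Q;
  fgap_right : forall z, Im z != 0 -> tends0 (fun n => ev g E a P Q false z (ebas a b n));
  fgap_left : forall z, Im z != 0 -> tends0 (fun n => ev g E a P Q true z (ebas a b (- n))) }.

Section FiniteGapBackground.
Variables (R : realType) (g : nat) (E : nat -> R) (a b : int -> R) (P Q U : {poly R}) (M : R).
Hypothesis H : finite_gap g E a b P Q U M.
Local Notation rt := (Rhalf g E).
Local Notation moment := (moment g E).
Local Notation e := (ebas a b).
Local Notation ev := (ev g E a P Q).
Local Notation A := (Abil a P Q U).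
Local Notation B := (Bbil a).
Local Notation F := (Fpol a b P Q U).
Local Notation W := (Ppol a b P Q U).
Implicit Types (z : R[i]) (n m l k : int).

Let hE := fgapE H.
Let a0 := fgapa H.
Let hM := fgapM H.
Let hU := fgapU H.
Let hQ := fgapQ H.

Lemma M_gt0 : 0 < M.
Proof. by apply: lt_le_trans (a0 0) _; apply: le_trans (ler_norm _) (hM 0).1. Qed.

Lemma Q_neq0 z : Im z != 0 -> (pC Q).[z] != 0.
Proof. by move=> zi; apply: gap_poly_neq0 hQ _. Qed.

Lemma ev_growth l m : bigO (fun z => ev false z (e l) * ev true z (e m)) (m - l).
Proof.
have h1 : bigO (fun z => ev false z (e l)) (- l).
  have [|C C0 hC] := @decay_bound R a b M (fun z n => ev false z (e n)) a0 hM _ l.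
    move=> z z0; split; [exact: ev_solves|exact: (fgap_right H)|exact: ev_ebas0].
  exists C, (Num.max 1 (6 * M)); split => [//||z z0]; first by rewrite le_max lexx.
  by rewrite ge_max => /andP[_]; apply: hC; rewrite gt_eqF.
have h2 : bigO (fun z => ev true z (e m)) m.
  have ra0 n : 0 < reflect_a a n by exact: a0.
  have rM n : `|reflect_a a n| <= M /\ `|reflect b n| <= M.
    by have [h _] := hM (- n - 1); have [_ h'] := hM (- n).
  have [|C C0 hC] := @decay_bound R _ _ M (fun z => reflect (fun n => ev true z (e n))) ra0 rM _ (- m).
    move=> z z0; split; first by apply: solves_reflect; exact: ev_solves.
      exact: (fgap_left H).
    by rewrite /reflect oppr0 ev_ebas0.
  exists C, (Num.max 1 (6 * M)); split => [//||z z0]; first by rewrite le_max lexx.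
  rewrite ge_max => /andP[_ zM]; have := hC z _ zM; rewrite /reflect opprK; apply.
  by rewrite gt_eqF.
by rewrite addrC; exact: bigOM h1 h2.
Qed.

Lemma AB_growth l m : bigO (fun z => (pC (A (e l) (e m))).[z] + (pC (B (e l) (e m))).[z] * rt z)
  (g%:Z + (m - l)).
Proof.
have [_ sQ] := gap_polyP hQ.
have := bigOM (bigO_poly (eq_leq sQ)) (ev_growth l m).
apply: bigO_ext => z z0; have zi : Im z != 0 by rewrite gt_eqF.
by rewrite -(ev_prod a0 hU _ _ (Q_neq0 zi)); ring.
Qed.

(** The two orders of the arguments give A + B R^(1/2) and A - B R^(1/2); half their sum eliminates
    B. *)
Lemma A_growth l m : bigO (fun z => (pC (A (e l) (e m))).[z]) (g%:Z + `|l - m|).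
Proof.
have h1 := bigO_le (_ : _ <= g%:Z + `|l - m|) (AB_growth l m).
have h2 := bigO_le (_ : _ <= g%:Z + `|l - m|) (AB_growth m l).
have h3 : bigO (fun z => (pC (A (e l) (e m))).[z] + (pC (B (e l) (e m))).[z] * rt z) (g%:Z + `|l - m|).
  by apply: h1; rewrite lerD2l -normrN opprB ler_norm.
have h4 : bigO (fun z => (pC (A (e m) (e l))).[z] + (pC (B (e m) (e l))).[z] * rt z) (g%:Z + `|l - m|).
  by apply: h2; rewrite lerD2l ler_norm.
have h5 := bigOM (bigO_cst (2^-1)%:C) (bigOD h3 h4); rewrite add0r in h5.
apply: bigO_ext h5 => z _; rewrite (AbilC _ _ _ _ (e m)) BbilN pvN.
have -> : (2^-1)%:C = 2^-1 :> R[i] by rewrite fmorphV rmorph_nat.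
by field.
Qed.

(** For m < l the quotient (A + B R^(1/2)) / R^(1/2) is O(1/z^2), so A / R^(1/2) is the polynomial
    -B up to a remainder without a 1/z term. *)
Lemma AB_moment l m : m < l -> moment (A (e l) (e m)) = 0.
Proof.
move=> ml; rewrite -oppr0; apply: (@moment_eqO _ _ _ hE _ (- B (e l) (e m))).
have h1 := bigOM (AB_growth l m) (bigO_inv_rt g E).
have h2 := bigO_le (_ : _ <= - 2) h1; apply: bigO_ext (h2 _) => [z z0|]; last by lia.
have r0 : rt z != 0 by rewrite rt_neq0// gt_eqF.
by rewrite pvN mulrDl mulfK// opprK mul0r subr0.
Qed.

Lemma A_three l m : a l * moment (A (e (l + 1)) (e m)) + a (l - 1) * moment (A (e (l - 1)) (e m))
  + b l * moment (A (e l) (e m)) = moment (A (mulX (e l)) (e m)).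
Proof. by rewrite -(ebasP b a0 l) !AbilD !AbilZ !(momentD hE) !(momentZ hE). Qed.

(** Off the diagonal this is decay at infinity. Multiplication by z is symmetric for [Abil], and
    pairing e_n with e_{n+1} in both ways shows that consecutive diagonal values agree; F_0 = Q is
    monic and gives 1. *)
Lemma moment_A l m : moment (A (e l) (e m)) = (l == m)%:R.
Proof.
have off i j : i != j -> moment (A (e i) (e j)) = 0.
  by rewrite neq_lt => /orP[ij|ij]; first rewrite AbilC; exact: AB_moment.
have [<-{m}|/off//] := eqVneq l m.
have [Qm sQ] := gap_polyP hQ.
have step n : moment (A (e n) (e n)) = moment (A (e (n + 1)) (e (n + 1))).
  have eX : moment (A (mulX (e n)) (e (n + 1))) = moment (A (mulX (e (n + 1))) (e n)).
    by rewrite AbilX AbilC.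
  have := A_three n (n + 1); rewrite eX -A_three addrK (off n) ?(off (n - 1)) ?(off (n + 1) n) ?(off (n + 1 + 1)); try lia.
  by rewrite !mulr0 !addr0 add0r => /(mulfI (lt0r_neq0 (a0 n))) ->.
elim/int_updown: l => [|n IH|n IH].
- by rewrite -/(F 0) Fpol0 (moment_monic hE).
- by rewrite -step.
- by rewrite step subrK.
Qed.

(** Growth at infinity bounds the degree, and the leading coefficient equals the moment, which is 1.
    Inside the bands neighbouring F_n have equal signs by [FP_identity], so every F_n has the signs
    of Q and hence a root in each gap. *)
Lemma Fpol_gap n : gap_poly g E (F n).
Proof.
have [Qm sQ] := gap_polyP hQ.
have sF : (size (F n) <= g.+1)%N.
  apply: bigO_size; have := A_growth n n; rewrite subrr normr0 addr0.
  by have -> : g.+1%:Z - 1 = g%:Z by lia.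
have lead : (F n)`_g = 1.
  have sm : (size (F n - (F n)`_g *: Q)%R <= g)%N.
    apply/leq_sizeP => j; rewrite leq_eqVlt => /predU1P[<-|gj].
      by have := monicP Qm; rewrite coefB coefZ /lead_coef sQ /= => ->; rewrite mulr1 subrr.
    by rewrite coefB coefZ (nth_default 0 (_ : size Q <= j)%N) ?sQ// nth_default ?mulr0 ?subrr// (leq_trans sF).
  have := moment_small hE sm; rewrite (momentB hE) (momentZ hE) (moment_monic hE Qm sQ) mulr1.
  by rewrite moment_A eqxx => /eqP; rewrite subr_eq0 => /eqP.
have szF : size (F n) = g.+1.
  apply/eqP; rewrite eqn_leq sF ltnNge; apply/negP => h.
  by move: lead; rewrite nth_default// => /eqP; rewrite eq_sym oner_eq0.
apply: (gap_poly_intro hE hQ _ szF); first by rewrite monicE /lead_coef szF lead.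
move=> k x kg xk; have ee := edge_poly_band hE kg xk.
have sgn m : 0 < (F m).[x] * (F (m + 1)).[x].
  have /(congr1 (fun p => p.[x])) := FP_identity b a0 hU m.
  rewrite hornerZ hornerM hornerD hornerN horner_exp => h.
  have a1 : 0 < 4 * a m ^+ 2 by rewrite mulr_gt0 ?exprn_gt0.
  rewrite -(pmulr_rgt0 _ a1) h; have := sqr_ge0 (W m).[x]; lra.
have q2 : Q.[x] != 0 by exact: (gap_poly_neq0r hE hQ kg xk).
have pos m : 0 < (F m).[x] * Q.[x] -> forall m', 0 < (F m).[x] * (F m').[x] -> 0 < (F m').[x] * Q.[x].
  by move=> h1 m' h2; have := mulr_gt0 h1 h2; have : 0 < (F m).[x] ^+ 2; nra.
suff h m : 0 < (F m).[x] * Q.[x] by exact: h.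
elim/int_updown: m => [|m IH|m IH].
- by rewrite Fpol0 -expr2 exprn_even_gt0.
- by apply: (pos m).
- by apply: (pos m) => //; rewrite mulrC -{2}(subrK 1 m).
Qed.

Lemma size_Wpol n : (size (W n) <= g.+2)%N.
Proof.
have [_ s1] := gap_polyP (Fpol_gap n); have [_ s2] := gap_polyP (Fpol_gap (n + 1)).
have := FP_identity b a0 hU n => /eqP; rewrite eq_sym subr_eq => /eqP h.
have sW : (size (W n ^+ 2) <= g.*2.+3)%N.
  rewrite h; apply: leq_trans (size_polyD _ _) _; rewrite geq_max; apply/andP; split.
    apply: leq_trans (size_scale_leq _ _) _; apply: leq_trans (size_polyMleq _ _) _.
    by rewrite s1 s2; lia.
  by rewrite /edge_poly size_prod_XsubC size_iota subn0.
have := size_exp (W n) 2; set s := size (W n ^+ 2) in sW *; set t := size (W n).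
by clear -sW; lia.
Qed.

Lemma uniform_bounds r : exists2 C, 0 <= C & forall n z, nc z <= r ->
  [/\ nc (pC (F n)).[z] <= C, nc (pC (W n)).[z] <= C,
      nc (pC (F n)^`()).[z] <= C & nc (pC (W n)^`()).[z] <= C].
Proof.
(* The disc is enlarged so as to contain the real points at which [deriv_bound] asks for a bound. *)
pose r1 := `|r| + g.+2%:R; have rr1 : r <= r1 by rewrite /r1; have := ler_norm r; have := ler0n R g.+2; lra.
have [C C0 hC] := gap_poly_le hE r1; have [D D0 hD] := poly_bound (edge_poly g E) r1.
have bF n z : nc z <= r1 -> nc (pC (F n)).[z] <= C by apply: hC; exact: Fpol_gap.
pose CW := 1 + 4 * M ^+ 2 * C ^+ 2 + D.
have CW1 : 1 <= CW by rewrite /CW -addrA lerDl addr_ge0// !mulr_ge0 ?exprn_ge0 ?(ltW M_gt0).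
have bW n z : nc z <= r1 -> nc (pC (W n)).[z] <= CW.
  move=> zr; have := FP_identity b a0 hU n => /eqP; rewrite eq_sym subr_eq => /eqP h.
  have h2 : nc (pC (W n)).[z] ^+ 2 <= CW - 1.
    rewrite (_ : CW - 1 = 4 * M ^+ 2 * C ^+ 2 + D); last by rewrite /CW; ring.
    rewrite -ncX -pvX h pvD pvZ pvM; apply: le_trans (ncD _ _) _.
    apply: lerD; last exact: hD.
    rewrite !ncM nc_real; apply: ler_pM; rewrite ?mulr_ge0 ?nc_ge0//.
      rewrite ger0_norm; last by rewrite mulr_ge0 ?sqr_ge0.
      rewrite ler_pM2l// lerXn2r ?nnegrE ?(ltW M_gt0) ?(ltW (a0 n))//.
      by apply: le_trans (ler_norm _) (hM n).1.
    by rewrite expr2; apply: ler_pM; rewrite ?nc_ge0// bF.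
  have := nc_ge0 (pC (W n)).[z]; nra.
have [K K0 hK] := deriv_bound g.+2 r.
have l1 (x : R) : `|x| <= g.+2%:R -> nc x%:C <= r1.
  by move=> h; rewrite nc_real /r1; have := normr_ge0 r; lra.
have dF n z : nc z <= r -> nc (pC (F n)^`()).[z] <= K * C.
  have [_ sF] := gap_polyP (Fpol_gap n).
  apply: (hK (F n) C _ _).2 => [|x /l1 /(bF n)]; first by rewrite sF.
  by rewrite pC_real nc_real.
have dW n z : nc z <= r -> nc (pC (W n)^`()).[z] <= K * CW.
  apply: (hK (W n) CW _ _).2 => [|x /l1 /(bW n)]; first exact: size_Wpol.
  by rewrite pC_real nc_real.
have [KC KW] : 0 <= K * C /\ 0 <= K * CW by split; rewrite mulr_ge0//; lra.
exists (C + CW + K * C + K * CW) => [|n z zr]; first by lra.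
have zr1 := le_trans zr rr1.
by split; [have := bF n z zr1|have := bW n z zr1|have := dF n z zr|have := dW n z zr]; lra.
Qed.

Lemma edge_poly_root j : (j < g.*2.+2)%N -> (edge_poly g E).[E j] = 0.
Proof.
move=> jN; apply/eqP; rewrite /edge_poly horner_prod prodf_seq_eq0; apply/hasP; exists j.
  by rewrite mem_index_iota.
by rewrite hornerXsubC subrr eqxx.
Qed.

Lemma band_edge_poly_le0 x : bands g E x -> (edge_poly g E).[x] <= 0.
Proof.
move=> [k kg /andP[x1 x2]].
have z := edge_poly_root.
have [<-|n1] := eqVneq (E k.*2) x; first by rewrite z//; lia.
have [->|n2] := eqVneq x (E k.*2.+1); first by rewrite z//; lia.
by apply/ltW/(edge_poly_band hE kg); rewrite /in_band !lt_neqAle n1 n2 x1 x2.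
Qed.

(** On the spectrum R <= 0, so A^2 <= A^2 - B^2 R = F_l F_m, which is bounded uniformly. *)
Lemma A_band_bound : exists2 C, 0 <= C & forall l m x, bands g E x -> `|(A (e l) (e m)).[x]| <= C.
Proof.
pose r := `|E 0%N| + `|E g.*2.+1|.
have [C C0 hC] := gap_poly_le hE r; exists C => // l m x xb.
have xr : `|x| <= r.
  case: (xb) => k kg /andP[x1 x2].
  have l1 : E 0%N <= x by apply: le_trans x1; apply: (edges_le hE); lia.
  have l2 : x <= E g.*2.+1 by apply: le_trans x2 _; apply: (edges_le hE); lia.
  rewrite ler_norml /r; have := ler_norm (E g.*2.+1); have := ler_norm (- E 0%N).
  by have := normr_ge0 (E 0%N); have := normr_ge0 (E g.*2.+1); rewrite normrN => *; apply/andP; split; lra.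
have bF n : `|(F n).[x]| <= C.
  by rewrite -nc_real -pC_real; apply: hC; [exact: Fpol_gap|rewrite nc_real].
have := congr1 (fun p => p.[x]) (Abil_Bbil a hU (e l) (e m)).
rewrite -/(F l) -/(F m) !hornerE => h.
have ee := band_edge_poly_le0 xb.
have : (A (e l) (e m)).[x] ^+ 2 <= C ^+ 2.
  apply: (@le_trans _ _ ((F l).[x] * (F m).[x])).
    by rewrite -h; have := sqr_ge0 (B (e l) (e m)).[x]; nra.
  apply: le_trans (ler_norm _) _; rewrite normrM expr2; apply: ler_pM => //.
by rewrite -real_normK ?num_real// ler_sqr ?nnegrE.
Qed.

(** At a fixed point inside the first band 4 a_n^2 F_n F_{n+1} >= -R > 0, while the F_n are bounded
    uniformly in n. *)
Lemma a_lower : exists2 c, 0 < c & forall n, c <= a n.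
Proof.
pose x := midband E 0; have xb := midbandP hE (leq0n g).
have ee := edge_poly_band hE (leq0n g) xb; rewrite -/x in ee.
have [C C0 hC] := uniform_bounds `|x|.
pose d := - (edge_poly g E).[x] / (4 * (C + 1) ^+ 2).
have d0 : 0 < d by rewrite divr_gt0 ?oppr_gt0 ?mulr_gt0 ?exprn_gt0//; lra.
exists (Num.sqrt d) => [|n]; first by rewrite sqrtr_gt0.
rewrite -ler_sqr ?nnegrE ?sqrtr_ge0 ?(ltW (a0 n))// sqr_sqrtr ?(ltW d0)// /d.
rewrite ler_pdivrMr; last by rewrite mulr_gt0 ?exprn_gt0//; lra.
have := congr1 (fun p => p.[x]) (FP_identity b a0 hU n); rewrite hornerZ hornerM hornerD hornerN horner_exp => h.
have bF m : `|(F m).[x]| <= C.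
  by rewrite -nc_real -pC_real; have [] := hC m x%:C _; rewrite ?nc_real.
have ff : (F n).[x] * (F (n + 1)).[x] <= (C + 1) ^+ 2.
  apply: le_trans (ler_norm _) _; rewrite normrM expr2; apply: ler_pM => //.
    by apply: le_trans (bF _) _; lra.
  by apply: le_trans (bF _) _; lra.
have := sqr_ge0 (W n).[x]; have a2 := exprn_gt0 2 (a0 n).
have := ler_wpM2l (ltW a2) ff; rewrite -mulrA in h *; lra.
Qed.

(** Up to a factor 2 these are the coefficients of [Gpol n l] e_k with respect to the e_m. By
    growth, (A(l,n) + B(l,n) R^(1/2)) A(k,m) / R is O(1/z^2), so the moment is the 1/z coefficient
    of A(l,n) A(k,m) / R, that is, the top coefficient of the remainder modulo R. Interpolation at
    the edges expresses it by values on the spectrum, where both factors are bounded. *)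
Lemma BA_moment_bound : exists2 C, 0 <= C & forall l n k m, n < l -> `|k - m| <= l - n ->
  `|moment (B (e l) (e n) * A (e k) (e m))| <= C.
Proof.
have [C C0 hC] := A_band_bound.
pose N := g.*2.+2; have N0 : (0 < N)%N by [].
(* The nodes are the edges, continued to an injective sequence on all naturals as [interpolation]
   requires. *)
pose x i := if (i < N)%N then E i else E N.-1 + i%:R.
have xN i : (i < N)%N -> x i = E i by rewrite /x => ->.
have big i j : (i < N)%N -> (N <= j)%N -> x i < x j.
  move=> iN Nj; rewrite xN// /x ltnNge Nj /=.
  have : E i <= E N.-1 by apply: (edges_le hE); rewrite -ltnS /=; clear -iN; lia.
  have : 1 <= j%:R :> R by rewrite ler1n; apply: leq_trans Nj.
  by lra.
have xi : injective x.
  move=> i j; have [iN|iN] := ltnP i N; have [jN|jN] := ltnP j N.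
  - rewrite !xN// => eij; have [ij|ij|//] := ltngtP i j.
      by have := edges_lt hE (i := i) (j := j); rewrite ij jN eij ltxx => /(_ isT).
    by have := edges_lt hE (i := j) (j := i); rewrite ij iN eij ltxx => /(_ isT).
  - by move=> eij; have := big i j iN jN; rewrite eij ltxx.
  - by move=> eij; have := big j i jN iN; rewrite eij ltxx.
  - have xE t : (N <= t)%N -> x t = E N.-1 + t%:R by rewrite /x ltnNge => ->.
    by rewrite !xE// => /addrI /eqP; rewrite eqr_nat => /eqP.
have [L hL] := interpolation N0 xi.
exists (\sum_(i < N) C ^+ 2 * `|(L i)`_N.-1|) => [|l n k m nl km].
  by rewrite sumr_ge0// => i _; rewrite mulr_ge0 ?sqr_ge0.
pose p := A (e l) (e n) * A (e k) (e m).
pose q := p %/ edge_poly g E; pose r := p %% edge_poly g E.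
have sE : size (edge_poly g E) = N.+1 by rewrite /edge_poly size_prod_XsubC size_iota subn0.
have E0 : edge_poly g E != 0 by rewrite -size_poly_gt0 sE.
have Em : edge_poly g E \is monic by exact: monic_prod_XsubC.
have sr : (size r <= N)%N by rewrite -ltnS -sE ltn_modp.
have pqr : p = q * edge_poly g E + r by exact: divp_eq.
pose tau := r`_N.-1.
have root_e (i : 'I_N) : (edge_poly g E).[x i] = 0.
  by rewrite xN// edge_poly_root.
have xb (i : 'I_N) : bands g E (x i).
  rewrite xN//; exists (i./2); first by have := ltn_ord i; rewrite /N; clear; lia.
  have iN : (i < g.*2.+2)%N := ltn_ord i.
  have io := odd_double_half i; case: (odd i) io => /= io.
    have -> : E i = E i./2.*2.+1 by congr E; clear -io; lia.
    by rewrite lexx andbT ltW//; apply: hE; clear -io iN; lia.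
  have ei : i./2.*2 = i by clear -io; lia.
  by rewrite ei lexx ltW//; apply: hE; clear -ei iN; lia.
have tb : `|tau| <= \sum_(i < N) C ^+ 2 * `|(L i)`_N.-1|.
  rewrite /tau {1}(hL r sr) coef_sum; apply: le_trans (ler_norm_sum _ _ _) _.
  apply: ler_sum => i _; rewrite coefZ normrM ler_wpM2r//.
  have -> : r.[x i] = p.[x i] by rewrite pqr !hornerE root_e mulr0 add0r.
  by rewrite /p hornerM normrM expr2; apply: ler_pM => //; apply: hC.
suff -> : moment (B (e l) (e n) * A (e k) (e m)) = tau by [].
rewrite -[RHS]opprK; apply: (@moment_eqO _ _ _ hE _ (- q)).
have h1 := bigOM (bigOM (AB_growth l n) (A_growth k m)) (bigO_inv_poly sE).
have {}h1 := bigO_le (_ : _ <= - 2) h1.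
have {}h1 := h1 _.
have h2 : bigO (fun z => (pC ('X * r - tau *: edge_poly g E)).[z] * z^-1 * (pC (edge_poly g E)).[z]^-1) (- 2).
  have s2 : (size ('X * r - tau *: edge_poly g E)%R <= N.-1.+1)%N.
    apply/leq_sizeP => j; rewrite coefB coefXM coefZ leq_eqVlt => /predU1P[<-|Nj].
      have := monicP Em; rewrite /lead_coef sE /= => ->; rewrite /tau mulr1.
      by rewrite subrr.
    rewrite !nth_default ?sE ?mulr0 ?subr0//; last by apply: leq_trans sr _; clear -Nj; lia.
    by case: ifP.
  have := bigOM (bigOM (bigO_poly s2) (bigO_inv R)) (bigO_inv_poly sE).
  by have -> : N.-1%:Z + - 1 + - N%:Z = - 2 by clear; lia.
apply: bigO_ext (bigOB (h1 _) h2) => [z z0|]; last by rewrite /N; lia.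
have zn : z != 0 by apply: contraTneq z0 => ->; rewrite ltxx.
have r0 : rt z != 0 by rewrite rt_neq0// gt_eqF.
have ez : (pC (edge_poly g E)).[z] != 0 by rewrite -rt_sqr sqrf_eq0.
have pz : (pC (A (e l) (e n))).[z] * (pC (A (e k) (e m))).[z] = (pC q).[z] * rt z ^+ 2 + (pC r).[z].
  by rewrite -pvM -/p pqr pvD pvM rt_sqr.
rewrite !(pvB, pvN, pvM, pvZ) pvXX -!rt_sqr mulrDl pz rmorphN.
by field; rewrite zn r0.
Qed.

End FiniteGapBackground.

(** * The truncated perturbation *)

Section AtomicNorm.
Variables (R : realType) (g : nat) (E : nat -> R) (a b : int -> R) (P Q U : {poly R}) (M : R).
Hypothesis H : finite_gap g E a b P Q U M.
Local Notation V := ({poly R} * {poly R})%type.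
Local Notation moment := (moment g E).
Local Notation e := (ebas a b).
Local Notation A := (Abil a P Q U).
Local Notation B := (Bbil a).
Implicit Types (u v w : V) (n m l k : int) (c d : R) (p q : {poly R}).

Let hE := fgapE H.
Let a0 := fgapa H.
Let hM := fgapM H.
Let hU := fgapU H.

Definition pmul p v : V := (p * v.1, p * v.2).
Lemma pmulDl p q v : pmul (p + q) v = pmul p v + pmul q v.
Proof. by rewrite /pmul !mulrDl. Qed.
Lemma pmulDr p u v : pmul p (u + v) = pmul p u + pmul p v.
Proof. by rewrite /pmul !mulrDr. Qed.
Lemma pmulZl c p v : pmul (c *: p) v = c *: pmul p v.
Proof. by rewrite /pmul -!scalerAl. Qed.
Lemma pmulZr c p v : pmul p (c *: v) = c *: pmul p v.
Proof. by rewrite /pmul -!scalerAr. Qed.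
Lemma pmul0r p : pmul p 0 = 0.
Proof. by rewrite /pmul !mulr0. Qed.
Lemma pmulX p v : pmul ('X * p) v = mulX (pmul p v).
Proof. by rewrite /pmul /mulX /= !mulrA. Qed.
Lemma pmulC c v : pmul c%:P v = c *: v.
Proof. by rewrite /pmul !mul_polyC. Qed.

(** This is an l^1 bound on coefficients over the sites from n on. The witness is a finite list in
    which sites may repeat, which makes sums and linear images immediate. *)
Definition nrm_le n v d := exists r : seq (R * int),
  [/\ v = \sum_(x <- r) x.1 *: e x.2, all (fun x => n <= x.2) r & \sum_(x <- r) `|x.1| <= d].

Lemma nrm_ge0 n v d : nrm_le n v d -> 0 <= d.
Proof. by move=> [r [_ _ h]]; apply: le_trans h; apply: sumr_ge0. Qed.
Lemma nrm_weak n m v c d : m <= n -> c <= d -> nrm_le n v c -> nrm_le m v d.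
Proof.
move=> mn cd [r [h1 h2 h3]]; exists r; split => //; last exact: le_trans cd.
by apply: sub_all h2 => x; apply: le_trans.
Qed.
Lemma nrm_e n k : n <= k -> nrm_le n (e k) 1.
Proof. by move=> nk; exists [:: (1, k)]; rewrite !big_seq1 /= scale1r normr1 nk. Qed.
Lemma nrm0 n d : 0 <= d -> nrm_le n 0 d.
Proof. by move=> d0; exists [::]; rewrite !big_nil. Qed.
Lemma nrmD n u v c d : nrm_le n u c -> nrm_le n v d -> nrm_le n (u + v) (c + d).
Proof.
move=> [r [h1 h2 h3]] [s [k1 k2 k3]]; exists (r ++ s).
by rewrite !big_cat /= all_cat h2 k2 -h1 -k1; split => //; exact: lerD.
Qed.
Lemma nrmZ n v c d : nrm_le n v d -> nrm_le n (c *: v) (`|c| * d).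
Proof.
move=> [r [h1 h2 h3]]; exists [seq (c * x.1, x.2) | x <- r]; split.
- by rewrite big_map h1 scaler_sumr; apply: eq_bigr => x _; rewrite scalerA.
- by rewrite all_map; exact: h2.
- by rewrite big_map -(eq_bigr _ (fun x _ => esym (normrM c x.1))) -mulr_sumr ler_wpM2l.
Qed.
Lemma nrmZle n v c c' d : nrm_le n v d -> `|c| <= c' -> nrm_le n (c *: v) (c' * d).
Proof.
move=> h hc; apply: nrm_weak (lexx n) _ (nrmZ c h).
by rewrite ler_wpM2r// (nrm_ge0 h).
Qed.
Lemma nrmN n v d : nrm_le n v d -> nrm_le n (- v) d.
Proof. by move/(nrmZ (-1)); rewrite scaleN1r normrN1 mul1r. Qed.
Lemma nrmB n u v c d : nrm_le n u c -> nrm_le n v d -> nrm_le n (u - v) (c + d).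
Proof. by move=> h k; apply: nrmD h (nrmN k). Qed.
Lemma nrm_sum n (I : eqType) (r : seq I) (F : I -> V) (d : I -> R) :
  (forall i, i \in r -> nrm_le n (F i) (d i)) -> nrm_le n (\sum_(i <- r) F i) (\sum_(i <- r) d i).
Proof.
elim: r => [|i r IH] h; first by rewrite !big_nil; exact: nrm0.
rewrite !big_cons; apply: nrmD; first by apply: h; rewrite mem_head.
by apply: IH => j jr; apply: h; rewrite in_cons jr orbT.
Qed.
Lemma nrm_lin (T : V -> V) n m v c d : (forall u w c, T (c *: u + w) = c *: T u + T w) -> T 0 = 0 ->
  0 <= c -> (forall k, n <= k -> nrm_le m (T (e k)) c) -> nrm_le n v d -> nrm_le m (T v) (c * d).
Proof.
move=> TL T0 c0 h [r [-> h2 h3]].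
have -> : T (\sum_(x <- r) x.1 *: e x.2) = \sum_(x <- r) x.1 *: T (e x.2).
  by elim: (r) => [|x s IH]; rewrite ?big_nil// !big_cons TL IH.
apply: (@nrm_weak m m _ (\sum_(x <- r) `|x.1| * c)) => //.
  by rewrite -mulr_suml mulrC ler_wpM2l.
apply: nrm_sum => x xr; apply: nrmZ; apply: h; exact: (allP h2).
Qed.

Lemma nrm_X n v d : nrm_le n v d -> nrm_le (n - 1) (mulX v) (3 * M * d).
Proof.
have M0 := M_gt0 H; move=> hv; have L := @nrm_lin (@mulX R) n (n - 1) v (3 * M) d; apply: L hv.
- by move=> u w c; rewrite /mulX /= !mulrDr -!scalerAr.
- by rewrite /mulX /= !mulr0.
- by rewrite mulr_ge0// ltW.
move=> k nk; rewrite -(ebasP b a0).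
have -> : 3 * M = M * 1 + M * 1 + M * 1 by ring.
by apply: nrmD; first apply: nrmD; apply: nrmZle; rewrite ?(hM _).1 ?(hM _).2//; apply: nrm_e; lia.
Qed.

Lemma nrm_moment n v d m : nrm_le n v d -> m < n -> moment (A v (e m)) = 0.
Proof.
move=> [r [-> h2 _]] mn; elim: r h2 => [|x r IH] /=.
  by rewrite big_nil Abil0 (moment0 hE).
case/andP => nx /IH {}IH; rewrite big_cons Abil_lin (momentD hE) (momentZ hE) IH (moment_A H) addr0.
by rewrite (_ : (x.2 == m) = false) ?mulr0//; lia.
Qed.

Lemma nrm_moment_sum n v d (s : seq int) : uniq s -> nrm_le n v d ->
  \sum_(m <- s) `|moment (A v (e m))| <= d.
Proof.
move=> us [r [-> _ h3]]; apply: le_trans h3; elim: r => [|x r IH].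
  by rewrite !big_nil big1// => m _; rewrite Abil0 (moment0 hE) normr0.
rewrite !big_cons.
apply: (@le_trans _ _ (\sum_(m <- s) (`|x.1| * (x.2 == m)%:R + `|moment (A (\sum_(x <- r) x.1 *: e x.2) (e m))|))).
  apply: ler_sum => m _; rewrite Abil_lin (momentD hE) (momentZ hE) (moment_A H).
  by apply: le_trans (ler_normD _ _) _; rewrite normrM (ger0_norm (ler0n _ _)).
rewrite big_split lerD //= -mulr_sumr ler_piMr//.
have count_le (t : seq int) : uniq t -> \sum_(m <- t) (x.2 == m)%:R <= 1 :> R.
  elim: t => [|m t IHt] /=; first by rewrite big_nil.
  case/andP => mt /IHt ht; rewrite big_cons; have [xm|nm] := eqVneq x.2 m; last by rewrite add0r.
  rewrite big1_seq ?addr0// => m' /andP[_ m't]; rewrite xm (_ : (m == m') = false)//.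
  by apply: contraTF m't => /eqP <-.
exact: count_le.
Qed.

Definition supp lo N v := exists c : nat -> R, v = \sum_(i < N) c i *: e (lo + (i : nat)%:Z).

Lemma supp0 lo N : supp lo N 0.
Proof. by exists (fun=> 0); rewrite big1// => i _; rewrite scale0r. Qed.
Lemma suppD lo N u v : supp lo N u -> supp lo N v -> supp lo N (u + v).
Proof.
move=> [c ->] [d ->]; exists (fun i => c i + d i); rewrite -big_split.
by apply: eq_bigr => i _; rewrite scalerDl.
Qed.
Lemma suppZ lo N c v : supp lo N v -> supp lo N (c *: v).
Proof.
move=> [d ->]; exists (fun i => c * d i); rewrite scaler_sumr.
by apply: eq_bigr => i _; rewrite scalerA.
Qed.
Lemma supp_e lo (N : nat) k : lo <= k < lo + N%:Z -> supp lo N (e k).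
Proof.
move=> /andP[h1 h2]; pose j := absz (k - lo)%R.
have jk : k = lo + j%:Z by rewrite /j; lia.
have jN : (j < N)%N by lia.
exists (fun i => (i == j)%:R); rewrite (bigD1 (Ordinal jN))//= eqxx scale1r -jk big1 ?addr0// => i ij.
by rewrite (_ : (i == j :> nat) = false) ?scale0r//; apply: negbTE.
Qed.
Lemma supp_sum lo N (n : nat) (F : 'I_n -> V) : (forall i, supp lo N (F i)) -> supp lo N (\sum_(i < n) F i).
Proof. by move=> h; elim/big_rec: _ => [|i x _ hx]; [exact: supp0|exact: suppD]. Qed.
Lemma supp_widen lo lo' (N N' : nat) v : lo' <= lo -> lo + N%:Z <= lo' + N'%:Z -> supp lo N v -> supp lo' N' v.
Proof.
move=> h1 h2 [c ->]; apply: supp_sum => i; apply: suppZ; apply: supp_e.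
by have := ltn_ord i; clear -h1 h2; lia.
Qed.
Lemma supp_X lo N v : supp lo N v -> supp (lo - 1) N.+2 (mulX v).
Proof.
move=> [c ->].
have -> : mulX (\sum_(i < N) c i *: e (lo + (i : nat)%:Z)) = \sum_(i < N) c i *: mulX (e (lo + (i : nat)%:Z)).
  elim/big_rec2 : _ => [|i x y _ <-]; first by rewrite /mulX /= !mulr0.
  by rewrite /mulX /= !mulrDr -!scalerAr.
apply: supp_sum => i; apply: suppZ; rewrite -(ebasP b a0).
by have ltn := ltn_ord i; apply: suppD; first apply: suppD; apply: suppZ; apply: supp_e; clear -ltn; lia.
Qed.
(** Orthonormality of the e_m recovers the coefficients as moments. *)
Lemma supp_coef lo N v : supp lo N v ->
  v = \sum_(i < N) moment (A v (e (lo + (i : nat)%:Z))) *: e (lo + (i : nat)%:Z).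
Proof.
move=> [c hv]; rewrite {1}hv; apply: eq_bigr => i _; congr (_ *: _).
have lin (t : seq 'I_N) w : moment (A (\sum_(j <- t) c j *: e (lo + (j : nat)%:Z)) w) =
    \sum_(j <- t) c j * moment (A (e (lo + (j : nat)%:Z)) w).
  elim: t => [|j t IH]; first by rewrite !big_nil Abil0 (moment0 hE).
  by rewrite !big_cons Abil_lin (momentD hE) (momentZ hE) IH.
rewrite hv lin (bigD1 i)//= (moment_A H) eqxx mulr1 big1 ?addr0// => j ji.
rewrite (moment_A H) (_ : (_ == _) = false) ?mulr0//; apply: contraNF ji => /eqP ji.
by apply/eqP/val_inj => /=; clear -ji; lia.
Qed.

(** This background solution in n vanishes at n = l and is polynomial in z; it is the kernel of the
    Volterra equation. The factor 2 cancels the 1/2 of [Bbil_next]. *)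
Definition Gpol n l : {poly R} := 2 *: B (e l) (e n).

Lemma Gpol_three n l : a n *: Gpol (n + 1) l + a (n - 1) *: Gpol (n - 1) l + b n *: Gpol n l = 'X * Gpol n l.
Proof.
have h : 'X * B (e l) (e n) = B (e l) (mulX (e n)) by rewrite Bbil.unlock /= -scalerAr; congr (_ *: _); ring.
by rewrite /Gpol -scalerAr h -(ebasP b a0 n) Bbil.unlock /= -!mul_polyC; ring.
Qed.
Lemma Gpol_sym n l : Gpol n l = - Gpol l n.
Proof. by rewrite /Gpol BbilN scalerN. Qed.
Lemma Gpol_diag n : Gpol n n = 0.
Proof. by rewrite /Gpol Bbilxx scaler0. Qed.
Lemma Gpol_next n : Gpol n (n + 1) = ((a n)^-1)%:P.
Proof.
have an := lt0r_neq0 (a0 n).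
have := Bbil_next b a0 n => /(congr1 (fun p => (2 / a n) *: p)).
rewrite scalerA divfK// /Gpol => ->.
by rewrite -mul_polyC -rmorphM; congr (_%:P); field.
Qed.

Lemma pmul_Gpol_step n l v : pmul (Gpol (n - 1) l) v =
  (a (n - 1))^-1 *: (mulX (pmul (Gpol n l) v) - a n *: pmul (Gpol (n + 1) l) v - b n *: pmul (Gpol n l) v).
Proof.
have an := lt0r_neq0 (a0 (n - 1)).
rewrite -pmulX -Gpol_three !pmulDl !pmulZl.
set x := a n *: _; set y := b n *: _; set w := a (n - 1) *: _.
have -> : x + w + y - x - y = w by rewrite (addrC x) (addrAC _ y) addrK addrK.
by rewrite /w [RHS]scalerA mulVf// scale1r.
Qed.

(** The recursion in n has three terms, so two consecutive cases are carried along; each step widens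
    the range of sites by one on both sides. *)
Lemma Gpol_supp l k (d : nat) :
  supp (k - d%:Z) d.*2.+1 (pmul (Gpol (l - d.+1%:Z) l) (e k)) /\
  supp (k - d.+1%:Z) d.*2.+3 (pmul (Gpol (l - d.+2%:Z) l) (e k)).
Proof.
elim: d => [|d [IH1 IH2]].
  have h0 : supp k 1 (pmul (Gpol (l - 1) l) (e k)).
    rewrite -{2}(subrK 1 l) Gpol_next pmulC; apply: suppZ; apply: supp_e; lia.
  rewrite subr0; split=> //.
  have -> : l - 2 = l - 1 - 1 by lia.
  rewrite pmul_Gpol_step subrK Gpol_diag /pmul !mul0r /=.
  apply: suppZ; apply: suppD; first apply: suppD.
  - exact: supp_X h0.
  - by rewrite -scaleN1r; apply: suppZ; apply: suppZ; exact: supp0.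
  - by rewrite -scaleN1r; apply: suppZ; apply: suppZ; apply: supp_widen h0; lia.
split; first by rewrite doubleS.
have -> : l - d.+3%:Z = l - d.+2%:Z - 1 by lia.
have e1 : l - d.+2%:Z + 1 = l - d.+1%:Z by lia.
rewrite pmul_Gpol_step e1 doubleS.
apply: suppZ; apply: suppD; first apply: suppD.
- by have := supp_X IH2; have -> : k - d.+1%:Z - 1 = k - d.+2%:Z by lia.
- by rewrite -scaleN1r; apply: suppZ; apply: suppZ; apply: supp_widen IH1; lia.
- by rewrite -scaleN1r; apply: suppZ; apply: suppZ; apply: supp_widen IH2; lia.
Qed.

(** At most 2 i + 1 coefficients occur, and [BA_moment_bound] bounds each of them independently of
    i; hence the growth is linear. *)
Lemma nrm_Gpol : exists2 K, 0 <= K & forall n (i : nat) k,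
  nrm_le (k - i%:Z) (pmul (Gpol n (n + 1 + i%:Z)) (e k)) (K * i.+1%:R).
Proof.
have [C C0 hC] := BA_moment_bound H; exists (4 * C) => [|n i k]; first by rewrite mulr_ge0.
have [h _] := Gpol_supp (n + 1 + i%:Z) k i.
have en : n + 1 + i%:Z - i.+1%:Z = n by lia.
rewrite en in h; rewrite (supp_coef h).
apply: (@nrm_weak (k - i%:Z) (k - i%:Z) _ (\sum_(j < i.*2.+1) 2 * C)) => //.
  rewrite sumr_const card_ord -[_ *+ _]mulr_natr.
  have -> : 4 * C * i.+1%:R = 2 * C * (i.+1.*2)%:R by rewrite -muln2 natrM; ring.
  by rewrite ler_wpM2l ?mulr_ge0// ler_nat; lia.
apply: nrm_sum => j _; rewrite -[2 * C]mulr1; apply: nrmZle.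
  by apply: nrm_e; clear; lia.
rewrite /pmul AbilM /Gpol -scalerAl (momentZ hE) normrM (ger0_norm (ler0n _ _)) ler_pM2l//.
by apply: hC; have := ltn_ord j; clear; lia.
Qed.

End AtomicNorm.

(** * The Volterra equation for finitely perturbed solutions *)

Section Volterra.
Variables (R : realType) (g : nat) (E : nat -> R) (a b : int -> R) (P Q U : {poly R}) (M : R).
Hypothesis H : finite_gap g E a b P Q U M.
Local Notation V := ({poly R} * {poly R})%type.
Local Notation e := (ebas a b).
Local Notation G := (Gpol a b).
Local Notation nrm_le := (nrm_le a b).
Implicit Types (u v w : V) (n m l : int) (c d X : R) (alpha beta : int -> R) (x y : int -> V).

Let a0 := fgapa H.

(** For i = 0 the term with alpha n x(n) is left out: there the kernel is the constant 1 / a n, and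
    the term is absorbed into the factor (a n + alpha n) / a n on the left of [volterra]. *)
Definition vterm alpha beta x n (i : nat) : V :=
  pmul (G n (n + 1 + i%:Z)) (alpha (n + 1 + i%:Z) *: x (n + 1 + i%:Z + 1)
    + (if i is 0%N then 0 else alpha (n + i%:Z)) *: x (n + i%:Z)
    + beta (n + 1 + i%:Z) *: x (n + 1 + i%:Z)).

Definition perturbed alpha beta x := forall n, (a n + alpha n) *: x (n + 1)
  + (a (n - 1) + alpha (n - 1)) *: x (n - 1) + (b n + beta n) *: x n = mulX (x n).

(** This is the discrete Wronskian of the Volterra kernel with [x]; for a perturbed solution its
    increments in l contain only the perturbation. *)
Definition boundary x n l : V := a l *: (pmul (G n l) (x (l + 1)) - pmul (G n (l + 1)) (x l)).

Lemma boundary_diag x n : boundary x n n = - x n.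
Proof.
rewrite /boundary Gpol_diag (Gpol_next H) /pmul !mul0r.
rewrite !mul_polyC -[(_ *: (x n).1, _)]/((a n)^-1 *: x n) -[(0, 0)]/(0 : V) sub0r scalerN.
by rewrite scalerA divff ?scale1r// lt0r_neq0.
Qed.

Lemma boundary_step alpha beta x n l : perturbed alpha beta x ->
  boundary x n (l + 1) = boundary x n l -
    pmul (G n (l + 1)) (alpha (l + 1) *: x (l + 1 + 1) + alpha l *: x l + beta (l + 1) *: x (l + 1)).
Proof.
move=> /(_ (l + 1)); rewrite addrK => e.
have e3 : a (l + 1) *: G n (l + 1 + 1) + a l *: G n l + b (l + 1) *: G n (l + 1) = 'X * G n (l + 1).
  have := Gpol_three H (l + 1) n; rewrite addrK => h.
  by rewrite !(Gpol_sym a b n) !scalerN mulrN -h !opprD.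
have e1 := congr1 (@fst _ _) e; have e2 := congr1 (@snd _ _) e; rewrite /= in e1 e2.
rewrite /boundary /pmul; case: (x (l + 1 + 1)) e1 e2 => p1 p2 /=; case: (x (l + 1)) => q1 q2 /=.
case: (x l) => r1 r2 /= e1 e2; rewrite -!mul_polyC !rmorphD /= in e1 e2 e3 *.
move: (G n (l + 1 + 1)) (G n l) (G n (l + 1)) e3 => g2 g0 g1 e3.
set A1 := (a (l + 1))%:P in e1 e2 e3 *; set A0 := (a l)%:P in e1 e2 e3 *.
set al1 := (alpha (l + 1))%:P in e1 e2 *; set al0 := (alpha l)%:P in e1 e2 *.
set b1 := (b (l + 1))%:P in e1 e2 e3 *; set be1 := (beta (l + 1))%:P in e1 e2 *.
apply/pair_equal_spec; split => /=.
  have : g1 * ('X * q1) - q1 * ('X * g1) = 0 by ring.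
  by rewrite -e1 -e3 -!mul_polyC -/A1 -/A0 => h; apply/eqP; rewrite -subr_eq0 -h; apply/eqP; ring.
have : g1 * ('X * q2) - q2 * ('X * g1) = 0 by ring.
by rewrite -e2 -e3 -!mul_polyC -/A1 -/A0 => h; apply/eqP; rewrite -subr_eq0 -h; apply/eqP; ring.
Qed.

Lemma boundary_sum alpha beta x n (d : nat) : perturbed alpha beta x ->
  boundary x n (n + d%:Z) = - x n - \sum_(i < d) pmul (G n (n + 1 + i%:Z))
   (alpha (n + 1 + i%:Z) *: x (n + 1 + i%:Z + 1) + alpha (n + i%:Z) *: x (n + i%:Z)
    + beta (n + 1 + i%:Z) *: x (n + 1 + i%:Z)).
Proof.
move=> hx; elim: d => [|d IH]; first by rewrite addr0 big_ord0 subr0 boundary_diag.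
have -> : n + d.+1%:Z = n + d%:Z + 1 by lia.
rewrite (boundary_step _ _ hx) IH big_ord_recr /= opprD addrA.
by have -> : n + d%:Z + 1 = n + 1 + d%:Z by lia.
Qed.

Lemma ebas_perturbed : perturbed (fun=> 0) (fun=> 0) e.
Proof. by move=> n; rewrite !addr0 (ebasP b a0). Qed.

(** At the far end [x] and e agree and have the same Wronskian with the kernel; at l = n this
    Wronskian is minus the solution itself. Summing the increments in between gives the equation. *)
Lemma volterra alpha beta x n (d : nat) : perturbed alpha beta x ->
  x (n + d.+1%:Z) = e (n + d.+1%:Z) -> x (n + d.+1%:Z + 1) = e (n + d.+1%:Z + 1) ->
  ((a n + alpha n) / a n) *: x n = e n - \sum_(i < d.+1) vterm alpha beta x n i.
Proof.
move=> hx h1 h2; have b1 := boundary_sum n d.+1 hx; have b2 := boundary_sum n d.+1 ebas_perturbed.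
have eb : boundary x n (n + d.+1%:Z) = boundary e n (n + d.+1%:Z) by rewrite /boundary h1 h2.
rewrite eb b2 [X in _ - X]big1 ?subr0 in b1; last first.
  by move=> i _; rewrite !scale0r !addr0 pmul0r.
have {b1} b1 : x n = e n - \sum_(i < d.+1) pmul (G n (n + 1 + i%:Z))
   (alpha (n + 1 + i%:Z) *: x (n + 1 + i%:Z + 1) + alpha (n + i%:Z) *: x (n + i%:Z)
    + beta (n + 1 + i%:Z) *: x (n + 1 + i%:Z)).
  by apply: oppr_inj; rewrite opprB [RHS]addrC b1 subrK.
have -> : ((a n + alpha n) / a n) *: x n = x n + (alpha n / a n) *: x n.
  by rewrite mulrDl scalerDl divff ?scale1r// lt0r_neq0.
have key : pmul (G n (n + 1 + 0)) (alpha (n + 1 + 0) *: x (n + 1 + 0 + 1) + alpha (n + 0) *: x (n + 0)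
    + beta (n + 1 + 0) *: x (n + 1 + 0)) = vterm alpha beta x n 0 + (alpha n / a n) *: x n.
  rewrite /vterm !addr0 (Gpol_next H) !pmulC scale0r addr0 -addrA (addrC (alpha n *: _)) addrA.
  by rewrite scalerDr scalerA (mulrC (alpha n)).
rewrite {1}b1 -addrA; congr (_ + _).
rewrite [in RHS]big_ord_recl [in LHS]big_ord_recl key.
by rewrite (addrAC (vterm _ _ _ _ _)) opprD subrK.
Qed.
End Volterra.

(** * Bounds uniform in the truncation *)

Section TruncatedPerturbation.
Variables (R : realType) (g : nat) (E : nat -> R) (a b : int -> R) (P Q U : {poly R}) (M : R).
Hypothesis H : finite_gap g E a b P Q U M.
Local Notation V := ({poly R} * {poly R})%type.
Local Notation e := (ebas a b).
Local Notation G := (Gpol a b).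
Local Notation nrm_le := (nrm_le a b).
Local Notation vterm := (vterm a b).
Implicit Types (u v w : V) (n m l : int) (c d X : R) (alpha beta : int -> R) (x y : int -> V).

Let a0 := fgapa H.
Let hM := fgapM H.

Lemma vterm_diff alpha beta alpha' beta' x x' n i :
  vterm alpha' beta' x' n i - vterm alpha beta x n i =
  vterm (fun l => alpha' l - alpha l) (fun l => beta' l - beta l) x' n i
  + vterm alpha beta (fun l => x' l - x l) n i.
Proof.
rewrite /vterm; case: i => [|i].
  rewrite !scale0r !addr0 /pmul /=; congr pair; rewrite -!mul_polyC !rmorphB /=; ring.
by rewrite /pmul /=; congr pair; rewrite -!mul_polyC !rmorphB /=; ring.
Qed.

Section SumBound.
Variable K : R.
Hypothesis K0 : 0 <= K.
Hypothesis hK : forall n (i : nat) k,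
  nrm_le (k - i%:Z) (pmul (G n (n + 1 + i%:Z)) (e k)) (K * i.+1%:R).

Lemma nrm_pmul n (i : nat) v d : nrm_le (n + i%:Z) v d ->
  nrm_le n (pmul (G n (n + 1 + i%:Z)) v) (K * i.+1%:R * d).
Proof.
apply: nrm_lin => [u w c|||k nk].
- by rewrite pmulDr pmulZr.
- exact: pmul0r.
- by rewrite mulr_ge0.
by apply: nrm_weak (hK n i k) => //; clear -nk; lia.
Qed.

Lemma vterm_sum_bound alpha beta x n (d : nat) (tau X : R) (del : int -> R) : 0 <= X ->
  (forall l, `|alpha l| + `|beta l| <= del l) ->
  (forall j : nat, nrm_le (n + 1 + j%:Z) (x (n + 1 + j%:Z)) X) ->
  (forall d : nat, \sum_(i < d) i.+1%:R * del (n + 1 + i%:Z) <= tau) ->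
  nrm_le n (\sum_(i < d) vterm alpha beta x n i) (3 * K * tau * X).
Proof.
move=> X0 hd hx ht.
have d0 l : 0 <= del l by apply: le_trans (hd l); rewrite addr_ge0.
have xl l k : n + 1 <= l -> k <= l -> nrm_le k (x l) X.
  move=> nl kl; have := hx (absz (l - (n + 1))%R); have -> : n + 1 + `|(l - (n + 1))%R|%N%:Z = l by lia.
  exact: nrm_weak.
have term (i : nat) : nrm_le n (vterm alpha beta x n i) (K * X * (i.+1%:R * del (n + 1 + i%:Z) +
    (if i is 0%N then 0 else i.+1%:R * del (n + i%:Z)))).
  have -> : K * X * (i.+1%:R * del (n + 1 + i%:Z) + (if i is 0%N then 0 else i.+1%:R * del (n + i%:Z)))
    = K * i.+1%:R * ((del (n + 1 + i%:Z) + (if i is 0%N then 0 else del (n + i%:Z))) * X).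
    by case: i => [|i]; ring.
  apply: nrm_pmul.
  have t1 : nrm_le (n + i%:Z) (alpha (n + 1 + i%:Z) *: x (n + 1 + i%:Z + 1)) (`|alpha (n + 1 + i%:Z)| * X).
    by apply: nrmZ; apply: xl; lia.
  have t3 : nrm_le (n + i%:Z) (beta (n + 1 + i%:Z) *: x (n + 1 + i%:Z)) (`|beta (n + 1 + i%:Z)| * X).
    by apply: nrmZ; apply: xl; lia.
  have t2 : nrm_le (n + i%:Z) ((if i is 0%N then 0 else alpha (n + i%:Z)) *: x (n + i%:Z))
      ((if i is 0%N then 0 else del (n + i%:Z)) * X).
    case: i {t1 t3} => [|i]; first by rewrite scale0r mul0r; exact: nrm0.
    apply: nrmZle; first by apply: xl; lia.
    by apply: le_trans (hd _); rewrite lerDl.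
  apply: nrm_weak (lexx _) _ (nrmD (nrmD t1 t2) t3).
  have := hd (n + 1 + i%:Z) => hh; rewrite -!mulrDl; apply: ler_wpM2r => //; rewrite addrAC lerD2r//.
have hs := nrm_sum (r := index_enum 'I_d) (fun (i : 'I_d) _ => term i).
apply: nrm_weak (lexx n) _ hs.
(* The terms at site n + 1 + i cost one tau. Those at site n + i with i >= 1 carry the weight i + 1
   <= 2 i, which costs two more. *)
rewrite -mulr_sumr; have -> : 3 * K * tau * X = K * X * (tau + 2 * tau) by ring.
apply: ler_wpM2l; first by rewrite mulr_ge0.
rewrite big_split /=; apply: lerD; first exact: ht.
case: d => [|d]; first by rewrite big_ord0; have := ht 0%N; rewrite big_ord0; lra.
rewrite big_ord_recl add0r; apply: le_trans (_ : 2 * \sum_(i < d) i.+1%:R * del (n + 1 + i%:Z) <= _); last first.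
  by rewrite ler_pM2l// ht.
rewrite mulr_sumr; apply: ler_sum => i _; rewrite mulrA.
have -> : n + lift ord0 i = n + 1 + i%:Z :> int by rewrite lift0; lia.
apply: ler_wpM2r => //; rewrite lift0 -natrM ler_nat; lia.
Qed.
End SumBound.

Variables (a' b' : int -> R).
Hypothesis a'0 : forall n, 0 < a' n.
Local Notation dlt := (fun n => `|a' n - a n| + `|b' n - b n|).
Variable tau : nat -> R.
Hypothesis htau : forall (n d : nat), \sum_(i < d) (n + i).+1%:R * dlt (n%:Z + i%:Z) <= tau n.
Hypothesis tau_dec : forall n m : nat, (n <= m)%N -> tau m <= tau n.
Hypothesis tau_lim : forall eps : R, 0 < eps -> exists n : nat, tau n <= eps.

Implicit Types N : nat.
Definition trunc N (f' f : int -> R) l := if l < N%:Z then f' l else f l.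
(** [tt_sol] starts its recursion at 0, so all indices are shifted in order to start at N from
    background values. *)
Definition Phi N n : V := tt_sol (@mulX R) (fun k => trunc N a' a (k + N%:Z)) (fun k => trunc N b' b (k + N%:Z))
  (e N%:Z, e (N%:Z + 1)) (n - N%:Z).

Lemma trunc_gt0 N n : 0 < trunc N a' a n.
Proof. by rewrite /trunc; case: ifP. Qed.

Lemma Phi_rec N n : trunc N a' a n *: Phi N (n + 1) + trunc N a' a (n - 1) *: Phi N (n - 1)
  + trunc N b' b n *: Phi N n = mulX (Phi N n).
Proof.
have := @tt_solP R _ (@mulX R) (fun k => trunc N a' a (k + N%:Z)) (fun k => trunc N b' b (k + N%:Z)) _
  (e N%:Z, e (N%:Z + 1)) (n - N%:Z).
have e1 : n - N%:Z - 1 = n - 1 - N%:Z by lia.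
have e2 : n - N%:Z + 1 = n + 1 - N%:Z by lia.
rewrite e1 e2 !subrK; apply => k; apply: lt0r_neq0; exact: trunc_gt0.
Qed.

Lemma Phi_e N n : N%:Z <= n -> Phi N n = e n.
Proof.
move=> Nn; have -> : n = N%:Z + (absz (n - N%:Z)%R)%:Z by lia.
move: (absz _) => k {n Nn}.
suff [] : Phi N (N%:Z + k%:Z) = e (N%:Z + k%:Z) /\ Phi N (N%:Z + k%:Z + 1) = e (N%:Z + k%:Z + 1) by [].
elim: k => [|k [h1 h2]].
  by rewrite addr0 /Phi subrr tt_sol0 (addrC N%:Z) addrK tt_sol1.
have -> : N%:Z + k.+1%:Z = N%:Z + k%:Z + 1 by lia.
split=> //; set n := N%:Z + k%:Z + 1 in h2 *.
have := Phi_rec N n; have := ebasP b a0 n; rewrite h2 => h3.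
have -> : Phi N (n - 1) = e (n - 1) by rewrite /n addrK.
have t f f' l : N%:Z <= l -> trunc N f' f l = f l by rewrite /trunc ltNge => ->.
rewrite !t; [|rewrite /n; clear; lia..].
by rewrite -h3 => /addIr/addIr; exact: (scalerI (lt0r_neq0 (a0 n))).
Qed.

Lemma Phi_perturbed N : perturbed a b (fun l => trunc N a' a l - a l) (fun l => trunc N b' b l - b l) (Phi N).
Proof. by move=> n; rewrite !(addrC (a _)) (addrC (b _)) !subrK Phi_rec. Qed.

Lemma Phi_volterra N n (d : nat) : N%:Z <= n + d.+1%:Z ->
  (trunc N a' a n / a n) *: Phi N n = e n - \sum_(i < d.+1)
    vterm (fun l => trunc N a' a l - a l) (fun l => trunc N b' b l - b l) (Phi N) n i.
Proof.
move=> nN; have h1 := Phi_e nN; have nN' : N%:Z <= n + d.+1%:Z + 1 by lia.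
rewrite -(volterra H (Phi_perturbed N) h1 (Phi_e nN')).
by rewrite (addrC (a n)) subrK.
Qed.

Lemma down_ind (C : nat -> Prop) (n1 N : nat) : (forall n : nat, (N <= n)%N -> C n) ->
  (forall n : nat, (n1 <= n < N)%N -> (forall j : nat, (n < j)%N -> C j) -> C n) ->
  forall n : nat, (n1 <= n)%N -> C n.
Proof.
move=> h1 h2 n n1n; have [k] := ubnP (N - n); elim: k n n1n => // k IH n n1n; rewrite ltnS => hk.
have [/h1//|nN] := leqP N n; apply: h2 => [|j nj]; first by rewrite n1n.
by apply: IH; [exact: leq_trans n1n (ltnW nj)|lia].
Qed.

Lemma tau_ge0 (n : nat) : 0 <= tau n.
Proof. by have := htau n 0; rewrite big_ord0. Qed.
Lemma dlt_le_tau (n : nat) : dlt n%:Z <= tau n.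
Proof. have := htau n 1; rewrite big_ord1 addr0; apply: le_trans; rewrite ler_peMl ?addr_ge0//.
by rewrite ler1n. Qed.
Lemma htau1 (n d : nat) : \sum_(i < d) i.+1%:R * dlt (n%:Z + 1 + i%:Z) <= tau n.
Proof.
apply: le_trans (htau n d.+1); rewrite big_ord_recl.
have d0 l : 0 <= `|a' l - a l| + `|b' l - b l| by rewrite addr_ge0.
apply: ler_wpDl; first by rewrite mulr_ge0.
apply: ler_sum => i _; rewrite lift0; have -> : n%:Z + i.+1%:Z = n%:Z + 1 + i%:Z by lia.
by apply: ler_wpM2r => //; rewrite ler_nat; clear; lia.
Qed.
Lemma trunc_dlt N l : `|trunc N a' a l - a l| + `|trunc N b' b l - b l| <= dlt l.
Proof.
by rewrite /trunc; case: ifP => // _; rewrite !subrr !normr0 addr0 addr_ge0.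
Qed.
Lemma trunc_diff N N' l : (N <= N')%N ->
  `|trunc N' a' a l - a l - (trunc N a' a l - a l)| + `|trunc N' b' b l - b l - (trunc N b' b l - b l)|
   <= (if N%:Z <= l then dlt l else 0).
Proof.
move=> NN; rewrite /trunc; case: (ltP l N%:Z) => lN.
  have -> : l < N'%:Z by lia.
  by rewrite !subrr !normr0 addr0.
by rewrite !subrr !subr0; case: ifP => // _; rewrite !subrr !normr0 addr0 addr_ge0.
Qed.

Lemma htau2 N (n d : nat) : (n < N)%N ->
  \sum_(i < d) i.+1%:R * (if N%:Z <= n%:Z + 1 + i%:Z then dlt (n%:Z + 1 + i%:Z) else 0) <= tau N.
Proof.
move=> nN; apply: le_trans (htau N (d - (N - n.+1))); elim: d => [|d IH].
  by rewrite big_ord0 sub0n big_ord0.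
rewrite big_ord_recr /=; case: ifP => h.
  have -> : (d.+1 - (N - n.+1) = (d - (N - n.+1)).+1)%N by clear -h nN; lia.
  have e1 : n%:Z + 1 + d%:Z = N%:Z + (d - (N - n.+1))%N%:Z by clear -h nN; lia.
  rewrite big_ord_recr /= lerD// -e1; apply: ler_wpM2r; first by rewrite addr_ge0.
  by rewrite ler_nat; clear -h nN; lia.
by have -> : (d.+1 - (N - n.+1) = d - (N - n.+1))%N by [clear -h nN; lia]; rewrite mulr0 addr0.
Qed.

(* Past n1 the Volterra operator is a contraction, which gives bounds uniform in the truncation. *)
Lemma Phi_uniform : exists n1 : nat, exists2 C, 0 <= C & forall N (n : nat), (n1 <= n)%N ->
  [/\ nrm_le n%:Z (Phi N n%:Z) C, nrm_le n%:Z (Phi N n%:Z - e n%:Z) (C * tau n) &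
    forall N', (N <= N')%N -> nrm_le n%:Z (Phi N' n%:Z - Phi N n%:Z) (C * tau N)].
Proof.
have [K K0 hK] := nrm_Gpol H; have [c c0 hc] := a_lower H; have M0 := M_gt0 H.
(* [Cf] bounds the quotient of [a] and its truncated counterpart; [Cb] is Cf (1 + 1), from the
   source e_n and a Volterra sum of norm at most 1. *)
pose Cf := 2 * M / c; pose Cb := 2 * Cf.
have am n : a n <= M by apply: le_trans (ler_norm _) (hM _).1.
have cM : c <= M by apply: le_trans (hc 0) (am 0).
have Cf1 : 1 <= Cf by rewrite /Cf ler_pdivlMr//; lra.
have Cb0 : 0 < Cb by rewrite /Cb; lra.
have Cf0 : 0 <= Cf by lra.
have KCC : 0 <= K * Cf * Cb by rewrite mulr_ge0 ?(ltW Cb0)// mulr_ge0.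
have c20 : 0 <= 2 / c by rewrite divr_ge0 ?(ltW c0).
(* The first bound keeps the truncated coefficient above c / 2; the second makes 3 K tau Cb <= 1. *)
pose eps := Num.min (c / 2) (1 / (3 * K * Cb + 1)).
have KC : 0 < 3 * K * Cb + 1 by have : 0 <= 3 * K * Cb by [rewrite mulr_ge0 ?(ltW Cb0)// mulr_ge0]; lra.
have eps0 : 0 < eps by rewrite lt_min !divr_gt0.
have [n1 hn1] := tau_lim eps0.
have small (n : nat) : (n1 <= n)%N -> tau n <= c / 2 /\ 3 * K * tau n * Cb <= 1.
  move=> h; have t := le_trans (tau_dec h) hn1; split.
    by apply: le_trans t _; rewrite /eps ge_min lexx.
  have {}t : tau n <= 1 / (3 * K * Cb + 1) by apply: le_trans t _; rewrite /eps ge_min lexx orbT.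
  have := tau_ge0 n; move: t; rewrite ler_pdivlMr// => t t0.
  have -> : 3 * K * tau n * Cb = tau n * (3 * K * Cb + 1) - tau n by ring.
  by lra.
have rho N (n : nat) : (n1 <= n)%N -> c / 2 <= trunc N a' a n%:Z.
  move=> nn; have [s _] := small n nn.
  rewrite /trunc; case: ifP => _; last by have := hc n%:Z; lra.
  have := dlt_le_tau n; have := hc n%:Z; have := normr_ge0 (b' n%:Z - b n%:Z).
  by have := ler_norm (- (a' n%:Z - a n%:Z)); rewrite normrN; lra.
have rho1 N (n : nat) : (n1 <= n)%N -> `|a n%:Z / trunc N a' a n%:Z| <= Cf.
  move=> nn; rewrite ger0_norm ?divr_ge0 ?(ltW (a0 _)) ?(ltW (trunc_gt0 _ _))//.
  rewrite ler_pdivrMr ?trunc_gt0//; apply: le_trans (am _) _.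
  have -> : M = Cf * (c / 2) by rewrite /Cf; field; exact: lt0r_neq0.
  by apply: ler_wpM2l; [lra|exact: rho].
have inv N (d n : nat) : (N <= n + d.+1)%N -> Phi N n%:Z = (a n%:Z / trunc N a' a n%:Z) *: (e n%:Z -
    \sum_(i < d.+1) vterm (fun l => trunc N a' a l - a l) (fun l => trunc N b' b l - b l) (Phi N) n%:Z i).
  move=> h; rewrite -Phi_volterra; last by clear -h; lia.
  rewrite scalerA; have := lt0r_neq0 (a0 n%:Z); have := lt0r_neq0 (trunc_gt0 N n%:Z) => t1 t2.
  by rewrite (_ : _ * _ = 1) ?scale1r//; field; rewrite t1 t2.
have cst (n j : nat) : n%:Z + 1 + j%:Z = (n + 1 + j)%N%:Z by clear; lia.
have B1 N : forall n : nat, (n1 <= n)%N -> nrm_le n%:Z (Phi N n%:Z) Cb.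
  apply: (@down_ind _ n1 N) => [n Nn|n /andP[nn nN] IH].
    rewrite Phi_e//; apply: nrm_weak (lexx _) _ (nrm_e _ _ (lexx _)); rewrite /Cb; lra.
  have [_ s] := small n nn.
  rewrite (inv N N n); last by clear; lia.
  have -> : Cb = Cf * (1 + 1) by rewrite /Cb; ring.
  apply: nrmZle (rho1 N n nn); apply: nrmB; first exact: nrm_e.
  apply: nrm_weak (lexx _) s _; apply: (vterm_sum_bound (del := dlt) K0 hK _ (ltW Cb0) (trunc_dlt N)) => [j|d].
    by rewrite cst; apply: IH; clear; lia.
  exact: htau1.
pose C2 := 2 / c + Cf * (3 * K * Cb).
have C20 : 0 <= C2.
  have -> : C2 = 2 / c + 3 * (K * Cf * Cb) by rewrite /C2; ring.
  by lra.
have S1 N (n d : nat) : (n1 <= n)%N -> nrm_le n%:Z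
    (\sum_(i < d) vterm (fun l => trunc N a' a l - a l) (fun l => trunc N b' b l - b l) (Phi N) n%:Z i)
    (3 * K * tau n * Cb).
  move=> nn; apply: (vterm_sum_bound (del := dlt) K0 hK _ (ltW Cb0) (trunc_dlt N)) => [j|d'].
    by rewrite cst; apply: B1; clear -nn; lia.
  exact: htau1.
have B2 N (n : nat) : (n1 <= n)%N -> nrm_le n%:Z (Phi N n%:Z - e n%:Z) (C2 * tau n).
  move=> nn; rewrite (inv N N n); last by clear; lia.
  rewrite scalerBr addrAC -{2}[e n%:Z]scale1r -scalerBl.
  have -> : C2 * tau n = 2 / c * tau n * 1 + Cf * (3 * K * tau n * Cb) by rewrite /C2; ring.
  apply: nrmB; last exact: nrmZle (S1 _ _ _ nn) (rho1 _ _ nn).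
  apply: nrmZle; first exact: nrm_e.
  have t0 := trunc_gt0 N n%:Z.
  have -> : a n%:Z / trunc N a' a n%:Z - 1 = - (trunc N a' a n%:Z - a n%:Z) / trunc N a' a n%:Z.
    by field; exact: lt0r_neq0.
  rewrite normrM normrN mulrC (ger0_norm (ltW _)) ?invr_gt0//; apply: ler_pM => //.
  - by rewrite invr_ge0 ltW.
  - rewrite -[2 / c]invf_div lef_pV2 ?posrE ?divr_gt0//; exact: rho.
  - apply: le_trans (dlt_le_tau n); apply: le_trans (trunc_dlt N _).
    by rewrite lerDl.
(* Subtracting the equations for N and N' leaves a source of norm 3 K tau(N) Cb and, after
   multiplication by Cf, a contraction by 1/2. This closes when C3 >= 6 K Cf Cb; the summand C2
   covers n >= N. *)
pose C3 := C2 + 6 * K * Cf * Cb.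
have C3E : C3 = C2 + 6 * (K * Cf * Cb) by rewrite /C3; ring.
have C30 : 0 <= C3 by lra.
have B3 N (N' : nat) : (N <= N')%N -> forall n : nat, (n1 <= n)%N ->
    nrm_le n%:Z (Phi N' n%:Z - Phi N n%:Z) (C3 * tau N).
  move=> NN n nn; move: (nn).
  apply: (@down_ind (fun n : nat => (n1 <= n)%N -> nrm_le n%:Z (Phi N' n%:Z - Phi N n%:Z) (C3 * tau N)) n1 N _ _ n nn) => {nn}n.
    move=> Nn n1n; rewrite (Phi_e (N := N))//; apply: nrm_weak (lexx _) _ (B2 N' n n1n).
    by apply: ler_pM; rewrite ?tau_ge0 ?tau_dec//; lra.
  move=> /andP[n1n nN] IH _; have [_ sn] := small n n1n.
  rewrite (inv N' N' n); last by clear; lia.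
  rewrite (inv N N' n); last by clear -NN; lia.
  have -> : trunc N' a' a n%:Z = trunc N a' a n%:Z.
    have h1 : n%:Z < N%:Z by clear -nN; lia.
    have h2 : n%:Z < N'%:Z by clear -nN NN; lia.
    by rewrite /trunc h1 h2.
  rewrite -scalerBr opprB addrC addrA subrK -opprB scalerN.
  have -> : C3 * tau N = Cf * (3 * K * tau N * Cb + (C3 - 3 * K * Cf * Cb) / Cf * tau N) by field; rewrite gt_eqF//; lra.
  apply: nrmN; apply: nrmZle (rho1 N n n1n); rewrite -sumrB.
  under eq_bigr => i _ do rewrite vterm_diff.
  rewrite big_split /=; apply: nrmD.
    apply: (vterm_sum_bound K0 hK _ (ltW Cb0) (del := fun l => if N%:Z <= l then dlt l else 0)) => [l|j|d'].
    - exact: trunc_diff.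
    - by rewrite cst; apply: B1; clear -n1n; lia.
    - exact: htau2.
  apply: nrm_weak (lexx _) _ (vterm_sum_bound (del := dlt) K0 hK (X := C3 * tau N) _ _ (trunc_dlt N) _ (htau1 n)).
  - have -> : 3 * K * tau n * (C3 * tau N) = (3 * K * tau n * Cb) * (C3 / Cb * tau N) by field; rewrite gt_eqF//; lra.
    apply: le_trans (_ : 1 * (C3 / Cb * tau N) <= _).
      by apply: ler_wpM2r sn; rewrite mulr_ge0 ?tau_ge0 ?divr_ge0 ?(ltW Cb0).
    rewrite mul1r; apply: ler_wpM2r (tau_ge0 N) _ _ _; rewrite ler_pdivlMr; last by lra.
    have -> : C3 / Cb * Cf = C3 / 2 by rewrite /Cb; field; rewrite gt_eqF//; lra.
    by rewrite /C3; lra.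
  - by rewrite mulr_ge0 ?tau_ge0.
  - by move=> j; rewrite cst; apply: IH; clear -n1n; lia.
exists n1, (Cb + C2 + C3) => [|N n n1n]; first by lra.
split=> [||N' NN].
- by apply: nrm_weak (lexx _) _ (B1 N n n1n); lra.
- by apply: nrm_weak (lexx _) _ (B2 N n n1n); apply: ler_wpM2r; [exact: tau_ge0|lra].
- by apply: nrm_weak (lexx _) _ (B3 N N' NN n n1n); apply: ler_wpM2r; [exact: tau_ge0|lra].
Qed.
End TruncatedPerturbation.

Lemma cvg_le_cst (R : realType) (u : nat -> R) (l c : R) : u N @[N --> \oo] --> l ->
  (exists N0 : nat, forall N, (N0 <= N)%N -> u N <= c) -> l <= c.
Proof.
move=> ul [N0 h]; rewrite -(cvg_lim (@Rhausdorff R) ul); apply: limr_le; first by apply/cvg_ex; exists l.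
by exists N0 => // N /=; exact: h.
Qed.

Lemma subr3 (V : zmodType) (p1 p2 q1 q2 r1 r2 : V) :
  (p1 - p2) + (q1 - q2) + (r1 - r2) = (p1 + q1 + r1) - (p2 + q2 + r2).
Proof. by rewrite (addrACA p1) -opprD addrACA -opprD. Qed.

Lemma cauchy_tail (R : realType) (u t : nat -> R) (N0 : nat) :
  (forall N, (N0 <= N)%N -> forall N', (N <= N')%N -> `|u N' - u N| <= t N) ->
  t N @[N --> \oo] --> (0 : R) ->
  u N @[N --> \oo] --> limn u /\ forall N, (N0 <= N)%N -> `|limn u - u N| <= t N.
Proof.
move=> hu ht.
have cu : cvgn u.
  apply/cauchy_cvgP/cauchy_exP => eps eps0.
  have /cvgrPdist_lt/(_ _ eps0) [n _ hn] := ht.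
  exists (u (maxn N0 n)), (maxn N0 n) => // N /= nN.
  rewrite /ball /= distrC; apply: le_lt_trans (hu _ (leq_maxl _ _) _ nN) _.
  by have := hn (maxn N0 n) (leq_maxr _ _); rewrite /= sub0r normrN; apply: le_lt_trans; exact: ler_norm.
split=> // N NN.
have h : `|u N' - u N| @[N' --> \oo] --> `|limn u - u N|.
  by apply: cvg_norm; apply: cvgB cu _; exact: cvg_cst.
by apply: cvg_le_cst h _; exists N => N'; exact: hu.
Qed.

(** * Coefficients of the kernel *)

Section KernelCoefficients.
Variables (R : realType) (g : nat) (E : nat -> R) (a b : int -> R) (P Q U : {poly R}) (M : R).
Hypothesis H : finite_gap g E a b P Q U M.
Variables (a' b' : int -> R).
Hypothesis a'0 : forall n, 0 < a' n.
Variable tau : nat -> R.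
Hypothesis htau : forall (n d : nat), \sum_(i < d) (n + i).+1%:R *
  (`|a' (n%:Z + i%:Z) - a (n%:Z + i%:Z)| + `|b' (n%:Z + i%:Z) - b (n%:Z + i%:Z)|) <= tau n.
Hypothesis tau_dec : forall n m : nat, (n <= m)%N -> tau m <= tau n.
Hypothesis tau_lim : forall eps : R, 0 < eps -> exists n : nat, tau n <= eps.
Local Notation V := ({poly R} * {poly R})%type.
Local Notation e := (ebas a b).
Local Notation A := (Abil a P Q U).
Local Notation nrm_le := (nrm_le a b).
Local Notation Phi := (Phi a b a' b').
Local Notation moment := (moment g E).
Implicit Types (u v w : V) (n m l : int) (c d : R) (N : nat).

Let hE := fgapE H.
Let a0 := fgapa H.

Lemma nrm_back (x : int -> V) n c d : a' n *: x (n + 1) + a' (n - 1) *: x (n - 1) + b' n *: x n = mulX (x n) ->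
  nrm_le n (x n) c -> nrm_le (n + 1) (x (n + 1)) d ->
  nrm_le (n - 1) (x (n - 1)) ((a' (n - 1))^-1 * (3 * M * c + `|b' n| * c + `|a' n| * d)).
Proof.
move=> e1 h1 h2.
have -> : x (n - 1) = (a' (n - 1))^-1 *: (mulX (x n) - b' n *: x n - a' n *: x (n + 1)).
  rewrite -e1 addrK addrAC subrr add0r scalerA mulVf ?scale1r//.
  by apply: lt0r_neq0.
apply: nrmZle; last by rewrite gtr0_norm// invr_gt0.
apply: nrmB; first apply: nrmB; first exact: (nrm_X H).
  by apply: nrmZ; apply: nrm_weak h1 => //; lia.
by apply: nrmZ; apply: nrm_weak h2 => //; lia.
Qed.

Lemma Phi_rec' N n : n < N%:Z -> a' n *: Phi N (n + 1) + a' (n - 1) *: Phi N (n - 1) + b' n *: Phi N n = mulX (Phi N n).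
Proof.
move=> nN; rewrite -(Phi_rec H b' a'0 N n) /trunc nN.
by have -> : n - 1 < N%:Z by lia.
Qed.

(** The contraction is available only past n1. The sites below are reached in finitely many steps by
    running the exact recursion backwards, with constants that depend on n. *)
Lemma Phi_nrm n : exists2 C, 0 <= C & exists N0 : nat, forall N, (N0 <= N)%N ->
  nrm_le n (Phi N n) C /\
  forall N', (N <= N')%N -> nrm_le n (Phi N' n - Phi N n) (C * tau N).
Proof.
have [n1 [C C0 hC]] := Phi_uniform H a'0 htau tau_dec tau_lim.
pose good l := exists2 C, 0 <= C & exists N0 : nat, forall N, (N0 <= N)%N ->
  nrm_le l (Phi N l) C /\
  forall N', (N <= N')%N -> nrm_le l (Phi N' l - Phi N l) (C * tau N).
have up l : n1%:Z <= l -> good l.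
  move=> nl; exists C => //; exists 0%N => N _.
  have [|h1 _ h3] := hC N (absz l); first by clear -nl; lia.
  have e1 : `|l|%N%:Z = l by clear -nl; lia.
  by rewrite e1 in h1 h3.
suff h (k : nat) : good (n1%:Z - k%:Z) /\ good (n1%:Z - k%:Z + 1).
  have [|nn] := leP n1%:Z n; first exact: up.
  have -> : n = n1%:Z - (absz (n1%:Z - n))%:Z by clear -nn; lia.
  by have [] := h (absz (n1%:Z - n)).
elim: k => [|k [IH1 IH2]]; first by rewrite subr0; split; apply: up; lia.
have -> : n1%:Z - k.+1%:Z = n1%:Z - k%:Z - 1 by lia.
set l := n1%:Z - k%:Z in IH1 IH2 *; rewrite subrK; split => //.
have [c c0 [N1 h1]] := IH1; have [d d0 [N2 h2]] := IH2.
pose D := (a' (l - 1))^-1 * (3 * M * c + `|b' l| * c + `|a' l| * d).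
have M0 := M_gt0 H.
exists D.
  by rewrite /D mulr_ge0 ?invr_ge0 ?(ltW (a'0 _))// !addr_ge0// !mulr_ge0// ltW.
exists (maxn (maxn N1 N2) (absz l).+1) => N; rewrite !geq_max => /andP[/andP[l1 l2] l3].
have [p1 p2] := h1 N l1; have [q1 q2] := h2 N l2.
have lN : l < N%:Z by clear -l3; lia.
split=> [|N' NN]; first exact: (nrm_back (Phi_rec' lN)).
have lN' : l < N'%:Z by clear -lN NN; lia.
have e1 : a' l *: (Phi N' (l + 1) - Phi N (l + 1)) + a' (l - 1) *: (Phi N' (l - 1) - Phi N (l - 1))
   + b' l *: (Phi N' l - Phi N l) = mulX (Phi N' l - Phi N l).
  have -> : mulX (Phi N' l - Phi N l) = mulX (Phi N' l) - mulX (Phi N l) by rewrite /mulX /= !mulrBr.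
  by rewrite -(Phi_rec' lN) -(Phi_rec' lN') !scalerBr subr3.
apply: nrm_weak (lexx _) _ (nrm_back (x := fun n => Phi N' n - Phi N n) e1 (p2 N' NN) (q2 N' NN)).
by rewrite /D; set i := (a' (l - 1))^-1; rewrite le_eqVlt; apply/orP; left; apply/eqP; ring.
Qed.

Definition kap N n m : R := moment (A (Phi N n) (e m)).
Definition kappa n m : R := limn (fun N => kap N n m).

Lemma nrm_moment1 n v d m : nrm_le n v d -> `|moment (A v (e m))| <= d.
Proof. by move=> h; have := nrm_moment_sum H (s := [:: m]) isT h; rewrite big_seq1. Qed.

Lemma kapB N N' n m : kap N' n m - kap N n m = moment (A (Phi N' n - Phi N n) (e m)).
Proof.
have -> : Phi N' n - Phi N n = (-1) *: Phi N n + Phi N' n by rewrite scaleN1r addrC.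
by rewrite Abil_lin (momentD hE) (momentZ hE) mulN1r addrC.
Qed.

Lemma tau_cvg : tau N @[N --> \oo] --> (0 : R).
Proof.
apply/cvgrPdist_le => eps eps0; have [n hn] := tau_lim eps0.
near=> N; rewrite sub0r normrN ger0_norm; last exact: (tau_ge0 htau).
apply: le_trans hn; apply: tau_dec; near: N; exact: nbhs_infty_ge.
Unshelve. all: by end_near.
Qed.

Lemma kap_cvg n m : kap N n m @[N --> \oo] --> kappa n m.
Proof.
have [C C0 [N0 hN]] := Phi_nrm n.
apply: (cauchy_tail (t := fun N => C * tau N) (N0 := N0) _ _).1 => [N NN N' NN'|].
  by rewrite kapB; have [_ h] := hN N NN; exact: nrm_moment1 (h N' NN').
by rewrite -[X in _ --> X](mulr0 C); apply: cvgM tau_cvg; exact: cvg_cst.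
Qed.

Lemma kappa_eq0 n m : m < n -> kappa n m = 0.
Proof.
move=> mn; have [C C0 [N0 hN]] := Phi_nrm n.
apply: (cvg_unique _ (kap_cvg (n := n) (m := m))) => //.
apply: cvg_near_cst; exists N0 => // N /= NN; have [h _] := hN N NN.
exact: (nrm_moment H h).
Qed.

Lemma kappa_sum n : exists2 C, 0 <= C & forall s : seq int, uniq s -> \sum_(m <- s) `|kappa n m| <= C.
Proof.
have [C C0 [N0 hN]] := Phi_nrm n; exists C => // s us.
have h : (\sum_(m <- s) `|kap N n m|) @[N --> \oo] --> \sum_(m <- s) `|kappa n m|.
  elim: (s) => [|x s' IH]; first by under eq_fun do rewrite big_nil; rewrite big_nil; exact: cvg_cst.
  under eq_fun do rewrite big_cons; rewrite big_cons; apply: cvgD IH.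
  by apply: cvg_norm; exact: kap_cvg.
apply: cvg_le_cst h _; exists N0 => N NN; have [h' _] := hN N NN.
exact: (nrm_moment_sum H us h').
Qed.

(** Both sides are limits of the moment of z A(Phi N n, e_m): multiplication by z may be moved to
    either argument and expanded by the recursion there. For N > n the truncation is not felt at
    n. *)
Lemma kappa_wave n m : a' n * kappa (n + 1) m + a' (n - 1) * kappa (n - 1) m + b' n * kappa n m
  = a m * kappa n (m + 1) + a (m - 1) * kappa n (m - 1) + b m * kappa n m.
Proof.
have h1 : (a' n * kap N (n + 1) m + a' (n - 1) * kap N (n - 1) m + b' n * kap N n m) @[N --> \oo] -->
    a' n * kappa (n + 1) m + a' (n - 1) * kappa (n - 1) m + b' n * kappa n m.
  by apply: cvgD; first apply: cvgD; apply: cvgM; do ?[exact: cvg_cst|exact: kap_cvg].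
have h2 : (a m * kap N n (m + 1) + a (m - 1) * kap N n (m - 1) + b m * kap N n m) @[N --> \oo] -->
    a m * kappa n (m + 1) + a (m - 1) * kappa n (m - 1) + b m * kappa n m.
  by apply: cvgD; first apply: cvgD; apply: cvgM; do ?[exact: cvg_cst|exact: kap_cvg].
apply: (cvg_unique _ h1) => //; apply: cvg_trans h2; apply: near_eq_cvg.
exists (absz n).+1 => // N /= nN; have lN : n < N%:Z by clear -nN; lia.
rewrite /kap -!(momentZ hE) -!(momentD hE); congr (moment _).
symmetry; transitivity (A (Phi N n) (mulX (e m))); first by rewrite -AbilX -(Phi_rec' lN) !AbilD !AbilZ.
by rewrite -(ebasP b a0 m) ![A (Phi N n) _]AbilC !AbilD !AbilZ.
Qed.
End KernelCoefficients.

(** * Boundary values of the solutions *)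

Section Flux.
Variables (R : realType) (a b : int -> R) (M : R) (z : R[i]) (u : int -> R[i]).
Hypothesis a0 : forall n, 0 < a n.
Hypothesis aM : forall n, `|a n| <= M.
Hypothesis hu : solves a b z u.
Hypothesis u0 : tends0 u.
Hypothesis z0 : 0 < Im z.
Implicit Types (n m : int).

(** This is the conserved current of the Jacobi equation: constant in n for real z, otherwise with
    increments Im z |u(n)|^2. *)
Definition flux n : R := a n * Im ((u n)^* * u (n + 1)).

Lemma flux_step n : flux n - flux (n - 1) = Im z * nc (u n) ^+ 2.
Proof.
have := hu n => /(congr1 (fun w => Im ((u n)^* * w))); rewrite /jacobi /flux subrK sqr_nc.
rewrite !(ImM, ReM, ImD, ReD, Im_conj, Re_conj) /= => h.
have -> : Im z * (Re (u n) ^+ 2 + Im (u n) ^+ 2) = Re (u n) * (Re z * Im (u n) + Im z * Re (u n)) +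
  - Im (u n) * (Re z * Re (u n) - Im z * Im (u n)) by ring.
by rewrite -h; ring.
Qed.

Lemma flux_le n : `|flux n| <= M * (nc (u n) * nc (u (n + 1))).
Proof.
rewrite /flux normrM; apply: ler_pM => //; apply: le_trans (Im_le_nc _) _.
by rewrite ncM nc_conj.
Qed.

Lemma flux_mono n (k : nat) : flux n <= flux (n + k%:Z).
Proof.
elim: k => [|k IH]; first by rewrite addr0.
apply: le_trans IH _; rewrite -subr_ge0.
have -> : n + k%:Z = n + k.+1%:Z - 1 by lia.
by rewrite flux_step mulr_ge0 ?sqr_ge0// ltW.
Qed.

Lemma flux_le0 n : flux n <= 0.
Proof.
have M0 : 0 < M by apply: lt_le_trans (a0 0) _; apply: le_trans (ler_norm _) (aM 0).
apply/ler_addgt0Pr => e e0; rewrite add0r.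
pose d := Num.min 1 (e / M); have d0 : 0 < d by rewrite lt_min ltr01 divr_gt0.
have [N hN] := u0 d0.
pose k := absz (N - n)%R; apply: le_trans (flux_mono n k) _.
have Nk : N <= n + k%:Z by rewrite /k; lia.
apply: le_trans (ler_norm _) _; apply: le_trans (flux_le _) _.
have -> : e = M * (e / M * 1) by field; exact: lt0r_neq0.
rewrite ler_pM2l//; apply: ler_pM; rewrite ?nc_ge0//.
  by apply: le_trans (hN _ Nk) _; rewrite /d ge_min lexx orbT.
by apply: le_trans (hN _ _) _; [lia|rewrite /d ge_min lexx].
Qed.

Lemma flux_decay n m : n < m -> Im z * nc (u m) ^+ 2 <= - flux n.
Proof.
move=> nm; rewrite -flux_step.
have -> : m - 1 = n + (absz (m - 1 - n)%R)%:Z by clear -nm; lia.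
by have := flux_mono n (absz (m - 1 - n)%R); have := flux_le0 m; lra.
Qed.

Lemma flux_norm_le n m : n <= m -> `|flux m| <= `|flux n|.
Proof.
move=> nm; have := flux_mono n (absz (m - n)%R).
have -> : n + (absz (m - n)%R)%:Z = m by clear -nm; lia.
by rewrite !ler0_norm ?flux_le0// lerN2.
Qed.

(** Decay makes the flux nonpositive everywhere, so Im z |u(m)|^2 is bounded by minus the flux at n.
    Applied to m = n + 1 this first bounds u(n + 1) by u(n), and then the flux at n by |u(n)|^2. *)
Lemma weyl_sup n m : n <= m -> nc (u m) <= (1 + M / Im z) * nc (u n).
Proof.
have M0 : 0 < M by apply: lt_le_trans (a0 0) _; apply: le_trans (ler_norm _) (aM 0).
have q0 : 0 <= M / Im z by rewrite divr_ge0 ?ltW.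
rewrite le_eqVlt => /predU1P[<-|nm]; first by rewrite mulrDl mul1r lerDl mulr_ge0 ?nc_ge0.
have h1 := flux_decay nm.
have h2 : Im z * nc (u (n + 1)) ^+ 2 <= - flux n by apply: flux_decay; lia.
have h3 := flux_le n; rewrite ler0_norm ?flux_le0// in h3.
have c1 := nc_ge0 (u n); have c2 := nc_ge0 (u (n + 1)); have c3 := nc_ge0 (u m).
have h4 : Im z * nc (u (n + 1)) <= M * nc (u n).
  have [->|p] := eqVneq (nc (u (n + 1))) 0; first by rewrite mulr0 mulr_ge0// ltW.
  have {}p : 0 < nc (u (n + 1)) by rewrite lt_def p.
  by rewrite -(ler_pM2r p); apply: le_trans (_ : - flux n <= _); [rewrite -mulrA -expr2|rewrite -mulrA].
apply: (@le_trans _ _ (M / Im z * nc (u n))); last by rewrite ler_wpM2r//; lra.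
have c4 : 0 <= M / Im z * nc (u n) by rewrite mulr_ge0.
rewrite -ler_sqr ?nnegrE// -(ler_pM2l z0); apply: le_trans h1 _; apply: le_trans h3 _.
have -> : Im z * (M / Im z * nc (u n)) ^+ 2 = M * nc (u n) * (M * nc (u n) / Im z).
  by field; exact: lt0r_neq0.
rewrite [leLHS]mulrA; apply: ler_wpM2l; first by rewrite mulr_ge0// ltW.
by rewrite ler_pdivlMr// mulrC.
Qed.
End Flux.

(** With p and q the values at neighbouring sites, their ratio is h / (2 c f), so the flux is |p|^2
    times an explicit function of z. *)
Lemma flux_identity (R : realType) (c : R) (p q f h : R[i]) : 2 * c%:C * q * f = h * p ->
  2 * (c * Im (p^* * q)) * nc f ^+ 2 = nc p ^+ 2 * Im (h * f^*).
Proof.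
move=> e; rewrite !sqr_nc.
have -> : (Re p ^+ 2 + Im p ^+ 2) * Im (h * f^*) = Im (h * p * (p^* * f^*)).
  by rewrite !(ImM, ReM, Im_conj, Re_conj); ring.
by rewrite -e !(ImM, ReM, Im_conj, Re_conj) /=; ring.
Qed.

Section EvaluationBounds.
Variables (R : realType) (g : nat) (E : nat -> R) (a b : int -> R) (P Q U : {poly R}) (M : R).
Hypothesis H : finite_gap g E a b P Q U M.
Local Notation rt := (Rhalf g E).
Local Notation V := ({poly R} * {poly R})%type.
Local Notation e := (ebas a b).
Local Notation ev := (ev g E a P Q).
Local Notation F := (Fpol a b P Q U).
Local Notation W := (Ppol a b P Q U).
Local Notation nrm_le := (nrm_le a b).
Implicit Types (u v w : V) (n m l k : int) (c d x y : R).

Let hE := fgapE H.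
Let a0 := fgapa H.
Let hM := fgapM H.
Let hU := fgapU H.
Let hQ := fgapQ H.

Lemma ev_bound s z n v d S : 0 <= S -> (forall k, n <= k -> nc (ev s z (e k)) <= S) -> nrm_le n v d ->
  nc (ev s z v) <= d * S.
Proof.
move=> S0 h [r [-> h2 h3]]; apply: (@le_trans _ _ (\sum_(x <- r) `|x.1| * S)); last first.
  by rewrite -mulr_suml ler_wpM2r.
elim: r h2 {h3} => [|x r IH] /=; first by rewrite !big_nil ev0 nc0.
move=> /andP[nx /IH hr]; rewrite !big_cons evD evZ; apply: le_trans (ncD _ _) _.
by rewrite lerD// ncM nc_real ler_wpM2l// h.
Qed.

Lemma rt_boundary x : ctends (0 : R)^'+ (fun y => rt (x +i* y)) (rt x%:C).
Proof.
apply: ctends_rt => //; first by near=> y => /=; apply: ltW; near: y; exact: nbhs_right_gt.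
split => /=; [exact: cvg_cst|exact: cvg_at_right_filter cvg_id].
Unshelve. all: by end_near.
Qed.

Lemma ev_curve (T : Type) (G : set_system T) {FG : Filter G} (f : T -> R[i]) s v (k : nat) x :
  (k <= g)%N -> in_band E k x -> ctends G f x%:C -> (\forall t \near G, 0 <= Im (f t)) ->
  ctends G (fun t => ev s (f t) v) (ev s x%:C v).
Proof.
move=> kg xk t f0.
have q0 : (pC Q).[x%:C] != 0 by rewrite pC_real fmorph_eq0; apply: (gap_poly_neq0r hE hQ kg xk).
have tp (p : {poly R}) : ctends G (fun t => (pC p).[f t]) (pC p).[x%:C] by exact: ctends_poly.
have trt : ctends G (fun t => rt (f t)) (rt x%:C) by exact: ctends_rt.
have t1 : ctends G (fun t => (pC P).[f t] + (-1) ^+ s * rt (f t)) ((pC P).[x%:C] + (-1) ^+ s * rt x%:C).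
  by apply: ctendsD (tp _) _; apply: ctendsM trt; exact: ctends_cst.
have t2 : ctends G (fun t => ((pC Q).[f t])^-1) ((pC Q).[x%:C])^-1 by exact: ctendsV.
exact: ctendsD (tp _) (ctendsM (tp _) (ctendsM (ctends_cst _) (ctendsM t1 t2))).
Qed.

Lemma ev_boundary s v (k : nat) x : (k <= g)%N -> in_band E k x ->
  ctends (0 : R)^'+ (fun y => ev s (x +i* y) v) (ev s x%:C v).
Proof.
move=> kg xk; apply: (ev_curve _ _ kg xk).
  by split => /=; [exact: cvg_cst|exact: cvg_at_right_filter cvg_id].
by near=> y => /=; apply: ltW; near: y; exact: nbhs_right_gt.
Unshelve. all: by end_near.
Qed.

Lemma poly_lip (p : {poly R}) x r d : `|x| + 1 <= r -> (forall z, nc z <= r -> nc (pC p^`()).[z] <= d) ->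
  forall y, 0 <= y <= 1 -> nc ((pC p).[x +i* y] - (pC p).[x%:C]) <= 2 * (d * y).
Proof.
move=> xr hd y /andP[y0 y1].
have := @cder_lip R (fun t => (pC p).[x%:C + t%:C * 'i]) (fun t => (pC p)^`().[x%:C + t%:C * 'i] * 'i) d 0 y y0.
have e1 (t : R) : x%:C + t%:C * 'i = x +i* t :> R[i] by rewrite [RHS]cplxE mulrC.
rewrite !e1 subr0; apply => t.
  by move=> _; apply: cder_poly; exact: cder_line.
rewrite in_itv/= => /andP[t0 ty]; rewrite ncM nc_i mulr1 deriv_map; apply: hd.
apply: le_trans xr; apply: le_trans (ncD _ _) _; rewrite ncM !nc_real nc_i mulr1 lerD2l ger0_norm//; lra.
Qed.

(** The constant in [weyl_sup] blows up as y tends to 0, so the flux is used directly. Its size at m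
    is at most that at n, and by [flux_identity] twice the flux times |F_m|^2 is |u(m)|^2 Im((W_m +
    R^(1/2)) conj F_m). At a band point this imaginary part has size |R^(1/2) F_m|, bounded below
    uniformly in m; Lipschitz bounds for F_m and W_m preserve half of it at small heights. *)
Lemma boundary_sup (k : nat) x n : (k <= g)%N -> in_band E k x -> exists2 C, 0 <= C &
  \forall y \near (0 : R)^'+, forall m, n <= m -> nc (ev false (x +i* y) (e m)) <= C.
Proof.
move=> kg xk; have M0 := M_gt0 H.
have [C C0 hC] := uniform_bounds H (`|x| + 1).
pose C1 := C + 1; have C10 : 0 < C1 by rewrite /C1; lra.
have {}hC m z : nc z <= `|x| + 1 -> [/\ nc (pC (F m)).[z] <= C1, nc (pC (W m)).[z] <= C1,
    nc (pC (F m)^`()).[z] <= C1 & nc (pC (W m)^`()).[z] <= C1].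
  by move=> /(hC m)[? ? ? ?]; rewrite /C1; split; lra.
pose del := Num.min (x - E k.*2) (E k.*2.+1 - x).
have /andP[xk1 xk2] := xk.
have del0 : 0 < del by rewrite lt_min !subr_gt0 xk1 xk2.
have Fx m : del ^+ g <= `|(F m).[x]|.
  rewrite -nc_real -pC_real; apply: (gap_poly_ge (Fpol_gap H m) (ltW del0)) => j y jg /andP[y1 y2].
  rewrite -rmorphB nc_real; have [h1 h2] := gap_side hE jg kg xk.
  have [jk|kj] := leqP j k.
    have h : E j.*2 <= E k.*2 by apply: (edges_le hE); clear -jk kg; lia.
    rewrite ger0_norm; last by lra.
    by apply: (@le_trans _ _ (x - E k.*2)); [rewrite ge_min lexx|lra].
  have h : E k.*2.+1 <= E j.*2.-1 by apply: (edges_le hE); clear -jg kj kg; lia.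
  rewrite ler0_norm; last by lra.
  by apply: (@le_trans _ _ (E k.*2.+1 - x)); [rewrite ge_min lexx orbT|lra].
pose rho := absrt g E x; have rho0 : 0 < rho := absrt_gt0 (band_not_edge hE kg xk).
have rtx : exists s : R, rt x%:C = 'i * s%:C /\ `|s| = rho.
  exists (- (-1) ^+ (g - k) * rho); split; first exact: (rt_band hE kg xk).
  by rewrite normrM normrN normrX normrN1 expr1n mul1r gtr0_norm.
have [s [rts srho]] := rtx.
pose c := rho * del ^+ g; have c0 : 0 < c by rewrite mulr_gt0 ?exprn_gt0.
pose S := nc (ev false x%:C (e n)) + nc (ev false x%:C (e (n + 1))) + 1.
have S1 : 1 <= S by rewrite /S; have := nc_ge0 (ev false x%:C (e n)); have := nc_ge0 (ev false x%:C (e (n + 1))); lra.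
pose T := 4 * C1 ^+ 2 * M * S ^+ 2 / c.
have T0 : 0 <= T.
  apply: divr_ge0 (ltW c0); apply: mulr_ge0 (sqr_ge0 _); apply: mulr_ge0 (ltW M0).
  by apply: mulr_ge0 (sqr_ge0 _).
exists (1 + T); first by lra.
(* For y <= [eta] the errors from F_m and W_m total at most c / 4; the error from R^(1/2) takes
   another c / 4 and leaves c / 2. *)
pose eta := Num.min 1 (c / (4 * (4 * C1 ^+ 2 + 2 * rho * C1))).
have K0 : 0 < 4 * (4 * C1 ^+ 2 + 2 * rho * C1) by rewrite mulr_gt0// addr_gt0 ?mulr_gt0 ?exprn_gt0.
have eta0 : 0 < eta by rewrite lt_min ltr01 divr_gt0.
have Enear v d : 0 < d -> \forall y \near (0 : R)^'+, nc (ev false x%:C v - ev false (x +i* y) v) < d.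
  by move=> d0; have /ctendsP := ev_boundary false v kg xk; apply.
have Rnear d : 0 < d -> \forall y \near (0 : R)^'+, nc (rt x%:C - rt (x +i* y)) < d.
  move=> d0; have /ctendsP : ctends (0 : R)^'+ (fun y => rt (x +i* y)) (rt x%:C); last by apply.
  exact: rt_boundary.
near=> y => m nm.
have n1 : nc (ev false x%:C (e n) - ev false (x +i* y) (e n)) < 1 by near: y; apply: Enear.
have n2 : nc (ev false x%:C (e (n + 1)) - ev false (x +i* y) (e (n + 1))) < 1 by near: y; apply: Enear.
have u3 : nc (rt x%:C - rt (x +i* y)) < c / (4 * C1).
  by near: y; apply: Rnear; rewrite divr_gt0// mulr_gt0.
move: n1 n2 u3; set z := x +i* y => n1 n2 u3.
have y0 : 0 < y by near: y; exact: nbhs_right_gt.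
have ye : y <= eta by near: y; exact: nbhs_right_le.
have y1 : y <= 1 by apply: le_trans ye _; rewrite /eta ge_min lexx.
have Iz : 0 < Im z by [].
have zi : Im z != 0 by rewrite gt_eqF.
have u1 : nc (ev false z (e n)) <= S.
  have := le_nc_dist (ev false z (e n)) (ev false x%:C (e n)); rewrite ncBC /S.
  by have := nc_ge0 (ev false x%:C (e (n + 1))); move: n1; clear -hE a0 hM hU hQ; lra.
have u2 : nc (ev false z (e (n + 1))) <= S.
  have := le_nc_dist (ev false z (e (n + 1))) (ev false x%:C (e (n + 1))); rewrite ncBC /S.
  by have := nc_ge0 (ev false x%:C (e n)); move: n2; clear -hE a0 hM hU hQ; lra.
pose u j := ev false z (e j).
have su : solves a b z u by exact: ev_solves.
have tu : tends0 u by exact: (fgap_right H).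
have aM j : `|a j| <= M by have [] := hM j.
have f1 := flux_norm_le a0 aM su tu Iz nm.
have f2 := @flux_le R a M u aM n.
have f3 : `|flux a u m| <= M * S ^+ 2.
  apply: le_trans f1 _; apply: le_trans f2 _; rewrite ler_pM2l// expr2.
  by apply: ler_pM; rewrite ?nc_ge0.
have zr : nc z <= `|x| + 1 by apply: le_trans (nc_le _) _; rewrite /= (gtr0_norm y0) lerD2l.
have xr : nc x%:C <= `|x| + 1 by rewrite nc_real lerDl ler01.
have [Fz Wz _ _] := hC m z zr; have [Fxx Wx _ _] := hC m x%:C xr.
have yy : 0 <= y <= 1 by rewrite (ltW y0).
have lF : nc ((pC (F m)).[z] - (pC (F m)).[x%:C]) <= 2 * (C1 * y).
  by apply: (poly_lip (lexx _)) yy => w /(hC m)[].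
have lW : nc ((pC (W m)).[z] - (pC (W m)).[x%:C]) <= 2 * (C1 * y).
  by apply: (poly_lip (lexx _)) yy => w /(hC m)[].
have key : c / 2 <= `|Im (((pC (W m)).[z] + rt z) * (pC (F m)).[z]^*)|.
  set Wz' := (pC (W m)).[z] in Wz lW *; set Fz' := (pC (F m)).[z] in Fz lF *.
  set X := (pC (F m)).[x%:C] in Fxx lF *; set Y := (pC (W m)).[x%:C] in Wx lW *.
  have Xr : X^* = X by rewrite /X pC_real conjCR.
  have lX : del ^+ g <= nc X by rewrite /X pC_real nc_real.
  have e1 : (Wz' + rt z) * Fz'^* = rt x%:C * X + Y * X +
     (Wz' * (Fz' - X)^* + X * (Wz' - Y) + (rt z - rt x%:C) * Fz'^* + rt x%:C * (Fz' - X)^*).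
    by rewrite !(rmorphB (conjc)) /= Xr; ring.
  have e2 : Im (rt x%:C * X + Y * X) = s * (F m).[x].
    by rewrite /X /Y !pC_real rts ImD !(ImM, ReM) /=; ring.
  rewrite e1 ImD e2.
  set D := _ * (Fz' - X)^* + _ + _ + _.
  have hD : nc D <= c / 2.
    have d1 : nc (Wz' * (Fz' - X)^*) <= C1 * (2 * (C1 * y)) by rewrite ncM nc_conj; apply: ler_pM; rewrite ?nc_ge0.
    have d2 : nc (X * (Wz' - Y)) <= C1 * (2 * (C1 * y)) by rewrite ncM; apply: ler_pM; rewrite ?nc_ge0.
    have d3 : nc ((rt z - rt x%:C) * Fz'^*) <= c / (4 * C1) * C1.
      by rewrite ncM nc_conj ncBC; apply: ler_pM; rewrite ?nc_ge0// ltW.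
    have d4 : nc (rt x%:C * (Fz' - X)^*) <= rho * (2 * (C1 * y)).
      by rewrite ncM nc_conj -absrt_nc; apply: ler_pM; rewrite ?nc_ge0// ltW.
    have d3' : c / (4 * C1) * C1 = c / 4 by field; exact: lt0r_neq0.
    have d5 : C1 * (2 * (C1 * y)) + C1 * (2 * (C1 * y)) + rho * (2 * (C1 * y)) <= c / 4.
      have hy : y * (4 * (4 * C1 ^+ 2 + 2 * rho * C1)) <= c.
        by rewrite -(ler_pdivlMr _ _ K0); apply: le_trans ye _; rewrite /eta ge_min lexx orbT.
      by move: hy; clear -hE a0 hM hU hQ; lra.
    apply: le_trans (ncD _ _) _; have := ncD (Wz' * (Fz' - X)^* + X * (Wz' - Y)) ((rt z - rt x%:C) * Fz'^*).
    have := ncD (Wz' * (Fz' - X)^*) (X * (Wz' - Y)).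
    by move: d1 d2 d3 d4 d5; rewrite d3'; clear -hE a0 hM hU hQ; lra.
  have : c <= `|s * (F m).[x]| by rewrite normrM srho /c ler_pM2l.
  have := Im_le_nc D; have := ler_normB (s * (F m).[x] + Im D) (Im D); rewrite addrK; move: hD; clear -hE a0 hM hU hQ; lra.
have e3 : 2 * flux a u m * nc (pC (F m)).[z] ^+ 2 =
    nc (u m) ^+ 2 * Im (((pC (W m)).[z] + rt z) * (pC (F m)).[z]^*).
  exact: flux_identity (ev_next b a0 hU m (Q_neq0 H zi)).
have h4 : nc (u m) ^+ 2 * (c / 2) <= 2 * (M * S ^+ 2) * C1 ^+ 2.
  apply: (@le_trans _ _ (`|2 * flux a u m * nc (pC (F m)).[z] ^+ 2|)).
    rewrite e3 normrM (ger0_norm (sqr_ge0 _)); apply: ler_wpM2l key; exact: sqr_ge0.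
  rewrite normrM (normrM 2) [X in _ * X]ger0_norm ?sqr_ge0// (ger0_norm (ler0n _ 2)); apply: ler_pM.
  - by apply: mulr_ge0.
  - exact: sqr_ge0.
  - by rewrite ler_pM2l.
  - by rewrite ler_sqr ?nnegrE ?nc_ge0 ?(ltW C10).
have h5 : nc (u m) ^+ 2 <= T.
  by rewrite /T ler_pdivlMr//; move: h4; clear -hE a0 hM hU hQ; lra.
have sq (v t : R) : v ^+ 2 <= t -> v <= 1 + t by clear -hE a0 hM hU hQ; nra.
by rewrite -/z -/(u m); exact: sq.
Unshelve. all: by end_near.
Qed.

Lemma boundary_sup_real (k : nat) x n : (k <= g)%N -> in_band E k x -> exists2 C, 0 <= C &
  (\forall y \near (0 : R)^'+, forall m, n <= m -> nc (ev false (x +i* y) (e m)) <= C) /\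
  forall m, n <= m -> nc (ev false x%:C (e m)) <= C.
Proof.
move=> kg xk; have [C C0 hC] := boundary_sup n kg xk; exists C => //; split => // m nm.
apply/ler_addgt0Pr => d d0; have /ctendsP/(_ d d0) h := ev_boundary false (e m) kg xk.
have [y [h1 h2]] := @filter_ex _ _ (at_right_proper_filter (0 : R)) _ (filterI hC h).
have := le_nc_dist (ev false x%:C (e m)) (ev false (x +i* y) (e m)); have := h1 m nm.
by move: h2; rewrite /=; lra.
Qed.
End EvaluationBounds.

Section ComplexSequences.
Variable R : realType.
Definition clim (u : nat -> R[i]) : R[i] := limn (fun N => Re (u N)) +i* limn (fun N => Im (u N)).

Lemma ccauchy_tail (u : nat -> R[i]) (t : nat -> R) (N0 : nat) :
  (forall N, (N0 <= N)%N -> forall N', (N <= N')%N -> nc (u N' - u N) <= t N) ->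
  t N @[N --> \oo] --> (0 : R) ->
  ctends \oo u (clim u) /\ forall N, (N0 <= N)%N -> nc (clim u - u N) <= 2 * t N.
Proof.
move=> hu ht.
have [|c1 l1] := cauchy_tail (u := fun N => Re (u N)) (t := t) (N0 := N0) _ ht.
  by move=> N NN N' NN'; rewrite -ReB; apply: le_trans (Re_le_nc _) _; exact: hu.
have [|c2 l2] := cauchy_tail (u := fun N => Im (u N)) (t := t) (N0 := N0) _ ht.
  by move=> N NN N' NN'; rewrite -ImB; apply: le_trans (Im_le_nc _) _; exact: hu.
split=> [//|N NN]; apply: le_trans (nc_le _) _; rewrite ReB ImB /=.
by have := l1 N NN; have := l2 N NN; lra.
Qed.
End ComplexSequences.

Section PerturbedSolution.
Variables (R : realType) (g : nat) (E : nat -> R) (a b : int -> R) (P Q U : {poly R}) (M : R).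
Hypothesis H : finite_gap g E a b P Q U M.
Variables (a' b' : int -> R).
Hypothesis a'0 : forall n, 0 < a' n.
Variable tau : nat -> R.
Hypothesis htau : forall (n d : nat), \sum_(i < d) (n + i).+1%:R *
  (`|a' (n%:Z + i%:Z) - a (n%:Z + i%:Z)| + `|b' (n%:Z + i%:Z) - b (n%:Z + i%:Z)|) <= tau n.
Hypothesis tau_dec : forall n m : nat, (n <= m)%N -> tau m <= tau n.
Hypothesis tau_lim : forall eps : R, 0 < eps -> exists n : nat, tau n <= eps.
Local Notation e := (ebas a b).
Local Notation ev := (ev g E a P Q).
Local Notation nrm_le := (nrm_le a b).
Local Notation Phi := (Phi a b a' b').
Implicit Types (n m l : int) (c d x y : R) (N : nat) (z : R[i]).

Let hE := fgapE H.
Let a0 := fgapa H.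
Let hM := fgapM H.
Let tcvg := tau_cvg htau tau_dec tau_lim.
Let t0 := tau_ge0 htau.

Definition Psi z n : R[i] := clim (fun N => ev false z (Phi N n)).

(** The rate depends on z only through a bound [S] for the background. The same statement therefore
    serves at nonreal points, with [weyl_sup], and uniformly down to the bands, with
    [boundary_sup]. *)
Lemma Psi_near n : exists2 C, 0 <= C & exists N0 : nat, forall z S, 0 <= S ->
  (forall m, n <= m -> nc (ev false z (e m)) <= S) ->
  ctends \oo (fun N => ev false z (Phi N n)) (Psi z n) /\
  forall N, (N0 <= N)%N -> nc (Psi z n - ev false z (Phi N n)) <= C * tau N * S.
Proof.
have [C C0 [N0 hC]] := Phi_nrm H a'0 htau tau_dec tau_lim n.
exists (2 * C); first by rewrite mulr_ge0.
exists N0 => z S S0 hS.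
have [||h1 h2] := @ccauchy_tail R (fun N => ev false z (Phi N n)) (fun N => C * tau N * S) N0.
- move=> N NN N' NN'; rewrite -evB; apply: (ev_bound S0 hS).
  by have [_] := hC N NN; apply.
- rewrite -[X in _ --> X](mul0r S); apply: cvgM; last exact: cvg_cst.
  by rewrite -[X in _ --> X](mulr0 C); apply: cvgM tcvg; exact: cvg_cst.
- by split=> // N NN; have := h2 N NN; rewrite !mulrA.
Qed.

Lemma ctends_near_eq (T : Type) (F : set_system T) {FF : Filter F} (f h : T -> R[i]) (l : R[i]) :
  (\forall t \near F, f t = h t) -> ctends F f l -> ctends F h l.
Proof.
by move=> fh [h1 h2]; split; [apply: cvg_trans h1|apply: cvg_trans h2]; apply: near_eq_cvg;
  apply: filterS fh => t ->.
Qed.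

Lemma weyl_sup_ev z n : 0 < Im z -> forall m, n <= m ->
  nc (ev false z (e m)) <= (1 + M / Im z) * nc (ev false z (e n)).
Proof.
move=> z0 m nm; apply: (@weyl_sup R a b M z (fun j => ev false z (e j))) nm => //.
- by move=> j; have [] := hM j.
- exact: ev_solves.
- by apply: (fgap_right H); rewrite gt_eqF.
Qed.

Lemma weyl_factor_ge0 z : 0 < Im z -> 0 <= 1 + M / Im z.
Proof. by move=> z0; rewrite addr_ge0// divr_ge0 ?(ltW z0)// ltW// (M_gt0 H). Qed.

Lemma Psi_ctends z n : 0 < Im z -> ctends \oo (fun N => ev false z (Phi N n)) (Psi z n).
Proof.
move=> z0; have [C C0 [N0 h]] := Psi_near n.
have [|h1 _] := h z _ _ (@weyl_sup_ev z _ z0); last exact: h1.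
by rewrite mulr_ge0 ?nc_ge0 ?weyl_factor_ge0.
Qed.

Lemma Psi_solves z : 0 < Im z -> solves a' b' z (Psi z).
Proof.
move=> z0 n.
have h1 : ctends \oo (fun N => (a' n)%:C * ev false z (Phi N (n + 1)) + (a' (n - 1))%:C * ev false z (Phi N (n - 1))
    + (b' n)%:C * ev false z (Phi N n)) (jacobi a' b' (Psi z) n).
  by apply: ctendsD; first apply: ctendsD; apply: ctendsM; do ?[exact: ctends_cst|exact: Psi_ctends].
have h2 : ctends \oo (fun N => z * ev false z (Phi N n)) (z * Psi z n).
  by apply: ctendsM; [exact: ctends_cst|exact: Psi_ctends].
have hn : \forall N \near \oo, z * ev false z (Phi N n) = (a' n)%:C * ev false z (Phi N (n + 1)) +
    (a' (n - 1))%:C * ev false z (Phi N (n - 1)) + (b' n)%:C * ev false z (Phi N n).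
  exists (absz n).+1 => // N /= nN; have lN : n < N%:Z by clear -nN; lia.
  by rewrite -evX -(Phi_rec' H b' a'0 lN) !evD !evZ.
have h3 : ctends \oo (fun N => (a' n)%:C * ev false z (Phi N (n + 1)) + (a' (n - 1))%:C * ev false z (Phi N (n - 1))
    + (b' n)%:C * ev false z (Phi N n)) (z * Psi z n) by exact: ctends_near_eq h2.
exact: (ctends_unique h1 h3).
Qed.

Lemma Psi_asym z : 0 < Im z -> exists2 C, 0 <= C & exists n1 : nat, forall n : nat, (n1 <= n)%N ->
  nc (Psi z n%:Z - ev false z (e n%:Z)) <= C * tau n * nc (ev false z (e n%:Z)).
Proof.
move=> z0; have [n1 [C C0 hC]] := Phi_uniform H a'0 htau tau_dec tau_lim.
have w0 := weyl_factor_ge0 z0.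
exists (C * (1 + M / Im z)); first by rewrite mulr_ge0.
exists n1 => n nn.
have h N : nc (ev false z (Phi N n%:Z) - ev false z (e n%:Z)) <= C * (1 + M / Im z) * tau n * nc (ev false z (e n%:Z)).
  have [_ h _] := hC N n nn; rewrite -evB.
  have -> : C * (1 + M / Im z) * tau n * nc (ev false z (e n%:Z)) =
    C * tau n * ((1 + M / Im z) * nc (ev false z (e n%:Z))) by ring.
  by apply: (ev_bound _ (@weyl_sup_ev z _ z0) h); rewrite mulr_ge0 ?nc_ge0.
apply/ler_addgt0Pr => d d0; have /ctendsP/(_ d d0)[N1 _ hN] := Psi_ctends n%:Z z0.
have := hN N1 (leqnn _); have := h N1; rewrite /=.
have := ncD (Psi z n%:Z - ev false z (Phi N1 n%:Z)) (ev false z (Phi N1 n%:Z) - ev false z (e n%:Z)).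
by rewrite addrA subrK; lra.
Qed.

(** Each truncation is continuous up to the axis, and [boundary_sup] makes the convergence in N
    uniform in small y. *)
Lemma Psi_boundary n (k : nat) x : (k <= g)%N -> in_band E k x ->
  ctends (0 : R)^'+ (fun y => Psi (x +i* y) n) (Psi x%:C n).
Proof.
move=> kg xk; have [C C0 [N0 hC]] := Psi_near n.
have [S S0 [hS hSx]] := boundary_sup_real H n kg xk.
apply/ctendsP => d d0.
have [N [NN tN]] : exists N, (N0 <= N)%N /\ C * tau N * S < d / 4.
  have K0 : 0 < C * S + 1 by rewrite ltr_wpDl// mulr_ge0.
  have d4 : 0 < d / 4 / (C * S + 1) by rewrite !divr_gt0.
  have [n1 hn1] := tau_lim d4.
  exists (maxn N0 n1); split; first exact: leq_maxl.
  have h := le_trans (tau_dec (leq_maxr N0 n1)) hn1.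
  have := t0 (maxn N0 n1); rewrite ler_pdivlMr// in h.
  have -> : C * tau (maxn N0 n1) * S = tau (maxn N0 n1) * (C * S + 1) - tau (maxn N0 n1) by ring.
  move=> h0; have [->|p] := eqVneq (tau (maxn N0 n1)) 0; first by rewrite mul0r subr0 divr_gt0.
  have {}p : 0 < tau (maxn N0 n1) by rewrite lt_def p.
  by lra.
have d2 : 0 < d / 2 by lra.
have /ctendsP/(_ _ d2) hev := ev_boundary H false (Phi N n) kg xk.
near=> y.
have e1 : nc (ev false x%:C (Phi N n) - ev false (x +i* y) (Phi N n)) < d / 2 by near: y.
have e2 : forall m, n <= m -> nc (ev false (x +i* y) (e m)) <= S by near: y.
have [_ /(_ N NN) f1] := hC _ S S0 e2; have [_ /(_ N NN) f2] := hC _ S S0 hSx.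
have -> : Psi x%:C n - Psi (x +i* y) n = (Psi x%:C n - ev false x%:C (Phi N n)) +
   (ev false x%:C (Phi N n) - ev false (x +i* y) (Phi N n)) - (Psi (x +i* y) n - ev false (x +i* y) (Phi N n)) by ring.
apply: le_lt_trans (ncB _ _) _.
have := ncD (Psi x%:C n - ev false x%:C (Phi N n)) (ev false x%:C (Phi N n) - ev false (x +i* y) (Phi N n)).
by lra.
Unshelve. all: by end_near.
Qed.

Lemma Psi_band n m (k : nat) x : (k <= g)%N -> in_band E k x ->
  ctends \oo (fun N => (Abil a P Q U (Phi N n) (e m)).[x]%:C + (Bbil a (Phi N n) (e m)).[x]%:C * Rhalf g E x%:C)
    (Psi x%:C n * ev true x%:C (e m) * Q.[x]%:C).
Proof.
move=> kg xk; have [C C0 [N0 hC]] := Psi_near n.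
have [S S0 [hS hSx]] := boundary_sup_real H n kg xk.
have [h _] := hC x%:C S S0 hSx.
have q0 : (pC Q).[x%:C] != 0 by rewrite pC_real fmorph_eq0; apply: (gap_poly_neq0r hE (fgapQ H) kg xk).
have h1 : ctends \oo (fun N => ev false x%:C (Phi N n) * ev true x%:C (e m) * Q.[x]%:C)
   (Psi x%:C n * ev true x%:C (e m) * Q.[x]%:C).
  by apply: ctendsM; [apply: ctendsM h _|]; exact: ctends_cst.
apply: ctends_near_eq h1; near=> N.
by rewrite -!pC_real (ev_prod a0 (fgapU H) _ _ q0).
Unshelve. all: by end_near.
Qed.
End PerturbedSolution.

Lemma log_modulus_derive (R : realType) (f : R -> R[i]) (t : R) (l : R[i]) : f t != 0 -> cder f t l ->
  is_derive t 1 (fun s => ln (nc (f s))) (Re (l / f t)).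
Proof.
move=> f0 [d1 d2].
have p0 : 0 < Re (f t) ^+ 2 + Im (f t) ^+ 2.
  by rewrite lt_def sqr_norm_neq0//= addr_ge0 ?sqr_ge0.
have e s : ln (nc (f s)) = 2^-1 * ln (Re (f s) * Re (f s) + Im (f s) * Im (f s)).
  rewrite -!expr2 -sqr_nc; have [->|n0] := eqVneq (nc (f s)) 0; first by rewrite expr0n /= ln0// mulr0.
  by rewrite lnXn ?lt_def ?n0 ?nc_ge0// -[X in _ * X]mulr_natl mulrA mulVf ?mul1r ?pnatr_eq0.
have -> : (fun s => ln (nc (f s))) = (fun s => 2^-1 * ln (Re (f s) * Re (f s) + Im (f s) * Im (f s))) by exact/funext.
have dq : is_derive t 1 (fun s => Re (f s) * Re (f s) + Im (f s) * Im (f s)) _ :=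
  is_deriveD (is_deriveM d1 d1) (is_deriveM d2 d2).
rewrite !expr2 in p0; have dl := is_derive1_ln p0.
have dc : is_derive t 1 (fun s => ln (Re (f s) * Re (f s) + Im (f s) * Im (f s))) _ :=
  is_derive1_comp (f := @ln R) (g := fun s => Re (f s) * Re (f s) + Im (f s) * Im (f s)) dl dq.
have dm : is_derive t 1 (fun s => 2^-1 * ln (Re (f s) * Re (f s) + Im (f s) * Im (f s))) _ :=
  is_deriveZ 2^-1 dc.
apply: (is_derive_eq' dm).
rewrite /GRing.scale /= ReM ReV ImV !expr2; field; exact: lt0r_neq0.
Qed.

(** * Lower bound for the Baker-Akhiezer function *)

Section LogDerivative.
Variables (R : realType) (g : nat) (E : nat -> R) (a b : int -> R) (P Q U : {poly R}) (M : R).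
Hypothesis H : finite_gap g E a b P Q U M.
Local Notation rt := (Rhalf g E).
Local Notation rt' := (rt' g E).
Local Notation V := ({poly R} * {poly R})%type.
Local Notation e := (ebas a b).
Local Notation ev := (ev g E a P Q).
Local Notation F := (Fpol a b P Q U).
Local Notation W := (Ppol a b P Q U).
Implicit Types (u v w : V) (n m l : int) (c d x y : R) (z : R[i]).

Let hE := fgapE H.
Let a0 := fgapa H.
Let hM := fgapM H.
Let hU := fgapU H.
Let hQ := fgapQ H.

Definition dval z : R[i] := (2 * (a 0)%:C)^-1 * (((pC P^`()).[z] + rt' z) / (pC Q).[z]
  + ((pC P).[z] + rt z) * (- (pC Q^`()).[z] / (pC Q).[z] ^+ 2)).
Definition dev z v : R[i] := (pC v.1^`()).[z] + (pC v.2^`()).[z] * val1 g E a P Q false z + (pC v.2).[z] * dval z.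

Lemma QH z : 0 < Im z -> (pC Q).[z] != 0.
Proof. by move=> z0; apply: (Q_neq0 H); rewrite gt_eqF. Qed.

Lemma holo_cst (c : R[i]) : holo (fun=> c) (fun=> 0).
Proof. by move=> f t l _ _; rewrite mul0r; exact: cder_cst. Qed.

Lemma holo_val : holo (val1 g E a P Q false) dval.
Proof.
have h1 := holoD (@holo_poly R P) (holo_rt g E).
have h2 := holoV QH (@holo_poly R Q).
have h3 := holoM (holo_cst (2 * (a 0)%:C)^-1) (holoM h1 h2).
move=> f t l f0 df; have := h3 f t l f0 df; rewrite mul0r add0r => d3.
by apply: cder_ext d3 => s; rewrite /val1 expr0 mul1r.
Qed.

Lemma holo_ev v : holo (fun z => ev false z v) (fun z => dev z v).
Proof.
have h := holoD (@holo_poly R v.1) (holoM (@holo_poly R v.2) holo_val).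
by move=> f t l f0 df; apply: cder_eq (h f t l f0 df) _; rewrite /dev; ring.
Qed.

Lemma devX z v : dev z (mulX v) = z * dev z v + ev false z v.
Proof. by rewrite /dev /mulX /ev /= !derivM derivX !mul1r !(pvD, pvM) pvXX; ring. Qed.
Lemma devD z u v : dev z (u + v) = dev z u + dev z v.
Proof. by rewrite /dev /= !derivD !pvD; ring. Qed.
Lemma devZ z c v : dev z (c *: v) = c%:C * dev z v.
Proof. by rewrite /dev /= !derivZ !pvZ; ring. Qed.

Lemma dev_three z n : (a n)%:C * dev z (e (n + 1)) + (a (n - 1))%:C * dev z (e (n - 1)) + (b n)%:C * dev z (e n)
  = z * dev z (e n) + ev false z (e n).
Proof. by rewrite -devX -(ebasP b a0) !devD !devZ. Qed.

Lemma dev0 z : dev z (e 0) = 0.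
Proof. by rewrite ebas0 /dev /= -polyC1 derivC deriv0 !pv0 !mul0r !addr0. Qed.

(** This is the Wronskian of the z-derivative of psi_+ with psi_-. Differentiating the equation in z
    adds the inhomogeneity psi_+, so the increments are psi_+ psi_- = F_n / Q. *)
Definition wronsk z n : R[i] := (a n)%:C *
  (dev z (e (n + 1)) * ev true z (e n) - dev z (e n) * ev true z (e (n + 1))).

Lemma wronsk_step z n : wronsk z n - wronsk z (n - 1) = ev false z (e n) * ev true z (e n).
Proof.
have h1 := dev_three z n; have h2 := ev_solves g E b P Q a0 true z n; rewrite /jacobi in h2.
rewrite /wronsk subrK.
transitivity (ev true z (e n) * ((a n)%:C * dev z (e (n + 1)) + (a (n - 1))%:C * dev z (e (n - 1)) + (b n)%:C * dev z (e n))
  - dev z (e n) * ((a n)%:C * ev true z (e (n + 1)) + (a (n - 1))%:C * ev true z (e (n - 1)) + (b n)%:C * ev true z (e n))).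
  by ring.
by rewrite h1 h2; ring.
Qed.

Lemma ev_diag z n : 0 < Im z -> ev false z (e n) * ev true z (e n) * (pC Q).[z] = (pC (F n)).[z].
Proof. by move=> z0; rewrite (ev_prod a0 hU _ _ (QH z0)) Bbilxx pv0 mul0r addr0. Qed.

Definition Spol (k : nat) : {poly R} := \sum_(1 <= j < k.+1) F j%:Z.

Lemma wronsk_sum z (k : nat) : 0 < Im z -> (wronsk z k%:Z - wronsk z 0) * (pC Q).[z] = (pC (Spol k)).[z].
Proof.
move=> z0; elim: k => [|k IH]; first by rewrite subrr mul0r /Spol big_geq// pv0.
rewrite /Spol big_nat_recr//= pvD -/(Spol k) -IH -ev_diag// -wronsk_step.
have -> : k.+1%:Z - 1 = k%:Z by lia.
by ring.
Qed.

Lemma F_neq0 z n : 0 < Im z -> (pC (F n)).[z] != 0.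
Proof. by move=> z0; apply: (gap_poly_neq0 (Fpol_gap H n)); rewrite gt_eqF. Qed.

Lemma ev_neq0 s z n : 0 < Im z -> ev s z (e n) != 0.
Proof.
move=> z0; have := F_neq0 n z0; rewrite -ev_diag//.
by case: s; apply: contraNneq => ->; rewrite ?mulr0 ?mul0r.
Qed.

Lemma ev_next_left z n : 0 < Im z ->
  2 * (a n)%:C * ev true z (e (n + 1)) * (pC (F n)).[z] = ((pC (W n)).[z] - rt z) * ev true z (e n).
Proof.
move=> z0; have q0 := QH z0; apply: (mulfI (ev_neq0 false n z0)); apply: (mulfI q0).
have h1 := ev_prod a0 hU (e n) (e (n + 1)) q0.
have hb : (a n)%:C * (pC (Bbil a (e n) (e (n + 1)))).[z] = - 2^-1.
  by rewrite BbilN -pvZ scalerN (Bbil_next b a0) pvN pvC fmorphV rmorph_nat.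
have hw : (pC (W n)).[z] = 2 * (a n)%:C * (pC (Abil a P Q U (e n) (e (n + 1)))).[z].
  by rewrite /Ppol pvZ rmorphM rmorph_nat.
transitivity (2 * (a n)%:C * (ev false z (e n) * ev true z (e (n + 1)) * (pC Q).[z]) * (pC (F n)).[z]); first by ring.
rewrite h1 -ev_diag// hw.
transitivity ((2 * (a n)%:C * (pC (Abil a P Q U (e n) (e (n + 1)))).[z] +
   2 * ((a n)%:C * (pC (Bbil a (e n) (e (n + 1)))).[z]) * rt z) * (ev false z (e n) * ev true z (e n) * (pC Q).[z])); first by ring.
have two : (2 : R[i]) != 0 by rewrite pnatr_eq0.
by rewrite hb; field.
Qed.

Lemma dev_next z n : 0 < Im z ->
  2 * (a n)%:C * (dev z (e (n + 1)) * (pC (F n)).[z] + ev false z (e (n + 1)) * (pC (F n)^`()).[z])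
  = ((pC (W n)^`()).[z] + rt' z) * ev false z (e n) + ((pC (W n)).[z] + rt z) * dev z (e n).
Proof.
move=> z0; pose f (t : R) : R[i] := z + t%:C * 1.
have f0 (t : R) : 0 < Im (f t) by rewrite /f mulr1 ImD /= addr0.
have f00 : f 0 = z by rewrite /f mul0r addr0.
have df : cder f 0 1 by exact: cder_line.
have h1 := holoM (holo_cst (2 * (a n)%:C)) (holoM (holo_ev (e (n + 1))) (@holo_poly R (F n))).
have h2 := holoM (holoD (@holo_poly R (W n)) (holo_rt g E)) (holo_ev (e n)).
have d1 := h1 f 0 1 (f0 0) df; have d2 := h2 f 0 1 (f0 0) df.
rewrite !f00 !mulr1 mul0r add0r in d1 d2; apply: (cder_uniq d1).
apply: cder_ext d2 => s; rewrite mulrA; exact: esym (ev_next b a0 hU n (QH (f0 s))).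
Qed.

Definition rterm z n : R[i] := (2^-1 * ((pC P^`()).[z] - (pC (W n)^`()).[z] - (pC Q^`()).[z] * ((pC P).[z] + rt z) / (pC Q).[z]
  + (pC (F n)^`()).[z] * ((pC (W n)).[z] + rt z) / (pC (F n)).[z])) / rt z.

(** [key] expresses the Wronskian at n by the logarithmic derivative, using the one-step ratios of
    both branches. Subtracting its value at 0, where psi_+ is constant in z, leaves the sum of the
    F_j; what remains is [rterm], which [rterm_bound] controls uniformly in k. *)
Lemma log_derivative z (k : nat) : 0 < Im z ->
  dev z (e k%:Z) / ev false z (e k%:Z) = (pC (Spol k)).[z] / rt z + rterm z k%:Z.
Proof.
move=> z0; have q0 := QH z0; have r0 : rt z != 0 by rewrite rt_neq0// gt_eqF.
have two : (2 : R[i]) != 0 by rewrite pnatr_eq0.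
have key n : 2 * wronsk z n * (pC Q).[z] = (pC (W n)^`()).[z] + rt' z + 2 * rt z * (dev z (e n) / ev false z (e n))
    - (pC (F n)^`()).[z] * ((pC (W n)).[z] + rt z) / (pC (F n)).[z].
  have f0 := F_neq0 n z0; have p0 := ev_neq0 false n z0.
  have h1 := dev_next n z0; have h2 := ev_next b a0 hU n q0; have h3 := ev_next_left n z0; have h4 := ev_diag n z0.
  rewrite /wronsk.
  move: (dev z (e (n + 1))) (dev z (e n)) (ev false z (e n)) (ev false z (e (n + 1))) (ev true z (e n)) (ev true z (e (n + 1)))
    h1 h2 h3 h4 p0 => D1 D0 p p1 q q1 h1 h2 h3 h4 p0.
  move: ((pC (F n)).[z]) ((pC (W n)).[z]) ((pC (F n)^`()).[z]) ((pC (W n)^`()).[z]) (rt z) (rt' z) (pC Q).[z] f0 h1 h2 h3 h4 q0 r0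
    => f w f' w' r r' qq f0 h1 h2 h3 h4 q0 r0.
  apply: (mulfI f0); apply: (mulfI f0).
  transitivity (f * qq * (q * (2 * (a n)%:C * (D1 * f + p1 * f'))) - qq * f' * q * (2 * (a n)%:C * p1 * f)
      - f * qq * D0 * (2 * (a n)%:C * q1 * f)); first by ring.
  rewrite h1 h2 h3.
  transitivity (f * (p * q * qq) * (w' + r') + f * 2 * r * (D0 / p) * (p * q * qq) - f' * (w + r) * (p * q * qq)).
    by field.
  by rewrite h4; field; rewrite f0 p0.
have := key k%:Z; have := key 0; rewrite dev0 mul0r mulr0 addr0 Fpol0 Ppol0 // => h0 hk.
have hs := wronsk_sum k z0.
have {}hs : 2 * (pC (Spol k)).[z] = 2 * wronsk z k%:Z * (pC Q).[z] - 2 * wronsk z 0 * (pC Q).[z] by rewrite -hs; ring.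
rewrite hk h0 in hs.
have f0 := F_neq0 k%:Z z0; have p0 := ev_neq0 false k%:Z z0.
have hs2 : (pC (Spol k)).[z] = 2^-1 * (2 * (pC (Spol k)).[z]) by rewrite mulKf.
rewrite hs2 hs /rterm; move: (dev z (e k%:Z) / ev false z (e k%:Z)) => L.
by field; rewrite q0 f0 r0.
Qed.
End LogDerivative.

(** Near x at least half of the distance d to y is kept; farther along the ray to z the height above
    the axis gives the bound. *)
Lemma segment_lower (R : realType) (z : R[i]) (x d : R) : 0 < Im z -> 0 < d -> exists2 c, 0 < c &
  forall t y : R, 0 <= t -> d <= `|x - y| -> c <= nc (x%:C + t%:C * (z - x%:C) - y%:C).
Proof.
move=> z0 d0; have l0 : 0 < nc (z - x%:C).
  by apply: lt_le_trans (Im_le_nc _); rewrite ImB /= subr0 gtr0_norm.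
have c0 : 0 < d * Im z / (2 * nc (z - x%:C)) by rewrite divr_gt0 ?mulr_gt0.
exists (Num.min (d / 2) (d * Im z / (2 * nc (z - x%:C)))); first by rewrite lt_min c0 divr_gt0.
move=> t y t0 hy; rewrite ge_min; have [h|h] := leP (t * nc (z - x%:C)) (d / 2).
  apply/orP; left.
  have := ncB (x%:C + t%:C * (z - x%:C) - y%:C) (t%:C * (z - x%:C)).
  rewrite (_ : _ - _ - _ = (x - y)%:C); last by rewrite rmorphB; ring.
  by rewrite nc_real ncM nc_real (ger0_norm t0); lra.
apply/orP; right; apply: le_trans (Im_le_nc _).
rewrite !(ImB, ImD) ImCM ImB /= !subr0 add0r ger0_norm; last by rewrite mulr_ge0// ltW.
rewrite ler_pdivrMr ?mulr_gt0//.
have -> : t * Im z * (2 * nc (z - x%:C)) = 2 * (t * nc (z - x%:C)) * Im z by ring.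
by rewrite ler_pM2r//; lra.
Qed.

Lemma ln_bound (R : realType) (m K y : R) : 0 < m -> m <= y -> y <= K -> `|ln y| <= `|ln m| + `|ln K|.
Proof.
move=> m0 my yK; have y0 := lt_le_trans m0 my; have K0 := lt_le_trans y0 yK.
have h1 : ln m <= ln y by rewrite ler_ln ?posrE.
have h2 : ln y <= ln K by rewrite ler_ln ?posrE.
rewrite ler_norml; have := ler_norm (- ln m); have := ler_norm (ln K); rewrite normrN.
by have := normr_ge0 (ln m); have := normr_ge0 (ln K); lra.
Qed.

Lemma ctends_nc (R : realType) (T : Type) (G : set_system T) {FG : Filter G} (f : T -> R[i]) l :
  ctends G f l -> nc (f t) @[t --> G] --> nc l.
Proof.
move=> /ctendsP h; apply/cvgrPdist_lt => d d0; have hd := h d d0; apply: filterS hd => t; apply: le_lt_trans.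
rewrite ler_norml; have := le_nc_dist l (f t); have := le_nc_dist (f t) l; rewrite (ncBC (f t)).
by lra.
Qed.

Section Growth.
Variables (R : realType) (g : nat) (E : nat -> R) (a b : int -> R) (P Q U : {poly R}) (M : R).
Hypothesis H : finite_gap g E a b P Q U M.
Local Notation rt := (Rhalf g E).
Local Notation V := ({poly R} * {poly R})%type.
Local Notation e := (ebas a b).
Local Notation ev := (ev g E a P Q).
Local Notation F := (Fpol a b P Q U).
Local Notation W := (Ppol a b P Q U).
Local Notation S := (Spol a b P Q U).
Local Notation rterm := (rterm g E a b P Q U).
Local Notation fprim := (fprim g E).
Local Notation bv := (bv g E).
Implicit Types (u v w : V) (m l : int) (c d x y : R) (z : R[i]).

Let hE := fgapE H.
Let a0 := fgapa H.
Let hM := fgapM H.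
Let hU := fgapU H.
Let hQ := fgapQ H.

Lemma band_distance (k : nat) x : (k <= g)%N -> in_band E k x -> exists2 d, 0 < d &
  (forall j, (j < g.*2.+2)%N -> d <= `|x - E j|) /\
  forall j y, (1 <= j <= g)%N -> E j.*2.-1 <= y <= E j.*2 -> d <= `|x - y|.
Proof.
move=> kg /andP[x1 x2]; exists (Num.min (x - E k.*2) (E k.*2.+1 - x)); first by rewrite lt_min !subr_gt0 x1.
split=> [j jg|j y jg /andP[y1 y2]]; rewrite ge_min.
  have [h|h] := leqP j k.*2.
    have := edges_le hE (i := j) (j := k.*2); rewrite h -ltnS => /(_ _) h'.
    have {}h' : E j <= E k.*2 by apply: h'; lia.
    by rewrite ger0_norm; [apply/orP; left; lra|lra].
  have h' : E k.*2.+1 <= E j by apply: (edges_le hE); lia.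
  by rewrite ler0_norm; [apply/orP; right; lra|lra].
have [h|h] := leqP j k.
  have h' : E j.*2 <= E k.*2 by apply: (edges_le hE); lia.
  by rewrite ger0_norm; [apply/orP; left; lra|lra].
have h' : E k.*2.+1 <= E j.*2.-1 by apply: (edges_le hE); lia.
by rewrite ler0_norm; [apply/orP; right; lra|lra].
Qed.

(** R^(1/2) is imaginary on the bands, so conjugation exchanges the two branches. *)
Lemma rt_conj_band s v (k : nat) x : (k <= g)%N -> in_band E k x ->
  ev (~~ s) x%:C v = (ev s x%:C v)^*.
Proof.
move=> kg xk.
have rC : (rt x%:C)^* = - rt x%:C by rewrite (rt_band hE kg xk); apply: c_eq; rewrite ?ReN ?ImN /=; ring.
have key q : ((2 * (a 0)%:C)^-1 * (((pC P).[x%:C] + q) / (pC Q).[x%:C]))^* =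
    (2 * (a 0)%:C)^-1 * (((pC P).[x%:C] + q^*) / (pC Q).[x%:C]).
  have gen (x1 x2 x3 : R) : ((x1%:C)^-1 * ((x2%:C + q) / x3%:C))^* = (x1%:C)^-1 * ((x2%:C + q^*) / x3%:C).
    etransitivity; first exact: conjMC.
    congr (_ * _); first by etransitivity; [exact: conjVC|congr (_^-1); exact: conjCR].
    etransitivity; first exact: conjMC.
    congr (_ * _); first by etransitivity; [exact: conjDC|congr (_ + _); exact: conjCR].
    by etransitivity; [exact: conjVC|congr (_^-1); exact: conjCR].
  have e2 : (2 * a 0)%:C = 2 * (a 0)%:C :> R[i] by rewrite mulr_natl mulr2n rmorphD /= mulr_natl mulr2n.
  by have := gen (2 * a 0) P.[x] Q.[x]; rewrite e2 -!pC_real.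
have st (x1 x2 : R) (w : R[i]) : (x1%:C + x2%:C * w)^* = x1%:C + x2%:C * w^*.
  etransitivity; first exact: conjDC.
  congr (_ + _); first exact: conjCR.
  by etransitivity; [exact: conjMC|congr (_ * _); exact: conjCR].
have := st v.1.[x] v.2.[x] (val1 g E a P Q s x%:C); rewrite -!pC_real => {}st.
have e2 : (val1 g E a P Q s x%:C)^* = val1 g E a P Q (~~ s) x%:C; last first.
  by rewrite /ev; etransitivity; last exact: (esym st); congr (_ + _ * _); exact: esym e2.
etransitivity; first exact: key; congr (_ * ((_ + _) / _)).
case: s {st} => /=; rewrite ?expr1 ?expr0 ?mulN1r ?mul1r; last exact: rC.
by etransitivity; [exact: (rmorphN (@conjc R))|rewrite -[RHS]opprK; congr (- _); exact: rC].
Qed.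

(** On a band |psi_+|^2 |Q| = |F_n|, and F_n is bounded from both sides because its roots stay in
    the gaps. *)
Lemma ev_band_bound (k : nat) x : (k <= g)%N -> in_band E k x -> exists2 C, 0 <= C &
  forall n : int, ev false x%:C (e n) != 0 /\ `|ln (nc (ev false x%:C (e n)))| <= C.
Proof.
move=> kg xk; have [d d0 [_ hd]] := band_distance kg xk.
have q0 : (pC Q).[x%:C] != 0 by rewrite pC_real fmorph_eq0; apply: (gap_poly_neq0r hE hQ kg xk).
have lowF n : d ^+ g <= nc (pC (F n)).[x%:C].
  apply: (gap_poly_ge (Fpol_gap H n)) => [|j y jg hy]; first exact: ltW.
  by rewrite -rmorphB nc_real; exact: hd jg hy.
have [C C0 hC] := uniform_bounds H `|x|.
have upF n : nc (pC (F n)).[x%:C] <= C by have [] := hC n x%:C; rewrite ?nc_real.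
have key n : nc (ev false x%:C (e n)) ^+ 2 * nc (pC Q).[x%:C] = nc (pC (F n)).[x%:C].
  have := ev_prod a0 hU (e n) (e n) q0; rewrite Bbilxx pv0 mul0r addr0 => /(congr1 (@nc R)).
  by rewrite !ncM (rt_conj_band false _ kg xk) nc_conj -expr2.
have dg : 0 < d ^+ g by rewrite exprn_gt0.
have Q0 : 0 < nc (pC Q).[x%:C] by rewrite nc_gt0.
exists (2^-1 * (`|ln (d ^+ g / nc (pC Q).[x%:C])| + `|ln (C / nc (pC Q).[x%:C])|)).
  by rewrite mulr_ge0// ?addr_ge0.
move=> n; have e1 : nc (ev false x%:C (e n)) ^+ 2 = nc (pC (F n)).[x%:C] / nc (pC Q).[x%:C].
  by rewrite -key mulfK ?gt_eqF.
have p0 : 0 < nc (ev false x%:C (e n)).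
  rewrite lt_def nc_ge0 andbT; apply: contraTneq (lt_le_trans dg (lowF n)) => p0.
  by rewrite -key p0 expr0n mul0r ltxx.
split; first by rewrite -nc_gt0.
have -> : ln (nc (ev false x%:C (e n))) = 2^-1 * ln (nc (ev false x%:C (e n)) ^+ 2).
  by rewrite lnXn// -[X in _ * X]mulr_natl mulrA mulVf ?mul1r ?pnatr_eq0.
rewrite e1 normrM gtr0_norm ?invr_gt0// ler_pM2l ?invr_gt0//.
apply: ln_bound; first by rewrite divr_gt0.
  by rewrite ler_pM2r ?invr_gt0.
by rewrite ler_pM2r ?invr_gt0.
Qed.

Lemma rterm_bound z (k : nat) x : 0 < Im z -> (k <= g)%N -> in_band E k x -> exists2 C, 0 <= C &
  forall (n : int) (t : R), 0 < t <= 1 -> nc (rterm (x%:C + t%:C * (z - x%:C)) n) <= C.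
Proof.
move=> z0 kg xk; have [d d0 [hd1 hd2]] := band_distance kg xk.
have [c c0 hc] := segment_lower x z0 d0.
pose r := `|x| + nc (z - x%:C).
have [C C0 hC] := uniform_bounds H r.
have [K K0 hK] := poly_bound (edge_poly g E) r.
pose G := C * (C + (1 + K)) / c ^+ g.
exists (2^-1 * (C + C + G + G) / c ^+ g.+1).
  by rewrite /G !(mulr_ge0, addr_ge0, invr_ge0, exprn_ge0)// ltW.
move=> n t /andP[t0 t1]; set w := _ + _.
have wr : nc w <= r.
  apply: le_trans (ncD _ _) _; rewrite nc_real lerD2l ncM nc_real gtr0_norm//.
  by rewrite ler_piMl ?nc_ge0.
have low p : gap_poly g E p -> c ^+ g <= nc (pC p).[w].
  move=> hp; apply: (gap_poly_ge hp) => [|j y jg hy]; first exact: ltW.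
  by apply: hc; [exact: ltW|exact: hd2 jg hy].
have rlow : c ^+ g.+1 <= nc (rt w).
  rewrite nc_rt -[c]sqr_sqrtr ?(ltW c0)// -exprM mul2n doubleS -[X in _ ^+ X]subn0 -prodr_const_nat.
  rewrite !big_mkord; apply: ler_prod => j _; rewrite sqrtr_ge0 /= ler_wsqrtr//.
  by apply: hc; [exact: ltW|apply: hd1].
have rup : nc (rt w) <= 1 + K.
  have := hK w wr; rewrite -rt_sqr ncX => h.
  have := sqr_ge0 (nc (rt w) - 1); rewrite sqrrB1; have := nc_ge0 (rt w); move: h.
  by move: (nc (rt w)) => y h y0; rewrite expr2 in h *; lra.
have Fn := low _ (Fpol_gap H n); have Qn := low _ hQ.
have [f1 w1 f2 w2] := hC n w wr; have := hC 0 w wr; rewrite Fpol0 Ppol0// => -[q1 p1 q2 p2].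
have cg : 0 < c ^+ g by rewrite exprn_gt0.
have cg1 : 0 < c ^+ g.+1 by rewrite exprn_gt0.
have frac (A B D : R[i]) : nc A <= C -> nc B <= C -> c ^+ g <= nc D -> nc (A * (B + rt w) / D) <= G.
  move=> hA hB hD; rewrite !ncM ncV; apply: ler_pM => //; rewrite ?mulr_ge0 ?invr_ge0 ?nc_ge0//.
    apply: ler_pM; rewrite ?nc_ge0//; apply: le_trans (ncD _ _) _; exact: lerD.
  by rewrite lef_pV2 ?posrE//; apply: lt_le_trans hD.
rewrite /rterm ncM ncV; apply: ler_pM; rewrite ?invr_ge0 ?nc_ge0//; last first.
  by rewrite lef_pV2 ?posrE//; apply: lt_le_trans rlow.
rewrite ncM; apply: ler_pM; rewrite ?nc_ge0//.
  by rewrite ncV nc_nat.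
have h1 := frac _ _ _ q2 p1 Qn; have h2 := frac _ _ _ f2 w1 Fn.
apply: le_trans (ncD _ _) _; apply: lerD => //.
apply: le_trans (ncB _ _) _; apply: lerD => //.
apply: le_trans (ncB _ _) _; exact: lerD.
Qed.

(** The logarithmic derivative is integrated along the segment from x to z; at x the logarithm of
    |psi_+| is bounded in n, and along the segment so is [rterm]. *)
Lemma log_growth z (k : nat) x : 0 < Im z -> (k <= g)%N -> in_band E k x -> exists2 C, 0 <= C &
  forall n : nat, `|ln (nc (ev false z (e n%:Z))) - Re (fprim (S n) z - bv (S n) x)| <= C.
Proof.
move=> z0 kg xk; have [C1 C10 h1] := ev_band_bound kg xk; have [C2 C20 h2] := rterm_bound z0 kg xk.
exists (C1 + C2 * nc (z - x%:C)); first by rewrite addr_ge0 ?mulr_ge0 ?nc_ge0.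
move=> n; have [p0 hp] := h1 n%:Z.
pose w (t : R) : R[i] := x%:C + t%:C * (z - x%:C).
have wI t : Im (w t) = t * Im z by rewrite ImD ImCM ImB /= subr0 add0r.
have w1 : w 1 = z by rewrite /w mul1r addrC subrK.
pose h t := ln (nc (ev false (w t) (e n%:Z))) - Re (fprim (S n) (w t)).
have dh (t : R) : 0 < t -> is_derive t 1 h (Re (rterm (w t) n%:Z * (z - x%:C))).
  move=> t0; have wt : 0 < Im (w t) by rewrite wI mulr_gt0.
  have d1 := log_modulus_derive (ev_neq0 H false n%:Z wt) (holo_ev H (e n%:Z) wt (cder_line x%:C (z - x%:C) t)).
  have [d2 _] := fprimP g E (S n) (z := x%:C) (v := z - x%:C) wt.
  have d3 : is_derive t 1 h _ := is_deriveB d1 d2.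
  apply: (is_derive_eq' d3); rewrite -ReB mulrAC (log_derivative H n wt) /fdens.
  by congr Re; ring.
have lip s : 0 < s <= 1 -> `|h 1 - h s| <= C2 * nc (z - x%:C).
  move=> /andP[s0 s1]; have -> : C2 * nc (z - x%:C) = C2 * nc (z - x%:C) * 1 by rewrite mulr1.
  apply: (@le_trans _ _ (C2 * nc (z - x%:C) * (1 - s))); last first.
    by apply: ler_wpM2l; [rewrite mulr_ge0 ?nc_ge0|lra].
  apply: (is_derive_lip s1 (f' := fun t => Re (rterm (w t) n%:Z * (z - x%:C)))) => t; rewrite in_itv /= => /andP[st t1].
    by apply: dh; lra.
  apply: le_trans (Re_le_nc _) _; rewrite ncM ler_wpM2r ?nc_ge0//; apply: h2.
  by rewrite t1 andbT; lra.
have wlim : ctends (0 : R)^'+ w x%:C.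
  have -> : x%:C = x%:C + 0%:C * (z - x%:C) by rewrite mul0r addr0.
  apply: ctendsD; first exact: ctends_cst.
  apply: ctendsM; last exact: ctends_cst.
  by split=> /=; [exact: cvg_at_right_filter cvg_id|exact: cvg_cst].
have wpos : \forall t \near (0 : R)^'+, 0 < Im (w t).
  by near=> t; rewrite wI mulr_gt0//; near: t; exact: nbhs_right_gt.
have hlim : h t @[t --> (0 : R)^'+] --> ln (nc (ev false x%:C (e n%:Z))) - Re (bv (S n) x).
  apply: cvgB; last first.
    by have [] := bval_curve hE (fprimP g E (S n)) wlim wpos.
  have hw : \forall t \near (0 : R)^'+, 0 <= Im (w t) by apply: filterS wpos => t /ltW.
  have c1 : ctends (0 : R)^'+ (fun t => ev false (w t) (e n%:Z)) (ev false x%:C (e n%:Z)) by exact: (ev_curve H false (e n%:Z) kg xk wlim hw).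
  have c2 : nc (ev false (w t) (e n%:Z)) @[t --> (0 : R)^'+] --> nc (ev false x%:C (e n%:Z)) by exact: ctends_nc.
  have cl : {for (nc (ev false x%:C (e n%:Z))), continuous (@ln R)} by apply: continuous_ln; rewrite nc_gt0.
  exact: (cvg_comp _ _ c2 cl).
have key : `|h 1 - (ln (nc (ev false x%:C (e n%:Z))) - Re (bv (S n) x))| <= C2 * nc (z - x%:C).
  apply: (cvg_dist_le hlim); near=> t; apply: lip; apply/andP; split; near: t; first exact: nbhs_right_gt.
  exact: nbhs_right_le.
rewrite /h w1 in key; rewrite ReB.
move: key hp; rewrite !ler_norml; lra.
Unshelve. all: by end_near.
Qed.
End Growth.

(** On a space of dimension n, functionals G_0, ..., G_{n-1} without common nontrivial zero form a
    basis of the dual: the matrix of their values on monomials is invertible, and [l] is a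
    combination of them. *)
Lemma dual_bound (R : realType) (n : nat) (G : nat -> {poly R} -> R) (l : {poly R} -> R) :
  (forall (j : nat) c p q, G j (c *: p + q) = c * G j p + G j q) ->
  (forall c p q, l (c *: p + q) = c * l p + l q) ->
  (forall p : {poly R}, (size p <= n)%N -> (forall j, (j < n)%N -> G j p = 0) -> p = 0) ->
  exists2 K : R, 0 <= K & forall (p : {poly R}) c, (size p <= n)%N -> (forall j, (j < n)%N -> `|G j p| <= c) -> `|l p| <= K * c.
Proof.
move=> hG hl inj.
have ext (f : {poly R} -> R) (h : forall c p q, f (c *: p + q) = c * f p + f q) (p : {poly R}) :
    (size p <= n)%N -> f p = \sum_(i < n) p`_i * f 'X^i.
  move=> sp; have f0 : f 0 = 0 by have := h (-1) 0 0; rewrite scaler0 addr0; lra.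
  have {1}-> : p = \sum_(i < n) p`_i *: 'X^i.
    by rewrite -(poly_def n (fun i => p`_i)) -[LHS](poly_rV_K sp) /rVpoly; apply/polyP => i;
       rewrite !coef_poly; case: ifP => // ilt; rewrite insubT mxE.
  by elim/big_rec2 : _ => [//|i y1 y2 _ <-]; exact: h.
pose A : 'M[R]_n := \matrix_(i, j) G j 'X^i.
have Grow (p : {poly R}) : (size p <= n)%N -> poly_rV p *m A = \row_j G j p.
  move=> sp; apply/rowP => j; rewrite !mxE (ext (G j) (hG j) p sp).
  by apply: eq_bigr => i _; rewrite !mxE.
have Au : A \in unitmx.
  rewrite -row_free_unit -kermx_eq0; apply/eqP/row_matrixP => i; rewrite row0.
  set v := matrix.row i _; have vA : v *m A = 0.
    by apply/sub_kermxP; exact: row_sub.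
  rewrite -(rVpolyK v) (_ : rVpoly v = 0) ?linear0//; apply: inj; first exact: size_poly.
  move=> j jn; have := Grow (rVpoly v) (size_poly _ _); rewrite rVpolyK vA => /rowP/(_ (Ordinal jn)).
  by rewrite !mxE.
exists (\sum_(i < n) (\sum_(j < n) `|invmx A j i|) * `|l 'X^i|).
  by apply: sumr_ge0 => i _; rewrite mulr_ge0// sumr_ge0.
move=> p c sp hp; rewrite (ext l hl p sp) mulr_suml; apply: le_trans (ler_norm_sum _ _ _) _.
apply: ler_sum => i _; rewrite normrM mulrAC ler_wpM2r//.
have -> : p`_i = \sum_(j < n) G j p * invmx A j i.
  have := congr1 (fun B => B *m invmx A) (Grow p sp); rewrite mulmxK// => /rowP/(_ i); rewrite !mxE => ->.
  by apply: eq_bigr => j _; rewrite mxE.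
apply: le_trans (ler_norm_sum _ _ _) _; rewrite mulr_suml; apply: ler_sum => j _.
by rewrite normrM mulrC ler_wpM2l// hp.
Qed.

(** * Integrals over the gaps *)

Section GapFunctionals.
Variables (R : realType) (g : nat) (E : nat -> R).
Hypothesis hE : band_edges g E.
Local Notation rt := (Rhalf g E).
Local Notation fprim := (fprim g E).
Local Notation bv := (bv g E).
Implicit Types (p q : {poly R}) (z : R[i]).

Lemma fprim_bv_lin (c x : R) p q z : 0 < Im z -> fprim (c *: p + q) z - bv (c *: p + q) x =
  c%:C * (fprim p z - bv p x) + (fprim q z - bv q x).
Proof.
move=> z0; pose P w := c%:C * fprim p w + fprim q w.
have hP : line_primitive P (fdens g E (c *: p + q)).
  move=> w v t t0.
  apply: cder_eq (cderD (cderM (cder_cst c%:C t) (fprimP g E p t0)) (fprimP g E q t0)) _.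
  by rewrite /fdens pvD pvZ; ring.
have cl p' : ctends (0 : R)^'+ (fun y => fprim p' (x +i* y)) (bv p' x).
  by apply: bval_lim => //; exact: fprimP.
have c1 : ctends (0 : R)^'+ (fun y => fprim (c *: p + q) z - fprim (c *: p + q) (x +i* y))
    (fprim (c *: p + q) z - bv (c *: p + q) x) by apply: ctendsB; [exact: ctends_cst|exact: cl].
have c2 : ctends (0 : R)^'+ (fun y => P z - P (x +i* y)) (P z - (c%:C * bv p x + bv q x)).
  apply: ctendsB; first exact: ctends_cst.
  by apply: ctendsD; [apply: ctendsM; [exact: ctends_cst|]|]; exact: cl.
transitivity (P z - (c%:C * bv p x + bv q x)); last by rewrite /P; ring.
apply: (ctends_unique c1); have [c21 c22] := c2.
have e : \forall y \near (0 : R)^'+, P z - P (x +i* y) = fprim (c *: p + q) z - fprim (c *: p + q) (x +i* y).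
  near=> y; rewrite (primitive_unique (z := z) (w := x +i* y) hP (fprimP g E (c *: p + q)))//=.
by split; [apply: cvg_trans c21|apply: cvg_trans c22]; apply: near_eq_cvg; apply: filterS e => y ->.
Unshelve. all: by end_near.
Qed.

(** Real parts are constant on bands, so this is the integral of p / R^(1/2) over the gap between
    the bands ([gap_integral]). Midpoints are used because [log_growth] is stated at interior band
    points. *)
Definition gapf (j : nat) p : R := Re (bv p (midband E j.+1)) - Re (bv p (midband E j)).

Lemma gapf_lin (j : nat) (c : R) p q : gapf j (c *: p + q) = c * gapf j p + gapf j q.
Proof. by rewrite /gapf -!ReB (bv_lin hE) (ReD (_ * _)) ReCM. Qed.

Lemma gapf_edges (j : nat) p : (j < g)%N -> gapf j p = Re (bv p (E j.+1.*2)) - Re (bv p (E j.*2.+1)).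
Proof.
move=> jg; have /andP[h1 h2] := midbandP hE (ltnW jg); have /andP[h3 h4] := midbandP hE jg.
have e1 := hE (i := j.*2); have e2 := hE (i := j.+1.*2).
rewrite /gapf /bv -(Re_bval_band hE (fprimP g E p) jg (x := midband E j.+1) (x' := E j.+1.*2)).
- rewrite -(Re_bval_band hE (fprimP g E p) (ltnW jg) (x := midband E j) (x' := E j.*2.+1))//.
    by rewrite !ltW.
  by rewrite lexx andbT ltW// e1//; clear -jg; lia.
- by rewrite !ltW.
- by rewrite lexx /= ltW// e2//; clear -jg; lia.
Qed.

(** Rolle's theorem applies to the real part of the primitive, whose derivative on the gap is p /
    R^(1/2). *)
Lemma gap_root (j : nat) p : (j < g)%N -> gapf j p = 0 -> exists2 x, E j.*2.+1 < x < E j.+1.*2 & root p x.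
Proof.
move=> jg; rewrite gapf_edges// => /eqP; rewrite subr_eq0 => /eqP e.
have j1 : (1 <= j.+1 <= g)%N by [].
have lt : E j.*2.+1 < E j.+1.*2 by apply: (edges_lt hE); clear -jg; lia.
have der x : E j.*2.+1 < x < E j.+1.*2 -> is_derive x 1 (fun y => Re (bv p y)) (Re (fdens g E p x%:C)).
  move=> xj; have [hx _] := gap_position hE j1 xj.
  by have [] := bval_der hE (fprimP g E p) (rt_real_neq0 hx).
have [x xj dx] : exists2 x, x \in `]E j.*2.+1, E j.+1.*2[ & is_derive x 1 (fun y => Re (bv p y)) 0.
  apply: Rolle => //.
  - by move=> x; rewrite in_itv /= => xj; have [] := der x xj.
  - by apply: continuous_subspaceT; exact: (bval_continuous hE (fprimP g E p)).1.
rewrite in_itv /= in xj; exists x => //; have [hx hb] := gap_position hE j1 xj.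
have e0 : Re (fdens g E p x%:C) = 0.
  have [_ <-] := der x xj; by have [_ ->] := dx.
have i0 := Im_fdens_gap hE p hb.
have : fdens g E p x%:C = 0 by apply: c_eq.
move/eqP; rewrite mulf_eq0 invr_eq0 (negPf (rt_real_neq0 hx)) orbF pC_real.
by rewrite (fmorph_eq0 (real_complex R)).
Qed.

(** One root in each of the g gaps is too many for a nonzero polynomial of degree below g. *)
Lemma gapf_inj p : (size p <= g)%N -> (forall j, (j < g)%N -> gapf j p = 0) -> p = 0.
Proof.
move=> sp h.
have /choice[r hr] : forall j : nat, exists x, (j < g)%N -> E j.*2.+1 < x < E j.+1.*2 /\ root p x.
  move=> j; have [jg|] := ltnP j g; last by exists 0.
  by have [x x1 x2] := gap_root jg (h j jg); exists x.
apply: (@roots_geq_poly_eq0 _ p (mkseq r g)).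
- apply/allP => x /mapP[j]; rewrite mem_iota => jg ->; exact: (hr j jg).2.
- apply/mkseq_uniqP => i j; rewrite !inE.
  wlog ij : i j / (i < j)%N => [hw ig jg e|ig jg e].
    case: (ltngtP i j) => // ij; first exact: hw.
    by apply/esym; apply: hw.
  have [/andP[_ i2] _] := hr i ig; have [/andP[j1 _] _] := hr j jg.
  have le : E i.+1.*2 <= E j.*2.+1 by apply: (edges_le hE); clear -ij jg; lia.
  by exfalso; rewrite e in i2; have := lt_le_trans i2 le; have := lt_trans j1; lra.
- by rewrite size_mkseq.
Qed.

Lemma gap_functional_bound z : 0 < Im z -> exists2 K : R, 0 <= K & forall p c, (size p <= g)%N ->
  (forall j, (j < g)%N -> `|gapf j p| <= c) -> `|Re (fprim p z - bv p (midband E 0))| <= K * c.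
Proof.
move=> z0; apply: (@dual_bound R g gapf (fun p => Re (fprim p z - bv p (midband E 0)))).
- by move=> j c p q; exact: gapf_lin.
- by move=> c p q; rewrite (fprim_bv_lin _ _ _ _ z0) (ReD (_ * _)) ReCM.
- exact: gapf_inj.
Qed.

Lemma absrt_gap_lower i : (i.+1 < g.*2.+2)%N -> exists2 c, 0 < c & forall x, E i < x < E i.+1 ->
  c * (Num.sqrt (x - E i) * Num.sqrt (E i.+1 - x)) <= absrt g E x.
Proof.
move=> ig; have [d d0 hd] := edge_gap hE.
exists (\prod_(0 <= k < g.*2.+2 | (k != i) && (k != i.+1)) Num.sqrt d).
  by apply: prodr_gt0 => k _; rewrite sqrtr_gt0.
move=> x /andP[x1 x2]; rewrite /absrt (bigD1_seq i) ?iota_uniq ?mem_index_iota ?(ltnW ig)//=.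
rewrite -[X in _ <= _ * X]big_filter (bigD1_seq i.+1) ?filter_uniq ?iota_uniq ?mem_filter ?mem_index_iota ?ig ?gtn_eqF//.
rewrite big_filter_cond.
rewrite (ger0_norm (_ : 0 <= x - E i)) ?subr_ge0 ?(ltW x1)// (ler0_norm (_ : x - E i.+1 <= 0)) ?subr_le0 ?(ltW x2)// opprB.
rewrite [X in _ <= X]mulrA mulrC ler_wpM2l ?mulr_ge0 ?sqrtr_ge0//.
rewrite [X in X <= _]big_nat_cond [X in _ <= X]big_nat_cond; apply: ler_prod => k /andP[kg /andP[k1 k2]].
rewrite sqrtr_ge0 /= ler_wsqrtr//.
have [ki|ik|ki] := ltngtP k i; last by rewrite ki eqxx in k1.
  have := hd k i; rewrite ki (ltnW ig) => /(_ isT) h; rewrite ger0_norm; lra.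
have h : d <= E k - E i.+1.
  by apply: hd; rewrite (andP kg).2 andbT ltn_neqAle eq_sym k2.
by rewrite ler0_norm; lra.
Qed.
End GapFunctionals.

(** * The quasi-momentum map *)

Section QuasiMomentum.
Variables (R : realType) (g : nat) (E lam : nat -> R).
Hypothesis hE : band_edges g E.
Hypothesis hlam : qm_zeros g E lam.
Local Notation rt := (Rhalf g E).
Local Notation fprim := (fprim g E).
Local Notation bv := (bv g E).
Implicit Types (p q : {poly R}) (z : R[i]).

Definition qmpoly : {poly R} := \prod_(1 <= k < g.+1) ('X - (lam k)%:P).
Local Notation L := qmpoly.

Lemma qm_densityE z : qm_density g E lam z = fdens g E L z.
Proof.
by rewrite /qm_density /fdens pv_prod; congr (_ / _); apply: eq_bigr => k _; rewrite pvXsubC.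
Qed.

Lemma qmpoly_gap : gap_poly g E L.
Proof. by exists lam => // j /hlam[/andP[h1 h2] _]; rewrite !ltW. Qed.

Lemma ctends_real (t : R) : ctends (nbhs t) (fun x : R => x%:C) t%:C.
Proof. by split=> /=; [exact: cvg_id|exact: cvg_cst]. Qed.

Lemma gap_integral p (j : nat) : (j < g)%N ->
  \int[lebesgue_measure]_(x in `[E j.*2.+1, E j.+1.*2]) Re (fdens g E p x%:C) = gapf g E j p.
Proof.
move=> jg; rewrite gapf_edges//.
have j1 : (1 <= j.+1 <= g)%N by [].
have lt : E j.*2.+1 < E j.+1.*2 by apply: (edges_lt hE); clear -jg; lia.
have ig : (j.*2.+1.+1 < g.*2.+2)%N by clear -jg; lia.
have [c c0 hc] := absrt_gap_lower hE ig.
have [K K0 hK] := poly_bound p (`|E j.*2.+1| + `|E j.+1.*2|).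
pose l := E j.+1.*2 - E j.*2.+1.
have l0 : 0 < Num.sqrt l by rewrite sqrtr_gt0 subr_gt0.
apply: (proj2 (@improper_FTC R (fun x => Re (fdens g E p x%:C)) (fun x => Re (bv p x)) (E j.*2.+1) (E j.+1.*2)
  (2 * (K / (c * Num.sqrt l))) lt _ _ _ _)).
- move=> t; rewrite in_itv /= => tj; have [hx _] := gap_position hE j1 tj.
  by have [] := bval_der hE (fprimP g E p) (rt_real_neq0 hx).
- by apply: continuous_subspaceT; exact: (bval_continuous hE (fprimP g E p)).1.
- move=> t; rewrite in_itv /= => tj; have [hx _] := gap_position hE j1 tj.
  have [] // : ctends (nbhs t) (fun x : R => fdens g E p x%:C) (fdens g E p t%:C).
  apply: ctends_fdens => //; [by apply: nearW => x /=|exact: rt_real_neq0|exact: ctends_real].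
- move=> t; rewrite in_itv /= => tj; have /andP[t1 t2] := tj; have low := hc t tj.
  have s1 : 0 < Num.sqrt (t - E j.*2.+1) by rewrite sqrtr_gt0 subr_gt0.
  have s2 : 0 < Num.sqrt (E j.+1.*2 - t) by rewrite sqrtr_gt0 subr_gt0.
  have ss : Num.sqrt l <= Num.sqrt (t - E j.*2.+1) + Num.sqrt (E j.+1.*2 - t).
    rewrite -(ler_pXn2r (ltn0Sn 1)) ?nnegrE ?addr_ge0 ?ltW// sqrrD !sqr_sqrtr ?subr_ge0 ?ltW//.
    have := mulr_gt0 s1 s2; rewrite /l; move: (_ * _) => y; rewrite mulr2n; lra.
  have up : nc (fdens g E p t%:C) <= K / (c * (Num.sqrt (t - E j.*2.+1) * Num.sqrt (E j.+1.*2 - t))).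
    rewrite /fdens ncM ncV -absrt_nc; apply: ler_pM; rewrite ?invr_ge0 ?nc_ge0 ?absrt_ge0//.
    - by rewrite absrt_nc nc_ge0.
    - apply: hK; rewrite nc_real ler_norml; have := ler_norm (E j.+1.*2); have := ler_norm (- E j.*2.+1); rewrite normrN.
      by have := normr_ge0 (E j.+1.*2); have := normr_ge0 (E j.*2.+1); lra.
    - by rewrite lef_pV2 ?posrE ?mulr_gt0//; apply: lt_le_trans low; rewrite !mulr_gt0.
  apply: le_trans (Re_le_nc _) (le_trans up _).
  move: s1 s2 ss l0; move: (Num.sqrt (t - _)) (Num.sqrt (_ - t)) (Num.sqrt l) => s1 s2 s s10 s20 ss s0.
  have -> : 2 * (K / (c * s)) / (2 * s1) + 2 * (K / (c * s)) / (2 * s2) = K / (c * (s1 * s2)) * ((s1 + s2) / s).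
    by field; rewrite !gt_eqF.
  by rewrite ler_peMr ?divr_ge0 ?mulr_ge0 ?(ltW c0) ?(ltW s10) ?(ltW s20)// ler_pdivlMr// mul1r.
Qed.

Lemma gapf_qm (j : nat) : (j < g)%N -> gapf g E j L = 0.
Proof.
move=> jg; have [_ h] := hlam (j := j.+1) jg; rewrite -gap_integral//.
have e := congr1 (@complex.Re R) h; rewrite /cint /= in e; rewrite -[RHS]e.
by congr Rintegral; apply/funext => x; rewrite qm_densityE.
Qed.

(** The real part is constant on each band, and the condition defining the lambda_j makes it equal
    on neighbouring bands; this is |w| = 1 on the spectrum. *)
Lemma Re_bv_qm x : bands g E x -> Re (bv L x) = Re (bv L (E 0%N)).
Proof.
move=> [k kg xk]; rewrite /bv -(Re_bval_band hE (fprimP g E L) kg xk (x' := E k.*2)); last first.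
  by rewrite lexx ltW//; apply: hE; clear -kg; lia.
elim: k kg {xk} => [//|k IH] kg; rewrite -IH; last exact: ltnW.
rewrite -(Re_bval_band hE (fprimP g E L) (ltnW kg) (x := E k.*2) (x' := E k.*2.+1)); last first.
- by rewrite lexx andbT ltW//; apply: hE; clear -kg; lia.
- by rewrite lexx ltW//; apply: hE; clear -kg; lia.
by have /eqP := gapf_qm kg; rewrite gapf_edges// subr_eq0 => /eqP.
Qed.

(** The segment starts on the axis, possibly at an edge, where the density has an inverse
    square-root singularity. Hence the improper theorem is used, with a primitive [G] completed at t
    = 0 by the boundary value. *)
Lemma segment_integral p (z : R[i]) (x : R) : 0 < Im z ->
  lebesgue_measure.-integrable `[0, 1] (EFin \o (fun t => Im (fdens g E p (x%:C + t%:C * (z - x%:C))))) /\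
  (z - x%:C) * cint `[0, 1] (fun t => fdens g E p (x%:C + t%:C * (z - x%:C))) = fprim p z - bv p x.
Proof.
move=> z0; set v := z - x%:C.
have vI : Im v = Im z by rewrite ImB /= subr0.
have v0 : v != 0 by apply: contraTneq z0 => e; rewrite -vI e ltxx.
pose w (t : R) : R[i] := x%:C + t%:C * v.
have wI t : Im (w t) = t * Im z by rewrite ImD ImCM vI add0r.
pose G (t : R) : R[i] := (if t == 0 then bv p x else fprim p (w t)) / v.
have dG (t : R) : 0 < t -> cder G t (fdens g E p (w t)).
  move=> t0; have wt : 0 < Im (w t) by rewrite wI mulr_gt0.
  have d1 := cderM (fprimP g E p (z := x%:C) (v := v) wt) (cder_cst v^-1 t).
  have d2 : cder (fun s => fprim p (w s) / v) t (fdens g E p (w t)).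
    by apply: (cder_eq d1); rewrite mulr0 addr0 mulfK.
  have hn : \forall s \near t, fprim p (w s) / v = G s.
    near=> s; have s0 : 0 < s by near: s; exact: lt_nbhsr.
    by rewrite /G gt_eqF.
  by split; [have [d3 _] := d2|have [_ d3] := d2]; apply: near_eq_is_derive d3; apply: filterS hn => s ->.
have [C C0 hC] := fdens_strip hE p (`|x| + nc v).
have [hloc _] := fdens_locbd g E p; have [K1 hK1] := hloc 1 (`|x| + nc v) ltr01.
pose K := C / Num.sqrt (Im z) + 2 * `|K1|.
have bnd (t : R) : 0 < t < 1 -> nc (fdens g E p (w t)) <= K / (2 * Num.sqrt t) + K / (2 * Num.sqrt (1 - t)).
  move=> /andP[t0 t1].
  have st : 0 < Num.sqrt t by rewrite sqrtr_gt0.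
  have sz : 0 < Num.sqrt (Im z) by rewrite sqrtr_gt0.
  have st1 : Num.sqrt t <= 1 by rewrite -[leRHS]sqrtr1 ler_wsqrtr// ltW.
  have K0 : 0 <= K by rewrite addr_ge0 ?divr_ge0 ?(ltW sz)// mulr_ge0.
  have wr : nc (w t) <= `|x| + nc v.
    apply: le_trans (ncD _ _) _; rewrite nc_real lerD2l ncM nc_real gtr0_norm//.
    by rewrite ler_piMl ?nc_ge0// ltW.
  suff h : nc (fdens g E p (w t)) <= K / (2 * Num.sqrt t).
    by apply: (le_trans h); rewrite lerDl divr_ge0// mulr_ge0 ?sqrtr_ge0.
  have [h|h] := leP (Im (w t)) 1.
    have := hC (w t) _ _ h; rewrite wI mulr_gt0// sqrtrM ?(ltW t0)// => /(_ _ isT) h'.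
    apply: le_trans (h' _) _; first by apply: le_trans (Re_le_nc _) wr.
    have -> : C / (2 * (Num.sqrt t * Num.sqrt (Im z))) = C / Num.sqrt (Im z) / (2 * Num.sqrt t).
      by field; rewrite !gt_eqF.
    by rewrite ler_pM2r ?invr_gt0 ?mulr_gt0// lerDl mulr_ge0.
  apply: le_trans (hK1 _ (ltW h) wr) _; apply: le_trans (ler_norm _) _.
  rewrite ler_pdivlMr ?mulr_gt0// /K.
  have k1 : `|K1| * (2 * Num.sqrt t) <= 2 * `|K1|.
    by have := ler_wpM2l (normr_ge0 K1) st1; rewrite mulr1 mulrCA => h1; rewrite ler_wpM2l.
  by apply: le_trans k1 _; rewrite lerDr divr_ge0// ltW.
have wlim t : ctends (nbhs t) w (w t).
  apply: ctendsD; first exact: ctends_cst.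
  by apply: ctendsM; [exact: ctends_real|exact: ctends_cst].
have wlim0 : ctends (0 : R)^'+ w x%:C.
  have -> : x%:C = x%:C + 0%:C * v by rewrite mul0r addr0.
  apply: ctendsD; first exact: ctends_cst.
  apply: ctendsM; last exact: ctends_cst.
  by split=> /=; [exact: cvg_at_right_filter cvg_id|exact: cvg_cst].
have wpos : \forall t \near (0 : R)^'+, 0 < Im (w t).
  by near=> t; rewrite wI mulr_gt0//; near: t; exact: nbhs_right_gt.
have cf (t : R) : 0 < t -> ctends (nbhs t) (fun s => fdens g E p (w s)) (fdens g E p (w t)).
  move=> t0; apply: ctends_fdens => //.
  - near=> s; rewrite wI mulr_ge0 ?ltW//; near: s; exact: lt_nbhsr.
  - by rewrite wI mulr_ge0 ?ltW.
  - by rewrite rt_neq0// wI gt_eqF// mulr_gt0.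
have G0 : ctends (0 : R)^'+ G (G 0).
  rewrite /G eqxx; have h := ctendsM (bval_curve hE (fprimP g E p) wlim0 wpos) (ctends_cst v^-1).
  have hn : \forall s \near (0 : R)^'+, fprim p (w s) / v = G s.
    near=> s; have s0 : 0 < s by near: s; exact: nbhs_right_gt.
    by rewrite /G gt_eqF.
  by have [h1 h2] := h; split; [apply: cvg_trans h1|apply: cvg_trans h2]; apply: near_eq_cvg; apply: filterS hn => s ->.
have cG (h : R[i] -> R) : (forall t : R, 0 < t -> {for t, continuous (fun s => h (G s))}) ->
    h (G t) @[t --> (0 : R)^'+] --> h (G 0) -> {within `[0, 1], continuous (fun t => h (G t))}.
  move=> h1 h2; apply/continuous_within_itvP => //; split => //.
    by move=> t; rewrite in_itv /= => /andP[t0 _]; exact: h1.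
  by apply: cvg_at_left_filter; exact: h1.
have cont (f : R -> R) (t : R) (l : R) : is_derive t 1 f l -> {for t, continuous f}.
  by move=> [d _]; apply: differentiable_continuous; apply/derivable1_diffP.
have eR : \int[lebesgue_measure]_(t in `[0, 1]) Re (fdens g E p (w t)) = Re (G 1) - Re (G 0).
  apply: (proj2 (@improper_FTC R (fun t => Re (fdens g E p (w t))) (fun t => Re (G t)) 0 1 K ltr01 _ _ _ _)).
  - by move=> t; rewrite in_itv /= => /andP[t0 _]; have [] := dG t t0.
  - by apply: cG; [move=> t t0; have [d _] := dG t t0; exact: cont d|have [] := G0].
  - by move=> t; rewrite in_itv /= => /andP[t0 _]; have [] := cf t t0.
  - by move=> t; rewrite in_itv /= subr0 => tI; apply: le_trans (Re_le_nc _) (bnd t tI).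
have [iI eI] : lebesgue_measure.-integrable `[0, 1] (EFin \o (fun t => Im (fdens g E p (w t)))) /\
    \int[lebesgue_measure]_(t in `[0, 1]) Im (fdens g E p (w t)) = Im (G 1) - Im (G 0).
  apply: (@improper_FTC R (fun t => Im (fdens g E p (w t))) (fun t => Im (G t)) 0 1 K ltr01 _ _ _ _).
  - by move=> t; rewrite in_itv /= => /andP[t0 _]; have [] := dG t t0.
  - by apply: cG; [move=> t t0; have [_ d] := dG t t0; exact: cont d|have [] := G0].
  - by move=> t; rewrite in_itv /= => /andP[t0 _]; have [] := cf t t0.
  - by move=> t; rewrite in_itv /= subr0 => tI; apply: le_trans (Im_le_nc _) (bnd t tI).
split; first exact: iI.
rewrite /cint eR eI; have -> : (Re (G 1) - Re (G 0)) +i* (Im (G 1) - Im (G 0)) = G 1 - G 0.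
  by apply: c_eq; rewrite ?ReB ?ImB.
rewrite /G eqxx oner_eq0 mulrC mulrBl !mulfVK//.
by have -> : w 1 = z by rewrite /w mul1r /v addrC subrK.
Unshelve. all: by end_near.
Qed.

Lemma w_halfE z : 0 < Im z -> w_half g E lam z = cexp (fprim L z - bv L (E 0%N)).
Proof.
move=> z0; rewrite /w_half -(proj2 (segment_integral _ _ z0)); congr (cexp (_ * cint _ _)).
by apply/funext => t; rewrite qm_densityE.
Qed.

Lemma cexp_conj z : cexp z^* = (cexp z)^*.
Proof. by case: z => x y; rewrite /cexp /= cosN sinN; apply: c_eq; rewrite /=; ring. Qed.

Lemma Rhalf_edge0 : rt (E 0%N)%:C = 0.
Proof. by rewrite /Rhalf big_nat_recl// subrr sqrtc0 mul0r oppr0. Qed.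

(** The density is conjugation symmetric along the segment from E_0; integrability lets the sign
    pass through the integral of the imaginary part. *)
Lemma w_half_conj z : 0 < Im z -> w_half g E lam z^* = (w_half g E lam z)^*.
Proof.
move=> z0; have [iI _] := segment_integral L (E 0%N) z0.
rewrite /w_half -cexp_conj; congr cexp.
set v := z - (E 0%N)%:C.
have -> : z^* - (E 0%N)%:C = v^* by apply: c_eq; rewrite /v ?(ReB, ImB, Re_conj, Im_conj) /= ?subr0.
have dC (t : R) : `[0, 1]%classic t -> qm_density g E lam ((E 0%N)%:C + t%:C * v^*) = (qm_density g E lam ((E 0%N)%:C + t%:C * v))^*.
  rewrite /= in_itv /= => /andP[t0 _]; rewrite !qm_densityE /fdens.
  have -> : (E 0%N)%:C + t%:C * v^* = ((E 0%N)%:C + t%:C * v)^*.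
    by apply: c_eq; rewrite ?(ReD, ImD, ReCM, ImCM, Re_conj, Im_conj) /=; ring.
  (* At t = 0 the root vanishes, and both sides are 0 by the convention for the inverse of 0. *)
  move: t0; rewrite le_eqVlt => /orP[/eqP <-|t0].
    rewrite mul0r addr0 (_ : ((E 0%N)%:C)^* = (E 0%N)%:C) ?Rhalf_edge0 ?invr0 ?mulr0 ?rmorph0//.
    exact: conjCR.
  rewrite rt_conj; first by rewrite -pC_conj (rmorphM (@conjc R)) /= (fmorphV (@conjc R)).
  by rewrite ImD ImCM /v ImB /= subr0 add0r gt_eqF// mulr_gt0.
etransitivity; last by apply: esym; exact: (rmorphM (@conjc R)).
congr (_ * _).
apply: c_eq; rewrite /cint /=.
  by apply: eq_Rintegral => t /set_mem /dC ->; rewrite Re_conj.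
rewrite -mulN1r -RintegralZl//; last first.
  by apply: eq_integrable iI => // t _; rewrite /= qm_densityE.
by apply: eq_Rintegral => t /set_mem /dC ->; rewrite Im_conj mulN1r.
Qed.
End QuasiMomentum.

Section BakerAkhiezerGrowth.
Variables (R : realType) (g : nat) (E lam : nat -> R) (a b : int -> R) (P Q U : {poly R}) (M : R).
Hypothesis H : finite_gap g E a b P Q U M.
Hypothesis hlam : qm_zeros g E lam.
Local Notation e := (ebas a b).
Local Notation ev := (ev g E a P Q).
Local Notation F := (Fpol a b P Q U).
Local Notation S := (Spol a b P Q U).
Local Notation fprim := (fprim g E).
Local Notation bv := (bv g E).
Local Notation L := (qmpoly g lam).
Local Notation mid := (midband E).
Implicit Types (z : R[i]).

Let hE := fgapE H.

(** Each F_j and L are monic of degree g, so the top coefficients cancel. *)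
Lemma Spol_size (n : nat) : (size (S n - n%:R *: L)%R <= g)%N.
Proof.
have [Lm Ls] := gap_polyP (qmpoly_gap hlam).
have -> : S n - n%:R *: L = \sum_(1 <= j < n.+1) (F j%:Z - L).
  by rewrite sumrB sumr_const_nat subn1 /= scaler_nat.
elim/big_ind : _ => [|p q hp hq|j _]; first by rewrite size_poly0.
  by apply: leq_trans (size_polyD _ _) _; rewrite geq_max hp.
have [Fm Fs] := gap_polyP (Fpol_gap H j%:Z).
apply/leq_sizeP => i; rewrite leq_eqVlt coefB => /orP[/eqP <-|gi].
  have := monicP Fm; have := monicP Lm; rewrite /lead_coef Fs Ls /= => -> ->.
  by rewrite subrr.
by rewrite !nth_default ?subrr ?Fs ?Ls.
Qed.

Lemma gapf_Spol : exists2 C, 0 <= C & forall (n j : nat), (j < g)%N -> `|gapf g E j (S n)| <= C.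
Proof.
have i0 : (0 : R) < Im ('i : R[i]) by rewrite /= ltr01.
have /choice[C hC] : forall j : nat, exists C, 0 <= C /\ ((j <= g)%N -> forall n : nat,
    `|ln (nc (ev false 'i (e n%:Z))) - Re (fprim (S n) 'i - bv (S n) (mid j))| <= C).
  move=> j; have [jg|_] := leqP j g; last by exists 0.
  by have [C C0 h] := log_growth H i0 jg (midbandP hE jg); exists C.
exists (\sum_(j < g) (C j + C j.+1)).
  by apply: sumr_ge0 => j _; rewrite addr_ge0//; [have [] := hC j|have [] := hC j.+1].
move=> n j jg; rewrite (bigD1 (Ordinal jg))//=.
have h0 : 0 <= \sum_(i < g | i != Ordinal jg) (C i + C i.+1).
  by apply: sumr_ge0 => i _; rewrite addr_ge0//; [have [] := hC i|have [] := hC i.+1].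
have [_ /(_ (ltnW jg) n)] := hC j; have [_ /(_ jg n)] := hC j.+1.
rewrite /gapf !ReB; move: (ln _) (Re (bv _ _)) (Re (bv _ _)) (Re _) => x1 x2 x3 x4.
by rewrite !ler_norml; move: h0; lra.
Qed.

Lemma BA_lower_bound z : 0 < Im z -> exists2 c, 0 < c & forall n : nat,
  c * expR (n%:R * Re (fprim L z - bv L (E 0%N))) <= nc (ev false z (e n%:Z)).
Proof.
move=> z0; have [C C0 hC] := log_growth H z0 (leq0n g) (midbandP hE (leq0n g)).
have [K K0 hK] := gap_functional_bound hE z0; have [G G0 hG] := gapf_Spol.
exists (expR (- (C + K * G))); first exact: expR_gt0.
move=> n; rewrite -expRD -[leRHS]lnK ?posrE ?nc_gt0 ?(ev_neq0 H)// ler_expR.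
have e0 : Re (bv L (E 0%N)) = Re (bv L (mid 0)).
  apply/esym/(Re_bv_qm hE hlam); exists 0%N => //.
  by have /andP[h1 h2] := midbandP hE (leq0n g); rewrite !ltW.
have hD : `|Re (fprim (S n - n%:R *: L) z - bv (S n - n%:R *: L) (mid 0))| <= K * G.
  apply: hK; first exact: Spol_size.
  move=> j jg; have -> : S n - n%:R *: L = (- n%:R) *: L + S n by rewrite scaleNr addrC.
  by rewrite (gapf_lin hE) (gapf_qm hE hlam jg) mulr0 add0r hG.
have eF := fprim_bv_lin hE n%:R (mid 0) L (S n - n%:R *: L) z0.
have eS : S n = n%:R *: L + (S n - n%:R *: L) by rewrite addrC subrK.
rewrite -eS in eF; have := hC n; rewrite eF (ReD (_ * _)) ReCM (ReB (fprim L z)) (ReB (fprim L z)) e0.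
by move: hD; rewrite !ler_norml; lra.
Qed.
End BakerAkhiezerGrowth.

(** * Identification of the Jost solution *)

Section JostUniqueness.
Variables (R : realType) (g : nat) (E lam : nat -> R) (a b : int -> R) (P Q U : {poly R}) (M : R).
Hypothesis H : finite_gap g E a b P Q U M.
Hypothesis hlam : qm_zeros g E lam.
Variables (a' b' : int -> R).
Hypothesis a'0 : forall n, 0 < a' n.
Variable tau : nat -> R.
Hypothesis htau : forall (n d : nat), \sum_(i < d) (n + i).+1%:R *
  (`|a' (n%:Z + i%:Z) - a (n%:Z + i%:Z)| + `|b' (n%:Z + i%:Z) - b (n%:Z + i%:Z)|) <= tau n.
Hypothesis tau_dec : forall n m : nat, (n <= m)%N -> tau m <= tau n.
Hypothesis tau_lim : forall eps : R, 0 < eps -> exists n : nat, tau n <= eps.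
Local Notation e := (ebas a b).
Local Notation ev := (ev g E a P Q).
Local Notation fprim := (fprim g E).
Local Notation bv := (bv g E).
Local Notation L := (qmpoly g lam).
Local Notation Psi := (Psi g E a b P Q a' b').
Implicit Types (z : R[i]).

Lemma wronskian_const z (u v : int -> R[i]) : solves a' b' z u -> solves a' b' z v ->
  forall n, (a' n)%:C * (u n * v (n + 1) - u (n + 1) * v n) = (a' 0)%:C * (u 0 * v (0 + 1) - u (0 + 1) * v 0).
Proof.
move=> hu hv; have step n : (a' n)%:C * (u n * v (n + 1) - u (n + 1) * v n) =
    (a' (n - 1))%:C * (u (n - 1) * v (n - 1 + 1) - u (n - 1 + 1) * v (n - 1)).
  rewrite subrK; have h1 := hu n; have h2 := hv n; rewrite /jacobi in h1 h2.
  have : u n * ((a' n)%:C * v (n + 1) + (a' (n - 1))%:C * v (n - 1) + (b' n)%:C * v n) =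
      v n * ((a' n)%:C * u (n + 1) + (a' (n - 1))%:C * u (n - 1) + (b' n)%:C * u n).
    by rewrite h1 h2; ring.
  by move=> /eqP; rewrite -subr_eq0 => /eqP h; apply/eqP; rewrite -subr_eq0; apply/eqP; rewrite -[RHS]h; ring.
elim/int_updown => [//|n IH|n IH]; first by rewrite step addrK.
by rewrite -step.
Qed.

Lemma solves_eq0 z (u : int -> R[i]) n : solves a' b' z u -> u n = 0 -> u (n + 1) = 0 -> forall m, u m = 0.
Proof.
move=> hu u0 u1 m.
have aC k : (a' k)%:C != 0 :> R[i] by rewrite fmorph_eq0 gt_eqF.
suff key : forall k, u (n + k) = 0 /\ u (n + k + 1) = 0.
  by have [] := key (m - n); rewrite addrC subrK.
elim/int_updown => [|k [h1 h2]|k [h1 h2]]; first by rewrite addr0.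
- rewrite addrA; split=> //; have := hu (n + k + 1); rewrite /jacobi h2 addrK h1 !mulr0 !addr0 => /eqP.
  by rewrite mulf_eq0 (negPf (aC _)) => /eqP.
- rewrite addrA subrK; split=> //; have := hu (n + k); rewrite /jacobi h2 h1 !mulr0 addr0 add0r => /eqP.
  by rewrite mulf_eq0 (negPf (aC _)) => /eqP.
Qed.

(** The Wronskian of v = u - Psi with Psi is constant up to the coefficient a', and that constant is
    a limit equal to 0; so v = k Psi from some site on. There v is arbitrarily small relative to
    psi_+, while Psi is comparable to it, so k = 0, and two consecutive zeros make v vanish
    everywhere. *)
Lemma jost_unique z (u : int -> R[i]) : 0 < Im z -> solves a' b' z u ->
  (forall d : R, 0 < d -> exists N : nat, forall n : nat, (N <= n)%N ->
     nc (u n%:Z - ev false z (e n%:Z)) <= d * expR (n%:R * Re (fprim L z - bv L (E 0%N)))) ->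
  u =1 Psi z.
Proof.
move=> z0 hu hlim.
have hP := Psi_solves H a'0 htau tau_dec tau_lim z0.
have [c c0 hc] := BA_lower_bound H hlam z0.
have [C C0 [n1 hC]] := Psi_asym H a'0 htau tau_dec tau_lim z0.
pose p n := ev false z (e n); pose v n := u n - Psi z n.
have p0 n : 0 < nc (p n) by rewrite nc_gt0 (ev_neq0 H).
have hv : solves a' b' z v.
  move=> n; have h1 := hu n; have h2 := hP n; rewrite /jacobi in h1 h2; rewrite /jacobi /v.
  by transitivity (z * u n - z * Psi z n); [rewrite -h1 -h2|]; ring.
have small (d : R) : 0 < d -> exists N : nat, forall n : nat, (N <= n)%N ->
    [/\ nc (v n%:Z) <= d * nc (p n%:Z), nc (p n%:Z) <= 2 * nc (Psi z n%:Z) & nc (Psi z n%:Z) <= 2 * nc (p n%:Z)].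
  move=> d0; have cd : 0 < c * (d / 2) by rewrite mulr_gt0// divr_gt0.
  have [N1 h1] := hlim _ cd.
  pose d1 := Num.min (d / 2) 2^-1; have d10 : 0 < d1 by rewrite lt_min divr_gt0//= invr_gt0.
  have C1 : 0 < C + 1 by lra.
  have [N2 h2] := tau_lim (divr_gt0 d10 C1).
  exists (maxn n1 (maxn N1 N2)) => n; rewrite !geq_max => /and3P[nn1 nN1 nN2].
  have k1 : nc (u n%:Z - p n%:Z) <= d / 2 * nc (p n%:Z).
    apply: le_trans (h1 n nN1) _; rewrite -/(p n%:Z) mulrAC mulrC.
    by apply: ler_wpM2l; [rewrite divr_ge0// ltW|exact: hc].
  have t1 : C * tau n <= d1.
    have h := le_trans (tau_dec nN2) h2; rewrite ler_pdivlMr// in h.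
    by have := tau_ge0 htau n; lra.
  have k2 : nc (Psi z n%:Z - p n%:Z) <= d1 * nc (p n%:Z).
    by apply: le_trans (hC n nn1) _; rewrite ler_wpM2r ?nc_ge0.
  have dd : d1 <= d / 2 /\ d1 <= 2^-1 by rewrite /d1 !ge_min !lexx orbT.
  have k3 : d1 * nc (p n%:Z) <= d / 2 * nc (p n%:Z) by rewrite ler_wpM2r ?nc_ge0//; case: dd.
  have k4 : d1 * nc (p n%:Z) <= 2^-1 * nc (p n%:Z) by rewrite ler_wpM2r ?nc_ge0//; case: dd.
  split.
  - have -> : v n%:Z = (u n%:Z - p n%:Z) - (Psi z n%:Z - p n%:Z) by rewrite /v; ring.
    by apply: le_trans (ncB _ _) _; lra.
  - by have := le_nc_dist (p n%:Z) (Psi z n%:Z); rewrite ncBC; lra.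
  - by have := le_nc_dist (Psi z n%:Z) (p n%:Z); have := p0 n%:Z; lra.
have wp : 0 <= 1 + M / Im z := weyl_factor_ge0 H z0.
have pb n : 0 <= n -> nc (p n) <= 1 + M / Im z.
  by move=> n0; have := weyl_sup_ev H z0 n0; rewrite ev_ebas0 nc1 mulr1.
have M0 := M_gt0 H; have T0 := tau_ge0 htau 0.
pose B := 1 + M / Im z; rewrite -/B in wp.
pose K := (M + tau 0) * (B * B).
have K0 : 0 <= K by rewrite !mulr_ge0// addr_ge0// ltW.
have aK (n : nat) : nc (a' n%:Z)%:C <= M + tau 0.
  rewrite nc_real; have [h1 _] := fgapM H n%:Z; have h2 := dlt_le_tau htau n.
  have h3 := tau_dec (leq0n n).
  have := ler_normD (a' n%:Z - a n%:Z) (a n%:Z); rewrite subrK; have := normr_ge0 (b' n%:Z - b n%:Z).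
  by lra.
have W0 n : v n * Psi z (n + 1) - v (n + 1) * Psi z n = 0.
  apply/eqP; rewrite -nc_eq0 eq_le nc_ge0 andbT; apply/ler_addgt0Pr => d d0; rewrite add0r.
  have a0n := a'0 n.
  have K1 : 0 < 4 * K + 1 by lra.
  have dk : 0 < a' n * d / (4 * K + 1) by rewrite divr_gt0// mulr_gt0.
  set d' := _ / _ in dk; have [N hN] := small _ dk.
  have d'2 : d' * (4 * K + 1) = a' n * d by rewrite /d' divfK ?gt_eqF.
  have [h1 _ h2] := hN N (leqnn N); have [h3 _ h4] := hN N.+1 (leqnSn N).
  have := wronskian_const hv hP n; rewrite -(wronskian_const hv hP N%:Z) => e1.
  have := congr1 (@nc R) e1; rewrite ncM nc_real gtr0_norm// ncM => e2.
  rewrite -(ler_pM2l a0n) e2 -d'2.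
  have -> : (N%:Z + 1 : int) = N.+1%:Z by clear; lia.
  have b1 := pb N%:Z (le0z_nat N); have b2 := pb N.+1%:Z (le0z_nat N.+1).
  rewrite -/B in b1 b2.
  have q1 : nc (v N%:Z) * nc (Psi z N.+1%:Z) <= d' * B * (2 * B).
    apply: ler_pM; rewrite ?nc_ge0//.
      by apply: le_trans h1 _; rewrite ler_wpM2l// ltW.
    by apply: le_trans h4 _; rewrite ler_wpM2l.
  have q2 : nc (v N.+1%:Z) * nc (Psi z N%:Z) <= d' * B * (2 * B).
    apply: ler_pM; rewrite ?nc_ge0//.
      by apply: le_trans h3 _; rewrite ler_wpM2l// ltW.
    by apply: le_trans h2 _; rewrite ler_wpM2l.
  have q : nc (v N%:Z * Psi z N.+1%:Z - v N.+1%:Z * Psi z N%:Z) <= 4 * d' * (B * B).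
    have -> : 4 * d' * (B * B) = d' * B * (2 * B) + d' * B * (2 * B) by ring.
    by apply: le_trans (ncB _ _) _; rewrite !ncM; exact: lerD.
  have := ler_pM (nc_ge0 _) (nc_ge0 _) (aK N) q.
  have -> : (M + tau 0) * (4 * d' * (B * B)) = d' * (4 * K + 1) - d' by rewrite /K; ring.
  by move/le_trans; apply; rewrite gerBl ltW.
have [N hN] := small 1 ltr01.
have P0 (n : nat) : (N <= n)%N -> Psi z n%:Z != 0.
  move=> nN; have [_ h _] := hN n nN; have := p0 n%:Z.
  by apply: contraTneq => e0; move: h; rewrite e0 nc0 mulr0 -leNgt.
pose k := v N%:Z / Psi z N%:Z.
have vk (n : nat) : (N <= n)%N -> v n%:Z = k * Psi z n%:Z.
  elim: n => [|n IH]; first by rewrite leqn0 => /eqP e0; rewrite /k e0 divfK// -e0 P0.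
  rewrite leq_eqVlt => /orP[/eqP e0|nN]; first by rewrite /k -e0 divfK// P0.
  have := W0 n%:Z; have -> : (n%:Z + 1 : int) = n.+1%:Z by clear; lia.
  rewrite IH// => /eqP; rewrite subr_eq0 mulrAC => /eqP h.
  by apply: (mulIf (P0 n nN)).
have k0 : k = 0.
  apply/eqP; rewrite -nc_eq0 eq_le nc_ge0 andbT; apply/ler_addgt0Pr => d d0; rewrite add0r.
  have d2 : 0 < d / 2 by rewrite divr_gt0.
  have [N' hN'] := small _ d2; have [h1 h2 _] := hN' (maxn N N') (leq_maxr _ _).
  rewrite vk ?leq_maxl// ncM in h1.
  have q0 : 0 < nc (Psi z (maxn N N')%:Z) by rewrite nc_gt0 P0// leq_maxl.
  rewrite -(ler_pM2r q0); apply: le_trans h1 _.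
  by have := ler_wpM2l (ltW d2) h2; lra.
have z1 : v N%:Z = 0 by rewrite vk// k0 mul0r.
have z2 : v (N%:Z + 1) = 0.
  have -> : (N%:Z + 1 : int) = N.+1%:Z by clear; lia.
  by rewrite vk// k0 mul0r.
by move=> n; apply/eqP; rewrite -subr_eq0; apply/eqP; exact: (solves_eq0 hv z1 z2 n).
Qed.
End JostUniqueness.

(** * The contour integral *)

Section Integrals.
Variable R : realType.
Local Notation mu := (@lebesgue_measure R).
Implicit Types (f : R -> R) (a b c v w : R).

(** The value is kept together with integrability, since it is integrability that allows intervals
    to be joined. *)
Definition has_int f a b v := mu.-integrable `[a, b] (EFin \o f) /\ \int[mu]_(t in `[a, b]) f t = v.

Lemma has_int_cat f a b c v w : a <= b -> b <= c -> has_int f a b v -> has_int f b c w -> has_int f a c (v + w).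
Proof.
move=> ab bc [i1 <-] [i2 <-].
have i3 : mu.-integrable `]b, c] (EFin \o f).
  by apply: integrableS i2 => //; apply: subset_itvr; rewrite bnd_simp.
have eD : `[a, c]%classic = `[a, b]%classic `|` `]b, c]%classic.
  by rewrite -itv_bndbnd_setU// bnd_simp.
have dj : [disjoint `[a, b]%classic & `]b, c]%classic].
  apply/disj_setPS => t /=; rewrite !in_itv /= => -[/andP[_ t1] /andP[t2 _]].
  by have := le_lt_trans t1 t2; rewrite ltxx.
have i4 : mu.-integrable (`[a, b] `|` `]b, c]) (EFin \o f).
  have /integrableP[m1 l1] := i1; have /integrableP[m3 l3] := i3.
  have mU : measurable_fun (`[a, b] `|` `]b, c]) (EFin \o f) by apply/measurable_funU.
  apply/integrableP; split => //; rewrite ge0_integral_setU//; last exact: measurableT_comp.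
  exact: lte_add_pinfty.
split; first by rewrite eD.
by rewrite eD Rintegral_setU//; congr (_ + _); rewrite Rintegral_itv_obnd_cbnd.
Qed.

Lemma integrable_closed f a b : mu.-integrable `]a, b[ (EFin \o f) -> mu.-integrable `[a, b] (EFin \o f).
Proof.
move=> /integrableP[m l]; have m' : measurable_fun `[a, b] (EFin \o f).
  apply/measurable_EFinP; apply: (@measurable_fun_itv_cc R a b false true).
  by apply/measurable_EFinP; exact: m.
apply/integrableP; split => //.
rewrite (@integral_itv_bndoo _ a b (fun t => `|(EFin \o f) t|%E) true false)//.
exact: measurableT_comp.
Qed.

(** The integrand is known only as a bounded pointwise limit of functions with explicit primitives;
    dominated convergence gives integrability and value together. *)
Lemma has_int_limit f (h F : nat -> R -> R) a b (K : R) : a < b ->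
  (forall N (t : R), a < t < b -> is_derive t 1 (F N) (h N t)) ->
  (forall N, {within `[a, b], continuous (F N)}) ->
  (forall N, {in `]a, b[, continuous (h N)}) ->
  (forall N t, a < t < b -> `|h N t| <= K) ->
  (forall t, a < t < b -> h N t @[N --> \oo] --> f t) ->
  exists2 v, has_int f a b v & F N b - F N a @[N --> \oo] --> v.
Proof.
move=> ab dF cF ch hK hf.
have K0 : 0 <= K.
  by apply: le_trans (hK 0%N ((a + b) / 2) _); rewrite ?normr_ge0//; apply/andP; split; lra.
have ftc N : mu.-integrable `[a, b] (EFin \o h N) /\ \int[mu]_(t in `[a, b]) h N t = F N b - F N a.
  apply: (@improper_FTC R (h N) (F N) a b (2 * (K * Num.sqrt (b - a)))) => //.
  move=> t tI; move: (tI); rewrite in_itv /= => /andP[t1 t2].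
  have s1 : 0 < Num.sqrt (t - a) by rewrite sqrtr_gt0 subr_gt0.
  have s3 : Num.sqrt (t - a) <= Num.sqrt (b - a) by rewrite ler_wsqrtr// lerD2r ltW.
  apply: le_trans (hK N t _) _; first by rewrite t1.
  apply: (@le_trans _ _ (2 * (K * Num.sqrt (b - a)) / (2 * Num.sqrt (t - a)))); last first.
    by rewrite lerDl divr_ge0// !mulr_ge0// ?sqrtr_ge0.
  by rewrite ler_pdivlMr ?mulr_gt0// mulrCA ler_pM2l// ler_wpM2l.
have mD : measurable (`]a, b[%classic : set R) by exact: measurable_itv.
have mh N : measurable_fun `]a, b[ (h N).
  apply: open_continuous_measurable_fun; first exact: interval_open.
  by move=> t; rewrite inE; exact: ch.
have mf : measurable_fun `]a, b[ f.
  apply: measurable_fun_cvg mh _ => t /=; rewrite in_itv; exact: hf.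
have [] := @dominated_convergence _ _ R mu `]a, b[%classic mD (fun N => EFin \o h N) (EFin \o f) (EFin \o cst K).
- by move=> N; apply/measurable_EFinP; exact: mh.
- by apply/measurable_EFinP; exact: mf.
- apply: aeW => t /=; rewrite in_itv /= => tI; apply: cvg_EFin; first exact: nearW.
  exact: hf.
- apply: (@integrableS _ _ _ mu `[a, b]%classic) => //; first exact: subset_itv_oo_cc.
  by have := @continuous_compact_integrable R (cst K) `[a, b]%classic; apply;
    [exact: segment_compact|move=> x; exact: cst_continuous].
- by apply: aeW => t N /=; rewrite in_itv /= lee_fin; exact: hK.
move=> i1 _ l1; have i2 := integrable_closed i1.
exists (\int[mu]_(t in `[a, b]) f t) => //.
have e1 N : (\int[mu]_(t in `]a, b[) (EFin \o h N) t)%E = (F N b - F N a)%:E.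
  have [j1 <-] := ftc N; rewrite /Rintegral -(@integral_itv_bndoo _ a b _ true false); last by apply/measurable_EFinP; exact: mh.
  by rewrite fineK// integrable_fin_num.
have e2 : (\int[mu]_(t in `]a, b[) (EFin \o f) t)%E = (\int[mu]_(t in `[a, b]) f t)%:E.
  rewrite /Rintegral -(@integral_itv_bndoo _ a b _ true false); last by apply/measurable_EFinP; exact: mf.
  by rewrite fineK// integrable_fin_num.
have e3 : (fun N => (F N b - F N a)%:E) = (fun N => \int[mu]_(x in `]a, b[) (EFin \o h N) x)%E.
  by apply/funext => N; rewrite e1.
by move: l1; rewrite e2 -e3 => /fine_cvgP[_].
Qed.
End Integrals.

Section ComplexExponential.
Variable R : realType.
Implicit Types (z : R[i]).
Lemma Re_cexp z : Re (cexp z) = expR (Re z) * cos (Im z).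
Proof. by rewrite /cexp ReCM. Qed.
Lemma Im_cexp z : Im (cexp z) = expR (Re z) * sin (Im z).
Proof. by rewrite /cexp ImCM. Qed.
Lemma nc_cexp z : nc (cexp z) = expR (Re z).
Proof.
apply/eqP; rewrite -(eqrXn2 (ltn0Sn 1)) ?nc_ge0 ?expR_ge0//; apply/eqP.
rewrite sqr_nc Re_cexp Im_cexp !exprMn -mulrDr cos2Dsin2 mulr1//.
Qed.
Lemma ctends_cexp {T : Type} (F : set_system T) {FF : Filter F} (f : T -> R[i]) l :
  ctends F f l -> ctends F (fun u => cexp (f u)) (cexp l).
Proof.
move=> [h1 h2]; split.
  under eq_fun do rewrite Re_cexp; rewrite Re_cexp.
  by apply: cvgM; [exact: (cvg_comp _ _ h1 (@continuous_expR R _))|exact: (cvg_comp _ _ h2 (@continuous_cos R _))].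
under eq_fun do rewrite Im_cexp; rewrite Im_cexp.
by apply: cvgM; [exact: (cvg_comp _ _ h1 (@continuous_expR R _))|exact: (cvg_comp _ _ h2 (@continuous_sin R _))].
Qed.
End ComplexExponential.

(** * The phase of w on the spectrum *)

Section PhaseFunction.
Variables (R : realType) (g : nat) (E lam : nat -> R).
Hypothesis hE : band_edges g E.
Hypothesis hlam : qm_zeros g E lam.
Local Notation bv := (bv g E).
Local Notation fprim := (fprim g E).
Local Notation L := (qmpoly g lam).
Implicit Types (x y t : R) (k : nat).

Definition theta x := Im (bv L x) - Im (bv L (E 0%N)).
Definition dtheta k x := (-1) ^+ (g - k) * L.[x] / absrt g E x.
Definition alpha k := theta (E k.*2).
Definition beta k := theta (E k.*2.+1).
(** The inverse of the phase on the k-th band, that is, lambda(w) as a function of the angle of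
    w. *)
Definition linv k t := xget 0 [set x | E k.*2 <= x <= E k.*2.+1 /\ theta x = t].

(** On the k-th band exactly the g - k factors with j > k are negative; R^(1/2) carries the same
    sign there, so the phase increases on every band. *)
Lemma qm_sign k x : (k <= g)%N -> in_band E k x -> 0 < (-1) ^+ (g - k) * L.[x].
Proof.
move=> kg xk; rewrite /qmpoly horner_prod (@big_cat_nat _ _ _ k.+1)//=.
have -> : (-1) ^+ (g - k) = \prod_(k.+1 <= j < g.+1) (-1 : R) by rewrite prodr_const_nat subSS.
rewrite mulrCA -big_split /=; apply: mulr_gt0; rewrite big_nat_cond; apply: prodr_gt0 => j /andP[/andP[j1 j2] _].
  have jg : (1 <= j <= g)%N by clear -j1 j2 kg; lia.
  have [/andP[_ l2] _] := hlam jg; have [h _] := gap_side hE jg kg xk.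
  by rewrite hornerXsubC; have := h j2; lra.
have jg : (1 <= j <= g)%N by clear -j1 j2 kg; lia.
have [/andP[l1 _] _] := hlam jg; have [_ h] := gap_side hE jg kg xk.
by rewrite hornerXsubC; have := h j1; lra.
Qed.

Lemma dtheta_gt0 k x : (k <= g)%N -> in_band E k x -> 0 < dtheta k x.
Proof.
by move=> kg xk; rewrite divr_gt0// ?(qm_sign kg xk)// absrt_gt0//; exact: (band_not_edge hE kg xk).
Qed.

Lemma bv_der p k x : (k <= g)%N -> in_band E k x ->
  is_derive x 1 (fun y => Im (bv p y)) ((-1) ^+ (g - k) * p.[x] / absrt g E x).
Proof.
move=> kg xk; have [_] := bval_der hE (fprimP g E p) (rt_real_neq0 (band_not_edge hE kg xk)).
by rewrite (Im_fdens_band hE _ kg xk).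
Qed.

Lemma theta_der k x : (k <= g)%N -> in_band E k x -> is_derive x 1 theta (dtheta k x).
Proof.
move=> kg xk; have d : is_derive x 1 (fun y => Im (bv L y) - Im (bv L (E 0%N))) _ :=
  is_deriveB (bv_der L kg xk) (is_derive_cst (Im (bv L (E 0%N))) x 1).
by apply: (is_derive_eq' d); rewrite subr0.
Qed.

Lemma bv_cont p : continuous (fun x => Im (bv p x)).
Proof. exact: (bval_continuous hE (fprimP g E p)).2. Qed.

Lemma theta_cont : continuous theta.
Proof. by move=> x; apply: cvgB; [exact: bv_cont|exact: cvg_cst]. Qed.

Lemma theta_inc k x y : (k <= g)%N -> E k.*2 <= x -> x < y -> y <= E k.*2.+1 -> theta x < theta y.
Proof.
move=> kg kx xy yk.
have inb c : c \in `]x, y[ -> in_band E k c.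
  by rewrite in_itv /= => /andP[c1 c2]; rewrite /in_band (le_lt_trans kx c1) (lt_le_trans c2 yk).
have [c cI e] : exists2 c, c \in `]x, y[ & theta y - theta x = dtheta k c * (y - x).
  apply: MVT => //; first by move=> c /inb; exact: theta_der.
  exact: continuous_subspaceT theta_cont.
by rewrite -subr_gt0 e mulr_gt0 ?subr_gt0// (dtheta_gt0 kg (inb c cI)).
Qed.

Lemma edge_lt k : (k <= g)%N -> E k.*2 < E k.*2.+1.
Proof. by move=> kg; apply: hE; clear -kg; lia. Qed.

Lemma alpha_lt k : (k <= g)%N -> alpha k < beta k.
Proof. by move=> kg; apply: (theta_inc kg) => //; exact: edge_lt. Qed.

(** The imaginary part is constant across a gap, so consecutive bands correspond to adjacent
    arcs. *)
Lemma alphaS k : (k < g)%N -> alpha k.+1 = beta k.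
Proof.
by move=> kg; rewrite /alpha /beta /theta /bv (Im_bval_gap_edges hE (fprimP g E L) (j := k.+1)).
Qed.

Lemma alpha0 : alpha 0 = 0.
Proof. by rewrite /alpha /theta subrr. Qed.

(** L is monic of degree g and has moment 1: the upper side of the spectrum covers exactly a half
    circle. *)
Lemma beta_last : beta g = pi.
Proof.
have [Lm Ls] := gap_polyP (qmpoly_gap hlam).
have := moment_monic hE Lm Ls; rewrite /moment => /(congr1 (fun x => x * pi)).
by rewrite divfK ?mul1r ?gt_eqF ?pi_gt0.
Qed.

Lemma alpha_le j k : (j <= k <= g)%N -> alpha j <= alpha k.
Proof.
case/andP; elim: k => [|k IH]; first by rewrite leqn0 => /eqP ->.
rewrite leq_eqVlt => /orP[/eqP ->//|jk] kg.
by apply: le_trans (IH jk (ltnW kg)) _; rewrite alphaS// ltW// alpha_lt// ltnW.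
Qed.

Lemma theta_closed k x : (k <= g)%N -> E k.*2 <= x <= E k.*2.+1 -> alpha k <= theta x <= beta k.
Proof.
move=> kg /andP[]; rewrite le_eqVlt => /orP[/eqP <-|x1].
  by move=> _; rewrite lexx ltW// alpha_lt.
rewrite le_eqVlt => /orP[/eqP ->|x2].
  by rewrite lexx ltW// alpha_lt.
by rewrite !ltW//; apply: (theta_inc kg) => //; exact: ltW.
Qed.

Lemma beta_le j k : (j < k <= g)%N -> beta j <= alpha k.
Proof.
move=> /andP[jk kg]; rewrite -alphaS; first by apply: alpha_le; rewrite jk.
exact: leq_trans kg.
Qed.

Lemma beta_le_pi k : (k <= g)%N -> beta k <= pi.
Proof.
rewrite -beta_last leq_eqVlt => /orP[/eqP ->//|kg].
by apply: (@le_trans _ _ (alpha g)); [apply: beta_le; rewrite kg leqnn|rewrite ltW// alpha_lt].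
Qed.

Lemma alpha_ge0 k : (k <= g)%N -> 0 <= alpha k.
Proof. by move=> kg; rewrite -alpha0; apply: alpha_le. Qed.

(** Arcs of different bands meet at most in end points, and these are excluded by taking x inside
    its band. *)
Lemma theta_inj k x y : (k <= g)%N -> in_band E k x -> bands g E y -> theta y = theta x -> y = x.
Proof.
move=> kg /andP[x1 x2] [j jg yj] e.
have a1 : alpha k < theta x by apply: (theta_inc kg) => //; exact: ltW.
have a2 : theta x < beta k by apply: (theta_inc kg) => //; exact: ltW.
have /andP[b1 b2] := theta_closed jg yj.
have [jk|kj|ejk] := ltngtP j k.
- by have := @beta_le j k; rewrite jk kg => /(_ isT); lra.
- by have := @beta_le k j; rewrite kj jg => /(_ isT); lra.
rewrite ejk in yj; have /andP[y1 y2] := yj.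
have [yx|xy|//] := ltgtP y x.
  by have := theta_inc kg y1 yx (ltW x2); rewrite e ltxx.
by have := theta_inc kg (ltW x1) xy y2; rewrite e ltxx.
Qed.

Lemma linvK k : (k <= g)%N -> {in `[E k.*2, E k.*2.+1], cancel theta (linv k)}.
Proof.
move=> kg x; rewrite in_itv /= => /andP[x1 x2]; apply: xget_unique; first by rewrite /= x1.
move=> y [/andP[y1 y2] e]; have [yx|xy|//] := ltgtP y x.
  by have := theta_inc kg y1 yx x2; rewrite e ltxx.
by have := theta_inc kg x1 xy y2; rewrite e ltxx.
Qed.

Lemma linv_cont k : (k <= g)%N -> {within `[alpha k, beta k], continuous (linv k)}.
Proof.
move=> kg; apply: segment_can_le_continuous; first exact/ltW/edge_lt.
  exact: continuous_subspaceT theta_cont.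
exact: linvK.
Qed.

Lemma linvP k t : (k <= g)%N -> alpha k < t < beta k -> in_band E k (linv k t) /\ theta (linv k t) = t.
Proof.
move=> kg /andP[t1 t2].
have [c cI ec] : exists2 c, c \in `[E k.*2, E k.*2.+1] & theta c = t.
  apply: IVT; first exact/ltW/edge_lt.
    exact: continuous_subspaceT theta_cont.
  by rewrite -/(alpha k) -/(beta k) minElt maxElt alpha_lt// !ltW.
rewrite -ec linvK//; split=> //; rewrite in_itv /= in cI; have /andP[c1 c2] := cI.
rewrite /in_band !lt_neqAle c1 c2 !andbT; apply/andP; split.
  by apply: contraTneq t1 => e; rewrite -ec -e ltxx.
by apply: contraTneq t2 => e; rewrite -ec e ltxx.
Qed.

Lemma linv_ends k : (k <= g)%N -> linv k (alpha k) = E k.*2 /\ linv k (beta k) = E k.*2.+1.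
Proof.
move=> kg; have h := ltW (edge_lt kg).
by split; apply: linvK => //; rewrite in_itv /= lexx h.
Qed.

Lemma linv_der k t : (k <= g)%N -> alpha k < t < beta k -> is_derive t 1 (linv k) (dtheta k (linv k t))^-1.
Proof.
move=> kg tI; have [xk e] := linvP kg tI.
rewrite -{1}e; apply: is_derive_inverse.
- have /andP[x1 x2] := xk; near=> x; apply: linvK => //; rewrite in_itv /= !ltW//; near: x.
    exact: lt_nbhsl.
  exact: lt_nbhsr.
- by near=> x; exact: theta_cont.
- exact: theta_der.
- by rewrite gt_eqF// dtheta_gt0.
Unshelve. all: by end_near.
Qed.

Lemma qmap_half (s : bool) x (y : R) : 0 < y -> qmap g E lam (x +i* ((-1) ^+ s * y)) =
  (if s then fun z => z^* else id) (cexp (fprim L (x +i* y) - bv L (E 0%N))).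
Proof.
move=> y0; have z0 : 0 < Im (x +i* y) by [].
rewrite -(w_halfE lam hE z0); have h := w_half_conj lam hE z0.
case: s; rewrite ?expr1 ?expr0 ?mulN1r ?mul1r /qmap.
  have -> : (complex.Im (x +i* - y) == 0) = false by rewrite /= oppr_eq0 gt_eqF.
  exact: h.
by have -> : (complex.Im (x +i* y) == 0) = false by rewrite /= gt_eqF.
Qed.

Lemma qmap_bdry (s : bool) x : bands g E x -> bdry s (qmap g E lam) x = cexp (0 +i* ((-1) ^+ s * theta x)).
Proof.
move=> bx; rewrite /bdry; apply: ctends_lim.
have h1 : ctends (0 : R)^'+ (fun y => cexp (fprim L (x +i* y) - bv L (E 0%N))) (cexp (0 +i* theta x)).
  have -> : 0 +i* theta x = bv L x - bv L (E 0%N).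
    by apply: c_eq; rewrite ?(ReB, ImB)//= (Re_bv_qm hE hlam bx) subrr.
  by apply: ctends_cexp; apply: ctendsB; [apply: bval_lim => //; exact: fprimP|exact: ctends_cst].
have [h2 h3] := h1.
have e : \forall y \near (0 : R)^'+, (if s then fun z => z^* else id) (cexp (fprim L (x +i* y) - bv L (E 0%N))) =
    qmap g E lam (x +i* ((-1) ^+ s * y)).
  by near=> y; rewrite qmap_half//; near: y; exact: nbhs_right_gt.
have -> : cexp (0 +i* ((-1) ^+ s * theta x)) = (if s then fun z => z^* else id) (cexp (0 +i* theta x)).
  case: s {e}; rewrite ?expr1 ?expr0 ?mulN1r ?mul1r//.
  by rewrite -cexp_conj.
split.
  have h4 : Re ((if s then fun z => z^* else id) (cexp (fprim L (x +i* y) - bv L (E 0%N)))) @[y --> (0 : R)^'+] -->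
      Re ((if s then fun z => z^* else id) (cexp (0 +i* theta x))).
    by case: s {e}; rewrite ?Re_conj; [under eq_fun do rewrite Re_conj|]; exact: h2.
  by apply: cvg_trans h4; apply: near_eq_cvg; apply: filterS e => y ->.
have h4 : Im ((if s then fun z => z^* else id) (cexp (fprim L (x +i* y) - bv L (E 0%N)))) @[y --> (0 : R)^'+] -->
    Im ((if s then fun z => z^* else id) (cexp (0 +i* theta x))).
  by case: s {e}; rewrite ?Im_conj; [under eq_fun do rewrite Im_conj; exact: cvgN|exact: h3].
by apply: cvg_trans h4; apply: near_eq_cvg; apply: filterS e => y ->.
Unshelve. all: by end_near.
Qed.

Lemma theta_range x : bands g E x -> 0 <= theta x <= pi.
Proof.
move=> [k kg xk]; have /andP[h1 h2] := theta_closed kg xk.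
by rewrite (le_trans (alpha_ge0 kg) h1) (le_trans h2 (beta_le_pi kg)).
Qed.

(** Inside an arc the set defining [lambda_of] has a single element: the sign of Im w selects the
    side of the cut, and the cosine determines a phase in [0, pi]. *)
Lemma lambda_of_band (s : bool) k t : (k <= g)%N -> alpha k < t < beta k ->
  lambda_of g E lam (cexp (0 +i* ((-1) ^+ s * t))) = linv k t /\
  (complex.Im (cexp (0 +i* ((-1) ^+ s * t))) < 0) = s.
Proof.
move=> kg tI; have [xk e] := linvP kg tI; have /andP[t1 t2] := tI.
have tpi : 0 < t < pi by rewrite (le_lt_trans (alpha_ge0 kg) t1) (lt_le_trans t2 (beta_le_pi kg)).
have sg : (complex.Im (cexp (0 +i* ((-1) ^+ s * t))) < 0) = s.
  rewrite Im_cexp /= expR0 mul1r; have := sin_gt0_pi tpi.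
  by case: s => h; rewrite ?expr1 ?expr0 ?mulN1r ?mul1r ?sinN; [rewrite oppr_lt0|rewrite ltNge ltW].
split=> //; rewrite /lambda_of sg; have bx : bands g E (linv k t).
  by exists k => //; have /andP[x1 x2] := xk; rewrite !ltW.
apply: xget_unique; first by split => //; rewrite qmap_bdry// e.
move=> y [hy]; rewrite qmap_bdry// => /(congr1 (@complex.Re R)); rewrite !Re_cexp /= expR0 !mul1r => ec.
have {}ec : cos (theta y) = cos t.
  by move: ec; case: s {sg}; rewrite ?expr1 ?expr0 ?mulN1r ?mul1r ?cosN.
apply: (theta_inj kg xk hy); rewrite e; apply: cos_inj ec; rewrite in_itv /=.
  exact: theta_range.
by have /andP[h1 h2] := tpi; rewrite !ltW.
Qed.
End PhaseFunction.

Section IntegralRules.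
Variable R : realType.
Local Notation mu := (@lebesgue_measure R).
Implicit Types (f h : R -> R) (a b c v w : R).

Lemma has_int_ext f h a b v : (forall t, a < t < b -> f t = h t) -> has_int f a b v -> has_int h a b v.
Proof.
move=> fh [i1 <-].
have mD : measurable (`]a, b[%classic : set R) by exact: measurable_itv.
have i2 : mu.-integrable `]a, b[ (EFin \o f) by apply: integrableS i1 => //; exact: subset_itv_oo_cc.
have i3 : mu.-integrable `]a, b[ (EFin \o h).
  by apply: eq_integrable i2 => // t; rewrite inE /= in_itv => /fh ->.
split; first exact: integrable_closed.
have /integrableP[m2 _] := i2; have /integrableP[m3 _] := i3.
rewrite /Rintegral (@integral_itv_bndoo _ a b _ true false m2) (@integral_itv_bndoo _ a b _ true false m3).
by congr fine; apply: eq_integral => t; rewrite inE /= in_itv => /fh ->.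
Qed.

Lemma has_intZ f a b v c : has_int f a b v -> has_int (fun t => c * f t) a b (c * v).
Proof.
move=> [i1 <-]; split; last by rewrite RintegralZl.
have mI : measurable (`[a, b]%classic : set (measurableTypeR R)) by exact: measurable_itv.
by apply: eq_integrable (integrableZl mI c i1) => // t _.
Qed.

(** The reflected integrand is handled with the reflected primitives; the increments of both
    families coincide, hence so do the limits. *)
Lemma has_int_limit_reflect f (h F : nat -> R -> R) a b c (K : R) : a < b ->
  (forall N (t : R), a < t < b -> is_derive t 1 (F N) (h N t)) ->
  (forall N, {within `[a, b], continuous (F N)}) ->
  (forall N, {in `]a, b[, continuous (h N)}) ->
  (forall N t, a < t < b -> `|h N t| <= K) ->
  (forall t, a < t < b -> h N t @[N --> \oo] --> f t) ->
  exists v, [/\ has_int f a b v, has_int (fun t => f (c - t)) (c - b) (c - a) v &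
    F N b - F N a @[N --> \oo] --> v].
Proof.
move=> ab dF cF ch hK hf; have [v hv lv] := has_int_limit ab dF cF ch hK hf.
have ds (t : R) : is_derive t 1 (fun s => c - s) (-1).
  have d : is_derive t 1 (fun s => c - s) _ := is_deriveB (is_derive_cst c t 1) (is_derive_id t 1).
  by apply: (is_derive_eq' d); rewrite sub0r.
have cs : continuous (fun s : R => c - s) by move=> s; apply: cvgB; [exact: cvg_cst|exact: cvg_id].
have [||||||v' hv' lv'] := @has_int_limit R (fun t => f (c - t)) (fun N t => h N (c - t)) (fun N t => - F N (c - t))
   (c - b) (c - a) K.
- by rewrite ltrD2l ltrN2.
- move=> N t /andP[t1 t2]; have tI : a < c - t < b by apply/andP; split; lra.
  have d : is_derive t 1 (fun s => - F N (c - s)) _ := is_deriveN (is_derive1_comp (f := F N) (g := fun s => c - s) (dF N _ tI) (ds t)).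
  by apply: (is_derive_eq' d); rewrite mulrN1 opprK.
- move=> N; apply/continuous_within_itvP; first by rewrite ltrD2l ltrN2.
  have /(continuous_within_itvP _ ab)[c1 c2 c3] := cF N.
  split.
  + move=> t; rewrite in_itv /= => /andP[t1 t2]; apply: cvgN.
    apply: (continuous_comp (f := fun s => c - s) (g := F N)); first exact: cs.
    by apply: c1; rewrite in_itv /=; apply/andP; split; lra.
  + apply: cvgN; rewrite (_ : c - (c - b) = b); last by ring.
    apply: (@decreasing_cvg_at_right_comp R (fun s => c - s) (F N) (c - b) +oo%O) => //.
    - by move=> x y _ _ xy; rewrite ltrD2l ltrN2.
    - by apply: cvg_at_right_filter; exact: cs.
    - by rewrite (_ : c - (c - b) = b) //; ring.
  + apply: cvgN; rewrite (_ : c - (c - a) = a); last by ring.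
    apply: (@decreasing_cvg_at_left_comp R (fun s => c - s) (F N) -oo%O (c - a)) => //.
    - by move=> x y _ _ xy; rewrite ltrD2l ltrN2.
    - by apply: cvg_at_left_filter; exact: cs.
    - by rewrite (_ : c - (c - a) = a) //; ring.
- move=> N t; rewrite in_itv /= => /andP[t1 t2].
  apply: (continuous_comp (f := fun s => c - s) (g := h N)); first exact: cs.
  by apply: ch; rewrite in_itv /=; apply/andP; split; lra.
- by move=> N t /andP[t1 t2]; apply: hK; apply/andP; split; lra.
- by move=> t /andP[t1 t2]; apply: hf; apply/andP; split; lra.
exists v; split => //; rewrite (_ : v = v')//.
have e x : c - (c - x) = x by ring.
have eF : (fun N => - F N (c - (c - a)) - - F N (c - (c - b))) = (fun N => F N b - F N a).
  by apply/funext => N; rewrite !e opprK addrC.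
by rewrite eF in lv'; exact: (cvg_unique _ lv lv').
Qed.
End IntegralRules.

Section CircleTiling.
Variables (R : realType) (g : nat) (E lam : nat -> R).
Hypothesis hE : band_edges g E.
Hypothesis hlam : qm_zeros g E lam.
Local Notation alpha := (alpha g E lam).
Local Notation beta := (beta g E lam).

(* The arc of parameters in [0, pi] is tiled by the images of the bands, and [pi, 2 pi] by their mirror images. *)
Lemma circle_tiling (J : R -> R) (c K : R) (h F : nat -> nat -> R -> R) :
  (forall k t, (k <= g)%N -> alpha k < t < beta k -> J (2 * pi - t) = c * J t) ->
  (forall k, (k <= g)%N -> forall N (t : R), alpha k < t < beta k -> is_derive t 1 (F k N) (h k N t)) ->
  (forall k, (k <= g)%N -> forall N, {within `[alpha k, beta k], continuous (F k N)}) ->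
  (forall k, (k <= g)%N -> forall N, {in `]alpha k, beta k[, continuous (h k N)}) ->
  (forall k, (k <= g)%N -> forall N t, alpha k < t < beta k -> `|h k N t| <= K) ->
  (forall k, (k <= g)%N -> forall t, alpha k < t < beta k -> h k N t @[N --> \oo] --> J t) ->
  exists v, has_int J 0 (2 * pi) (v + c * v) /\
    \sum_(j < g.+1) (F j N (beta j) - F j N (alpha j)) @[N --> \oo] --> v.
Proof.
move=> hJ dF cF ch hK hf.
have piece k : (k <= g)%N -> exists v, [/\ has_int J (alpha k) (beta k) v,
    has_int J (2 * pi - beta k) (2 * pi - alpha k) (c * v) & F k N (beta k) - F k N (alpha k) @[N --> \oo] --> v].
  move=> kg; have ab := alpha_lt hE hlam kg.
  have [v [h1 h2 h3]] := has_int_limit_reflect (2 * pi) ab (dF k kg) (cF k kg) (ch k kg) (hK k kg) (hf k kg).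
  exists v; split => //; apply: has_int_ext (has_intZ c h2) => t /andP[t1 t2].
  rewrite -(hJ k _ kg); first by congr J; ring.
  by apply/andP; split; lra.
have ind k : (k <= g)%N -> exists v, [/\ has_int J 0 (beta k) v, has_int J (2 * pi - beta k) (2 * pi) (c * v) &
    \sum_(j < k.+1) (F j N (beta j) - F j N (alpha j)) @[N --> \oo] --> v].
  elim: k => [|k IH] kg.
    have [v [h1 h2 h3]] := piece 0%N kg; rewrite alpha0 subr0 in h1 h2.
    by exists v; split => //; under eq_fun do rewrite big_ord1.
  have [v [h1 h2 h3]] := IH (ltnW kg); have [w [k1 k2 k3]] := piece k.+1 kg.
  have ab := alpha_lt hE hlam kg; have ab0 := alpha_lt hE hlam (ltnW kg).
  have a0 := alpha_ge0 hE hlam (ltnW kg); have aS := alphaS lam hE kg.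
  exists (v + w); split.
  - rewrite aS in k1 ab; apply: has_int_cat h1 k1; last exact: ltW.
    by apply: le_trans a0 (ltW ab0).
  - rewrite aS in k2 ab; rewrite (_ : c * (v + w) = c * w + c * v); last by ring.
    apply: has_int_cat k2 h2.
      by rewrite lerD2l lerN2 ltW.
    by rewrite gerBl; apply: le_trans a0 (ltW ab0).
  - under eq_fun do rewrite big_ord_recr /=.
    exact: cvgD.
have [v [h1 h2 h3]] := ind g (leqnn g).
exists v; split => //; rewrite beta_last// in h1 h2; have e : 2 * pi - pi = pi :> R by ring.
rewrite e in h2; apply: has_int_cat h1 h2; first exact: pi_ge0.
by have := pi_ge0 R; lra.
Qed.
End CircleTiling.

Lemma bdry_half (R : realType) (f G : R[i] -> R[i]) (s : bool) (x : R) l :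
  (forall z, 0 < Im z -> f z = G z) -> (forall z, 0 < Im z -> f z^* = (G z)^*) ->
  ctends (0 : R)^'+ (fun y => G (x +i* y)) l -> bdry s f x = if s then l^* else l.
Proof.
move=> h1 h2 [l1 l2]; rewrite /bdry; apply: ctends_lim.
case: s; rewrite ?expr1 ?expr0.
  have e : \forall y \near (0 : R)^'+, (G (x +i* y))^* = f (x +i* (-1 * y)).
    by near=> y; rewrite -h2 /= ?mulN1r//; near: y; exact: nbhs_right_gt.
  split; rewrite ?(Re_conj, Im_conj).
    by apply: cvg_trans l1; apply: near_eq_cvg; apply: filterS e => y <-; rewrite Re_conj.
  by apply: cvg_trans (cvgN l2); apply: near_eq_cvg; apply: filterS e => y <-; rewrite Im_conj.
have e : \forall y \near (0 : R)^'+, G (x +i* y) = f (x +i* (1 * y)).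
  by near=> y; rewrite mul1r h1//=; near: y; exact: nbhs_right_gt.
by split; [apply: cvg_trans l1|apply: cvg_trans l2]; apply: near_eq_cvg; apply: filterS e => y <-.
Unshelve. all: by end_near.
Qed.

(** * Evaluation of the contour integral *)

Section KernelIntegral.
Variables (R : realType) (g : nat) (E lam mu : nat -> R) (a b : int -> R) (P Q U : {poly R}) (M : R).
Hypothesis H : finite_gap g E a b P Q U M.
Hypothesis hlam : qm_zeros g E lam.
Hypothesis hQmu : Q = \prod_(1 <= j < g.+1) ('X - (mu j)%:P).
Variables (a' b' : int -> R).
Hypothesis a'0 : forall n, 0 < a' n.
Variable tau : nat -> R.
Hypothesis htau : forall (n d : nat), \sum_(i < d) (n + i).+1%:R *
  (`|a' (n%:Z + i%:Z) - a (n%:Z + i%:Z)| + `|b' (n%:Z + i%:Z) - b (n%:Z + i%:Z)|) <= tau n.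
Hypothesis tau_dec : forall n m : nat, (n <= m)%N -> tau m <= tau n.
Hypothesis tau_lim : forall eps : R, 0 < eps -> exists n : nat, tau n <= eps.
Local Notation V := ({poly R} * {poly R})%type.
Local Notation e := (ebas a b).
Local Notation ev := (ev g E a P Q).
Local Notation A := (Abil a P Q U).
Local Notation B := (Bbil a).
Local Notation bv := (bv g E).
Local Notation L := (qmpoly g lam).
Local Notation Phi := (Phi a b a' b').
Local Notation Psi := (Psi g E a b P Q a' b').
Local Notation alpha := (alpha g E lam).
Local Notation beta := (beta g E lam).
Local Notation linv := (linv g E lam).
Local Notation dth := (dtheta g E lam).
Local Notation nrm_le := (nrm_le a b).

Let hE := fgapE H.
Let hU := fgapU H.
Let hQ := fgapQ H.

Lemma nrm_functional (T : V -> R) n v d C : (forall c u w, T (c *: u + w) = c * T u + T w) ->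
  0 <= C -> (forall k, `|T (e k)| <= C) -> nrm_le n v d -> `|T v| <= d * C.
Proof.
move=> hT C0 hC [r [-> _ rd]].
have T0 : T 0 = 0 by have := hT (-1) 0 0; rewrite scaler0 addr0; lra.
apply: (@le_trans _ _ (\sum_(x <- r) `|x.1| * C)); last by rewrite -mulr_suml ler_wpM2r.
elim: r {rd} => [|x r IH]; first by rewrite !big_nil T0 normr0.
rewrite !big_cons hT; apply: le_trans (ler_normD _ _) _; apply: lerD => //.
by rewrite normrM ler_wpM2l.
Qed.

(** Bounds for the e_k extend to v through its l^1 coefficients. For B the bounded quantity is B
    |R|^(1/2), since B^2 |R| <= A(k,k) A(m,m) on the spectrum. *)
Lemma AB_nrm_bound : exists2 C, 0 <= C & forall n m v d x, bands g E x -> nrm_le n v d ->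
  `|(A v (e m)).[x]| <= d * C /\ `|(B v (e m)).[x]| * absrt g E x <= d * C.
Proof.
have [C C0 hC] := A_band_bound H; exists C => // n m v d x xb hv.
have r0 : 0 <= absrt g E x by rewrite absrt_nc nc_ge0.
split.
  apply: (nrm_functional (T := fun u => (A u (e m)).[x]) _ C0 _ hv) => [c u w|k]; last exact: hC.
  by rewrite Abil_lin hornerD hornerZ.
rewrite -{1}(ger0_norm r0) -normrM.
apply: (nrm_functional (T := fun u => (B u (e m)).[x] * absrt g E x) _ C0 _ hv) => [c u w|k].
  have -> : B (c *: u + w) (e m) = c *: B u (e m) + B w (e m).
    by rewrite Bbil.unlock /= -!mul_polyC; ring.
  by rewrite hornerD hornerZ; ring.
have := congr1 (fun p => p.[x]) (Abil_Bbil a hU (e k) (e m)).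
rewrite !(hornerD, hornerN, hornerM, horner_exp) => h.
have ee := band_edge_poly_le0 H xb; have hr := sqr_absrt g E x; rewrite ler0_norm// in hr.
have h1 := hC k k x xb; have h2 := hC m m x xb.
rewrite -(ler_pXn2r (ltn0Sn 1)) ?nnegrE// real_normK ?num_real// exprMn hr.
apply: (@le_trans _ _ ((A (e k) (e k)).[x] * (A (e m) (e m)).[x])).
  by rewrite -h; have := sqr_ge0 (A (e k) (e m)).[x]; lra.
by apply: le_trans (ler_norm _) _; rewrite normrM expr2; apply: ler_pM.
Qed.

(** The lambda_j lie strictly inside the gaps, hence at positive distance from every band, edges
    included. *)
Lemma qmpoly_lower : exists2 c, 0 < c & forall k x, (k <= g)%N -> in_band E k x -> c <= `|L.[x]|.
Proof.
exists (\prod_(1 <= j < g.+1) Num.min (lam j - E j.*2.-1) (E j.*2 - lam j)).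
  rewrite big_nat_cond; apply: prodr_gt0 => j /andP[jg _].
  by have [/andP[h1 h2] _] := hlam jg; rewrite lt_min !subr_gt0 h1.
move=> k x kg xk; rewrite /qmpoly horner_prod normr_prod.
rewrite [X in X <= _]big_nat_cond [X in _ <= X]big_nat_cond; apply: ler_prod => j /andP[jg _].
have [/andP[h1 h2] _] := hlam jg; rewrite hornerXsubC le_min !subr_ge0 (ltW h1) (ltW h2) /= ge_min.
have [s1 s2] := gap_side hE jg kg xk.
have [jk|kj] := leqP j k.
  have h3 := s1 jk; rewrite ger0_norm; [apply/orP; right|]; lra.
have h3 := s2 kj; rewrite ler0_norm; [apply/orP; left|]; lra.
Qed.

Lemma bands_open k x : (k <= g)%N -> in_band E k x -> bands g E x.
Proof. by move=> kg /andP[h1 h2]; exists k => //; rewrite !ltW. Qed.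

Variables (n m : int) (f1 f2 : R[i] -> R[i]).
Hypothesis f1U : forall z, 0 < Im z -> f1 z = Psi z n.
Hypothesis f1L : forall z, 0 < Im z -> f1 z^* = (Psi z n)^*.
Hypothesis f2U : forall z, 0 < Im z -> f2 z = ev true z (e m).
Hypothesis f2L : forall z, 0 < Im z -> f2 z^* = (ev true z (e m))^*.

Definition arc_value x : R[i] := Psi x%:C n * ev true x%:C (e m) * Q.[x]%:C / L.[x]%:C.

Definition circle_integrand (t : R) : R[i] :=
  circle_value g E lam f1 (cexp (0 +i* t)) * circle_value g E lam f2 (cexp (0 +i* t)) *
    omega_density g E mu lam (cexp (0 +i* t)) * ('i * cexp (0 +i* t)).

(** The factor 1 / w of d omega cancels against dw = i w dt, and the boundary values from below are
    the conjugates of those from above. *)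
Lemma circle_integrand_band (s : bool) k t : (k <= g)%N -> alpha k < t < beta k ->
  circle_integrand ((-1) ^+ s * t) = 'i * (if s then (arc_value (linv k t))^* else arc_value (linv k t)).
Proof.
move=> kg tI; have [xk ex] := linvP hE hlam kg tI.
have [el es] := lambda_of_band hE hlam s kg tI.
have c1 := Psi_boundary H a'0 htau tau_dec tau_lim n kg xk.
have c2 := ev_boundary H true (e m) kg xk.
rewrite /circle_integrand /circle_value es el.
rewrite (bdry_half s f1U f1L c1) (bdry_half s f2U f2L c2) /omega_density el.
have w0 : cexp (0 +i* ((-1) ^+ s * t)) != 0 by rewrite -nc_eq0 nc_cexp gt_eqF// expR_gt0.
have -> : \prod_(1 <= j < g.+1) (((linv k t)%:C - (mu j)%:C) / ((linv k t)%:C - (lam j)%:C)) =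
    Q.[linv k t]%:C / L.[linv k t]%:C :> R[i].
  rewrite prodf_div -!pC_real hQmu /qmpoly !pv_prod.
  by congr (_ / _); apply: eq_bigr => j _; rewrite pvXsubC.
have gen (p q r w : R[i]) : w != 0 -> p * q * (r / w) * ('i * w) = 'i * (p * q * r) by move=> h; field.
rewrite gen//; congr (_ * _); rewrite /arc_value; case: (s); last by rewrite mulrA.
have ea (p q r w : R[i]) : p * q * r / w = p * (q * (r / w)) by rewrite !mulrA.
rewrite -mulrA ea; apply: esym; etransitivity; first exact: (rmorphM (@conjc R)).
congr (_ * _); etransitivity; first exact: (rmorphM (@conjc R)).
congr (_ * _).
by rewrite -(fmorph_div (real_complex R)); exact: conjCR.
Qed.

Lemma circle_integrand_mirror k t : (k <= g)%N -> alpha k < t < beta k ->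
  circle_integrand (2 * pi - t) = 'i * (arc_value (linv k t))^*.
Proof.
move=> kg tI; rewrite -(circle_integrand_band true kg tI) expr1 mulN1r /circle_integrand.
have -> : cexp (0 +i* (2 * pi - t)) = cexp (0 +i* - t) :> R[i]; last by [].
have e2 : 2 * pi - t = - t + pi + pi by ring.
by apply: c_eq; rewrite ?Re_cexp ?Im_cexp /= e2 ?cosDpi ?sinDpi ?opprK.
Qed.

Lemma linv_continuous k t : (k <= g)%N -> alpha k < t < beta k -> {for t, continuous (linv k)}.
Proof.
move=> kg tI; have [d _] := linv_der hE hlam kg tI.
by apply: differentiable_continuous; apply/derivable1_diffP.
Qed.

Lemma absrt_continuous x : {for x, continuous (absrt g E)}.
Proof.
have c : ctends (nbhs x) (fun y : R => Rhalf g E y%:C) (Rhalf g E x%:C).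
  by apply: ctends_rt => //; [exact: nearW|exact: ctends_real].
have -> : absrt g E = fun y => nc (Rhalf g E y%:C) by apply/funext => y; rewrite absrt_nc.
exact: ctends_nc c.
Qed.

(** As functions of the angle the approximants A / L have the primitive Im bv of A, since the
    derivative of the inverse phase is |R^(1/2)| / |L|. This primitive agrees at the two ends of a
    gap, so the contributions of the bands telescope to pi times a moment. *)
Lemma Im_integrand_int : has_int (fun t => Im (circle_integrand t)) 0 (2 * pi) (2 * (pi * kappa g E a b P Q U a' b' n m)).
Proof.
have [C C0 hC] := AB_nrm_bound; have [c c0 hc] := qmpoly_lower.
have [D D0 [N0 hD]] := Phi_nrm H a'0 htau tau_dec tau_lim n.
(* The shift by [N0] makes the uniform norm bound hold for every index. *)
pose AN N := A (Phi (N + N0) n) (e m).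
have [//|k kg N t tI|k kg N|k kg N t|k kg N t tI|k kg t tI|v [hv lv]] :=
  @circle_tiling R g E lam hE hlam (fun t => Im (circle_integrand t)) 1 (D * C / c)
   (fun k N t => (AN N).[linv k t] / L.[linv k t]) (fun k N t => Im (bv (AN N) (linv k t))) .
- move=> k t kg tI; rewrite (circle_integrand_mirror kg tI).
  have := circle_integrand_band false kg tI; rewrite expr0 mul1r => ->.
  by rewrite !ImM Re_conj Im_conj /= !mul0r !add0r mul1r.
- have [xk _] := linvP hE hlam kg tI.
  have d := is_derive1_comp (f := fun x => Im (bv (AN N) x)) (g := linv k) (bv_der hE (AN N) kg xk) (linv_der hE hlam kg tI).
  apply: (is_derive_eq' d); rewrite /dtheta.
  have r0 := absrt_gt0 (band_not_edge hE kg xk); have l0 := qm_sign hE hlam kg xk.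
  have l1 : L.[linv k t] != 0 by apply: contraTneq l0 => ->; rewrite mulr0 ltxx.
  by field; rewrite l1 gt_eqF//= signr_eq0.
- move=> t; apply: (continuous_comp (g := fun x => Im (bv (AN N) x))); first exact: (linv_cont hE hlam kg).
  exact: bv_cont.
- rewrite in_itv /= => tI; have [xk _] := linvP hE hlam kg tI.
  have cl := linv_continuous kg tI.
  apply: cvgM; first exact: (continuous_comp cl (@continuous_horner _ _ _)).
  apply: cvgV; first by rewrite -normr_gt0; apply: lt_le_trans (hc k _ kg xk).
  exact: (continuous_comp cl (@continuous_horner _ _ _)).
- have [xk _] := linvP hE hlam kg tI.
  have [hN _] := hD (N + N0)%N (leq_addl _ _).
  have [h1 _] := hC n m _ _ _ (bands_open kg xk) hN.
  rewrite normrM normfV; apply: ler_pM => //; rewrite ?invr_ge0//.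
  by rewrite lef_pV2 ?posrE//; [exact: hc kg xk|apply: lt_le_trans (hc k _ kg xk)].
- have [xk _] := linvP hE hlam kg tI.
  have [h1 _] := Psi_band H a'0 htau tau_dec tau_lim n m kg xk.
  have := circle_integrand_band false kg tI; rewrite expr0 mul1r => ->.
  have -> : Im ('i * arc_value (linv k t)) = Re (Psi (linv k t)%:C n * ev true (linv k t)%:C (e m) * Q.[linv k t]%:C) / L.[linv k t].
    rewrite ImM /arc_value /= mul0r add0r mul1r.
    by rewrite -fmorphV mulrC ReCM mulrC.
  apply: cvgM; last exact: cvg_cst.
  have h2 : (A (Phi N n) (e m)).[linv k t] @[N --> \oo] -->
      Re (Psi (linv k t)%:C n * ev true (linv k t)%:C (e m) * Q.[linv k t]%:C).
    apply: cvg_trans h1; apply: near_eq_cvg; apply: nearW => N.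
    by rewrite (rt_band hE kg xk) ReD ReCM ReM /=; ring.
  by rewrite (cvg_shiftn N0 (fun N => (A (Phi N n) (e m)).[linv k t])).
suff e1 : v = pi * kappa g E a b P Q U a' b' n m by have -> : 2 * (pi * kappa g E a b P Q U a' b' n m) = v + 1 * v by rewrite e1; ring.
have hk : kap g E a b P Q U a' b' (N + N0)%N n m @[N --> \oo] --> kappa g E a b P Q U a' b' n m.
  by rewrite (cvg_shiftn N0 (fun N => kap g E a b P Q U a' b' N n m)); exact: (kap_cvg H a'0 htau tau_dec tau_lim).
have h2 : pi * kap g E a b P Q U a' b' (N + N0)%N n m @[N --> \oo] --> pi * kappa g E a b P Q U a' b' n m.
  by apply: cvgM hk; exact: cvg_cst.
apply: (cvg_unique _ lv _) => //; rewrite (_ : (fun N => _) = (fun N => pi * kap g E a b P Q U a' b' (N + N0)%N n m))//.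
apply/funext => N.
rewrite /kap /moment mulrC divfK ?gt_eqF ?pi_gt0// -/(AN N).
have tele k : (k <= g)%N -> \sum_(j < k.+1) (Im (bv (AN N) (linv j (beta j))) - Im (bv (AN N) (linv j (alpha j)))) =
    Im (bv (AN N) (E k.*2.+1)) - Im (bv (AN N) (E 0%N)).
  elim: k => [|k IH] kg; first by rewrite big_ord1; have [-> ->] := linv_ends hE hlam (leq0n g).
  rewrite big_ord_recr /= IH ?(ltnW kg)//; have [-> ->] := linv_ends hE hlam kg.
  by have := Im_bval_gap_edges hE (fprimP g E (AN N)) (j := k.+1) kg; rewrite -/(bv _ _) -/(bv _ _) /= => ->; ring.
by rewrite -tele.
Qed.

(** Mirror arcs contribute with opposite signs, so the value is 0 once integrability is known. For
    that the approximants are polynomials B in x times dx / dt, with polynomial primitives. *)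
Lemma Re_integrand_int : has_int (fun t => Re (circle_integrand t)) 0 (2 * pi) 0.
Proof.
have [C C0 hC] := AB_nrm_bound; have [c c0 hc] := qmpoly_lower.
have [D D0 [N0 hD]] := Phi_nrm H a'0 htau tau_dec tau_lim n.
pose BN N := B (Phi (N + N0) n) (e m).
have [//|k kg N t tI|k kg N|k kg N t|k kg N t tI|k kg t tI|v [hv lv]] :=
  @circle_tiling R g E lam hE hlam (fun t => Re (circle_integrand t)) (-1) (D * C / c)
   (fun k N t => (BN N).[linv k t] * (dth k (linv k t))^-1) (fun k N t => (antideriv (BN N)).[linv k t]) .
- move=> k t kg tI; rewrite (circle_integrand_mirror kg tI).
  have := circle_integrand_band false kg tI; rewrite expr0 mul1r => ->.
  by rewrite !ReM Re_conj Im_conj /=; ring.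
- have d := is_derive1_comp (f := horner (antideriv (BN N))) (g := linv k) (is_derive_poly _ _) (linv_der hE hlam kg tI).
  by apply: (is_derive_eq' d); rewrite deriv_antideriv.
- move=> t; apply: (continuous_comp (g := horner (antideriv (BN N)))); first exact: (linv_cont hE hlam kg).
  exact: continuous_horner.
- rewrite in_itv /= => tI; have [xk _] := linvP hE hlam kg tI.
  have cl := linv_continuous kg tI.
  apply: cvgM; first exact: (continuous_comp cl (@continuous_horner _ _ _)).
  apply: cvgV; first by rewrite gt_eqF// dtheta_gt0.
  apply: cvgM; first by apply: cvgM; [exact: cvg_cst|exact: (continuous_comp cl (@continuous_horner _ _ _))].
  apply: cvgV; first by rewrite gt_eqF// absrt_gt0//; exact: (band_not_edge hE kg xk).
  exact: (continuous_comp cl (@absrt_continuous _)).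
- have [xk _] := linvP hE hlam kg tI.
  have [hN _] := hD (N + N0)%N (leq_addl _ _).
  have [_ h1] := hC n m _ _ _ (bands_open kg xk) hN.
  have r0 := absrt_gt0 (band_not_edge hE kg xk); have l0 := qm_sign hE hlam kg xk.
  have et : dth k (linv k t) = `|L.[linv k t]| / absrt g E (linv k t).
    by congr (_ / _); rewrite -(gtr0_norm l0) normrMsign.
  rewrite et invf_div mulrA normrM normfV normr_id normrM (gtr0_norm r0).
  apply: ler_pM => //; rewrite ?invr_ge0 ?mulr_ge0 ?(ltW r0)//.
  by rewrite lef_pV2 ?posrE//; [exact: hc kg xk|apply: lt_le_trans (hc k _ kg xk)].
- have [xk _] := linvP hE hlam kg tI.
  have [_ h1] := Psi_band H a'0 htau tau_dec tau_lim n m kg xk.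
  have := circle_integrand_band false kg tI; rewrite expr0 mul1r => ->.
  have -> : Re ('i * arc_value (linv k t)) = - Im (Psi (linv k t)%:C n * ev true (linv k t)%:C (e m) * Q.[linv k t]%:C) / L.[linv k t].
    rewrite ReM /arc_value /= mul0r sub0r mul1r.
    by rewrite -fmorphV mulrC ImCM mulrC mulNr.
  have -> : (fun N => (BN N).[linv k t] * (dth k (linv k t))^-1) =
     (fun N => - ((BN N).[linv k t] * - ((-1) ^+ (g - k) * absrt g E (linv k t))) / L.[linv k t]).
    apply/funext => N; rewrite /dtheta !invfM invrK -exprVn invrN1; ring.
  apply: cvgM; last exact: cvg_cst.
  apply: cvgN.
  have h2 : (B (Phi N n) (e m)).[linv k t] * - ((-1) ^+ (g - k) * absrt g E (linv k t)) @[N --> \oo] -->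
      Im (Psi (linv k t)%:C n * ev true (linv k t)%:C (e m) * Q.[linv k t]%:C).
    apply: cvg_trans h1; apply: near_eq_cvg; apply: nearW => N.
    by rewrite (rt_band hE kg xk) ImD ImCM ImM /=; ring.
  by rewrite (cvg_shiftn N0 (fun N => (B (Phi N n) (e m)).[linv k t] * _)).
by rewrite mulN1r subrr in hv.
Qed.

Lemma circle_kernel : (2 * (pi : R)%:C * 'i)^-1 * circle_int (fun w =>
    circle_value g E lam f1 w * circle_value g E lam f2 w * omega_density g E mu lam w) =
  (kappa g E a b P Q U a' b' n m)%:C.
Proof.
have [_ h1] := Re_integrand_int; have [_ h2] := Im_integrand_int.
rewrite /circle_int /cint; set I1 := Rintegral _ _ _; set I2 := Rintegral _ _ _.
have -> : I1 = 0 by exact: h1.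
have -> : I2 = 2 * (pi * kappa g E a b P Q U a' b' n m) by exact: h2.
have p0 : (pi : R)%:C != 0 by rewrite fmorph_eq0 gt_eqF// pi_gt0.
have -> : 0 +i* (2 * (pi * kappa g E a b P Q U a' b' n m)) = 2 * (pi : R)%:C * 'i * (kappa g E a b P Q U a' b' n m)%:C.
  have e2 : 2 * (pi : R)%:C * 'i * (kappa g E a b P Q U a' b' n m)%:C =
    (2 * (pi * kappa g E a b P Q U a' b' n m))%:C * 'i by rewrite !rmorphM rmorph_nat; ring.
  by rewrite e2; apply: c_eq; rewrite ?ReCM ?ImCM /= ?mulr0 ?mulr1.
by rewrite mulKf// !mulf_neq0// ?pnatr_eq0// -nc_eq0 nc_i oner_eq0.
Qed.
End KernelIntegral.

(** Unordered sums over the integers enter the argument only through bounds for their finite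
    subsums. *)
Lemma esum_finite_bound (R : realType) (T : choiceType) (D : set T) (f : T -> R) : (forall i, 0 <= f i) ->
  (\esum_(i in D) (f i)%:E < +oo)%E ->
  exists2 C, 0 <= C & forall s : seq T, uniq s -> (forall i, i \in s -> D i) -> \sum_(i <- s) f i <= C.
Proof.
move=> f0 hf; set S := esum _ _ in hf.
have S0 : (0 <= S)%E by apply: esum_ge0 => i _; rewrite lee_fin.
exists (fine S); first exact: fine_ge0.
move=> s us sD; rewrite -lee_fin fineK ?ge0_fin_numE// -sumEFin.
apply: esum_ge; exists [set` s]; last by rewrite -fsbig_seq.
by split; [exact: finite_seq|move=> i /=; exact: sD].
Qed.

(** * Summation by parts *)

Section NonnegativeSeries.
Variables (R : realType) (f : nat -> R) (C : R).
Hypothesis f0 : forall i, 0 <= f i.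
Hypothesis fC : forall N : nat, \sum_(i < N) f i <= C.
Implicit Types (N : nat).

Lemma partial_mono N d : \sum_(i < N) f i <= \sum_(i < (N + d)%N) f i.
Proof. by rewrite big_split_ord /= lerDl sumr_ge0. Qed.

Lemma bounded_series : exists l, (\sum_(i < N) f i @[N --> \oo] --> l) /\ forall N, \sum_(i < N) f i <= l.
Proof.
have hm : {homo (fun N => \sum_(i < N) f i) : N N' / (N <= N')%N >-> N <= N'}.
  by move=> N N' NN; rewrite -(subnKC NN); exact: partial_mono.
have hc : cvgn (fun N => \sum_(i < N) f i).
  by apply: nondecreasing_is_cvgn => //; exists C => _ [N _ <-].
exists (limn (fun N => \sum_(i < N) f i)); split; first exact: hc.
by move=> N; exact: (nondecreasing_cvgn_le hm hc).
Qed.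

Lemma series_terms0 (d : R) : 0 < d -> exists N0 : nat, forall N, (N0 <= N)%N -> f N <= d.
Proof.
have [l [hl lle]] := bounded_series; move=> d0.
move/cvgrPdist_lt: hl => /(_ d d0)[N0 _ hN]; exists N0 => N NN.
have := hN N NN; have := lle N.+1; rewrite big_ord_recr /= => h1; have := lle N => h2.
by rewrite ger0_norm ?subr_ge0//; lra.
Qed.

(** The tails form a nonincreasing function [tau] that becomes arbitrarily small; in this form the
    summability of the perturbation is used. *)
Lemma series_tail : exists tau : nat -> R, [/\
  forall n d : nat, \sum_(i < d) f (n + i)%N <= tau n,
  forall n m : nat, (n <= m)%N -> tau m <= tau n &
  forall eps : R, 0 < eps -> exists n : nat, tau n <= eps].
Proof.
have [l [hl lle]] := bounded_series.
exists (fun n => l - \sum_(i < n) f i); split.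
- by move=> n d; have := lle (n + d)%N; rewrite big_split_ord /=; lra.
- by move=> n m nm; rewrite lerD2l lerN2 -(subnKC nm); exact: partial_mono.
- move=> d d0; move/cvgrPdist_lt: hl => /(_ d d0)[N0 _ hN]; exists N0.
  by have := hN N0 (leqnn N0); have := lle N0 => h1; rewrite ger0_norm ?subr_ge0//; lra.
Qed.
End NonnegativeSeries.

Lemma square_summable_tends0 (R : realType) (s : bool) (u : int -> R[i]) : ell2_near s u ->
  tends0 (fun n => u ((-1) ^+ s * n)).
Proof.
move=> hu; have [|C C0 hC] := @esum_finite_bound R int [set n | 0 <= (-1) ^+ s * n] (fun n => nc (u n) ^+ 2) _ hu.
  by move=> i; exact: sqr_ge0.
have ss (k : int) : (-1) ^+ s * ((-1) ^+ s * k) = k by rewrite mulrA -expr2 sqrr_sign mul1r.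
have hS N : \sum_(i < N) nc (u ((-1) ^+ s * (i : nat)%:Z)) ^+ 2 <= C.
  rewrite -(big_mkord xpredT (fun i => nc (u ((-1) ^+ s * i%:Z)) ^+ 2)).
  rewrite -(big_map (fun i : nat => (-1) ^+ s * i%:Z) xpredT (fun k => nc (u k) ^+ 2)).
  apply: hC.
    rewrite map_inj_uniq ?iota_uniq// => i j /(congr1 (fun k => (-1) ^+ s * k)).
    by rewrite !ss => -[].
  by move=> k /mapP[i _ ->] /=; rewrite ss.
move=> d d0; have d2 : 0 < d ^+ 2 by rewrite exprn_gt0.
have [N0 hN] := series_terms0 (f := fun i => nc (u ((-1) ^+ s * i%:Z)) ^+ 2) (fun i => sqr_ge0 _) hS d2.
exists N0%:Z => n nn; have n0 : 0 <= n by apply: le_trans nn.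
rewrite -(gez0_abs n0) -(ler_pXn2r (ltn0Sn 1)) ?nnegrE ?nc_ge0 ?(ltW d0)//.
by apply: hN; clear -nn n0; lia.
Qed.

Section TransformIdentity.
Variables (R : realType) (a b a' b' : int -> R) (M : R) (kap : int -> int -> R).
Hypothesis aM : forall n, `|a n| <= M.
Hypothesis kap0 : forall n m, m < n -> kap n m = 0.
Hypothesis kap_sum : forall n, exists2 C, 0 <= C & forall s : seq int, uniq s -> \sum_(m <- s) `|kap n m| <= C.
Hypothesis kap_wave : forall n m, a' n * kap (n + 1) m + a' (n - 1) * kap (n - 1) m + b' n * kap n m
  = a m * kap n (m + 1) + a (m - 1) * kap n (m - 1) + b m * kap n m.
Local Notation K := (fun n m => (kap n m)%:C : R[i]).
Implicit Types (n m : int) (f : int -> R[i]).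

Lemma kap_series n N : \sum_(i < N) `|kap n (n + (i : nat)%:Z)| <= projT1 (cid2 (kap_sum n)).
Proof.
case: cid2 => C C0 hC /=.
rewrite -(big_mkord xpredT (fun i => `|kap n (n + i%:Z)|)).
rewrite -(big_map (fun i : nat => n + i%:Z) xpredT (fun k => `|kap n k|)); apply: hC.
by rewrite map_inj_uniq ?iota_uniq// => i j /addrI[].
Qed.

Lemma partialE n N f : transform_partial false K f n N = \sum_(i < N) K n (n + (i : nat)%:Z) * f (n + (i : nat)%:Z).
Proof.
by rewrite /transform_partial /series /= big_mkord; apply: eq_bigr => i _; rewrite /toward mul1r.
Qed.

Lemma transform_ctends n f : bounded_towards false f ->
  ctends \oo (transform_partial false K f n) (transform false K f n).
Proof.
move=> [N1 [F hF]].
pose c i := `|kap n (n + i%:Z)|.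
have [l [hl lle]] := bounded_series (f := c) (fun i => normr_ge0 _) (kap_series n).
have [||h _] := @ccauchy_tail R (transform_partial false K f n) (fun N => `|F| * (l - \sum_(i < N) c i)) (absz (N1 - n)).
- move=> N NN N' NN'; rewrite !partialE -(subnKC NN') big_split_ord /= [X in nc X]addrAC subrr add0r.
  apply: le_trans (nc_sum _ _ _) _.
  apply: (@le_trans _ _ (\sum_(i < N' - N) `|F| * c (N + i)%N)).
    apply: ler_sum => i _; rewrite ncM nc_real mulrC; apply: ler_wpM2r => //.
    apply: le_trans (hF _ _) (ler_norm _); rewrite mul1r; clear -NN; lia.
  rewrite -mulr_sumr; apply: ler_wpM2l => //.
  by have := lle (N + (N' - N))%N; rewrite big_split_ord /=; lra.
- rewrite -[X in _ --> X](mulr0 `|F|); apply: cvgM; first exact: cvg_cst.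
  by rewrite -[X in _ --> X](subrr l); apply: cvgB hl; exact: cvg_cst.
suff -> : transform false K f n = clim (transform_partial false K f n) by [].
exact: (ctends_lim h).
Qed.

Lemma bounded_jacobi f : (forall n, `|b n| <= M) -> bounded_towards false f -> bounded_towards false (jacobi a b f).
Proof.
move=> bM [N [F hF]]; exists (N + 1), (3 * (M * F)) => n; rewrite mul1r => nn.
have M0 : 0 <= M by apply: le_trans (aM 0).
rewrite /jacobi; apply: le_trans (ncD _ _) _.
have h k : N <= k -> nc (f k) <= F by move=> ?; apply: hF; rewrite mul1r.
have g (c x : R) y : `|c| <= M -> nc y <= F -> nc (c%:C * y) <= M * F.
  by move=> h1 h2; rewrite ncM nc_real; apply: ler_pM; rewrite ?nc_ge0.
have h1 := ncD ((a n)%:C * f (n + 1)) ((a (n - 1))%:C * f (n - 1)).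
have k1 := g _ 0 _ (aM n) (h (n + 1) _); have k2 := g _ 0 _ (aM (n - 1)) (h (n - 1) _).
have k3 := g _ 0 _ (bM n) (h n _).
have e1 : N <= n + 1 by clear -nn; lia.
have e2 : N <= n - 1 by clear -nn; lia.
have e3 : N <= n by clear -nn; lia.
by have := k1 e1; have := k2 e2; have := k3 e3; lra.
Qed.

(** The three rows start at different sites; the lengths N, N + 2 and N + 1 make every sum end at
    site n + N, so that a single boundary term remains. *)
Lemma abel_identity n f (N : nat) :
  (a' n)%:C * transform_partial false K f (n + 1) N + (a' (n - 1))%:C * transform_partial false K f (n - 1) N.+2
   + (b' n)%:C * transform_partial false K f n N.+1 =
  transform_partial false K (jacobi a b f) n N.+1 +
  (a (n + N%:Z))%:C * (K n (n + N%:Z + 1) * f (n + N%:Z) - K n (n + N%:Z) * f (n + N%:Z + 1)).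
Proof.
rewrite !partialE.
pose G j (m : int) := K j m * f m.
have s1 : \sum_(i < N.+2) K (n - 1) (n - 1 + (i : nat)%:Z) * f (n - 1 + (i : nat)%:Z) =
    G (n - 1) (n - 1) + \sum_(i < N.+1) G (n - 1) (n + (i : nat)%:Z).
  rewrite big_ord_recl addr0; congr (_ + _); apply: eq_bigr => i _.
  by have -> : n - 1 + (lift ord0 i : nat)%:Z = n + (i : nat)%:Z by rewrite lift0; clear; lia.
have s2 : \sum_(i < N) K (n + 1) (n + 1 + (i : nat)%:Z) * f (n + 1 + (i : nat)%:Z) =
    \sum_(i < N.+1) G (n + 1) (n + (i : nat)%:Z).
  rewrite big_ord_recl addr0 {1}/G kap0 ?rmorph0 ?mul0r ?add0r; last by clear; lia.
  apply: eq_bigr => i _.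
  by have -> : n + (lift ord0 i : nat)%:Z = n + 1 + (i : nat)%:Z by rewrite lift0; clear; lia.
rewrite s1 s2 mulrDr !mulr_sumr.
have w m : (a' n)%:C * G (n + 1) m + (a' (n - 1))%:C * G (n - 1) m + (b' n)%:C * G n m =
    ((a m)%:C * K n (m + 1) + (a (m - 1))%:C * K n (m - 1) + (b m)%:C * K n m) * f m.
  by have := congr1 (real_complex R) (kap_wave n m); rewrite !rmorphD !rmorphM /= => <-; rewrite /G; ring.
(* Row n - 1 has the extra site m = n - 1. There the wave equation reduces to one term on each side,
   because rows n and n + 1 vanish to the left of n. *)
have e0 : (a' (n - 1))%:C * G (n - 1) (n - 1) = (a (n - 1))%:C * (K n n * f (n - 1)).
  have := w (n - 1); rewrite /G subrK (kap0 (n := n) (m := n - 1)) ?(kap0 (n := n) (m := n - 1 - 1)) ?(kap0 (n := n + 1) (m := n - 1));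
    do ?[by clear; lia].
  by rewrite !rmorph0 !(mul0r, mulr0, add0r, addr0) => ->; ring.
rewrite e0.
elim: N {s1 s2} => [|N IH].
  rewrite !big_ord1 !addr0; have := w n; rewrite /G /jacobi (kap0 (n := n) (m := n - 1)) ?rmorph0; last by clear; lia.
  move: (kap n) => k h.
  transitivity ((a (n - 1))%:C * ((k n)%:C * f (n - 1)) +
    ((a' n)%:C * ((kap (n + 1) n)%:C * f n) + (a' (n - 1))%:C * ((kap (n - 1) n)%:C * f n) + (b' n)%:C * ((k n)%:C * f n))).
    by ring.
  by rewrite h; ring.
rewrite !(big_ord_recr N.+1) /=.
have ep : n + N.+1%:Z = n + N%:Z + 1 by clear; lia.
rewrite ep; set p := n + N%:Z + 1; have p1 : n + N%:Z = p - 1 by rewrite /p addrK.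
have := w p; move: IH; rewrite p1 subrK /jacobi /G.
set X1 := \sum_(i < N.+1) _; set X2 := \sum_(i < N.+1) _; set X3 := \sum_(i < N.+1) _; set X4 := \sum_(i < N.+1) _.
move: X1 X2 X3 X4 => X1 X2 X3 X4 IH wp.
transitivity ((X1 + ((a (n - 1))%:C * ((kap n n)%:C * f (n - 1)) + X2) + X3) +
  ((a' n)%:C * ((kap (n + 1) p)%:C * f p) + (a' (n - 1))%:C * ((kap (n - 1) p)%:C * f p) + (b' n)%:C * ((kap n p)%:C * f p))).
  by ring.
by rewrite IH wp; ring.
Qed.

(** In the limit the boundary term disappears: kernel entries are terms of a convergent series,
    while [a] and [f] stay bounded towards infinity. *)
Lemma transform_intertwines f : (forall n, `|b n| <= M) -> bounded_towards false f -> forall n,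
  jacobi a' b' (transform false K f) n = transform false K (jacobi a b f) n.
Proof.
move=> bM hf n; have hj := bounded_jacobi bM hf.
pose u (N : nat) := (a (n + N%:Z))%:C * (K n (n + N%:Z + 1) * f (n + N%:Z) - K n (n + N%:Z) * f (n + N%:Z + 1)).
have u0 : ctends \oo u 0.
  have [N1 [F hF]] := hf; have M0 : 0 <= M by apply: le_trans (aM 0).
  apply/ctendsP => d d0; have MF : 0 < 2 * M * `|F| + 1 by rewrite ltr_wpDl// !mulr_ge0.
  have [N0 hN] := series_terms0 (f := fun i => `|kap n (n + i%:Z)|) (fun i => normr_ge0 _) (kap_series n) (divr_gt0 d0 MF).
  exists (maxn N0 (absz (N1 - n))) => // N /=; rewrite geq_max => /andP[NN0 NN1].
  have b1 : nc (f (n + N%:Z)) <= `|F|.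
    by apply: le_trans (hF _ _) (ler_norm _); rewrite mul1r; clear -NN1; lia.
  have b2 : nc (f (n + N%:Z + 1)) <= `|F|.
    by apply: le_trans (hF _ _) (ler_norm _); rewrite mul1r; clear -NN1; lia.
  have k1 := hN N NN0; have k2 := hN N.+1 (leqW NN0).
  have ep : n + N.+1%:Z = n + N%:Z + 1 by clear; lia.
  rewrite ep in k2; set e := d / _ in k1 k2; have e0 : 0 < e by rewrite divr_gt0.
  rewrite sub0r ncN /u ncM nc_real.
  have q1 : nc (K n (n + N%:Z + 1) * f (n + N%:Z)) <= e * `|F|.
    by rewrite ncM nc_real; apply: ler_pM; rewrite ?nc_ge0.
  have q2 : nc (K n (n + N%:Z) * f (n + N%:Z + 1)) <= e * `|F|.
    by rewrite ncM nc_real; apply: ler_pM; rewrite ?nc_ge0.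
  have q3 := le_trans (ncB _ _) (lerD q1 q2).
  apply: le_lt_trans (ler_pM (normr_ge0 _) (nc_ge0 _) (aM _) q3) _.
  have -> : d = e * (2 * M * `|F| + 1) by rewrite /e divfK// gt_eqF.
  have -> : M * (e * `|F| + e * `|F|) = e * (2 * M * `|F|) by ring.
  by rewrite ltr_pM2l// ltrDl.
have sh (k : nat) j h : ctends \oo (transform_partial false K h j) (transform false K h j) ->
    ctends \oo (fun N => transform_partial false K h j (N + k)%N) (transform false K h j).
  by move=> [h1 h2]; split; rewrite (cvg_shiftn k (fun N => _ (transform_partial false K h j N))).
have t1 := sh 0%N _ _ (transform_ctends (n + 1) hf); have t2 := sh 2%N _ _ (transform_ctends (n - 1) hf).
have t3 := sh 1%N _ _ (transform_ctends n hf); have t4 := sh 1%N _ _ (transform_ctends n hj).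
have L1 : ctends \oo (fun N : nat => (a' n)%:C * transform_partial false K f (n + 1) (N + 0)%N +
   (a' (n - 1))%:C * transform_partial false K f (n - 1) (N + 2)%N + (b' n)%:C * transform_partial false K f n (N + 1)%N)
   (jacobi a' b' (transform false K f) n).
  by apply: ctendsD; first apply: ctendsD; apply: ctendsM => //; exact: ctends_cst.
have L2 : ctends \oo (fun N : nat => transform_partial false K (jacobi a b f) n (N + 1)%N + u N)
    (transform false K (jacobi a b f) n).
  by rewrite -[X in ctends _ _ X]addr0; exact: ctendsD.
apply: (ctends_unique L1); rewrite (_ : (fun N : nat => _) = (fun N => transform_partial false K (jacobi a b f) n (N + 1)%N + u N)); first exact: L2.
by apply/funext => N; rewrite addn0 addn1 addn2 abel_identity.
Qed.
End TransformIdentity.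

(** * The background operator and its reflection *)

Section Dirichlet.
Variables (R : realType) (g : nat) (E mu sigma : nat -> R) (a b : int -> R) (psiq : bool -> R[i] -> int -> R[i]).
Hypothesis hE : band_edges g E.
Hypothesis hmu : dirichlet_data g E mu sigma.
Hypothesis hq : finite_gap_background g E mu sigma a b psiq.
Local Notation rt := (Rhalf g E).

Definition dir_poly : {poly R} := \prod_(1 <= j < g.+1) ('X - (mu j)%:P).
(** This is the polynomial P obtained by clearing denominators in the formula for psi_{q,+/-}(z, 1).
    Taking real parts loses nothing, since the residues are real ([RhatE]). *)
Definition dir_num : {poly R} := ('X - (b 0)%:P) * dir_poly +
  \sum_(1 <= j < g.+1) complex.Re (Rhat g E mu sigma j) *: \prod_(1 <= k < g.+1 | k != j) ('X - (mu k)%:P).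
Definition dir_quot : {poly R} := (dir_num ^+ 2 - edge_poly g E) %/ dir_poly.

Lemma nonreal_regular z : Im z != 0 -> ~ exceptional g E mu z.
Proof. by move=> z0 [[x _ e]|[j _ e]]; rewrite -e eqxx in z0. Qed.

Lemma mu_lt i j : (1 <= i)%N -> (i < j <= g)%N -> mu i < mu j.
Proof.
move=> i1 ij; have [/andP[_ h1] _] := hmu (j := i) ltac:(clear -i1 ij; lia).
have [/andP[h2 _] _] := hmu (j := j) ltac:(clear -i1 ij; lia).
apply: le_lt_trans h1 (lt_le_trans _ h2); apply: (edges_lt hE); clear -i1 ij; lia.
Qed.

Lemma mu_neq i j : (1 <= i <= g)%N -> (1 <= j <= g)%N -> i != j -> mu i != mu j.
Proof.
move=> ig jg; rewrite neq_ltn => /orP[ij|ji].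
  by rewrite lt_eqF// mu_lt//; clear -ig jg ij; lia.
by rewrite gt_eqF// mu_lt//; clear -ig jg ji; lia.
Qed.

Lemma Rhalf_dirichlet j : (1 <= j <= g)%N -> rt (mu j)%:C = (Re (rt (mu j)%:C))%:C.
Proof.
move=> jg; apply: c_eq => //=; apply: (Im_rt_gap hE) => k kg; apply/negP => xk.
have [/andP[h1 h2] _] := hmu jg; have [s1 s2] := gap_side hE jg kg xk.
by have [jk|kj] := leqP j k; [have := s1 jk|have := s2 kj]; lra.
Qed.

Lemma RhatE j : (1 <= j <= g)%N -> Rhat g E mu sigma j = (complex.Re (Rhat g E mu sigma j))%:C /\
  complex.Re (Rhat g E mu sigma j) * \prod_(1 <= k < g.+1 | k != j) (mu j - mu k) = sigma j * Re (rt (mu j)%:C).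
Proof.
move=> jg; have p0 : \prod_(1 <= k < g.+1 | k != j) (mu j - mu k) != 0.
  rewrite prodf_seq_neq0; apply/allP => k; rewrite mem_index_iota => kg.
  by apply/implyP => kj; rewrite subr_eq0 mu_neq// eq_sym.
have -> : Rhat g E mu sigma j = (sigma j * Re (rt (mu j)%:C) / \prod_(1 <= k < g.+1 | k != j) (mu j - mu k))%:C.
  rewrite /Rhat Rhalf_dirichlet// fmorph_div rmorphM; congr (_ / _).
  by rewrite rmorph_prod; apply: eq_bigr => k _; rewrite rmorphB.
by split=> //=; rewrite divfK.
Qed.

(** The residues are chosen precisely for this: P^2 = R at every mu_j, so that Q divides P^2 - R. *)
Lemma dir_num_root j : (1 <= j <= g)%N -> dir_num.[mu j] = sigma j * Re (rt (mu j)%:C).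
Proof.
move=> jg; have [_ <-] := RhatE jg.
have jI : j \in index_iota 1 g.+1 by rewrite mem_index_iota.
have q0 : dir_poly.[mu j] = 0.
  by apply/eqP; rewrite horner_prod prodf_seq_eq0; apply/hasP; exists j; rewrite //= hornerXsubC subrr.
rewrite /dir_num hornerD hornerM q0 mulr0 add0r horner_sum (bigD1_seq j) ?iota_uniq//= [X in _ + X = _]big1_seq ?addr0.
  by rewrite hornerZ horner_prod; congr (_ * _); apply: eq_bigr => k _; rewrite hornerXsubC.
move=> i /andP[ij iI]; rewrite hornerZ; apply/eqP; rewrite mulf_eq0; apply/orP; right.
rewrite horner_prod prodf_seq_eq0; apply/hasP; exists j => //.
by rewrite eq_sym ij hornerXsubC subrr eqxx.
Qed.

Lemma dir_poly_neq0 z : Im z != 0 -> (pC dir_poly).[z] != 0.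
Proof.
move=> z0; rewrite pv_prod prodf_seq_neq0; apply/allP => j _ /=.
by rewrite pvXsubC subr_eq0; apply: contraNneq z0 => ->.
Qed.

Lemma dir_quotP : dir_poly * dir_quot = dir_num ^+ 2 - edge_poly g E.
Proof.
rewrite mulrC divpK// /dir_poly -(big_map mu xpredT (fun x => 'X - x%:P)); apply: uniq_roots_dvdp.
  apply/allP => x /mapP[j]; rewrite mem_index_iota => jg ->.
  rewrite /root hornerD hornerN horner_exp dir_num_root// exprMn.
  have [_ sg] := hmu jg; have -> : sigma j ^+ 2 = 1 by case: sg => ->; rewrite ?expr1n ?sqrrN ?expr1n.
  have := rt_sqr g E (mu j)%:C; rewrite Rhalf_dirichlet// pC_real -rmorphXn => /(congr1 (@complex.Re R)) /= ->.
  by rewrite mul1r subrr.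
rewrite uniq_rootsE map_inj_in_uniq ?iota_uniq// => i j; rewrite !mem_index_iota => ig jg e.
by apply/eqP; apply: contraTT (introT eqP e) => ij; exact: mu_neq.
Qed.

Lemma baker_akhiezer1E s z : Im z != 0 -> baker_akhiezer1 g E mu sigma a b s z = val1 g E a dir_num dir_poly s z.
Proof.
move=> z0; have q0 := dir_poly_neq0 z0; rewrite /baker_akhiezer1 /val1; congr (_ * _).
have qE : (pC dir_poly).[z] = \prod_(1 <= j < g.+1) (z - (mu j)%:C).
  by rewrite pv_prod; apply: eq_bigr => j _; rewrite pvXsubC.
rewrite -qE mulrDl -mulrA; congr (_ + _).
rewrite /dir_num pvD pvM pvXsubC mulrDl mulfK//; congr (_ + _).
rewrite pv_sum mulr_suml; apply: eq_big_seq => j; rewrite mem_index_iota => jg.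
have [rE _] := RhatE jg.
have eP : (pC (\prod_(1 <= k < g.+1 | k != j) ('X - (mu k)%:P))).[z] = \prod_(1 <= k < g.+1 | k != j) (z - (mu k)%:C).
  by rewrite pv_prod; apply: eq_bigr => k _; rewrite pvXsubC.
rewrite rE pvZ eP /= -mulrA; congr (_ * _).
have jI : j \in index_iota 1 g.+1 by rewrite mem_index_iota.
move: q0; rewrite qE (bigD1_seq j) ?iota_uniq//=.
by rewrite mulf_eq0 negb_or => /andP[h1 h2]; rewrite invfM mulrCA divff// mulr1.
Qed.

Lemma psiq_ev s z : Im z != 0 -> psiq s z =1 (fun n => ev g E a dir_num dir_poly s z (ebas a b n)).
Proof.
move=> z0; have ze := nonreal_regular z0; have a0 := fg_pos hq; have [hs _ h0] := fg_weyl hq s ze.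
apply: (solves_unique (fun n => lt0r_neq0 (a0 n)) hs); first exact: (ev_solves g E b dir_num dir_poly a0 s z).
  by rewrite ev_ebas0.
by rewrite ev_ebas1 -(baker_akhiezer1E s z0) (fg_value1 hq).
Qed.

Lemma background_finite_gap : exists M, finite_gap g E a b dir_num dir_poly dir_quot M.
Proof.
have [M hM] := fg_bounded hq; exists M; split => //.
- exact: fg_pos hq.
- exact: dir_quotP.
- by exists mu => // j /hmu[].
- move=> z z0; have [_ h _] := fg_weyl hq false (nonreal_regular z0).
  have := square_summable_tends0 h; rewrite (_ : (fun n => _) = fun n => ev g E a dir_num dir_poly false z (ebas a b n))//.
  by apply/funext => n; rewrite mul1r psiq_ev.
- move=> z z0; have [_ h _] := fg_weyl hq true (nonreal_regular z0).
  have := square_summable_tends0 h; rewrite (_ : (fun n => _) = fun n => ev g E a dir_num dir_poly true z (ebas a b (- n)))//.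
  by apply/funext => n; rewrite mulN1r psiq_ev.
Qed.
End Dirichlet.

(** * Reflection of the background *)

Section Reflection.
Variables (R : realType) (g : nat) (E : nat -> R) (a b : int -> R) (P Q U : {poly R}) (M : R).
Hypothesis H : finite_gap g E a b P Q U M.
Local Notation P' := (2 *: (('X - (b 0)%:P) * Q) - P).
Local Notation U' := (4 *: (('X - (b 0)%:P) ^+ 2 * Q) - 4 *: (('X - (b 0)%:P) * P) + U).
Local Notation ra := (reflect_a a).
Local Notation rb := (reflect b).

(** The equation at site 0 gives a(-1) psi(-1) = z - b(0) - a(0) psi(1), whence P' = 2 (z - b(0)) Q
    - P. R^(1/2) changes sign, so the branches are exchanged; U' is then forced by Q U' = P'^2 -
    R. *)
Lemma ev_reflect s z n : Im z != 0 -> ev g E ra P' Q s z (ebas ra rb n) = ev g E a P Q (~~ s) z (ebas a b (- n)).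
Proof.
move=> z0; have a0 := fgapa H; have ra0 k : 0 < ra k by exact: a0.
have q0 := Q_neq0 H z0.
apply: (solves_unique (a := ra) (b := rb) (z := z) (u := fun n => ev g E ra P' Q s z (ebas ra rb n))
  (v := fun n => ev g E a P Q (~~ s) z (ebas a b (- n))) (fun k => lt0r_neq0 (ra0 k))).
- exact: (ev_solves g E rb P' Q ra0 s z).
- exact: (solves_reflect (ev_solves g E b P Q a0 (~~ s) z)).
- by rewrite oppr0 !ev_ebas0.
have := ev_solves g E b P Q a0 (~~ s) z 0; rewrite /jacobi sub0r add0r ev_ebas0 ev_ebas1 => h.
have aC : (a (-1))%:C != 0 :> R[i] by rewrite fmorph_eq0 gt_eqF.
have aC0 : (a 0)%:C != 0 :> R[i] by rewrite fmorph_eq0 gt_eqF.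
have two : (2 : R[i]) != 0 by rewrite pnatr_eq0.
apply: (mulfI aC); rewrite ev_ebas1.
transitivity (z - (b 0)%:C - (a 0)%:C * val1 g E a P Q (~~ s) z); last first.
  by move: (val1 _ _ _ _ _ _ _) (ev _ _ _ _ _ _ _ _) h => v y; rewrite !mulr1 => <-; ring.
rewrite /val1 /reflect_a oppr0 sub0r pvB pvZ pvM pvXsubC rmorph_nat.
have -> : (-1) ^+ (~~ s) = - (-1) ^+ s :> R[i] by case: (s); rewrite /= ?expr0 ?expr1 ?opprK.
by field; rewrite aC aC0 q0.
Qed.

Lemma reflect_finite_gap : finite_gap g E ra rb P' Q U' M.
Proof.
split.
- exact: fgapE H.
- by move=> n; exact: fgapa H _.
- by move=> n; have [h1 _] := fgapM H (- n - 1); have [_ h2] := fgapM H (- n).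
- transitivity (P' ^+ 2 - P ^+ 2 + Q * U); last by rewrite (fgapU H); ring.
  by rewrite -!mul_polyC !polyC_natr; ring.
- exact: fgapQ H.
- move=> z z0 d d0; have [N hN] := fgap_left H z0 d0; exists N => n nn.
  by rewrite ev_reflect//; exact: hN.
- move=> z z0 d d0; have [N hN] := fgap_right H z0 d0; exists N => n nn.
  by rewrite ev_reflect// opprK; exact: hN.
Qed.
End Reflection.

Section UpperSign.
Variables (R : realType) (g : nat) (E mu lam : nat -> R) (a b : int -> R) (P Q U : {poly R}) (M : R).
Hypothesis H : finite_gap g E a b P Q U M.
Hypothesis hlam : qm_zeros g E lam.
Hypothesis hQmu : Q = \prod_(1 <= j < g.+1) ('X - (mu j)%:P).
Variables (a' b' : int -> R) (psiq : bool -> R[i] -> int -> R[i]) (psi : R[i] -> int -> R[i]) (C : R).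
Hypothesis a'0 : forall n, 0 < a' n.
Hypothesis hC : forall N : nat, \sum_(i < N) i.+1%:R * (`|a' i%:Z - a i%:Z| + `|b' i%:Z - b i%:Z|) <= C.
Hypothesis hpsiq : forall s z, Im z != 0 -> psiq s z =1 (fun n => ev g E a P Q s z (ebas a b n)).
Hypothesis hpsi : forall z, Im z != 0 -> solves a' b' z (psi z) /\
  nc (qmap g E lam z ^ (- k%:Z) * (psi z k%:Z - psiq false z k%:Z)) @[k --> \oo] --> (0 : R).
Local Notation Psi := (Psi g E a b P Q a' b').
Local Notation ev := (ev g E a P Q).
Local Notation e := (ebas a b).

Let hE := fgapE H.

Lemma ev_conj s z v : Im z != 0 -> ev s z^* v = (ev s z v)^*.
Proof.
move=> z0; rewrite /ev /val1 rt_conj// -!pC_conj.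
have c2 : ((2 * (a 0)%:C)^-1 : R[i])^* = (2 * (a 0)%:C)^-1.
  have -> : 2 * (a 0)%:C = (2 * a 0)%:C :> R[i] by rewrite rmorphM rmorph_nat.
  by rewrite -fmorphV; exact: conjCR.
have gen (x y w p r q : R[i]) : w^* = w -> ((x + y * (w * ((p + r) / q)))^* = x^* + y^* * (w * ((p^* + r^*) / q^*))).
  move=> hw; rewrite -{2}hw; apply: etrans; first exact: conjDC.
  congr (_ + _); apply: etrans; first exact: conjMC.
  congr (_ * _); apply: etrans; first exact: conjMC.
  congr (_ * _); apply: etrans; first exact: conjMC.
  by congr (_ * _); [exact: conjDC|exact: conjVC].
apply: esym; apply: etrans; first exact: gen.
congr (_ + _ * (_ * ((_ + _) / _))); case: (s); rewrite ?expr0 ?expr1 ?mul1r ?mulN1r//.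
exact: (rmorphN (@conjc R)).
Qed.

Lemma solves_conj z u : solves a' b' z u -> solves a' b' z^* (fun n => (u n)^*).
Proof.
move=> hu n; have := congr1 (@conjc R) (hu n); rewrite /jacobi => h.
have gen (x y w u1 u2 u3 : R[i]) : x^* = x -> y^* = y -> w^* = w ->
    (x * u1 + y * u2 + w * u3)^* = x * u1^* + y * u2^* + w * u3^*.
  move=> hx hy hw; rewrite -{2}hx -{2}hy -{2}hw; apply: etrans; first exact: conjDC.
  congr (_ + _); last exact: conjMC.
  by apply: etrans; [exact: conjDC|congr (_ + _); exact: conjMC].
have h2 := gen _ _ _ (u (n + 1)) (u (n - 1)) (u n) (conjCR (a' n)) (conjCR (a' (n - 1))) (conjCR (b' n)).
by apply: etrans (esym h2) (etrans h _); exact: conjMC.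
Qed.

Lemma nc_qmap (s : bool) z : 0 < Im z -> nc (qmap g E lam ((if s then fun w => w^* else id) z)) =
  expR (Re (fprim g E (qmpoly g lam) z - bv g E (qmpoly g lam) (E 0%N))).
Proof.
case: z => x y /= y0; have h := qmap_half lam hE s x y0.
have -> : (if s then fun w => w^* else id) (x +i* y) = x +i* ((-1) ^+ s * y).
  by case: (s); rewrite ?expr1 ?expr0 ?mulN1r ?mul1r.
by rewrite h -nc_cexp; case: (s); rewrite ?nc_conj.
Qed.

(** In the lower half plane the conjugate of psi solves the equation at the conjugate point, with
    conjugate asymptotics, because all coefficients are real; uniqueness in the upper half plane
    then applies to it. *)
Lemma jost_Psi tau :
  (forall (n d : nat), \sum_(i < d) (n + i).+1%:R *
    (`|a' (n%:Z + i%:Z) - a (n%:Z + i%:Z)| + `|b' (n%:Z + i%:Z) - b (n%:Z + i%:Z)|) <= tau n) ->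
  (forall n m : nat, (n <= m)%N -> tau m <= tau n) ->
  (forall eps : R, 0 < eps -> exists n : nat, tau n <= eps) ->
  forall (s : bool) z n, 0 < Im z -> psi ((if s then fun w => w^* else id) z) n = (if s then fun w => w^* else id) (Psi z n).
Proof.
move=> htau tdec tlim s z n z0; set c := if s then fun w : R[i] => w^* else id.
have cK w : c (c w) = w by rewrite /c; case: (s); rewrite // conjcK.
have z1 : Im z != 0 by rewrite gt_eqF.
have c0 : Im (c z) != 0 by rewrite /c; case: (s); rewrite ?Im_conj ?oppr_eq0.
have [hs hl] := hpsi c0.
rewrite -[LHS]cK; congr c.
apply: (jost_unique H hlam a'0 htau tdec tlim z0 (u := fun k => c (psi (c z) k))).
  by rewrite -{1}(cK z) /c; move: hs; rewrite /c; case: (s) => // /solves_conj.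
move=> d d0; move/cvgrPdist_le: hl => /(_ d d0)[N _ hN]; exists N => k kN.
have := hN k kN; rewrite /= sub0r normrN ger0_norm ?nc_ge0// -exprnN ncM ncV ncX nc_qmap// -expRM_natl.
rewrite mulrC ler_pdivrMr ?expR_gt0// => h; apply: le_trans h; rewrite hpsiq// /c.
case: (s) => //; rewrite ev_conj//.
have -> : (psi z^* k%:Z)^* - ev false z (e k%:Z) = (psi z^* k%:Z - (ev false z (e k%:Z))^*)^*.
  by apply: c_eq; rewrite ?(ReB, ImB, Re_conj, Im_conj) ?opprB ?opprK; ring.
by rewrite nc_conj.
Qed.

Definition upper_kernel (n m : int) : R[i] := (2 * (pi : R)%:C * 'i)^-1 * circle_int (fun w =>
  circle_value g E lam (fun z => psi z n) w * circle_value g E lam (fun z => psiq true z m) w * omega_density g E mu lam w).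

Lemma upper_transform f : bounded_towards false f ->
  (forall n, cvgn (transform_partial false upper_kernel f n)) /\
  (forall n, cvgn (transform_partial false upper_kernel (jacobi a b f) n)) /\
  (forall n, jacobi a' b' (transform false upper_kernel f) n = transform false upper_kernel (jacobi a b f) n).
Proof.
move=> hf.
have [|tau [t1 t2 t3]] := @series_tail R (fun i => i.+1%:R * (`|a' i%:Z - a i%:Z| + `|b' i%:Z - b i%:Z|)) C _ hC.
  by move=> i; rewrite mulr_ge0// addr_ge0.
have htau (n d : nat) : \sum_(i < d) (n + i).+1%:R *
    (`|a' (n%:Z + i%:Z) - a (n%:Z + i%:Z)| + `|b' (n%:Z + i%:Z) - b (n%:Z + i%:Z)|) <= tau n by exact: t1.
have -> : upper_kernel = fun n m => (kappa g E a b P Q U a' b' n m)%:C.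
  apply/funext => n; apply/funext => m.
  apply: (circle_kernel H hlam hQmu a'0 htau t2 t3).
  - by move=> z z0; exact: (jost_Psi htau t2 t3 false).
  - by move=> z z0; exact: (jost_Psi htau t2 t3 true).
  - by move=> z z0; rewrite hpsiq// gt_eqF.
  - move=> z z0; have zc : Im z^* != 0 by rewrite Im_conj oppr_eq0 gt_eqF.
    by rewrite hpsiq// ev_conj// gt_eqF.
have k0 := kappa_eq0 H a'0 htau t2 t3; have ks := kappa_sum H a'0 htau t2 t3.
have kw := kappa_wave H a'0 htau t2 t3.
have aM n : `|a n| <= M by have [] := fgapM H n.
have bM n : `|b n| <= M by have [] := fgapM H n.
have cv h n : bounded_towards false h -> cvgn (transform_partial false (fun n m => (kappa g E a b P Q U a' b' n m)%:C) h n).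
  by move=> hh; apply: cvgP (ctends_cvg (transform_ctends ks n hh)).
split; first by move=> n; exact: cv.
split; first by move=> n; apply: cv; exact: (bounded_jacobi aM bM).
by move=> n; exact: (transform_intertwines aM k0 ks kw bM hf).
Qed.
End UpperSign.

(** * One-sided sums of the perturbation *)

Section PerturbationSums.
Variables (R : realType) (aq bq a b : int -> R).
Hypothesis hsum : summable_perturbation aq bq a b.
Local Notation dl := (fun m => `|a m - aq m| + `|b m - bq m|).

Lemma weighted_sum : exists2 C, 0 <= C & forall (h : nat -> int), injective h -> forall N : nat,
  \sum_(i < N) `|(h i)%:~R| * dl (h i) <= C.
Proof.
have [|C C0 hC] := @esum_finite_bound R int setT (fun m => `|m%:~R| * dl m) _ hsum.
  by move=> m; rewrite mulr_ge0// addr_ge0.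
exists C => // h hi N; rewrite -(big_mkord xpredT (fun i => `|(h i)%:~R| * dl (h i))).
rewrite -(big_map h xpredT (fun m => `|m%:~R| * dl m)); apply: hC => //.
by rewrite map_inj_uniq ?iota_uniq.
Qed.

(** The weight |n| of the hypothesis vanishes at the origin, so that term is added separately;
    elsewhere i + 1 <= 2 i. *)
Lemma weighted_sum_right : exists C, forall N : nat, \sum_(i < N) i.+1%:R * dl i%:Z <= C.
Proof.
have [C C0 hC] := weighted_sum.
exists (dl 0 + 2 * C) => N; have := hC (fun i => i%:Z) (fun i j => @congr1 _ _ absz i j) N => hN.
apply: (@le_trans _ _ (dl 0 + 2 * \sum_(i < N) `|(i : nat)%:Z%:~R| * dl (i : nat)%:Z)); last by lra.
case: N {hN} => [|N]; first by rewrite !big_ord0 mulr0 addr0 addr_ge0.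
rewrite !big_ord_recl normr0 mul0r add0r mul1r lerD2l mulr_sumr; apply: ler_sum => i _.
rewrite mulrA ler_wpM2r ?addr_ge0// lift0 -pmulrn ger0_norm ?ler0n//.
by rewrite -natrM ler_nat; clear; lia.
Qed.

(** The reflected off-diagonal coefficient with index i sits at -i - 1 and already has weight i + 1;
    the diagonal one sits at -i and is treated as on the right. *)
Lemma weighted_sum_left : exists C, forall N : nat, \sum_(i < N) i.+1%:R *
  (`|reflect_a a i%:Z - reflect_a aq i%:Z| + `|reflect b i%:Z - reflect bq i%:Z|) <= C.
Proof.
have [C C0 hC] := weighted_sum.
have i1 : injective (fun i : nat => - i%:Z - 1) by move=> i j; clear; lia.
have i2 : injective (fun i : nat => - i%:Z) by move=> i j; clear; lia.
exists (C + (dl 0 + 2 * C)) => N.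
have h1 := hC _ i1 N; have h2 := hC _ i2 N.
pose S1 := \sum_(i < N) `|(- (i : nat)%:Z - 1)%:~R| * dl (- (i : nat)%:Z - 1).
pose S2 := \sum_(i < N) `|(- (i : nat)%:Z)%:~R| * dl (- (i : nat)%:Z).
have k1 : \sum_(i < N) i.+1%:R * `|reflect_a a i%:Z - reflect_a aq i%:Z| <= S1.
  apply: ler_sum => i _; apply: ler_pM => //; last by rewrite lerDl.
  have -> : - (i : nat)%:Z - 1 = - i.+1%:Z by clear; lia.
  by rewrite mulrNz normrN -pmulrn ger0_norm ?ler0n.
have k2 : \sum_(i < N) i.+1%:R * `|reflect b i%:Z - reflect bq i%:Z| <= dl 0 + 2 * S2.
  rewrite /S2; case: (N) => [|N']; first by rewrite !big_ord0 mulr0 addr0 addr_ge0.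
  rewrite !big_ord_recl /reflect oppr0 normr0 mul0r add0r mul1r; apply: lerD; first by rewrite lerDr.
  rewrite mulr_sumr; apply: ler_sum => i _.
  rewrite mulrA; apply: ler_pM => //; last by rewrite lerDr.
  rewrite lift0 mulrNz normrN -pmulrn ger0_norm ?ler0n//.
  by rewrite -natrM ler_nat; clear; lia.
under eq_bigr do rewrite mulrDr; rewrite big_split /=.
by move: k1 k2 h1 h2; rewrite -/S1 -/S2; lra.
Qed.
End PerturbationSums.

Theorem theorem5p2 (R : realType) (g : nat) (E mu sigma lam : nat -> R)
    (aq bq a b : int -> R) (psiq psi : bool -> R[i] -> int -> R[i])
    (hE : band_edges g E)
    (hmu : dirichlet_data g E mu sigma)
    (hq : finite_gap_background g E mu sigma aq bq psiq)
    (hlam : qm_zeros g E lam)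
    (ha : forall n, 0 < a n)
    (hsum : summable_perturbation aq bq a b)
    (hpsi : forall s, jost_solution g E mu lam psiq a b s (psi s)) :
  forall (s : bool) (f : int -> R[i]), bounded_towards s f ->
    let K := kernelK g E mu lam psiq psi s in
    (forall n, cvgn (transform_partial s K f n)) /\
    (forall n, cvgn (transform_partial s K (jacobi aq bq f) n)) /\
    (forall n, jacobi a b (transform s K f) n
               = transform s K (jacobi aq bq f) n).
Proof.
have [M H] := background_finite_gap hE hmu hq.
case=> f hf K; last first.
  have [C hC] := weighted_sum_right hsum.
  apply: (upper_transform H hlam (mu := mu) (psiq := psiq) (psi := psi false) erefl ha hC (psiq_ev hE hmu hq) _ hf).
  move=> z z0; have [h1 h2] := hpsi false z (nonreal_regular z0); split => //.
  by move: h2; rewrite /toward /= ; under eq_fun do rewrite expr0 !mul1r.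
have [C hC] := weighted_sum_left hsum.
(* Reflection exchanges the two branches of the background, hence the negated sign. *)
pose psiq' s z n := psiq (~~ s) z (- n).
have H' := reflect_finite_gap H.
have hf' : bounded_towards false (reflect f).
  have [N [F hF]] := hf; exists N, F => n; rewrite mul1r => nn; apply: hF; rewrite mulrNN mul1r.
  exact: nn.
have hq' s z : Im z != 0 -> psiq' s z =1 _ := fun z0 n => etrans (psiq_ev hE hmu hq (~~ s) z0 (- n)) (esym (ev_reflect H s n z0)).
have ha' n : 0 < reflect_a a n by exact: ha.
have [|c1 [c2 c3]] := upper_transform H' hlam (mu := mu) (psiq := psiq') (psi := fun z n => psi true z (- n)) erefl ha' hC hq' _ hf'.
  move=> z z0; have [h1 h2] := hpsi true z (nonreal_regular z0); split; first exact: solves_reflect.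
  by move: h2; rewrite /toward /=; under eq_fun do rewrite expr1 mulN1r mulN1r opprK.
set K' := upper_kernel _ _ _ _ _ _ in c1 c2 c3.
have KE n m : K n m = K' (- n) (- m) by rewrite /K /kernelK /K' /upper_kernel /psiq' !opprK.
have pE h n : transform_partial true K h n = transform_partial false K' (reflect h) (- n).
  apply/funext => N; rewrite /transform_partial /series; apply: eq_bigr => k _ /=.
  have e : n + toward true k = - (- n + toward false k).
    by rewrite /toward expr0 expr1 mul1r mulN1r opprD opprK.
  by rewrite e KE opprK.
have tE h : transform true K h = reflect (transform false K' (reflect h)).
  by apply/funext => n; rewrite /transform pE.
have jE : reflect (jacobi aq bq f) = jacobi (reflect_a aq) (reflect bq) (reflect f).
  by apply/funext => n; rewrite jacobi_reflect.
split; first by move=> n; rewrite pE; exact: c1.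
split; first by move=> n; rewrite pE jE; exact: c2.
move=> n; rewrite !tE jE [RHS]/reflect -c3.
move: (transform false K' (reflect f)) => u.
have eu : reflect (reflect u) = u by apply/funext => m; rewrite /reflect opprK.
by have := jacobi_reflect a b (reflect u) (- n); rewrite eu opprK => ->.
Qed.
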